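(* Let $(E,h)$ be a complete asymptotically flat $n$-manifold, $I\subset\mathbb R$ an interval, and $(\overline M,\overline g)=(E\times I,\ h+dt^2)$ the Riemannian product, with $\overline X=\partial/\partial t$. Let $(M,g)\looparrowright(\overline M,\overline g)$ be a two-sided asymptotically flat hypersurface with unit normal $N$ and with smooth compact (connected) inner boundary $\Gamma$ lying on some slice $E_{t_0}=E\times\{t_0\}$, where it bounds a compact domain $\Omega\subset E_{t_0}$, and assume that $M$ is orthogonal to $E_{t_0}$ along $\Gamma$ (with orientations fixed as in the context). Then $$m_g=m_h+c_n\int_\Gamma s_1(\mu)\,d\Gamma+c_n\int_M\Theta_{\overline X}\left(R_g-R_h+\mathrm{Ric}_h(N^t,N^t)\right)dM,$$ where $\mu$ is the unit normal to $\Gamma$ in $E_{t_0}$ pointing inward with respect to $\Omega$, $s_1(\mu)$ is the mean curvature of $\Gamma\hookrightarrow E_{t_0}$ with respect to $\mu$, $\Theta_{\overline X}=\langle\overline X,N\rangle$, and $N^t$ is the horizontal component of $N$ (its component tangent to the slices).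
   Context: Throughout $n\ge 3$, manifolds are connected and smooth, and repeated indices are summed. Asymptotically flat ends and mass. An asymptotically flat end is an $n$-dimensional Riemannian manifold with metric $h$ and coordinates $x=(x_1,\dots,x_n)$ given by a diffeomorphism from $\mathbb R^n-\overline B_1(0)$ such that, as $|x|\to\infty$ and for some $\tau>(n-2)/2$, $h_{ij}=\delta_{ij}+O(|x|^{-\tau})$ and $h_{ij,k}:=\partial h_{ij}/\partial x_k=O(|x|^{-\tau-1})$, and such that the scalar curvature $R_h$ is integrable. Its ADM mass is $$m_h=\lim_{r\to\infty}c_n\int_{\Sigma_r}\left(h_{ij,j}-h_{jj,i}\right)\nu^i\,d\Sigma_r,\qquad c_n=\frac{1}{2(n-1)\omega_{n-1}},$$ where $\Sigma_r=\{|x|=r\}$, $\nu$ is its outward unit normal and $\omega_{n-1}$ is the volume of the unit $(n-1)$-sphere. A complete Riemannian manifold $(E,h)$ is asymptotically flat if there is a compact $C\subset E$ such that $E-C$ is an asymptotically flat end; $m_h$ is then the mass of this end. Ambient product. $\overline M=E\times I$, $\overline g=h+dt^2$, $\overline X=\partial/\partial t=\mathbf e_0$ is the unit normal to the (totally geodesic) slices $E_t=E\times\{t\}$. $R_h$ is extended to $\overline M$, and $\mathrm{Ric}_h$ to horizontal vectors, in the obvious way (independently of $t$). Asymptotically flat hypersurfaces. A complete, isometrically immersed $n$-manifold $(M,g)\looparrowright(\overline M,\overline g)$, possibly with compact inner boundary, is asymptotically flat if $R_g$ is integrable and there is a compact $K\subset M$ such that $M-K$ is a vertical graph $\{(x,f(x))\}$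 over the end $E-C$, where $f$ is smooth with values in $I$ and satisfies, at infinity and for some $\tau>(n-2)/2$, $f_i=O(|x|^{-\tau/2})$ and $f_{ij}=O(|x|^{-\tau/2-1})$ (partial derivatives in $x$). Its mass $m_g$ is the ADM mass of the end $M-K$ (computed in the coordinates $x$, where $g_{ij}=h_{ij}+f_if_j$). Two-sided means $M$ carries a global unit normal $N$; it is chosen so that $N=\mathbf e_0$ at infinity. Mean curvature with respect to a unit normal $\mu$ is the trace of $-\overline\nabla\mu$ over the tangent space of $\Gamma$ (positive for round spheres with inward normal). Orientations: let $\eta$ be the exterior unit co-normal to $M$ along $\Gamma$; by orthogonality $\eta=\pm\mathbf e_0$. The orientation of the slice determined by $\mu$ agrees with the one induced by $\mathbf e_0$, which means that $\eta=\pm\mathbf e_0$ along $\Gamma$ entails $N=\mp\mu$ along $\Gamma$. *)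

(* Defs.v *)
From HB Require Import structures.
From mathcomp Require Import all_boot all_order all_algebra.
From mathcomp Require Import all_classical all_reals all_analysis.

Set Implicit Arguments.
Unset Strict Implicit.
Unset Printing Implicit Defensive.

Import Order.TTheory GRing.Theory Num.Theory.
Import numFieldNormedType.Exports.

Local Open Scope classical_set_scope.
Local Open Scope ring_scope.

(* Manifolds have dimension m.+1 and boundaries have dimension m: the paper's
   n is m.+1.  Vectors of R^n are row vectors. *)

Section Euclidean.
Context {R : realType}.

Definition enorm n (x : 'rV[R]_n) : R := Num.sqrt (\sum_i x 0 i ^+ 2).

Definition basis_vec n (i : 'I_n) : 'rV[R]_n := delta_mx 0 i.

(* i-th partial derivative of f at x, for f meaningful on A only: the increment
   stays in A, so that the quotient is one-sided at the boundary of a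
   half-space. *)
Definition pd n (A : set 'rV[R]_n) (f : 'rV[R]_n -> R) (i : 'I_n)
    (x : 'rV[R]_n) : R :=
  lim ((fun s : R => s^-1 * (f (x + s *: basis_vec i) - f x)) @
    within [set s : R | s != 0 /\ A (x + s *: basis_vec i)] (nbhs (0 : R))).

Fixpoint Ck n (k : nat) (U : set 'rV[R]_n) (f : 'rV[R]_n -> R) : Prop :=
  match k with
  | 0%N => forall x, U x -> {for x, continuous f}
  | k'.+1 => forall i : 'I_n,
      (forall x, U x -> derivable f x (basis_vec i)) /\
      Ck k' U (fun x => 'D_(basis_vec i) f x)
  end.

(* A is arbitrary: smooth means locally extendable to a smooth function on an
   open set. *)
Definition smooth_on n (A : set 'rV[R]_n) (f : 'rV[R]_n -> R) : Prop :=
  forall x, A x -> exists U : set 'rV[R]_n, exists F : 'rV[R]_n -> R,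
    [/\ open U, U x, forall k, Ck k U F & forall y, A y -> U y -> f y = F y].

Definition half_space m : set 'rV[R]_m.+1 := [set x | 0 <= x 0 ord0].

(* Lebesgue integral over R^n as an iterated integral (Tonelli, Fubini). *)
Fixpoint lint n : ('rV[R]_n -> \bar R) -> \bar R :=
  match n return ('rV[R]_n -> \bar R) -> \bar R with
  | 0%N => fun f => f 0
  | k.+1 => fun f =>
      (\int[lebesgue_measure]_(t in [set: R])
        lint (fun y : 'rV[R]_k => f (row_mx (t%:M : 'rV[R]_1) y)))%E
  end.

(* Integral over {|x| = r} for the surface measure
   sigma_r(A) = (n / r) * Leb {s x | x in A, 0 < s <= 1}. *)
Definition sphere_int n (r : R) (f : 'rV[R]_n -> R) : R :=
  n%:R / r * fine (lint (fun x : 'rV[R]_n =>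
    (if enorm x <= r then f ((r / enorm x) *: x) else 0)%:E)).

Definition exterior n : set 'rV[R]_n := [set x | 1 < enorm x].

(* f = O(|x|^(-s)) at infinity. *)
Definition decays n (s : R) (f : 'rV[R]_n -> R) : Prop :=
  exists K : R, \forall r \near +oo,
    forall x : 'rV[R]_n, enorm x = r -> `|f x| <= K * r `^ (- s).

End Euclidean.
Arguments exterior {R} n.
Arguments half_space {R} m.

Section CoordinateCurvature.
Context {R : realType} (n : nat).
Implicit Types (A : set 'rV[R]_n) (G : 'rV[R]_n -> 'M[R]_n).

(* christoffel A G k i j is Gamma^k_{ij}. *)
Definition christoffel A G (k i j : 'I_n) (x : 'rV[R]_n) : R :=
  2^-1 * \sum_l invmx (G x) k l *
    (pd A (fun y => G y j l) i x + pd A (fun y => G y i l) j x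
     - pd A (fun y => G y i j) l x).

Definition ricci_coord A G (x : 'rV[R]_n) : 'M[R]_n := \matrix_(i, j)
  (\sum_k (pd A (christoffel A G k i j) k x - pd A (christoffel A G k i k) j x)
   + \sum_k \sum_l
       (christoffel A G k k l x * christoffel A G l i j x
        - christoffel A G k j l x * christoffel A G l i k x)).

End CoordinateCurvature.

Section Manifolds.
Context {R : realType}.

(* to_coord is meaningful on chart_dom only, of_coord on its image only. *)
Record chart (m : nat) (T : topologicalType) := Chart {
  chart_dom : set T;
  to_coord : T -> 'rV[R]_m.+1;
  of_coord : 'rV[R]_m.+1 -> T }.

Definition chart_cod m (T : topologicalType) (c : chart m T)
    : set 'rV[R]_m.+1 :=
  to_coord c @` chart_dom c.

Definition is_chart m (T : topologicalType) (c : chart m T) : Prop :=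
  [/\ open (chart_dom c),
      exists2 O : set 'rV[R]_m.+1,
        open O & chart_cod c = O \/ chart_cod c = O `&` half_space m,
      forall p, chart_dom c p -> of_coord c (to_coord c p) = p,
      {within chart_dom c, continuous (to_coord c)} &
      {within chart_cod c, continuous (of_coord c)}].

Definition compatible m (T : topologicalType) (c d : chart m T) : Prop :=
  forall j,
    smooth_on (to_coord c @` (chart_dom c `&` chart_dom d))
      (fun x => to_coord d (of_coord c x) 0 j) /\
    smooth_on (to_coord d @` (chart_dom c `&` chart_dom d))
      (fun x => to_coord c (of_coord d x) 0 j).

(* Nonempty connected smooth manifold, possibly with boundary; the atlas is
   maximal.  The base point is only required by the measurability library. *)
Record manifold (m : nat) := Manifold {
  space :> ptopologicalType;
  atlas : set (chart m space);
  chart_at : space -> chart m space;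
  chart_at_atlas : forall p, atlas (chart_at p);
  chart_at_dom : forall p, chart_dom (chart_at p) p;
  atlas_chart : forall c, atlas c -> is_chart c;
  atlas_compatible : forall c d, atlas c -> atlas d -> compatible c d;
  atlas_maximal : forall c, is_chart c ->
    (forall d, atlas d -> compatible c d) -> atlas c;
  space_hausdorff : hausdorff_space space;
  space_second_countable : @second_countable space;
  space_connected : connected [set: space] }.

Definition boundary m (M : manifold m) : set M :=
  [set p | ~ (chart_cod (chart_at p))° (to_coord (chart_at p) p)].

(* A tangent vector at p is the row of its components in chart_at p, and a
   bilinear form on T_pM is its matrix there. *)
Definition metric_field m (M : manifold m) := M -> 'M[R]_m.+1.

Definition dot n (B : 'M[R]_n) (v w : 'rV[R]_n) : R := (v *m B *m w^T) 0 0.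

Definition jacobian m (T : topologicalType) (c d : chart m T)
    (x : 'rV[R]_m.+1) : 'M[R]_m.+1 :=
  \matrix_(i, j) pd (chart_cod c) (fun y => to_coord d (of_coord c y) 0 j) i x.

(* Matrix in the chart c of the bilinear form at of_coord c x. *)
Definition coef m (M : manifold m) (c : chart m M) (g : metric_field M)
    (x : 'rV[R]_m.+1) : 'M[R]_m.+1 :=
  let q := of_coord c x in
  let J := jacobian c (chart_at q) x in J *m g q *m J^T.

(* Components in the chart c of a tangent vector v at q. *)
Definition vec_in m (M : manifold m) (c : chart m M) (q : M)
    (v : 'rV[R]_m.+1) : 'rV[R]_m.+1 :=
  v *m jacobian (chart_at q) c (to_coord (chart_at q) q).

Definition riemannian m (M : manifold m) (g : metric_field M) : Prop :=
  [/\ forall p, (g p)^T = g p,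
      forall p v, v != 0 -> 0 < dot (g p) v v &
      forall c, atlas c -> forall i j,
        smooth_on (chart_cod c) (fun x => coef c g x i j)].

Definition ricci m (M : manifold m) (g : metric_field M) (p : M) : 'M[R]_m.+1 :=
  let c := chart_at p in ricci_coord (chart_cod c) (coef c g) (to_coord c p).

Definition scal m (M : manifold m) (g : metric_field M) (p : M) : R :=
  \sum_i \sum_j invmx (g p) i j * ricci g p i j.

(* Completeness for the Riemannian distance.  The infimum over C^1 curves is
   that over piecewise C^1 ones: a corner can be passed with zero velocity. *)
Definition velocity m (M : manifold m) (gam : R -> M) (t : R) : 'rV[R]_m.+1 :=
  \row_j derive1 (fun s : R => to_coord (chart_at (gam t)) (gam s) 0 j) t.

Definition C1_curve m (M : manifold m) (gam : R -> M) : Prop :=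
  continuous gam /\
  forall t j, let f (s : R) : R := to_coord (chart_at (gam t)) (gam s) 0 j in
    (\forall s \near t, derivable f s 1) /\ {for t, continuous (derive1 f)}.

Definition curve_length m (M : manifold m) (g : metric_field M) (gam : R -> M)
    : \bar R :=
  (\int[lebesgue_measure]_(t in (`[0%R, 1%R] : set R))
    (Num.sqrt (dot (g (gam t)) (velocity gam t) (velocity gam t)))%:E)%E.

Definition riem_dist m (M : manifold m) (g : metric_field M) (p q : M)
    : \bar R :=
  ereal_inf [set curve_length g gam | gam in
    [set gam : R -> M | [/\ C1_curve gam, gam 0 = p & gam 1 = q]]].

Definition riem_complete m (M : manifold m) (g : metric_field M) : Prop :=
  forall u : nat -> M,
    (forall e : R, 0 < e -> exists N : nat, forall i j : nat,
      (N <= i)%N -> (N <= j)%N -> (riem_dist g (u i) (u j) < e%:E)%E) ->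
    exists p : M, u n @[n --> \oo] --> p.

Definition borel m (M : manifold m) : measurableType (@open M).-sigma :=
  g_sigma_algebraType (@open M).

Definition volume_measure m (M : manifold m) (g : metric_field M)
    (mu : {measure set (borel M) -> \bar R}) : Prop :=
  forall c, atlas c -> forall A : set (borel M), measurable A ->
    (A : set M) `<=` chart_dom c ->
    mu A = lint (fun x =>
      (\1_(to_coord c @` (A : set M)) x * Num.sqrt (\det (coef c g x)))%:E).

(* Measure induced by g on the boundary, on which the coordinate of index 0 of
   a chart vanishes. *)
Definition boundary_measure m (M : manifold m) (g : metric_field M)
    (sigma : {measure set (borel M) -> \bar R}) : Prop :=
  sigma (~` @boundary m M : set (borel M)) = 0%E /\
  forall c, atlas c -> forall A : set (borel M), measurable A ->
    (A : set M) `<=` chart_dom c `&` @boundary m M ->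
    sigma A = lint (fun y : 'rV[R]_m =>
      let x : 'rV[R]_m.+1 := row_mx (0 : 'rV[R]_1) y in
      (\1_(to_coord c @` (A : set M)) x *
         Num.sqrt (\det (row' ord0 (col' ord0 (coef c g x)))))%:E).

End Manifolds.
Arguments chart R m T : clear implicits.
Arguments manifold R m : clear implicits.
Arguments boundary {R m} M.

Section Maps.
Context {R : realType} (m : nat) (M E : manifold R m).
Implicit Types (u : M -> E) (f : M -> R) (h : metric_field E).

Definition smooth_fun f : Prop :=
  forall c, atlas c -> smooth_on (chart_cod c) (fun x => f (of_coord c x)).

Definition smooth_map u : Prop :=
  continuous u /\
  forall (c : chart R m M) (d : chart R m E), atlas c -> atlas d -> forall j,
    smooth_on (to_coord c @` (chart_dom c `&` u @^-1` chart_dom d))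
      (fun x => to_coord d (u (of_coord c x)) 0 j).

(* V p is a tangent vector of E at u p. *)
Definition smooth_along u (V : M -> 'rV[R]_m.+1) : Prop :=
  forall (c : chart R m M) (d : chart R m E), atlas c -> atlas d -> forall j,
    smooth_on (to_coord c @` (chart_dom c `&` u @^-1` chart_dom d))
      (fun x => vec_in d (u (of_coord c x)) (V (of_coord c x)) 0 j).

(* Row i is the image of the i-th coordinate vector of chart_at p. *)
Definition diff_map u (p : M) : 'M[R]_m.+1 :=
  let c := chart_at p in
  \matrix_(i, j) pd (chart_cod c)
    (fun y => to_coord (chart_at (u p)) (u (of_coord c y)) 0 j)
    i (to_coord c p).

Definition diff_fun f (p : M) : 'rV[R]_m.+1 :=
  let c := chart_at p in
  \row_i pd (chart_cod c) (fun y => f (of_coord c y)) i (to_coord c p).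

(* (u, tau) is an immersion of M into E x I. *)
Definition immersion (I : interval R) u (tau : M -> R) : Prop :=
  [/\ smooth_map u, smooth_fun tau, forall p, tau p \in I &
      forall p, row_free (row_mx (diff_map u p) (diff_fun tau p)^T)].

(* Metric induced on M by (u, tau) from h + dt^2. *)
Definition induced_metric h u (tau : M -> R) : metric_field M := fun p =>
  diff_map u p *m h (u p) *m (diff_map u p)^T
  + (diff_fun tau p)^T *m diff_fun tau p.

(* Nt + Theta e_0 is a unit normal field along (u, tau), with Nt p tangent to
   E at u p. *)
Definition unit_normal h u (tau : M -> R) (Nt : M -> 'rV[R]_m.+1)
    (Theta : M -> R) : Prop :=
  [/\ smooth_along u Nt, smooth_fun Theta,
      forall p, dot (h (u p)) (Nt p) (Nt p) + Theta p ^+ 2 = 1 &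
      forall p i, dot (h (u p)) (Nt p) (row i (diff_map u p))
                  + Theta p * diff_fun tau p 0 i = 0].

(* Image under u of the a-th coordinate vector of the boundary of M.  In the
   theorem tau is constant on the boundary, which is identified with its image
   in the slice. *)
Definition boundary_tangent u (p : M) (a : 'I_m) : 'rV[R]_m.+1 :=
  row (lift ord0 a) (diff_map u p).

(* Unit normal in (E, h) to the image of the boundary of M, pointing into
   Omega. *)
Definition inward_unit_normal h u (Omega : set E) (mu : M -> 'rV[R]_m.+1)
    : Prop :=
  forall p, boundary M p ->
  [/\ dot (h (u p)) (mu p) (mu p) = 1,
      forall a, dot (h (u p)) (mu p) (boundary_tangent u p a) = 0 &
      \forall s \near (0 : R)^'+,
        Omega (of_coord (chart_at (u p))
                 (to_coord (chart_at (u p)) (u p) + s *: mu p))].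

(* Trace of - nabla mu over the tangent space of u (boundary M), for a field
   mu along the boundary of M with mu p tangent to E at u p. *)
Definition mean_curvature h u (mu : M -> 'rV[R]_m.+1) (p : M) : R :=
  let c := chart_at p in
  let e := chart_at (u p) in
  let X := boundary_tangent u p in
  let nabla_mu a : 'rV[R]_m.+1 := \row_k
    (pd (chart_cod c)
        (fun y => vec_in e (u (of_coord c y)) (mu (of_coord c y)) 0 k)
        (lift ord0 a) (to_coord c p)
     + \sum_i \sum_j
         christoffel (chart_cod e) (coef e h) k i j (to_coord e (u p))
         * X a 0 i * mu p 0 j) in
  let gam : 'M[R]_m := \matrix_(a, b) dot (h (u p)) (X a) (X b) in
  - \sum_a \sum_b invmx gam a b * dot (h (u p)) (nabla_mu a) (X b).

(* In a chart at a boundary point, vectors pointing out of M have a negative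
   component of index 0. *)
Definition exterior_conormal (g : metric_field M) (eta : M -> 'rV[R]_m.+1)
    : Prop :=
  forall p, boundary M p ->
  [/\ dot (g p) (eta p) (eta p) = 1,
      forall a, dot (g p) (eta p) (basis_vec (lift ord0 a)) = 0 &
      eta p 0 ord0 < 0].

End Maps.

Definition compact_domain (T : topologicalType) (Omega : set T) : Prop :=
  [/\ compact Omega, connected Omega° & closure Omega° = Omega].

Section AsymptoticallyFlat.
Context {R : realType} (m : nat).

(* G is the matrix of a metric in the coordinates of an end. *)
Definition asymptotically_euclidean (G : 'rV[R]_m.+1 -> 'M[R]_m.+1) : Prop :=
  exists2 s : R, (m.+1%:R - 2) / 2 < s &
    (forall i j, decays s (fun x => G x i j - (i == j)%:R)) /\
    (forall i j k, decays (s + 1) (pd (exterior m.+1) (fun x => G x i j) k)).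

Definition c_ADM : R :=
  (2 * m%:R * sphere_int 1 (fun _ : 'rV[R]_m.+1 => 1))^-1.

Definition ADM_flux (G : 'rV[R]_m.+1 -> 'M[R]_m.+1) (r : R) : R :=
  sphere_int r (fun x =>
    \sum_i (\sum_j (pd (exterior m.+1) (fun y => G y i j) j x
                    - pd (exterior m.+1) (fun y => G y j j) i x))
           * (x 0 i / r)).

Definition ADM_mass (G : 'rV[R]_m.+1 -> 'M[R]_m.+1) : R :=
  c_ADM * lim (ADM_flux G r @[r --> +oo]).

(* phi is the chart given by the coordinates of the end. *)
Definition asymptotically_flat (E : manifold R m) (h : metric_field E)
    (dE : {measure set (borel E) -> \bar R}) (phi : chart R m E) : Prop :=
  [/\ atlas phi, chart_cod phi = exterior m.+1, compact (~` chart_dom phi),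
      asymptotically_euclidean (coef phi h) &
      dE.-integrable (chart_dom phi : set (borel E)) (EFin \o scal h)].

(* theta = phi o u is the chart of M given by the graph coordinates over the
   end, and f is the function whose graph it is. *)
Definition asymptotically_flat_hypersurface (E : manifold R m)
    (phi : chart R m E) (M : manifold R m) (g : metric_field M)
    (dM : {measure set (borel M) -> \bar R}) (u : M -> E) (tau : M -> R)
    (theta : chart R m M) : Prop :=
  let f x := tau (of_coord theta x) in
  [/\ dM.-integrable ([set: M] : set (borel M)) (EFin \o scal g),
      atlas theta /\ compact (~` chart_dom theta),
      chart_cod theta = chart_cod phi,
      forall p, chart_dom theta p ->
        chart_dom phi (u p) /\ to_coord phi (u p) = to_coord theta p
    & exists2 s : R, (m.+1%:R - 2) / 2 < s &
        (forall i, decays (s / 2) (pd (exterior m.+1) f i)) /\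
        (forall i j, decays (s / 2 + 1)
           (pd (exterior m.+1) (pd (exterior m.+1) f i) j))].

(* M minus the part of the end theta where |x| > r. *)
Definition truncation (M : manifold R m) (theta : chart R m M) (r : R)
    : set (borel M) :=
  ~` [set p : M | chart_dom theta p /\ r < enorm (to_coord theta p)].

(* J is the integral of F over M, as the limit of its integrals over the
   truncations.  The second clause follows from the first by dominated
   convergence. *)
Definition is_integral_AF (M : manifold R m) (theta : chart R m M)
    (dM : {measure set (borel M) -> \bar R}) (F : M -> R) (J : R) : Prop :=
  (\int[dM]_(p in truncation theta r) F p) @[r --> +oo] --> J /\
  (dM.-integrable ([set: M] : set (borel M)) (EFin \o F) ->
   \int[dM]_(p in ([set: M] : set (borel M))) F p = J).

End AsymptoticallyFlat.

(* Main.v *)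
(* The covector field H dtau + dTheta, where H is the mean curvature of M in E x I, has divergence
   Theta (R_g - R_h + Ric_h(Nt, Nt)): this is a trace of the Gauss and Codazzi equations.
   Integrate it over the truncations of M.  On Gamma, orthogonality makes its conormal component
   - s_1(mu).  On the sphere |x| = r its flux is, up to o(1), the difference of the ADM fluxes of
   g and h, because in graph coordinates it differs from the difference of the two ADM fields by
   O(|x|^(-2s-1)).  Each ADM flux converges, since the divergence of its field is the scalar
   curvature up to integrable terms, quadratic in the metric and its first derivatives. *)
Require Import Defs.
From HB Require Import structures.
From mathcomp Require Import all_boot all_order all_algebra.
From mathcomp Require Import all_classical all_reals all_analysis.
From mathcomp Require Import measurable_realfun ring lra.

Set Implicit Arguments.
Unset Strict Implicit.
Unset Printing Implicit Defensive.

Import Order.TTheory GRing.Theory Num.Theory.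
Import numFieldNormedType.Exports.

Local Open Scope classical_set_scope.
Local Open Scope ring_scope.

(** The divergence identity is local: it is proved for one chart of M and one chart of E. The frame
    made of the coordinate vectors of M and of N has a connection form whose blocks are the
    Levi-Civita connection of g and the second fundamental form, so that Gauss and Codazzi are two
    blocks of one curvature identity. The mean curvature H is also defined in charts, and its
    invariance is what glues the local fields together. Two facts about the end have to be proved.
    The mass is written with [lim], which means something only once the fluxes converge. And only
    the complement of the chart of the end is known to be compact, while Stokes' formula needs
    compact truncations: one has to exclude that the core lies at |x| = infinity instead of |x| = 1,
    and the infinite volume of the end does this. The integral over M is a limit over truncations
    because the integrand need not be absolutely integrable: the fluxes converge by cancellation of
    second derivatives. Cutoffs are C^1 splines, so regularity of finite order is tracked
    throughout, through local extensions that make sense up to the boundary of a half-space. *)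

Notation jacobian := Defs.jacobian.
Notation dom := chart_dom.
Notation cod := chart_cod.
Notation ev := basis_vec.
Notation sqrdet A := (Num.sqrt (\det A)).
Notation Gamma_ M := (boundary M : set (borel M)).
Notation pt := of_coord.
Notation co := to_coord.
Ltac bigr := apply: eq_bigr.

(** * Partial derivatives on subsets of half-spaces *)

Section PartialDerivatives.
Context {R : realType}.

Lemma is_derive_line n (F : 'rV[R]_n -> R) (z v : 'rV[R]_n) (t : R) : derivable F (z + t *: v) v ->
  is_derive t 1 (fun s => F (z + s *: v)) ('D_v F (z + t *: v)).
move=> dF.
have E (h : R) : (fun s => F (z + s *: v)) (h *: 1 + t) = F (h *: v + (z + t *: v)).
  rewrite /= -[h *: 1]/(h * 1) mulr1 scalerDl; congr F. by rewrite addrCA.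
split.
  rewrite /derivable; under eq_fun do rewrite [(_ \o _) _]E; exact: dF.
by rewrite /derive; under eq_fun do rewrite [(_ \o _) _]E.
Qed.

Lemma mvt_line n (F : 'rV[R]_n -> R) (z : 'rV[R]_n) i (d : R) : (forall t : R, 0 <= t <= 1 ->
     derivable F (z + (t * d) *: ev i) (ev i)) -> exists2 t : R, 0 <= t <= 1 &
    F (z + d *: ev i) - F z = d * 'D_(ev i) F (z + (t * d) *: ev i).
move=> dF.
pose G (t : R) := F (z + (t * d) *: ev i).
have dG (t : R) : 0 <= t <= 1 -> is_derive t 1 G (d * 'D_(ev i) F (z + (t * d) *: ev i)).
  move=> t01; have := is_derive_line (dF t t01) => H1. have H2 : is_derive t 1 (fun s : R => s * d) d.
    have -> : (fun s : R => s * d) = id * cst d by apply/funext.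
    by apply: is_derive_eq; rewrite scaler0 add0r -[LHS]/(d * 1) mulr1.
  have := @is_derive1_comp _ (fun s => F (z + s *: ev i)) (fun s => s * d) t _ _ H1 H2.
  by rewrite /comp mulrC.
have cG : {within `[0, 1], continuous G}.
  apply: derivable_within_continuous => t; rewrite in_itv /= => t01. by case: (dG t t01).
have dG' (t : R) : t \in `]0, 1[%R -> is_derive t 1 G (d * 'D_(ev i) F (z + (t * d) *: ev i)).
  by move=> t01; apply: dG; move: t01; rewrite in_itv /= => /andP[/ltW -> /ltW ->].
have [c c01] := MVT_segment ler01 dG' cG.
rewrite subr0 mulr1 /G mul1r mul0r scale0r addr0 => ->.
by exists c => //; move: c01; rewrite in_itv.
Qed.

Lemma coord_le_norm n (v : 'rV[R]_n) j : `|v 0 j| <= `|v|.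
rewrite [leRHS]/Num.Def.normr/= mx_normrE.
exact: (le_bigmax _ _ (ord0, j)).
Qed.

Lemma norm_rV_le n (v : 'rV[R]_n) r : 0 <= r -> (forall j, `|v 0 j| <= r) -> `|v| <= r.
move=> r0 H; rewrite [leLHS]/Num.Def.normr/= mx_normrE.
by apply: bigmax_le => // -[i j] _ /=; rewrite ord1.
Qed.

(** Move from x to y one coordinate at a time: for the sup norm every intermediate point stays
    within [|y - x|] of x. Only partial derivatives are used, which is all that [Ck] gives. *)
Lemma mvt_box n (F : 'rV[R]_n -> R) (x y : 'rV[R]_n) e :
  (forall z : 'rV[R]_n, `|z - x| < e -> forall i, derivable F z (ev i)) -> `|y - x| < e ->
  exists2 c : 'I_n -> 'rV[R]_n, (forall i, `|c i - x| <= `|y - x|) &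
    F y - F x = \sum_i (y 0 i - x 0 i) * 'D_(ev i) F (c i).
move=> dF yx.
pose z k : 'rV[R]_n := \row_j if (j < k)%N then y 0 j else x 0 j.
have zS (k : 'I_n) : z k.+1 = z k + (y 0 k - x 0 k) *: ev k.
  apply/rowP => j; rewrite !mxE eqxx ltnS leq_eqVlt (_ : (nat_of_ord j == k) = (j == k)) //.
  case: (eqVneq j k) => [->|_] /=; last by rewrite mulr0 addr0. by rewrite ltnn /= mulr1 addrC subrK.
have zt (k : 'I_n) (t : R) : 0 <= t <= 1 -> `|z k + (t * (y 0 k - x 0 k)) *: ev k - x| <= `|y - x|.
  move=> /andP[t0 t1]; apply: norm_rV_le => // j.
  apply: le_trans (coord_le_norm _ j); rewrite !mxE eqxx /=. have [->|jk] := eqVneq j k.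
    rewrite ltnn mulr1 addrAC subrr add0r normrM (ger0_norm t0). by rewrite ler_piMl.
  rewrite mulr0 addr0; case: ifP => // _; rewrite subrr normr0 //.
have step (k : 'I_n) : exists2 c : 'rV[R]_n, `|c - x| <= `|y - x| &
    F (z k.+1) - F (z k) = (y 0 k - x 0 k) * 'D_(ev k) F c.
  rewrite zS; have [t t01 ->] := @mvt_line n F (z k) k (y 0 k - x 0 k)
    (fun t t01 => dF _ (le_lt_trans (zt k t t01) yx) k).
  by exists (z k + (t * (y 0 k - x 0 k)) *: ev k) => //; exact: zt.
have [c c1 c2] := fin_all_exists2 step.
exists c => //.
under eq_bigr do rewrite -c2.
rewrite -(big_mkord xpredT (fun k => F (z k.+1) - F (z k))) telescope_sumr //.
by congr (F _ - F _); apply/rowP => j; rewrite !mxE ?ltn_ord.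
Qed.

Lemma near_norm n (x : 'rV[R]_n) (e : R) : 0 < e -> \forall y \near x, `|y - x| < e.
by move=> e0; apply/nbhs_ballP; exists e => // y; rewrite -ball_normE /= distrC.
Qed.

Lemma open_ball n (U : set 'rV[R]_n) x :
  open U -> U x -> exists2 e : R, 0 < e & forall z : 'rV[R]_n, `|z - x| < e -> U z.
move=> oU Ux; have /nbhs_ballP[e e0 H] : nbhs x U by exact: open_nbhs_nbhs.
by exists e => // z zt; apply: H; rewrite -ball_normE /= distrC.
Qed.

Lemma is_derive_cvg (W : normedModType R) (f : R -> W) (t : R) (l : W) :
  h^-1 *: (f (h + t) - f t) @[h --> 0^'] --> l -> is_derive t 1 f l.
have E : (fun h : R => h^-1 *: (f (h + t) - f t)) =
   (fun h : R => h^-1 *: ((f \o shift t) (h *: 1) - f t)).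
  by apply/funext => h; rewrite /= -[h *: 1]/(h * 1) mulr1.
rewrite E => H; split; first by apply/cvg_ex; exists l.
by apply/cvg_lim.
Qed.

Lemma is_derive_cvg_inv (W : normedModType R) (f : R -> W) (t : R) (l : W) :
  is_derive t 1 f l -> h^-1 *: (f (h + t) - f t) @[h --> 0^'] --> l.
have E : (fun h : R => h^-1 *: (f (h + t) - f t)) =
   (fun h : R => h^-1 *: ((f \o shift t) (h *: 1) - f t)).
  by apply/funext => h; rewrite /= -[h *: 1]/(h * 1) mulr1.
by rewrite E => -[H <-].
Qed.

Lemma cvg_sumr (T : Type) (F : set_system T) (FF : Filter F) (I : Type) (r : seq I)
    (f : I -> T -> R) (l : I -> R) : (forall i, f i x @[x --> F] --> l i) ->
  \sum_(i <- r) f i x @[x --> F] --> \sum_(i <- r) l i.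
move=> H; elim: r => [|a r IH].
  by under eq_fun do rewrite big_nil; rewrite big_nil; exact: cvg_cst.
by under eq_fun do rewrite big_cons; rewrite big_cons; exact: cvgD.
Qed.

Lemma cvg_lincomb (T : Type) (F : set_system T) (FF : Filter F) p (c : R)
    (a b : 'I_p -> T -> R) (la lb : 'I_p -> R) :
  (forall i, a i x @[x --> F] --> la i) -> (forall i, b i x @[x --> F] --> lb i) ->
  c + \sum_i a i x * b i x @[x --> F] --> c + \sum_i la i * lb i.
move=> Ha Hb; apply: cvgD; first exact: cvg_cst.
by apply: cvg_sumr => i; apply: cvgM.
Qed.

(** [Ck 1] provides continuous partial derivatives but no differential. The increment of F is
    written by [mvt_box] with mean value points [c h j], which tend to [gam t], and the continuity
    of the partial derivatives gives the limit. *)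
Lemma chain1 p (U : set 'rV[R]_p) (F : 'rV[R]_p -> R) (gam : R -> 'rV[R]_p) (t : R) g :
  open U -> U (gam t) -> Ck 1 U F -> (forall j, is_derive t 1 (fun s => gam s 0 j) (g j)) ->
  is_derive t 1 (F \o gam) (\sum_j 'D_(ev j) F (gam t) * g j).
move=> oU Ut C1F dgam.
have [e e0 eU] := open_ball oU Ut.
have dF z : `|z - gam t| < e -> forall i, derivable F z (ev i).
  by move=> /eU Uz i; apply: (C1F i).1.
have cgam : h + t @[h --> 0^'] --> t.
  rewrite -[X in _ --> X]add0r; apply: cvgD; last exact: cvg_cst. exact: nbhs_dnbhs.
have {}cgam : gam (h + t) @[h --> 0^'] --> gam t.
  apply: (@cvg_comp _ _ _ (fun h => h + t) gam _ (nbhs t)) => //.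
  suff : differentiable gam t by move/differentiable_continuous.
  apply/derivable1_diffP/derivable_mxP => i j. by rewrite ord1; case: (dgam j).
have /choice[c cP] : forall h : R, exists c : 'I_p -> 'rV[R]_p,
   (forall i, `|c i - gam t| <= `|gam (h + t) - gam t|) /\
   (`|gam (h + t) - gam t| < e -> F (gam (h + t)) - F (gam t) =
     \sum_i (gam (h + t) 0 i - gam t 0 i) * 'D_(ev i) F (c i)).
  move=> h; have [H|H] := pselect (`|gam (h + t) - gam t| < e).
    by have [c c1 c2] := mvt_box dF H; exists c.
  by exists (fun=> gam t); split=> [i|//]; rewrite subrr normr0.
apply: is_derive_cvg.
have cc j : c h j @[h --> 0^'] --> gam t.
  apply/cvgrPdist_lt => d d0; move/cvgrPdist_lt: cgam => /(_ d d0).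
  apply: filterS => h; rewrite ![`|gam t - _|]distrC; apply: le_lt_trans. exact: (cP h).1.
have : \sum_j 'D_(ev j) F (c h j) * (h^-1 * (gam (h + t) 0 j - gam t 0 j))
     @[h --> 0^'] --> \sum_j 'D_(ev j) F (gam t) * g j.
  apply: cvg_sumr => j; apply: cvgM; last exact: (is_derive_cvg_inv (dgam j)).
  apply: (@cvg_comp _ _ _ (fun h => c h j) ('D_(ev j) F) _ (nbhs (gam t))).
    exact: cc.
  exact: (C1F j).2.
apply: cvg_trans; apply: near_eq_cvg.
move/cvgrPdist_lt: cgam => /(_ e e0); apply: filterS => h.
rewrite distrC => /(cP h).2 /= ->; rewrite scaler_sumr; bigr => j _.
by rewrite -[RHS]/(h^-1 * (_ * _)); ring.
Qed.

Lemma is_derive_dir n (F : 'rV[R]_n -> R) (x v : 'rV[R]_n) (d : R) :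
  is_derive x v F d <-> is_derive (0 : R) 1 (fun t : R => F (t *: v + x)) d.
have E : (fun h : R => h^-1 *: ((F \o shift x) (h *: v) - F x)) =
   (fun h : R => h^-1 *: (((fun t : R => F (t *: v + x)) \o shift 0) (h *: 1) -
                          (fun t : R => F (t *: v + x)) 0)).
  by apply/funext => h; rewrite /= -[h *: 1]/(h * 1) mulr1 addr0 scale0r add0r.
by split=> -[H1 H2]; split; move: H1 H2; rewrite /derivable /derive E.
Qed.

Lemma chainv n p (U : set 'rV[R]_p) (F : 'rV[R]_p -> R) (G : 'rV[R]_n -> 'rV[R]_p) (x v : 'rV[R]_n) g :
  open U -> U (G x) -> Ck 1 U F -> (forall j, is_derive x v (fun y => G y 0 j) (g j)) ->
  is_derive x v (F \o G) (\sum_j 'D_(ev j) F (G x) * g j).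
move=> oU Ux CF dG; apply/is_derive_dir.
have E : x = 0 *: v + x by rewrite scale0r add0r.
have := @chain1 p U F (fun t => G (t *: v + x)) 0 g oU.
by rewrite -E => /(_ Ux CF); apply => j; apply/is_derive_dir.
Qed.

Lemma chain_scal n (phi : R -> R) (F : 'rV[R]_n -> R) (x v : 'rV[R]_n) a d :
  is_derive (F x) 1 phi a -> is_derive x v F d -> is_derive x v (phi \o F) (a * d).
move=> dphi /is_derive_dir dF; apply/is_derive_dir.
have E : x = 0 *: v + x by rewrite scale0r add0r.
by apply: (@is_derive1_comp _ phi (fun t => F (t *: v + x))) => //; rewrite -E.
Qed.

Lemma cvg_rV (T : Type) (F : set_system T) (FF : Filter F) n (f : T -> 'rV[R]_n) (l : 'rV[R]_n) :
  (forall j, f x 0 j @[x --> F] --> l 0 j) -> f x @[x --> F] --> l.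
move=> H; apply/cvgrPdist_le => e e0.
have : \forall x \near F, forall j, `|l 0 j - f x 0 j| <= e.
  by apply: filter_forall => j; have /cvgrPdist_le := H j; apply.
apply: filterS => x Hx; apply: norm_rV_le => [|j]; first exact: ltW.
by rewrite !mxE.
Qed.

Lemma rV_coord_continuous n (j : 'I_n) : continuous (fun x : 'rV[R]_n => x 0 j).
exact: coord_continuous. Qed.

(** * C^k functions on open sets *)

Section Ck.
Variable n : nat.
Implicit Types (U : set 'rV[R]_n) (F G : 'rV[R]_n -> R).

Lemma open_near U (P : 'rV[R]_n -> Prop) x :
  open U -> U x -> (forall y, U y -> P y) -> \forall y \near x, P y.
by move=> oU Ux H; apply: filterS H _; exact: open_nbhs_nbhs. Qed.

Lemma Ck_eq k U F G : open U -> (forall x, U x -> F x = G x) -> Ck k U F -> Ck k U G.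
elim: k U F G => [|k IH] U F G oU E CF /=.
  move=> x Ux; have H : F @ x --> G x by rewrite -(E x Ux); exact: CF.
  have N : \forall y \near x, F y = G y by exact: open_near oU Ux E. exact: cvg_trans (near_eq_cvg N) H.
move=> i; have [H1 H2] := CF i; split=> [x Ux|].
  have N : \forall y \near x, F y = G y by exact: open_near oU Ux E.
  exact: near_eq_derivable N (H1 x Ux).
apply: IH H2 => // x Ux; apply: near_eq_derive.
exact: open_near oU Ux E.
Qed.

Lemma Ck_sub k U V F : V `<=` U -> Ck k U F -> Ck k V F.
move=> VU; elim: k F => [|k IH] F CF /=; first by move=> x /VU /CF.
move=> i; have [H1 H2] := CF i; split=> [x /VU /H1 //|]; exact: IH.
Qed.

(** For positive k the definition of [Ck] speaks of derivatives only, so the continuity of F itself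
    has to be derived; it follows from the increment formula of [mvt_box]. *)
Lemma C1_continuous U F : open U -> Ck 1 U F -> forall x, U x -> {for x, continuous F}.
move=> oU CF x Ux.
have [e e0 eU] := open_ball oU Ux.
have dF z : `|z - x| < e -> forall i, derivable F z (ev i).
  by move=> /eU Uz i; apply: (CF i).1.
have /choice[c cP] : forall y : 'rV[R]_n, exists c : 'I_n -> 'rV[R]_n,
   (forall i, `|c i - x| <= `|y - x|) /\ (`|y - x| < e -> F y =
     F x + \sum_i (y 0 i - x 0 i) * 'D_(ev i) F (c i)).
  move=> y; have [H|H] := pselect (`|y - x| < e).
    by have [c c1 c2] := mvt_box dF H; exists c; split=> // _; rewrite -c2 addrC subrK.
  by exists (fun=> x); split=> [i|//]; rewrite subrr normr0.
have cc j : (fun y => c y j) @ x --> x.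
  apply/(@cvgrPdist_lt _ _ _ _ (nbhs_filter x)) => d d0.
  have := near_norm x d0; apply: filterS => h; rewrite [`|x - _|]distrC. apply: le_lt_trans.
  exact: (cP h).1.
have : (fun y : 'rV[R]_n => F x + \sum_j (y 0 j - x 0 j) * 'D_(ev j) F (c y j)) @ x -->
     F x + \sum_j (x 0 j - x 0 j) * 'D_(ev j) F x.
  apply: (cvg_lincomb (nbhs_filter x)) => j.
    apply: (@cvgB _ _ _ (nbhs x) (nbhs_filter x)); first exact: rV_coord_continuous.
    exact: (@cvg_cst _ _ _ (nbhs x) (nbhs_filter x)).
  apply: (@cvg_comp _ _ _ (fun h => c h j) ('D_(ev j) F) _ (nbhs x)).
    exact: cc.
  exact: (CF j).2.
rewrite (eq_bigr (fun=> 0)); last by move=> j _; rewrite subrr mul0r.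
rewrite big1 // addr0 => H.
have N : nbhs x [set y : 'rV[R]_n | F x + \sum_j (y 0 j - x 0 j) * 'D_(ev j) F (c y j) = F y].
  by have := near_norm x e0; apply: filterS => y /(cP y).2.
exact: cvg_trans (near_eq_cvg N) H.
Qed.

Lemma CkW k U F : open U -> Ck k.+1 U F -> Ck k U F.
move=> oU; elim: k F => [|k IH] F CF; first exact: C1_continuous.
by move=> i; have [H1 H2] := CF i; split=> //; apply: IH.
Qed.

Lemma Ck_cst k U (c : R) : Ck k U (fun=> c).
elim: k c => [|k IH] c /=; first by move=> x _; exact: cst_continuous.
move=> i; split=> [x _|]; first exact: derivable_cst.
have -> : (fun x : 'rV[R]_n => 'D_(ev i) (fun=> c) x) = (fun=> 0).
  by apply/funext => x; rewrite derive_cst.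
exact: IH.
Qed.

Lemma CkD k U F G : open U -> Ck k U F -> Ck k U G -> Ck k U (fun x => F x + G x).
move=> oU; elim: k F G => [|k IH] F G CF CG /=.
  by move=> x Ux; apply: (@cvgD _ _ _ (nbhs x) (nbhs_filter x)); [exact: CF|exact: CG].
move=> i; have [F1 F2] := CF i; have [G1 G2] := CG i; split=> [x Ux|].
  by apply: derivableD; [exact: F1|exact: G1].
apply: Ck_eq oU _ (IH _ _ F2 G2) => x Ux.
by rewrite [RHS]deriveD //; [exact: F1|exact: G1].
Qed.

Lemma CkM k U F G : open U -> Ck k U F -> Ck k U G -> Ck k U (fun x => F x * G x).
move=> oU; elim: k F G => [|k IH] F G CF CG /=.
  by move=> x Ux; apply: (@cvgM _ _ (nbhs x) (nbhs_filter x)); [exact: CF|exact: CG].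
move=> i; have [F1 F2] := CF i; have [G1 G2] := CG i; split=> [x Ux|].
  by apply: derivableM; [exact: F1|exact: G1].
have := CkD oU (IH _ _ (CkW oU CF) G2) (IH _ _ (CkW oU CG) F2).
apply: Ck_eq oU _ => x Ux.
by rewrite [RHS]deriveM //; [exact: F1|exact: G1].
Qed.

Lemma CkV k U F : open U -> (forall x, U x -> F x != 0) -> Ck k U F -> Ck k U (fun x => (F x)^-1).
move=> oU F0; elim: k F F0 => [|k IH] F F0 CF /=.
  by move=> x Ux; apply: (@cvgV _ _ (nbhs x) (nbhs_filter x)); [exact: F0|exact: CF].
move=> i; have [F1 F2] := CF i; split=> [x Ux|].
  by apply: derivableV; [exact: F0|exact: F1].
have IF := IH _ F0 (CkW oU CF).
have := CkM oU (CkM oU (CkM oU (Ck_cst k U (-1)) IF) IF) F2.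
apply: Ck_eq oU _ => x Ux.
rewrite [RHS]deriveV; [|exact: F0|exact: F1].
by rewrite -[RHS]/(_ * _) -exprVn expr2 mulN1r !mulNr.
Qed.

Lemma Ck_coord k U j : Ck k U (fun x => x 0 j).
have D x i : is_derive x (ev i) (fun x : 'rV[R]_n => x 0 j) ((i == j)%:R).
  have Dl : is_derive (0 : R) 1 (fun t : R => t * (i == j)%:R + x 0 j) ((i == j)%:R).
    have -> : (fun t : R => t * (i == j)%:R + x 0 j) =
      id * cst ((i == j)%:R) + cst (x 0 j) by apply/funext.
    by apply: is_derive_eq; rewrite scaler0 add0r addr0 -[LHS]/(_ * 1) mulr1.
  apply/is_derive_dir; have -> : (fun t : R => (t *: ev i + x) 0 j) =
      (fun t : R => t * (i == j)%:R + x 0 j) => //.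
  by apply/funext => t; rewrite !mxE eqxx /= eq_sym.
case: k => [|k]; first by move=> x _; exact: rV_coord_continuous.
move=> i; split=> [x _|]; first by case: (D x i).
have -> : (fun x => 'D_(ev i) (fun x : 'rV[R]_n => x 0 j) x) = (fun=> (i == j)%:R).
  by apply/funext => x; case: (D x i).
exact: Ck_cst.
Qed.

End Ck.

Lemma Ck_sum n k (U : set 'rV[R]_n) (I : Type) (r : seq I) (P : pred I) (F : I -> 'rV[R]_n -> R) :
  open U -> (forall i, P i -> Ck k U (F i)) -> Ck k U (fun x => \sum_(i <- r | P i) F i x).
move=> oU H; elim: r => [|a r IH].
  by under eq_fun do rewrite big_nil; exact: Ck_cst.
have [Pa|/negbTE Pa] := boolP (P a); under eq_fun do rewrite big_cons Pa //=.
  by apply: CkD => //; exact: H.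
exact: IH.
Qed.

Lemma Ck_sqrt n k (U : set 'rV[R]_n) (F : 'rV[R]_n -> R) :
  open U -> (forall x, U x -> 0 < F x) -> Ck k U F -> Ck k U (fun x => Num.sqrt (F x)).
move=> oU F0; elim: k => [|k IH] CF /=.
  move=> x Ux; apply: (@cvg_comp _ _ _ F (@Num.sqrt R) _ (nbhs (F x))); first exact: CF.
  exact: sqrt_continuous.
move=> i; have [F1 F2] := CF i.
have D x : U x -> is_derive x (ev i) (fun x => Num.sqrt (F x)) ((2 * Num.sqrt (F x))^-1 * 'D_(ev i) F x).
  move=> Ux; apply: chain_scal; first exact: is_derive1_sqrt (F0 x Ux). exact/derivableP/F1.
split=> [x /D[] //|].
have s0 x : U x -> 2 * Num.sqrt (F x) != 0.
  by move=> /F0 Fx; rewrite mulf_neq0 // gt_eqF // sqrtr_gt0.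
have := CkM oU (CkV oU s0 (CkM oU (Ck_cst k U 2) (IH (CkW oU CF)))) F2.
by apply: Ck_eq oU _ => x /D[].
Qed.

Lemma Ck_comp n p k (U : set 'rV[R]_n) (V : set 'rV[R]_p) (F : 'rV[R]_p -> R)
    (G : 'rV[R]_n -> 'rV[R]_p) : open U -> open V -> (forall x, U x -> V (G x)) ->
  Ck k V F -> (forall j, Ck k U (fun x => G x 0 j)) -> Ck k U (F \o G).
move=> oU oV UV; elim: k F => [|k IH] F CF CG /=.
  move=> x Ux; apply: (@cvg_comp _ _ _ G F _ (nbhs (G x))); last exact: CF (UV x Ux).
  by apply: (cvg_rV (nbhs_filter x)) => j; exact: (CG j).
have CF1 : Ck 1 V F.
  by clear -CF oV; elim: k CF => // k IH CF; apply: IH; exact: CkW.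
move=> i; have D x : U x -> is_derive x (ev i) (F \o G)
    (\sum_j 'D_(ev j) F (G x) * 'D_(ev i) (fun y => G y 0 j) x).
  move=> Ux; apply: (chainv oV (UV x Ux) CF1) => j. by apply/derivableP; exact: (CG j i).1.
split=> [x /D[] //|].
have := @Ck_sum n k U _ (index_enum 'I_p) xpredT (fun j x => 'D_(ev j) F (G x) *
   'D_(ev i) (fun y => G y 0 j) x) oU.
move=> H; apply: (Ck_eq oU _ (H _)) => [x /D[] //|j _].
apply: (CkM oU); last exact: (CG j i).2.
by apply: (IH ('D_(ev j) F)); [exact: (CF j).2|move=> l; exact: CkW].
Qed.

(** Mean value theorem along e_i for the increment of F in the direction e_j, then along e_j for the
    i-th partial derivative. *)
Lemma mvt2 n (F : 'rV[R]_n -> R) (x : 'rV[R]_n) i j (h : R) :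
  (forall s t : R, 0 <= s <= 1 -> 0 <= t <= 1 -> let z := x + (s * h) *: ev i + (t * h) *: ev j in
     derivable F z (ev i) /\ derivable ('D_(ev i) F) z (ev j)) ->
  exists s t : R, [/\ 0 <= s <= 1, 0 <= t <= 1 & F (x + h *: ev i + h *: ev j) - F (x + h *: ev i)
     - (F (x + h *: ev j) - F x) = h * h * 'D_(ev j) ('D_(ev i) F)
      (x + (s * h) *: ev i + (t * h) *: ev j)].
move=> H.
pose G y := F (y + h *: ev j) - F y.
have dG (s : R) : 0 <= s <= 1 -> is_derive (x + (s * h) *: ev i) (ev i) G
     ('D_(ev i) F (x + (s * h) *: ev i + h *: ev j)
      - 'D_(ev i) F (x + (s * h) *: ev i)).
  move=> s01; have [H1 _] := H s 1 s01 ltac:(by rewrite ler01 lexx).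
  have [H2 _] := H s 0 s01 ltac:(by rewrite ler01 lexx).
  rewrite mul1r in H1; rewrite mul0r scale0r addr0 in H2. apply: is_deriveB; last exact: derivableP.
  apply/is_derive_dir; move/derivableP/is_derive_dir: H1. by under eq_fun do rewrite addrA.
have [s s01 Es] := @mvt_line n G x i h (fun s s01 => @ex_derive _ _ _ _ _ _ _ (dG s s01)).
have [t t01 Et] := @mvt_line n ('D_(ev i) F) (x + (s * h) *: ev i) j h (fun t t01 => (H s t s01 t01).2).
exists s, t; split=> //.
have := derive_val (is_derive := dG s s01); rewrite Et => E.
by rewrite -[LHS]/(G (x + h *: ev i) - G x) Es E mulrA.
Qed.

(** Schwarz: the second difference is symmetric in i and j, and by [mvt2] it is h^2 times either
    mixed derivative at a point within 2 h of x. *)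
Lemma derive_sym n (U : set 'rV[R]_n) (F : 'rV[R]_n -> R) i j x : open U -> Ck 2 U F -> U x ->
  'D_(ev j) ('D_(ev i) F) x = 'D_(ev i) ('D_(ev j) F) x.
move=> oU CF Ux; have [e e0 eU] := open_ball oU Ux.
have bv k : `|ev k : 'rV[R]_n| <= 1.
  apply: norm_rV_le => // l; rewrite mxE eqxx /=. by case: eqP => _; rewrite ?normr1 ?normr0.
have near (h s t : R) k l : 0 <= s <= 1 -> 0 <= t <= 1 ->
    `|x + (s * h) *: ev k + (t * h) *: ev l - x| <= 2 * `|h|.
  move=> /andP[s0 s1] /andP[t0 t1]; rewrite addrC !addrA addNr add0r.
  have B (r : R) q : 0 <= r -> r <= 1 -> `|(r * h) *: ev q : 'rV[R]_n| <= `|h|.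
    move=> r0 r1; rewrite normrZ -[leRHS]mulr1; apply: ler_pM => //.
    by rewrite normrM (ger0_norm r0) ler_piMl.
  apply: le_trans (ler_normD _ _) _; rewrite mulr_natl mulr2n. by apply: lerD; exact: B.
have key k l (d : R) : 0 < d -> exists2 c : 'rV[R]_n, `|c - x| <= 2 * `|d| & 2 * d < e ->
   F (x + d *: ev k + d *: ev l) - F (x + d *: ev k)
     - (F (x + d *: ev l) - F x) = d * d * 'D_(ev l) ('D_(ev k) F) c.
  move=> d0; have [de|de] := pselect (2 * d < e); last first.
    by exists x => //; rewrite subrr normr0 mulr_ge0.
  have [|s [t [s01 t01 E]]] := @mvt2 n F x k l d.
    move=> s t s01 t01; have zU : U (x + (s * d) *: ev k + (t * d) *: ev l).
      by apply: eU; apply: le_lt_trans (near _ _ _ _ _ s01 t01) _; rewrite gtr0_norm.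
    by split; [exact: (CF k).1|exact: ((CF k).2 l).1].
  by exists (x + (s * d) *: ev k + (t * d) *: ev l) => //; exact: near.
have [d [d0 small]] : exists d : nat -> R, (forall m, 0 < d m) /\
    forall a, 0 < a -> \forall k \near \oo, 2 * d k < a.
  exists (fun m => m.+1%:R^-1); split=> [m|a a0]; first by rewrite invr_gt0.
  have d2 : 0 < a / 2 by rewrite divr_gt0.
  have := near_infty_natSinv_lt (PosNum d2); apply: filterS => m /= H. by rewrite mulrC -ltr_pdivlMr.
have lim k l : exists2 u : nat -> 'rV[R]_n, u @ \oo --> x & \forall m \near \oo,
   F (x + d m *: ev k + d m *: ev l) - F (x + d m *: ev k)
     - (F (x + d m *: ev l) - F x) = d m * d m * 'D_(ev l) ('D_(ev k) F) (u m).
  have /choice[u uP] : forall m : nat, exists c : 'rV[R]_n, `|c - x| <= 2 * d m /\ (2 * d m < e ->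
   F (x + d m *: ev k + d m *: ev l) - F (x + d m *: ev k)
     - (F (x + d m *: ev l) - F x) = d m * d m * 'D_(ev l) ('D_(ev k) F) c).
    move=> m; have [c c1 c2] := key k l _ (d0 m). by exists c; split=> //; rewrite gtr0_norm in c1.
  exists u; last by apply: filterS (small e e0) => m H; exact: (uP m).2.
  apply/cvgrPdist_lt => a a0; apply: filterS (small a a0) => m H.
  by rewrite distrC; exact: le_lt_trans (uP m).1 H.
have [u ux uE] := lim i j; have [v vx vE] := lim j i.
have cu : 'D_(ev j) ('D_(ev i) F) (u m) @[m --> \oo] --> 'D_(ev j) ('D_(ev i) F) x.
  exact: (cvg_comp _ _ ux (((CF i).2 j).2 x Ux)).
have cv : 'D_(ev i) ('D_(ev j) F) (v m) @[m --> \oo] --> 'D_(ev i) ('D_(ev j) F) x.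
  exact: (cvg_comp _ _ vx (((CF j).2 i).2 x Ux)).
rewrite -(cvg_lim (@Rhausdorff R) cu); apply: (cvg_lim (@Rhausdorff R)).
have cancel (c a b p q : R) : 0 < c -> p = c * c * a -> q = c * c * b -> p = q -> a = b.
  move=> c0 -> -> /mulfI; apply; by rewrite gt_eqF // mulr_gt0.
apply: cvg_trans cv; apply: near_eq_cvg.
apply: filterS2 uE vE => m E1 E2; apply: (cancel _ _ _ _ _ (d0 m) E2 E1).
rewrite [x + _ + _]addrAC; ring.
Qed.

(** * C^k functions up to the boundary of a half-space *)

Definition regular m (A : set 'rV[R]_m.+1) : Prop :=
  exists2 O : set 'rV[R]_m.+1, open O & A = O \/ A = O `&` half_space m.

(** Finite-order form of [smooth_on], needed because the cutoffs used later are only C^1. *)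
Definition CkA n (k : nat) (A : set 'rV[R]_n) (f : 'rV[R]_n -> R) : Prop :=
  forall x, A x -> exists U : set 'rV[R]_n, exists F : 'rV[R]_n -> R,
    [/\ open U, U x, Ck k U F & forall y, A y -> U y -> f y = F y].

Section CkA.
Variable n : nat.
Implicit Types (A B U : set 'rV[R]_n) (f g : 'rV[R]_n -> R).

Lemma smooth_CkA k A f : smooth_on A f -> CkA k A f.
by move=> H x /H[U [F [oU Ux CF E]]]; exists U, F. Qed.

Lemma CkA_eq k A f g : (forall x, A x -> f x = g x) -> CkA k A f -> CkA k A g.
move=> E H x Ax; have [U [F [oU Ux CF EF]]] := H x Ax.
by exists U, F; split=> // y Ay Uy; rewrite -E // EF.
Qed.

Lemma CkA_sub k A B f : B `<=` A -> CkA k A f -> CkA k B f.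
move=> BA H x /BA /H[U [F [oU Ux CF EF]]].
by exists U, F; split=> // y /BA; exact: EF.
Qed.

Lemma CkA_local k A f : (forall x, A x -> exists U, [/\ open U, U x & CkA k (A `&` U) f]) -> CkA k A f.
move=> H x Ax; have [U [oU Ux HU]] := H x Ax.
have [V [F [oV Vx CF EF]]] := HU x (conj Ax Ux).
exists (U `&` V), F; split; [exact: openI| by []| |].
  by apply: Ck_sub CF; exact: subIsetr.
by move=> y Ay [Uy Vy]; exact: EF.
Qed.

Lemma CkAW k A f : CkA k.+1 A f -> CkA k A f.
by move=> H x /H[U [F [oU Ux CF EF]]]; exists U, F; split=> //; exact: CkW.
Qed.

Lemma CkA_cst k A (c : R) : CkA k A (fun=> c).
by move=> x Ax; exists setT, (fun=> c); split=> //; [exact: openT|exact: Ck_cst].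
Qed.

Lemma CkA_coord k A j : CkA k A (fun x => x 0 j).
by move=> x Ax; exists setT, (fun x => x 0 j); split=> //; [exact: openT|exact: Ck_coord].
Qed.

Hint Resolve CkA_cst CkA_coord : core.

Lemma CkA_bin k A (op : R -> R -> R) f g :
  (forall U F G, open U -> Ck k U F -> Ck k U G -> Ck k U (fun x => op (F x) (G x))) ->
  CkA k A f -> CkA k A g -> CkA k A (fun x => op (f x) (g x)).
move=> Hop Hf Hg x Ax; have [U [F [oU Ux CF EF]]] := Hf x Ax.
have [V [G [oV Vx CG EG]]] := Hg x Ax.
exists (U `&` V), (fun x => op (F x) (G x)); split; [exact: openI|by []| |].
  apply: Hop; first exact: openI.
    by apply: Ck_sub CF; exact: subIsetl.
  by apply: Ck_sub CG; exact: subIsetr.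
by move=> y Ay [Uy Vy]; rewrite EF // EG.
Qed.

Lemma CkAD k A f g : CkA k A f -> CkA k A g -> CkA k A (fun x => f x + g x).
by apply: CkA_bin => *; exact: CkD. Qed.

Lemma CkAM k A f g : CkA k A f -> CkA k A g -> CkA k A (fun x => f x * g x).
by apply: CkA_bin => *; exact: CkM. Qed.

Lemma CkAN k A f : CkA k A f -> CkA k A (fun x => - f x).
move=> Hf; apply: (@CkA_eq k A (fun x => -1 * f x)) => [x _|]; first by rewrite mulN1r.
by apply: CkAM => //.
Qed.

Lemma CkAB k A f g : CkA k A f -> CkA k A g -> CkA k A (fun x => f x - g x).
by move=> Hf Hg; apply: CkAD => //; exact: CkAN. Qed.

Lemma CkA_big k A (op : R -> R -> R) (a : R) (I : Type) (r : seq I) (P : pred I) (f : I -> 'rV[R]_n -> R) :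
  (forall f g, CkA k A f -> CkA k A g -> CkA k A (fun x => op (f x) (g x))) ->
  (forall i, P i -> CkA k A (f i)) -> CkA k A (fun x => \big[op/a]_(i <- r | P i) f i x).
move=> Hop H; elim: r => [|b r IH].
  by under eq_fun do rewrite big_nil; exact: CkA_cst.
have [Pb|/negbTE Pb] := boolP (P b); under eq_fun do rewrite big_cons Pb //=.
  by apply: Hop => //; exact: H.
exact: IH.
Qed.

Lemma CkA_sum k A (I : Type) (r : seq I) (P : pred I) (f : I -> 'rV[R]_n -> R) :
  (forall i, P i -> CkA k A (f i)) -> CkA k A (fun x => \sum_(i <- r | P i) f i x).
by apply: CkA_big => *; exact: CkAD. Qed.

Lemma CkA_prod k A (I : Type) (r : seq I) (P : pred I) (f : I -> 'rV[R]_n -> R) :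
  (forall i, P i -> CkA k A (f i)) -> CkA k A (fun x => \prod_(i <- r | P i) f i x).
by apply: CkA_big => *; exact: CkAM. Qed.

Lemma Ck0 k U F : open U -> Ck k U F -> Ck 0 U F.
by move=> oU; elim: k => // k IH CF; apply: IH; exact: CkW. Qed.

(** Off A the extension F may leave the domain P of [op], so its neighbourhood is cut down to the
    open part where F lies in P. *)
Lemma CkA_un k A (P : set R) (op : R -> R) f : open P -> (forall x, A x -> P (f x)) ->
  (forall U F, open U -> (forall x, U x -> P (F x)) -> Ck k U F -> Ck k U (fun x => op (F x))) ->
  CkA k A f -> CkA k A (fun x => op (f x)).
move=> oP fP Hop Hf x Ax; have [U [F [oU Ux CF EF]]] := Hf x Ax.
have oV : open (U `&` F @^-1` P).
  rewrite openE => y [Uy Py]; apply: filterI; first exact: open_nbhs_nbhs.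
  by apply: (Ck0 oU CF Uy); exact: open_nbhs_nbhs.
exists (U `&` F @^-1` P), (op \o F); split=> //.
- by split=> //=; rewrite -EF //; exact: fP.
- apply: Hop => //; first by move=> y [].
  by apply: Ck_sub CF; exact: subIsetl.
- by move=> y Ay [Uy _] /=; rewrite EF.
Qed.

Lemma CkAV k A f : (forall x, A x -> f x != 0) -> CkA k A f -> CkA k A (fun x => (f x)^-1).
move=> f0; apply: (@CkA_un k A [set x | x != 0] (@GRing.inv R) f (@open_neq R 0) f0).
by move=> U F oU HF CF; exact: CkV.
Qed.

Lemma CkA_sqrt k A f : (forall x, A x -> 0 < f x) -> CkA k A f -> CkA k A (fun x => Num.sqrt (f x)).
move=> f0; apply: (@CkA_un k A [set x | 0 < x] (@Num.sqrt R) f (@open_gt R 0) f0).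
by move=> U F oU HF CF; exact: Ck_sqrt.
Qed.

(** Each component has its own neighbourhood; the intersection of finitely many interiors is a
    common one. The last clause serves compositions: H is continuous on W only, so a preimage of an
    open set is open only after intersection with W. *)
Lemma CkA_ext_map p k A (G : 'rV[R]_n -> 'rV[R]_p) x : (forall j, CkA k A (fun y => G y 0 j)) -> A x ->
  exists (W : set 'rV[R]_n) (H : 'rV[R]_n -> 'rV[R]_p), [/\ open W /\ W x,
    forall j, Ck k W (fun y => H y 0 j), forall y, A y -> W y -> G y = H y &
    forall V, open V -> open (W `&` H @^-1` V)].
move=> HG Ax; have /choice[W HW] : forall j : 'I_p, exists W : set 'rV[R]_n * ('rV[R]_n -> R),
    [/\ open W.1, W.1 x, Ck k W.1 W.2 & forall y, A y -> W.1 y -> G y 0 j = W.2 y].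
  by move=> j; have [U [g []]] := HG j x Ax; exists (U, g).
pose H y : 'rV[R]_p := \row_j (W j).2 y.
pose W0 : set 'rV[R]_n := [set y | forall j, ((W j).1)° y].
have oW0 : open W0.
  rewrite openE => y Wy; apply: (filter_forall (nbhs_filter y)) => j.
  by apply: open_nbhs_nbhs; split; [exact: open_interior|exact: Wy].
have W01 j : W0 `<=` (W j).1 by move=> y /(_ j); exact: interior_subset.
have CH j : Ck k W0 (fun y => H y 0 j).
  have -> : (fun y => H y 0 j) = (W j).2 by apply/funext => y; rewrite mxE.
  by have [_ _ C _] := HW j; exact: Ck_sub C.
exists W0, H; split=> // [|y Ay Wy|V oV].
- by split=> // j; have [oW Wx _ _] := HW j; apply: open_nbhs_nbhs.
- apply/rowP => j; rewrite mxE; by have [_ _ _ ->] := HW j => //; exact: W01.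
rewrite openE => y [Wy Vy]; apply: filterI; first exact: open_nbhs_nbhs.
suff : H @ y --> H y by apply; exact: open_nbhs_nbhs.
by apply: (cvg_rV (nbhs_filter y)) => j; exact: (Ck0 oW0 (CH j)).
Qed.

Lemma CkA_comp p k A (B : set 'rV[R]_p) (f : 'rV[R]_p -> R) (G : 'rV[R]_n -> 'rV[R]_p) :
  (forall x, A x -> B (G x)) -> CkA k B f -> (forall j, CkA k A (fun x => G x 0 j)) -> CkA k A (f \o G).
move=> AB Hf HG x Ax; have [V [F [oV Vx CF EF]]] := Hf _ (AB x Ax).
have [W [H [[oW Wx] CH GH /(_ V oV) oWH]]] := CkA_ext_map HG Ax.
exists (W `&` H @^-1` V), (F \o H); split=> //.
- by split=> //=; rewrite -GH.
- apply: (Ck_comp oWH oV) => //; first by move=> y [].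
  by move=> j; apply: Ck_sub (CH j); exact: subIsetl.
- move=> y Ay [Wy Vy] /=; rewrite GH // EF //.
  by rewrite -GH //; exact: AB.
Qed.

Lemma CkA_cvg k A f x : CkA k A f -> A x -> f @ within A (nbhs x) --> f x.
move=> Hf Ax; have [U [F [oU Ux CF EF]]] := Hf x Ax.
rewrite EF //; have H : F @ within A (nbhs x) --> F x.
  apply: cvg_trans (Ck0 oU CF Ux). by apply: cvg_app; exact: cvg_within.
apply: cvg_trans H; apply: near_eq_cvg; rewrite near_withinE.
by apply: filterS (open_nbhs_nbhs (conj oU Ux)) => y Uy Ay; rewrite EF.
Qed.

Lemma CkA_continuous k A f : CkA k A f -> {within A, continuous f}.
by move=> Hf; apply/(@subspace_continuousP 'rV[R]_n) => x Ax; exact: CkA_cvg Hf Ax. Qed.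

End CkA.
#[local] Hint Resolve CkA_cst CkA_coord : core.

(** * Rules for one-sided partial derivatives *)

Section PdLocal.
Variable n : nat.
Implicit Types (A B U : set 'rV[R]_n) (f g : 'rV[R]_n -> R).

Lemma near_line U i x : open U -> U x -> \forall s \near (0 : R), U (x + s *: ev i).
move=> oU Ux.
have c : x + s *: ev i @[s --> (0 : R)] --> x.
  rewrite -[X in _ --> X]addr0 -(scale0r (ev i)). by apply: cvgD; [exact: cvg_cst|apply: cvgZr_tmp].
by apply: c; exact: open_nbhs_nbhs.
Qed.

(** [pd] in the direction i sees a single line. This covers functions that are known to agree only
    on the face of a half-space, for i tangent to the face. *)
Lemma pd_line A B f g i x : f x = g x ->
  (\forall s \near (0 : R), A (x + s *: ev i) <-> B (x + s *: ev i)) ->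
  (\forall s \near (0 : R), A (x + s *: ev i) -> f (x + s *: ev i) = g (x + s *: ev i)) ->
  pd A f i x = pd B g i x.
move=> fx AB fg; rewrite /pd; congr (lim _).
apply/seteqP; split=> P /=; rewrite /fmap /= /within /=; apply: filterS3 AB fg => s ABs fgs HP [s0 Bs].
  by rewrite /= -fx -fgs; [apply: HP; split=> //|]; apply/ABs.
by rewrite /= fx fgs //; apply: HP; split=> //; apply/ABs.
Qed.

Lemma pd_local A B U f g i x : open U -> U x -> (forall y, U y -> (A y <-> B y)) ->
  (forall y, U y -> A y -> f y = g y) -> A x -> pd A f i x = pd B g i x.
move=> oU Ux AB fg Ax; have N := near_line i oU Ux.
apply: (pd_line (fg x Ux Ax)); first by apply: filterS N => s /AB.
by apply: filterS N => s Us; exact: fg.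
Qed.

End PdLocal.

Section Pd.
Variable m : nat.
Implicit Types (A B U : set 'rV[R]_m.+1) (f g : 'rV[R]_m.+1 -> R).

Lemma regular_openI A U : regular A -> open U -> regular (A `&` U).
move=> [W oO AO] oU; exists (W `&` U); first exact: openI.
by case: AO => ->; [left|right; rewrite setIAC].
Qed.

Lemma open_regular U : open U -> regular U.
by move=> oU; exists U => //; left. Qed.

(** Small increments s > 0 keep a point of a half-space in it, so the filter in [pd] is proper even
    at the boundary and its limits are unique. *)
Lemma pd_filter A i x : regular A -> A x ->
  ProperFilter (within [set s : R | s != 0 /\ A (x + s *: ev i)] (nbhs (0 : R))).
move=> [W oO AO] Ax; split; last exact: within_filter.
rewrite /within /= => H.
have Ox : W x by case: AO Ax => -> // -[].
have : nbhs (0 : R) [set s : R | (s != 0 /\ A (x + s *: ev i) -> False) /\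
    W (x + s *: ev i)] by exact: filterI H (near_line i oO Ox).
move=> /nbhs_ballP[e /= e0 He].
have [|H1 H2] := He (e / 2).
  by rewrite /ball /= sub0r normrN gtr0_norm ?divr_gt0 // ltr_pdivrMr // ltr_pMr // ltr1n.
apply: H1; split; first by rewrite gt_eqF // divr_gt0.
case: AO Ax => -> // -[_ x0]; split=> //; rewrite /half_space /= !mxE eqxx.
by rewrite addr_ge0 // mulr_ge0 // divr_ge0 // ltW.
Qed.

Lemma pd_ext_cvg A f U F i x : A x -> open U -> U x ->
  (forall y, A y -> U y -> f y = F y) -> derivable F x (ev i) ->
  (fun s : R => s^-1 * (f (x + s *: ev i) - f x)) @
    within [set s : R | s != 0 /\ A (x + s *: ev i)] (nbhs (0 : R)) --> 'D_(ev i) F x.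
move=> Ax oU Ux E dF.
have dFc : (fun h : R => h^-1 *: ((F \o shift x) (h *: ev i) - F x)) @ 0^' -->
   'D_(ev i) F x by exact: dF.
have : (fun h : R => h^-1 *: ((F \o shift x) (h *: ev i) - F x)) @
   within [set s : R | s != 0 /\ A (x + s *: ev i)] (nbhs (0 : R)) --> 'D_(ev i) F x.
  apply: cvg_trans dFc; apply: cvg_app => P; rewrite /dnbhs.
  change (within (fun y : R => y != 0) (nbhs (0 : R)) P ->
    within [set s : R | s != 0 /\ A (x + s *: ev i)] (nbhs (0 : R)) P).
  by rewrite /within /=; apply: filterS => s /= HP [/HP].
apply: cvg_trans; apply: near_eq_cvg; rewrite near_withinE.
have := near_line i oU Ux; apply: filterS => s Us [s0 As] /=.
by rewrite (E _ As Us) (E _ Ax Ux) [s *: _ + x]addrC.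
Qed.

(** The bridge to open sets: any local extension computes [pd], and through it the rules of calculus
    carry over to A. *)
Lemma pdE A f U F i x : regular A -> A x -> open U -> U x ->
  (forall y, A y -> U y -> f y = F y) -> derivable F x (ev i) -> pd A f i x = 'D_(ev i) F x.
move=> rA Ax oU Ux E dF; have PF := pd_filter i rA Ax.
by apply: (cvg_lim (@Rhausdorff R)); exact: pd_ext_cvg E dF.
Qed.

Lemma CkA_ext A f x : CkA 1 A f -> regular A -> A x ->
  exists U F, [/\ open U, U x, Ck 1 U F, forall y, A y -> U y -> f y = F y &
     forall i y, A y -> U y -> pd A f i y = 'D_(ev i) F y].
move=> Hf rA Ax; have [U [F [oU Ux CF EF]]] := Hf x Ax.
exists U, F; split=> // i y Ay Uy; apply: (pdE rA Ay oU Uy EF).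
exact: (CF i).1.
Qed.

Lemma pd_cvg A f i x : CkA 1 A f -> regular A -> A x -> (fun s : R => s^-1 * (f (x + s *: ev i) - f x)) @
    within [set s : R | s != 0 /\ A (x + s *: ev i)] (nbhs (0 : R)) --> pd A f i x.
move=> Cf rA Ax; have [U [F [oU Ux CF EF]]] := Cf x Ax.
have dF := (CF i).1 x Ux.
by rewrite (pdE rA Ax oU Ux EF dF); exact: pd_ext_cvg EF dF.
Qed.

Lemma CkA_pd k A f i : regular A -> CkA k.+1 A f -> CkA k A (pd A f i).
move=> rA Hf x Ax; have [U [F [oU Ux CF EF]]] := Hf x Ax.
exists U, ('D_(ev i) F); split=> //; first exact: (CF i).2.
by move=> y Ay Uy; apply: (pdE rA Ay oU Uy EF); exact: (CF i).1.
Qed.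

Lemma pd_eq A f g i x : A x -> (forall y, A y -> f y = g y) -> pd A f i x = pd A g i x.
by move=> Ax E; apply: (@pd_local _ A A setT _ _ i x openT) => // y _ /E. Qed.

Lemma pd_cst A c i x : regular A -> A x -> pd A (fun=> c) i x = 0.
move=> rA Ax; rewrite (@pdE _ _ setT (fun=> c)) //; last exact: openT.
exact: derive_cst.
Qed.

Lemma pd_coord A i j x : regular A -> A x -> pd A (fun y => y 0 j) i x = (i == j)%:R.
move=> rA Ax; have C := @Ck_coord m.+1 1 setT j.
rewrite (@pdE _ _ setT (fun y => y 0 j)) //; [|exact: openT|exact: (C i).1].
have D : is_derive (0 : R) 1 (fun t : R => t * (i == j)%:R + x 0 j) ((i == j)%:R).
  have -> : (fun t : R => t * (i == j)%:R + x 0 j) =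
    id * cst ((i == j)%:R) + cst (x 0 j) by apply/funext.
  by apply: is_derive_eq; rewrite scaler0 add0r addr0 -[LHS]/(_ * 1) mulr1.
suff : is_derive x (ev i) (fun y : 'rV[R]_m.+1 => y 0 j) ((i == j)%:R) by case.
apply/is_derive_dir; have -> // : (fun t : R => (t *: ev i + x) 0 j) =
    (fun t : R => t * (i == j)%:R + x 0 j).
by apply/funext => t; rewrite !mxE eqxx /= eq_sym.
Qed.

Lemma pd_bin A f g (op : R -> R -> R) (dop : R -> R -> R -> R -> R) i x :
  (forall F G, derivable F x (ev i) -> derivable G x (ev i) ->
    is_derive x (ev i) (fun y => op (F y) (G y)) (dop (F x) (G x) ('D_(ev i) F x) ('D_(ev i) G x))) ->
  regular A -> A x -> CkA 1 A f -> CkA 1 A g ->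
  pd A (fun y => op (f y) (g y)) i x = dop (f x) (g x) (pd A f i x) (pd A g i x).
move=> D rA Ax Hf Hg; have [U [F [oU Ux CF EF dF]]] := CkA_ext Hf rA Ax.
have [V [G [oV Vx CG EG dG]]] := CkA_ext Hg rA Ax.
have := D F G ((CF i).1 x Ux) ((CG i).1 x Vx) => -[H1 H2].
rewrite dF // dG // EF // EG // -H2.
apply: (@pdE _ _ (U `&` V)) => //; first exact: openI.
by move=> y Ay [Uy Vy]; rewrite EF // EG.
Qed.

Lemma pdD A f g i x : regular A -> A x -> CkA 1 A f -> CkA 1 A g ->
  pd A (fun y => f y + g y) i x = pd A f i x + pd A g i x.
apply: (@pd_bin _ f g (fun a b => a + b) (fun _ _ a b => a + b)) => F G dF dG.
by apply: is_deriveD; exact: derivableP.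
Qed.

Lemma pdM A f g i x : regular A -> A x -> CkA 1 A f -> CkA 1 A g ->
  pd A (fun y => f y * g y) i x = pd A f i x * g x + f x * pd A g i x.
apply: (@pd_bin _ f g (fun a b => a * b) (fun a b c d => c * b + a * d)) => F G dF dG.
have := is_deriveM (derivableP dF) (derivableP dG).
rewrite -[_ + _]/(F x * 'D_(ev i) G x + G x * 'D_(ev i) F x).
by rewrite addrC [G x * _]mulrC.
Qed.

Lemma pdZ A f c i x : regular A -> A x -> CkA 1 A f -> pd A (fun y => c * f y) i x = c * pd A f i x.
by move=> rA Ax Hf; rewrite pdM ?pd_cst ?mul0r ?add0r //; exact: CkA_cst.
Qed.

Lemma pdN A f i x : regular A -> A x -> CkA 1 A f -> pd A (fun y => - f y) i x = - pd A f i x.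
move=> rA Ax Hf; rewrite -mulN1r -pdZ //.
by apply: pd_eq => // y _; rewrite mulN1r.
Qed.

Lemma pdB A f g i x : regular A -> A x -> CkA 1 A f -> CkA 1 A g ->
  pd A (fun y => f y - g y) i x = pd A f i x - pd A g i x.
by move=> rA Ax Hf Hg; rewrite pdD // ?pdN //; exact: CkAN. Qed.

Lemma pd_sum A (I : Type) (r : seq I) (P : pred I) (f : I -> 'rV[R]_m.+1 -> R) i x :
  regular A -> A x -> (forall j, P j -> CkA 1 A (f j)) ->
  pd A (fun y => \sum_(j <- r | P j) f j y) i x = \sum_(j <- r | P j) pd A (f j) i x.
move=> rA Ax H; elim: r => [|a r IH].
  by rewrite big_nil; under eq_fun do rewrite big_nil; exact: pd_cst.
rewrite big_cons -IH; have [Pa|/negbTE Pa] := boolP (P a).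
  under eq_fun do rewrite big_cons Pa. by apply: pdD => //; [exact: H|exact: CkA_sum].
by under eq_fun do rewrite big_cons Pa.
Qed.

Lemma pdC A f i j x : regular A -> A x -> CkA 2 A f -> pd A (pd A f i) j x = pd A (pd A f j) i x.
move=> rA Ax Hf; have [U [F [oU Ux CF EF]]] := Hf x Ax.
have E l y : A y -> U y -> pd A f l y = 'D_(ev l) F y.
  by move=> Ay Uy; apply: (pdE rA Ay oU Uy EF); exact: (CF l).1.
rewrite (pdE rA Ax oU Ux (E i)); last exact: ((CF i).2 j).1.
rewrite (pdE rA Ax oU Ux (E j)); last exact: ((CF j).2 i).1.
exact: derive_sym oU CF Ux.
Qed.

End Pd.

Lemma pd_comp m p (A : set 'rV[R]_m.+1) (B : set 'rV[R]_p.+1) (f : 'rV[R]_p.+1 -> R) (G : 'rV[R]_m.+1 -> 'rV[R]_p.+1) i x :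
  regular A -> regular B -> A x -> (forall y, A y -> B (G y)) -> CkA 1 B f ->
  (forall j, CkA 1 A (fun y => G y 0 j)) ->
  pd A (fun y => f (G y)) i x = \sum_j pd B f j (G x) * pd A (fun y => G y 0 j) i x.
move=> rA rB Ax AB Hf HG.
have [V [F [oV Vx CF EF dF]]] := CkA_ext Hf rB (AB x Ax).
have [W [H [[oW Wx] CH GH /(_ V oV) oWH]]] := CkA_ext_map HG Ax.
have DH j : is_derive x (ev i) (fun y => H y 0 j) ('D_(ev i) (fun y => H y 0 j) x).
  by apply/derivableP; exact: (CH j i).1.
have VH : V (H x) by rewrite -GH.
have [D1 D2] := chainv oV VH CF DH.
have Wx' : (W `&` H @^-1` V) x by [].
have EH y : A y -> (W `&` H @^-1` V) y -> f (G y) = (F \o H) y.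
  move=> Ay [Wy Vy] /=; rewrite -GH // EF //; first exact: AB. by rewrite GH.
rewrite (pdE rA Ax oWH Wx' EH D1) D2; bigr => j _.
rewrite (dF j _ (AB x Ax) Vx) -GH //; have [D3 D4] := DH j.
by rewrite (pdE rA Ax oW Wx (F := fun y => H y 0 j) _ D3) // => y Ay Wy; rewrite GH.
Qed.

End PartialDerivatives.
#[local] Hint Resolve CkA_cst CkA_coord : core.

Lemma mxDE {R : realType} p q (X Y : 'M[R]_(p, q)) i j : (X + Y) i j = X i j + Y i j.
by rewrite mxE. Qed.

Lemma mxNE {R : realType} p q (X : 'M[R]_(p, q)) i j : (- X) i j = - X i j.
by rewrite mxE. Qed.

Lemma mxZE {R : realType} p q c (X : 'M[R]_(p, q)) i j : (c *: X) i j = c * X i j.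
by rewrite mxE. Qed.

Ltac mxlin := apply/matrixP => ? ?; rewrite !(mxDE, mxNE); ring.

(** * The divergence identity in coordinates *)

Section MatrixCalculus.
Context {R : realType} (m : nat).
Implicit Types (A B : set 'rV[R]_m.+1).

Definition sm A (f : 'rV[R]_m.+1 -> R) := forall k, CkA k A f.
Definition smx A p q (G : 'rV[R]_m.+1 -> 'M[R]_(p, q)) := forall a b, sm A (fun y => G y a b).
Definition dmx A p q (G : 'rV[R]_m.+1 -> 'M[R]_(p, q)) (i : 'I_m.+1) x : 'M[R]_(p, q) :=
  \matrix_(a, b) pd A (fun y => G y a b) i x.

Lemma dmxE A p q (G : 'rV[R]_m.+1 -> 'M[R]_(p, q)) i x a b :
  dmx A G i x a b = pd A (fun y => G y a b) i x.
by rewrite mxE. Qed.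

Lemma smx_eq A p q (G H : 'rV[R]_m.+1 -> 'M[R]_(p, q)) :
  (forall y, A y -> G y = H y) -> smx A G -> smx A H.
by move=> E HG a b k; apply: CkA_eq (HG a b k) => y /E ->. Qed.

Lemma smxM A p q r (G : 'rV[R]_m.+1 -> 'M[R]_(p, q)) (H : 'rV[R]_m.+1 -> 'M[R]_(q, r)) :
  smx A G -> smx A H -> smx A (fun y => G y *m H y).
move=> HG HH a b k; under eq_fun do rewrite mxE.
by apply: CkA_sum => c _; apply: CkAM; [exact: HG|exact: HH].
Qed.

Lemma smxD A p q (G H : 'rV[R]_m.+1 -> 'M[R]_(p, q)) : smx A G -> smx A H -> smx A (fun y => G y + H y).
move=> HG HH a b k; under eq_fun do rewrite mxE.
by apply: CkAD; [exact: HG|exact: HH].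
Qed.

Lemma smxN A p q (G : 'rV[R]_m.+1 -> 'M[R]_(p, q)) : smx A G -> smx A (fun y => - G y).
by move=> HG a b k; under eq_fun do rewrite mxE; exact: CkAN (HG a b k). Qed.

Lemma smxT A p q (G : 'rV[R]_m.+1 -> 'M[R]_(p, q)) : smx A G -> smx A (fun y => (G y)^T).
by move=> HG a b k; under eq_fun do rewrite mxE; exact: HG. Qed.

Lemma smxZ A p q (f : 'rV[R]_m.+1 -> R) (G : 'rV[R]_m.+1 -> 'M[R]_(p, q)) :
  sm A f -> smx A G -> smx A (fun y => f y *: G y).
move=> Hf HG a b k; under eq_fun do rewrite mxE.
by apply: CkAM; [exact: Hf|exact: HG].
Qed.

Lemma smx_sum A p q (I : Type) (r : seq I) (G : I -> 'rV[R]_m.+1 -> 'M[R]_(p, q)) :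
  (forall i, smx A (G i)) -> smx A (fun y => \sum_(i <- r) G i y).
by move=> HG a b k; under eq_fun do rewrite summxE; apply: CkA_sum => i _; exact: HG.
Qed.

Lemma smx_cst A p q (C : 'M[R]_(p, q)) : smx A (fun=> C).
by move=> a b k; exact: CkA_cst. Qed.

Lemma sm_pd A f i : regular A -> sm A f -> sm A (pd A f i).
by move=> rA Hf k; apply: CkA_pd. Qed.

Lemma smx_dmx A p q (G : 'rV[R]_m.+1 -> 'M[R]_(p, q)) i : regular A -> smx A G -> smx A (dmx A G i).
by move=> rA HG a b k; under eq_fun do rewrite mxE; apply: sm_pd. Qed.

Lemma sm_det A p (G : 'rV[R]_m.+1 -> 'M[R]_p) : smx A G -> sm A (fun y => \det (G y)).
move=> HG k; rewrite /determinant; apply: CkA_sum => s _.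
apply: CkAM => //.
by apply: CkA_prod => i _; exact: HG.
Qed.

Lemma smx_inv A p (G : 'rV[R]_m.+1 -> 'M[R]_p) :
  (forall y, A y -> G y \in unitmx) -> smx A G -> smx A (fun y => invmx (G y)).
move=> uG HG; apply: (@smx_eq A p p (fun y => (\det (G y))^-1 *: \adj (G y))).
  by move=> y Ay; rewrite /invmx uG.
apply: smxZ.
  move=> k; apply: CkAV; last exact: sm_det. by move=> y /uG; rewrite unitmxE unitfE.
move=> a b k; under eq_fun do rewrite mxE /cofactor.
apply: CkAM => //.
by apply: sm_det => c d l; under eq_fun do rewrite !mxE; exact: HG.
Qed.

Section Laws.
Variables (A : set 'rV[R]_m.+1) (rA : regular A) (x : 'rV[R]_m.+1) (Ax : A x).

Lemma dmx_eq p q (G H : 'rV[R]_m.+1 -> 'M[R]_(p, q)) i :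
  (forall y, A y -> G y = H y) -> dmx A G i x = dmx A H i x.
by move=> E; apply/matrixP => a b; rewrite !mxE; apply: pd_eq => // y /E ->.
Qed.

Lemma dmxM p q r (G : 'rV[R]_m.+1 -> 'M[R]_(p, q)) (H : 'rV[R]_m.+1 -> 'M[R]_(q, r)) i :
  smx A G -> smx A H -> dmx A (fun y => G y *m H y) i x = dmx A G i x *m H x + G x *m dmx A H i x.
move=> HG HH; apply/matrixP => a b; rewrite !mxE -big_split /=.
under [X in pd _ X]eq_fun do rewrite mxE.
rewrite pd_sum // => [|c _]; last by apply: CkAM; [exact: HG|exact: HH].
bigr => c _; rewrite pdM ?mxE //; [exact: HG|exact: HH].
Qed.

Lemma dmxD p q (G H : 'rV[R]_m.+1 -> 'M[R]_(p, q)) i :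
  smx A G -> smx A H -> dmx A (fun y => G y + H y) i x = dmx A G i x + dmx A H i x.
move=> HG HH; apply/matrixP => a b; rewrite !mxE.
under [X in pd _ X]eq_fun do rewrite mxE.
by apply: pdD => //; [exact: HG|exact: HH].
Qed.

Lemma dmxN p q (G : 'rV[R]_m.+1 -> 'M[R]_(p, q)) i :
  smx A G -> dmx A (fun y => - G y) i x = - dmx A G i x.
move=> HG; apply/matrixP => a b; rewrite !mxE.
under [X in pd _ X]eq_fun do rewrite mxE.
by apply: pdN => //; exact: HG.
Qed.

Lemma dmxT p q (G : 'rV[R]_m.+1 -> 'M[R]_(p, q)) i : dmx A (fun y => (G y)^T) i x = (dmx A G i x)^T.
apply/matrixP => a b; rewrite !mxE.
by under [X in pd _ X]eq_fun do rewrite mxE.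
Qed.

Lemma dmxZ p q (f : 'rV[R]_m.+1 -> R) (G : 'rV[R]_m.+1 -> 'M[R]_(p, q)) i : sm A f -> smx A G ->
  dmx A (fun y => f y *: G y) i x = pd A f i x *: G x + f x *: dmx A G i x.
move=> Hf HG; apply/matrixP => a b; rewrite !mxE.
under [X in pd _ X]eq_fun do rewrite mxE.
by rewrite pdM //; exact: HG.
Qed.

Lemma dmx_sum p q (I : Type) (r : seq I) (G : I -> 'rV[R]_m.+1 -> 'M[R]_(p, q)) i :
  (forall j, smx A (G j)) -> dmx A (fun y => \sum_(j <- r) G j y) i x = \sum_(j <- r) dmx A (G j) i x.
move=> HG; apply/matrixP => a b; rewrite !mxE summxE.
under [X in pd _ X]eq_fun do rewrite summxE.
rewrite pd_sum // => [|j _]; last exact: HG.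
by bigr => j _; rewrite mxE.
Qed.

Lemma dmx_cst p q (C : 'M[R]_(p, q)) i : dmx A (fun=> C) i x = 0.
by apply/matrixP => a b; rewrite !mxE pd_cst. Qed.

Lemma dmxC p q (G : 'rV[R]_m.+1 -> 'M[R]_(p, q)) i j :
  smx A G -> dmx A (dmx A G i) j x = dmx A (dmx A G j) i x.
move=> HG; apply/matrixP => a b.
transitivity (pd A (fun y => dmx A G i y a b) j x); first exact: mxE.
transitivity (pd A (fun y => dmx A G j y a b) i x); last by apply/esym; exact: mxE.
transitivity (pd A (pd A (fun y => G y a b) i) j x).
  by apply: pd_eq => // y _; exact: mxE.
rewrite pdC //; last exact: HG.
by apply: pd_eq => // y _; apply/esym; exact: mxE.
Qed.

Lemma dmx_block p1 p2 q1 q2 (G1 : 'rV[R]_m.+1 -> 'M[R]_(p1, q1))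
    (G2 : 'rV[R]_m.+1 -> 'M[R]_(p1, q2)) (G3 : 'rV[R]_m.+1 -> 'M[R]_(p2, q1))
    (G4 : 'rV[R]_m.+1 -> 'M[R]_(p2, q2)) i : dmx A (fun y => block_mx (G1 y) (G2 y) (G3 y) (G4 y)) i x =
  block_mx (dmx A G1 i x) (dmx A G2 i x) (dmx A G3 i x) (dmx A G4 i x).
apply/matrixP => a b; rewrite !mxE.
under [X in pd _ X]eq_fun do rewrite !mxE.
case: (fintype.split a) => a'; rewrite !mxE.
  under [X in pd _ X]eq_fun do rewrite !mxE. by case: (fintype.split b) => b'; rewrite !mxE.
under [X in pd _ X]eq_fun do rewrite !mxE.
by case: (fintype.split b) => b'; rewrite !mxE.
Qed.

Lemma dmx_comp B p q (u : 'rV[R]_m.+1 -> 'rV[R]_m.+1) (H : 'rV[R]_m.+1 -> 'M[R]_(p, q)) i :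
  regular B -> (forall y, A y -> B (u y)) -> (forall j, sm A (fun y => u y 0 j)) -> smx B H ->
  dmx A (fun y => H (u y)) i x = \sum_a pd A (fun y => u y 0 a) i x *: dmx B H a (u x).
move=> rB AB Hu HH; apply/matrixP => a b; rewrite !mxE summxE.
rewrite (@pd_comp _ _ _ A B (fun y => H y a b) u) //; last first.
- by move=> j; exact: Hu.
- exact: HH.
by bigr => c _; rewrite !mxE mulrC.
Qed.

End Laws.

Lemma smx_comp A B p q (u : 'rV[R]_m.+1 -> 'rV[R]_m.+1) (H : 'rV[R]_m.+1 -> 'M[R]_(p, q)) :
  (forall y, A y -> B (u y)) -> (forall j, sm A (fun y => u y 0 j)) ->
  smx B H -> smx A (fun y => H (u y)).
move=> AB Hu HH a b k; apply: (CkA_comp AB (HH a b k)) => j; exact: Hu.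
Qed.

Lemma smx_block A p1 p2 q1 q2 (G1 : 'rV[R]_m.+1 -> 'M[R]_(p1, q1))
    (G2 : 'rV[R]_m.+1 -> 'M[R]_(p1, q2)) (G3 : 'rV[R]_m.+1 -> 'M[R]_(p2, q1))
    (G4 : 'rV[R]_m.+1 -> 'M[R]_(p2, q2)) : smx A G1 -> smx A G2 -> smx A G3 -> smx A G4 ->
  smx A (fun y => block_mx (G1 y) (G2 y) (G3 y) (G4 y)).
move=> H1 H2 H3 H4 a b k.
rewrite -(splitK a) -(splitK b); case: (fintype.split a) => a' /=; case: (fintype.split b) => b' /=.
- by under eq_fun do rewrite block_mxEul; exact: H1.
- by under eq_fun do rewrite block_mxEur; exact: H2.
- by under eq_fun do rewrite block_mxEdl; exact: H3.
- by under eq_fun do rewrite block_mxEdr; exact: H4.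
Qed.

(** Matrix of R(d_i, d_j) in a frame. A frame is a column e of vectors with nabla_i e = Gam_i e, so
    nabla_i nabla_j e = (d_i Gam_j + Gam_j Gam_i) e; this fixes the order of the products. *)
Definition curv A p (Gam : 'I_m.+1 -> 'rV[R]_m.+1 -> 'M[R]_p) i j x : 'M[R]_p :=
  dmx A (Gam j) i x - dmx A (Gam i) j x + Gam j x *m Gam i x - Gam i x *m Gam j x.

Lemma trmxD p q (X Y : 'M[R]_(p, q)) : (X + Y)^T = X^T + Y^T.
by apply/matrixP => i j; rewrite !mxE. Qed.

Lemma trmxN p q (X : 'M[R]_(p, q)) : (- X)^T = - X^T.
by apply/matrixP => i j; rewrite !mxE. Qed.

Lemma trmxB p q (X Y : 'M[R]_(p, q)) : (X - Y)^T = X^T - Y^T.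
by rewrite trmxD trmxN. Qed.

(** The hypothesis is the equality of the mixed second derivatives of P, expanded with d_i P = C_i P
    - P K_i; the terms C P K are symmetric in i and j and cancel. *)
Lemma frame_algebra p (Ci Cj Ki Kj P Cij Cji Kij Kji : 'M[R]_p) :
  Cij *m P + Ci *m (Cj *m P - P *m Kj) - ((Cj *m P - P *m Kj) *m Ki + P *m Kij) =
  Cji *m P + Cj *m (Ci *m P - P *m Ki) - ((Ci *m P - P *m Ki) *m Kj + P *m Kji) ->
  (Cji - Cij + Cj *m Ci - Ci *m Cj) *m P = P *m (Kji - Kij + Kj *m Ki - Ki *m Kj).
rewrite !mulmxDl !mulmxDr !mulmxN !mulNmx !mulmxA => E.
have {}E a b := congr1 (fun (M : 'M[R]_p) => M a b) E.
apply/matrixP => a b; move: (E a b) => {E}.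
rewrite !(mxDE, mxNE); lra.
Qed.

(** The same for H with d_i H = K_i H + H K_i^T: the curvature of a metric connection is
    antisymmetric. *)
Lemma metric_algebra p (Kij Kji Ki Kj H : 'M[R]_p) :
  Kij *m H + Ki *m (Kj *m H + H *m Kj^T) + ((Kj *m H + H *m Kj^T) *m Ki^T + H *m Kij^T) =
  Kji *m H + Kj *m (Ki *m H + H *m Ki^T) + ((Ki *m H + H *m Ki^T) *m Kj^T + H *m Kji^T) ->
  (Kji - Kij + Kj *m Ki - Ki *m Kj) *m H + H *m (Kji - Kij + Kj *m Ki - Ki *m Kj)^T = 0.
rewrite !(trmxD, trmxN, trmx_mul) !mulmxDl !mulmxDr !mulmxN !mulNmx !mulmxA => E.
have {}E a b := congr1 (fun (M : 'M[R]_p) => M a b) E.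
apply/matrixP => a b; move: (E a b) => {E}.
rewrite !(mxDE, mxNE) (_ : (0 : 'M[R]_p) a b = 0); [lra|by rewrite mxE].
Qed.

(** * The Levi-Civita connection in coordinates *)

Section LeviCivita.
Variables (A : set 'rV[R]_m.+1) (rA : regular A) (g : 'rV[R]_m.+1 -> 'M[R]_m.+1).
Hypotheses (sg : smx A g) (gT : forall y, A y -> (g y)^T = g y).
Hypothesis ug : forall y, A y -> g y \in unitmx.

(** Row j holds the components of nabla_i d_j. Their lowered version [low] consists of the
    Christoffel symbols of the first kind. *)
Definition chr (i : 'I_m.+1) y : 'M[R]_m.+1 := \matrix_(j, k) christoffel A g k i j y.

Definition low (i : 'I_m.+1) y : 'M[R]_m.+1 := \matrix_(j, l)
  (2^-1 * (pd A (fun z => g z j l) i y + pd A (fun z => g z i l) j y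
     - pd A (fun z => g z i j) l y)).

Lemma invmx_sym p (X : 'M[R]_p) : X^T = X -> (invmx X)^T = invmx X.
by move=> E; rewrite trmx_inv E. Qed.

Lemma chr_low i y : A y -> chr i y = low i y *m invmx (g y).
move=> Ay; apply/matrixP => j k; rewrite !mxE /christoffel mulr_sumr.
have S l : invmx (g y) k l = invmx (g y) l k.
  by rewrite -{1}(invmx_sym (gT Ay)) mxE.
by bigr => l _; rewrite mxE S; ring.
Qed.

Lemma chr_smooth i : smx A (chr i).
apply: (@smx_eq A _ _ (fun y => low i y *m invmx (g y))) => [y /chr_low -> //|].
apply: smxM; last exact: smx_inv.
move=> j l k; under eq_fun do rewrite mxE.
apply: CkAM => //.
by apply: CkAB; [apply: CkAD|]; apply: sm_pd => //; exact: sg.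
Qed.

Lemma g_sym_pd y i j k : A y -> pd A (fun z => g z i j) k y = pd A (fun z => g z j i) k y.
by move=> Ay; apply: pd_eq => // z Az; rewrite -[in LHS](gT Az) mxE. Qed.

Lemma chr_metric y i : A y -> dmx A g i y = chr i y *m g y + g y *m (chr i y)^T.
move=> Ay; rewrite chr_low // trmx_mul invmx_sym ?gT // mulmxA mulmxV ?ug // mul1mx.
rewrite mulmxKV ?ug //; apply/matrixP => j l; rewrite !mxE.
rewrite (g_sym_pd l j _ Ay); lra.
Qed.

Lemma chr_torsion y i j k : A y -> chr i y j k = chr j y i k.
move=> Ay; rewrite !mxE /christoffel; congr (_ * _); bigr => l _.
by rewrite (g_sym_pd i j _ Ay) [pd A _ i y + _]addrC.
Qed.

Lemma dmx_inv i y : A y ->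
  dmx A (fun z => invmx (g z)) i y = - (invmx (g y) *m dmx A g i y *m invmx (g y)).
move=> Ay; have sI : smx A (fun z => invmx (g z)) by apply: smx_inv.
have := dmxM rA Ay i sg sI.
rewrite (@dmx_eq A y Ay _ _ _ (fun=> 1%:M) i (fun z Az => mulmxV (ug Az))) dmx_cst //.
move=> /(congr1 (mulmx (invmx (g y)))); rewrite mulmx0 mulmxDr !mulmxA mulVmx ?ug //.
by rewrite mul1mx => /esym/eqP; rewrite addrC addr_eq0 => /eqP.
Qed.

Lemma dmx_invmx i y : A y -> dmx A (fun z => invmx (g z)) i y =
  - (invmx (g y) *m chr i y + (chr i y)^T *m invmx (g y)).
move=> Ay; rewrite (dmx_inv i Ay) (chr_metric i Ay); congr (- _).
rewrite mulmxDr mulmxDl mulmxA mulmxK ?ug // mulmxA mulVmx ?ug // mul1mx //.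
Qed.

(** Koszul's argument. It identifies the tangential block of the connection of an adapted frame with
    the Levi-Civita connection of g without computing that block. *)
Lemma chr_unique y (b : 'I_m.+1 -> 'M[R]_m.+1) : A y ->
  (forall i, dmx A g i y = b i *m g y + g y *m (b i)^T) ->
  (forall i j k, b i j k = b j i k) -> forall i, b i = chr i y.
move=> Ay bm bt i; rewrite chr_low //.
have bg k j l : (b k *m g y) j l = (b j *m g y) k l.
  by rewrite !mxE; bigr => q _; rewrite bt.
have pg k j l : pd A (fun z => g z j l) k y = (b k *m g y) j l + (b k *m g y) l j.
  have /(congr1 (fun (M : 'M[R]_m.+1) => M j l)) := bm k.
  by rewrite dmxE mxE -{2}(gT Ay) -trmx_mul [(_^T) _ _]mxE.
have -> : low i y = b i *m g y; last by rewrite mulmxK ?ug.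
apply/matrixP => j l; rewrite mxE !pg (bg j i) (bg l i) (bg l j i); lra.
Qed.

Lemma ricci_curv y : A y -> ricci_coord A g y = \matrix_(i, j) \sum_k (curv A chr k j y) i k.
move=> Ay; apply/matrixP => i j; rewrite !mxE -big_split; bigr => k _ /=.
have T a b c z : A z -> christoffel A g c a b z = christoffel A g c b a z.
  by move=> Az; have := chr_torsion a b c Az; rewrite !mxE.
have E a b c d : dmx A (chr a) b y c d = pd A (christoffel A g d a c) b y.
  by rewrite dmxE; apply: pd_eq => // z _; rewrite mxE.
rewrite !(mxDE, mxNE) !E (pd_eq k Ay (T i j k)) (pd_eq j Ay (T i k k)) -!addrA.
congr (_ + (_ + _)); rewrite sumrB; congr (_ - _); rewrite mxE; bigr => l _.
  by rewrite !mxE (T j i) // mulrC.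
by rewrite !mxE (T k i) // mulrC.
Qed.

End LeviCivita.

(* P is a moving frame and B_i = (D_i P + P Gam_i) P^-1 the connection form in this frame: the curvature
   of B is that of Gam conjugated by P, and its blocks are the Gauss and Codazzi equations. *)
Section Frame.
Variables (A : set 'rV[R]_m.+1) (rA : regular A) (p : nat).
Variables (P H G : 'rV[R]_m.+1 -> 'M[R]_p) (Gam : 'I_m.+1 -> 'rV[R]_m.+1 -> 'M[R]_p).
Hypotheses (sP : smx A P) (sH : smx A H) (sGam : forall i, smx A (Gam i)).
Hypothesis PHP : forall y, A y -> P y *m H y *m (P y)^T = G y.
Hypothesis uG : forall y, A y -> G y \in unitmx.
Hypothesis dH : forall y i, A y -> dmx A H i y = Gam i y *m H y + H y *m (Gam i y)^T.

(** P H P^T = G exhibits a right inverse of the square matrix P, hence its inverse. The product in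
    the other order, [QP], is the completeness relation of the frame. *)
Definition frame_inv y := H y *m (P y)^T *m invmx (G y).
Definition conn i y := (dmx A P i y + P y *m Gam i y) *m frame_inv y.

Lemma sG : smx A G.
by apply: (smx_eq PHP); apply: smxM; [exact: smxM|exact: smxT]. Qed.

Lemma PQ y : A y -> P y *m frame_inv y = 1%:M.
by move=> Ay; rewrite /frame_inv !mulmxA PHP // mulmxV // uG. Qed.

Lemma QP y : A y -> frame_inv y *m P y = 1%:M.
by move=> Ay; apply: mulmx1C; exact: PQ. Qed.

Lemma s_conn i : smx A (conn i).
apply: smxM; first by apply: smxD; [exact: smx_dmx|exact: smxM].
apply: smxM; first by apply: smxM => //; exact: smxT.
by apply: smx_inv => //; exact: sG.
Qed.

Lemma d_frame i y : A y -> dmx A P i y = conn i y *m P y - P y *m Gam i y.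
by move=> Ay; rewrite /conn -mulmxA QP // mulmx1 addrK. Qed.

Lemma d_metric i y : A y -> dmx A G i y = conn i y *m G y + G y *m (conn i y)^T.
move=> Ay; rewrite -(dmx_eq Ay i PHP).
rewrite dmxM //; [|exact: smxM|exact: smxT].
rewrite (dmxM rA Ay i sP sH) dmxT d_frame // dH // -PHP //.
move: (conn i y) (Gam i y) (P y) (H y) => C K P0 H0.
rewrite trmxB !trmx_mul !mulmxDl !mulmxBr !mulmxDr !mulmxA.
by rewrite !mulmxDl !mulNmx; mxlin.
Qed.

Lemma curv_frame i j y : A y -> curv A conn i j y *m P y = P y *m curv A Gam i j y.
move=> Ay; have := @dmxC A rA y Ay _ _ P i j sP.
have E k l : dmx A (dmx A P k) l y = dmx A (conn k) l y *m P y + conn k y *m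
    (conn l y *m P y - P y *m Gam l y) - ((conn l y *m P y - P y *m Gam l y) *m Gam k y
    + P y *m dmx A (Gam k) l y).
  rewrite (dmx_eq Ay l (@d_frame k)). have sC := s_conn k.
  rewrite dmxD //; [|exact: smxM|by apply: smxN; exact: smxM]. rewrite dmxN //; last exact: smxM.
  by rewrite (dmxM rA Ay l sC sP) (dmxM rA Ay l sP (sGam k)) d_frame.
rewrite !E /curv.
move: (dmx A (conn i) j y) (dmx A (conn j) i y) (dmx A (Gam i) j y) (dmx A (Gam j) i y).
move: (conn i y) (conn j y) (Gam i y) (Gam j y) (P y) => {E}.
exact: frame_algebra.
Qed.

Lemma curv_antisym i j y : A y -> curv A Gam i j y *m H y + H y *m (curv A Gam i j y)^T = 0.
move=> Ay; have := @dmxC A rA y Ay _ _ H i j sH.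
have E k l : dmx A (dmx A H k) l y = dmx A (Gam k) l y *m H y + Gam k y *m
    (Gam l y *m H y + H y *m (Gam l y)^T) + ((Gam l y *m H y + H y *m (Gam l y)^T)
    *m (Gam k y)^T + H y *m (dmx A (Gam k) l y)^T).
  rewrite (dmx_eq Ay l (fun y => @dH y k)). have sT : smx A (fun y => (Gam k y)^T) by exact: smxT.
  rewrite dmxD //; [|exact: smxM|exact: smxM].
  by rewrite (dmxM rA Ay l (sGam k) sH) (dmxM rA Ay l sH sT) dmxT dH.
rewrite !E /curv.
move: (dmx A (Gam i) j y) (dmx A (Gam j) i y) (Gam i y) (Gam j y) (H y) => {E}.
exact: metric_algebra.
Qed.

End Frame.

(** * Traces of the Gauss and Codazzi equations at a point *)

Section Contraction.
Variable n : nat.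

Lemma sum_exchange32 (F : 'I_n -> 'I_n -> 'I_n -> 'I_n -> 'I_n -> R) :
  \sum_p \sum_j \sum_i \sum_a \sum_b F p j i a b = \sum_a \sum_b \sum_p \sum_j \sum_i F p j i a b.
transitivity (\sum_p \sum_j \sum_a \sum_b \sum_i F p j i a b).
  bigr => p _; bigr => j _; rewrite exchange_big /=. by bigr => a _; rewrite exchange_big.
transitivity (\sum_p \sum_a \sum_b \sum_j \sum_i F p j i a b).
  bigr => p _; rewrite exchange_big /=. by bigr => a _; rewrite exchange_big.
rewrite exchange_big /=; bigr => a _; exact: exchange_big.
Qed.

Variables (h hi gam g A U : 'M[R]_n) (N t : 'rV[R]_n) (Th : R).
Variables (Om Og : 'I_n -> 'I_n -> 'M[R]_n) (nA : 'I_n -> 'M[R]_n) (dH : 'I_n -> R).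

Variables (W E : 'I_n -> 'I_n -> 'M[R]_n) (C : 'M[R]_n).
Let ric (O : 'I_n -> 'I_n -> 'M[R]_n) i j := \sum_k O k j i k.
Let ricN := \sum_i \sum_j N 0 i * N 0 j * ric Om i j.
Let H := \tr (gam *m A).

Hypotheses (hT : h^T = h) (hhi : h *m hi = 1%:M) (gamT : gam^T = gam).
Hypotheses (ggam : g *m gam = 1%:M) (AT : A^T = A).
Hypothesis WE : forall i j, W i j = \sum_a \sum_b (U i a * U j b) *: Om a b.
Hypothesis EE : forall a b, E a b = Om a b *m h.
Hypothesis CE : C = U^T *m gam *m U.
Hypothesis hC : C = hi - N^T *m N.
Hypothesis hN : t *m gam *m U = - Th *: N.
Hypothesis Om_h : forall a b, Om a b *m h + h *m (Om a b)^T = 0.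
Hypothesis Om_asym : forall a b, Om b a = - Om a b.
Hypothesis gauss : forall i j,
  (Og i j - (row j A)^T *m (row i A *m gam) + (row i A)^T *m (row j A *m gam)) *m g
  = U *m W i j *m h *m U^T.
Hypothesis codazzi : forall i j k, nA i j k - nA j i k = (U *m W i j *m h *m N^T) k 0.
Hypothesis nAT : forall i, (nA i)^T = nA i.
Hypothesis dHE : forall k, dH k = \tr (gam *m nA k).

Let hiT : hi^T = hi.
have hih : hi *m h = 1%:M by apply: mulmx1C.
have h2 : hi^T *m h = 1%:M by rewrite -{1}hT -trmx_mul hhi trmx1.
by rewrite -[hi^T]mulmx1 -hhi mulmxA h2 mul1mx.
Qed.

Let Ehi a b : E a b *m hi = Om a b.
by rewrite EE -mulmxA hhi mulmx1. Qed.

Let ET a b : (E a b)^T = - E a b.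
by apply/eqP; rewrite -addr_eq0 addrC EE trmx_mul hT Om_h. Qed.

Let hiE a b : hi *m E a b = - (Om a b)^T.
by rewrite -[E a b]opprK -ET mulmxN -{1}hiT -trmx_mul Ehi. Qed.

Let NEN a b : N *m E a b *m N^T = 0.
apply/matrixP => i j; rewrite !ord1 [RHS]mxE.
have : (N *m E a b *m N^T)^T 0 0 = - (N *m E a b *m N^T) 0 0.
  by rewrite trmx_mul trmxK trmx_mul ET mulNmx mulmxN mulmxA mxNE.
by rewrite mxE => /eqP; rewrite -addr_eq0 -mulr2n mulrn_eq0 => /eqP.
Qed.

Let W_E (X : 'M[R]_n) p (Z : 'M[R]_(n, p)) i j :
  X *m W i j *m h *m Z = \sum_a \sum_b (U i a * U j b) *: (X *m E a b *m Z).
rewrite WE mulmx_sumr !mulmx_suml; bigr => a _.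
rewrite mulmx_sumr !mulmx_suml; bigr => b _.
by rewrite -scalemxAr -!scalemxAl EE !mulmxA.
Qed.

(** By [hC] the matrix C = U^T g^-1 U is h^-1 minus N^T N. In the expansion of C E C the term with N
    on both sides of E vanishes by antisymmetry ([NEN]), and each of the two mixed terms is a Ricci
    term, whence the factor 2. *)
Let trace1 : \sum_p \sum_j gam p j * \sum_i (U *m W i j *m h *m (U^T *m gam)) p i =
  \sum_i \sum_j hi i j * ric Om i j - 2 * ricN.
transitivity (\sum_a \sum_b (C *m E a b *m C) b a).
  transitivity (\sum_p \sum_j \sum_i \sum_a \sum_b
     gam p j * (U i a * U j b * (U *m E a b *m (U^T *m gam)) p i)).
    bigr => p _; bigr => j _; rewrite mulr_sumr.
    bigr => i _; rewrite W_E // summxE mulr_sumr; bigr => a _.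
    by rewrite summxE mulr_sumr; bigr => b _; rewrite mxE.
  rewrite sum_exchange32; bigr => a _; bigr => b _.
  have -> : C *m E a b *m C = (gam *m U)^T *m (U *m E a b *m (U^T *m gam) *m U).
    by rewrite CE trmx_mul gamT !mulmxA.
  rewrite mxE; bigr => p _; rewrite 3!mxE mulr_suml; bigr => j _.
  by rewrite mulr_sumr; bigr => i _; ring.
have EC a b : (C *m E a b *m C) b a = (hi *m Om a b) b a
    - (N^T *m (N *m Om a b)) b a + ((Om a b)^T *m N^T *m N) b a.
  have -> : C *m E a b *m C = hi *m (E a b *m hi) - N^T *m (N *m (E a b *m hi))
      - (hi *m E a b) *m N^T *m N + N^T *m (N *m E a b *m N^T) *m N.
    by rewrite hC !(mulmxBl, mulmxBr, mulmxA); mxlin.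
  by rewrite Ehi hiE NEN mulmx0 mul0mx addr0 !mulNmx opprK !(mxDE, mxNE).
transitivity (\sum_a \sum_b ((hi *m Om a b) b a - (N^T *m (N *m Om a b)) b a
   - (N^T *m (N *m Om b a)) a b)).
  bigr => a _; bigr => b _; rewrite EC; congr (_ + _).
  have -> : (Om a b)^T *m N^T *m N = (N^T *m (N *m Om a b))^T by rewrite !trmx_mul trmxK.
  by rewrite mxE [Om b a]Om_asym !mulmxN mxNE opprK.
have NO : \sum_a \sum_b (N^T *m (N *m Om a b)) b a = ricN.
  rewrite exchange_big /=; transitivity (\sum_b \sum_c N 0 b * N 0 c * ric Om c b); last first.
    rewrite exchange_big /=; bigr => c _; bigr => b _. by rewrite [N 0 b * _]mulrC.
  bigr => b _; under [RHS]eq_bigr do rewrite /ric mulr_sumr.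
  rewrite exchange_big /=; bigr => a _; rewrite mxE big_ord1 !mxE mulr_sumr. by bigr => c _; ring.
have NO' : \sum_a \sum_b (N^T *m (N *m Om b a)) a b = ricN by rewrite exchange_big /= NO.
have HO : \sum_a \sum_b (hi *m Om a b) b a = \sum_i \sum_j hi i j * ric Om i j.
  rewrite exchange_big /=; transitivity (\sum_b \sum_c hi b c * ric Om c b).
    bigr => b _; under [RHS]eq_bigr do rewrite /ric mulr_sumr.
    by rewrite exchange_big /=; bigr => a _; rewrite mxE.
  rewrite exchange_big /=; bigr => c _; bigr => b _. by rewrite -{1}hiT mxE.
under eq_bigr do rewrite !sumrB.
by rewrite !sumrB HO NO NO'; ring.
Qed.

(** By [hN] the horizontal part of grad tau is - Theta N, so the Codazzi term contracted with grad
    tau is a Ricci curvature in the direction of N. *)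
Let trace2 : \sum_i \sum_j \sum_k gam i j * (t *m gam) 0 k * (U *m W i k *m h *m N^T) j 0 = Th * ricN.
have tU b : \sum_k (t *m gam) 0 k * U k b = - Th * N 0 b.
  by have := congr1 (fun (M : 'rV[R]_n) => M 0 b) hN; rewrite !mxE.
transitivity (\sum_a \sum_b (- Th * N 0 b) * (C *m E a b *m N^T) a 0).
  transitivity (\sum_i \sum_j \sum_k \sum_a \sum_b
     gam i j * (t *m gam) 0 k * (U i a * U k b * (U *m E a b *m N^T) j 0)).
    do 3!(bigr => ? _); rewrite W_E summxE mulr_sumr; bigr => a _.
    by rewrite summxE mulr_sumr; bigr => b _; rewrite mxZE.
  rewrite sum_exchange32; bigr => a _; bigr => b _.
  have -> : C *m E a b *m N^T = (gam *m U)^T *m (U *m E a b *m N^T).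
    by rewrite CE trmx_mul gamT !mulmxA.
  rewrite -tU exchange_big /= [(_ *m _) a 0]mxE mulr_sumr; bigr => j _.
  have -> : (gam *m U)^T a j = \sum_i gam j i * U i a by rewrite !mxE.
  rewrite mulr_suml mulr_sumr; bigr => i _; rewrite mulr_suml.
  bigr => k _; have -> : gam i j = gam j i by rewrite -{1}gamT mxE. ring.
transitivity (\sum_a \sum_b Th * (N 0 b * (N *m Om a b) 0 a)).
  bigr => a _; bigr => b _.
  have -> : C *m E a b *m N^T = (hi *m E a b) *m N^T - N^T *m (N *m E a b *m N^T).
    by rewrite hC !(mulmxBl, mulmxBr, mulmxA).
  rewrite hiE NEN mulmx0 subr0 mulNmx mxNE -trmx_mul [(_^T) a 0]mxE; ring.
rewrite exchange_big /= /ricN mulr_sumr.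
transitivity (\sum_b \sum_c Th * (N 0 b * N 0 c * ric Om c b)); last first.
  rewrite exchange_big /=; bigr => c _; rewrite mulr_sumr. by bigr => b _; rewrite [N 0 b * _]mulrC.
bigr => b _; rewrite -!mulr_sumr; congr (_ * _).
under [RHS]eq_bigr do rewrite /ric mulr_sumr.
rewrite [RHS]exchange_big /= mulr_sumr; bigr => a _; rewrite mxE mulr_sumr.
by bigr => c _; ring.
Qed.

Let AgA := \tr (gam *m A *m gam *m A).

Let gaussR : \sum_i \sum_j gam i j * ric Og i j =
  \sum_i \sum_j hi i j * ric Om i j - 2 * ricN + H ^+ 2 - AgA.
have gamg : gam *m g = 1%:M by apply: mulmx1C.
have OgE i j : Og i j = U *m W i j *m h *m (U^T *m gam) + (row j A)^T *m (row i A *m gam)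
   - (row i A)^T *m (row j A *m gam).
  have := congr1 (mulmx^~ gam) (gauss i j); rewrite -mulmxA ggam mulmx1 -[in RHS]mulmxA => <-. mxlin.
transitivity (\sum_p \sum_j gam p j * \sum_i (U *m W i j *m h *m (U^T *m gam)) p i +
   (\sum_p \sum_j gam p j * \sum_i (A j p * (A *m gam) i i)
    - \sum_p \sum_j gam p j * \sum_i (A i p * (A *m gam) j i))).
  rewrite -sumrB -big_split; bigr => p _ /=. rewrite -sumrB -big_split; bigr => j _ /=.
  rewrite -mulrBr -mulrDr -sumrB -big_split /ric; congr (_ * _); bigr => i _ /=.
  rewrite OgE !(mxDE, mxNE) -addrA; congr (_ + (_ - _)).
    by rewrite mxE big_ord1 !mxE; congr (_ * _); bigr => l _; rewrite mxE.
  by rewrite mxE big_ord1 !mxE; congr (_ * _); bigr => l _; rewrite mxE.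
rewrite trace1 -!addrA; congr (_ + (_ + (_ - _))).
  have -> : H ^+ 2 = \tr (gam *m A) * \tr (A *m gam) by rewrite [\tr (A *m gam)]mxtrace_mulC -/H expr2.
  rewrite /mxtrace mulr_suml; bigr => p _; rewrite mxE mulr_suml.
  bigr => j _; rewrite -mulrA; congr (_ * _); rewrite mulr_sumr. by bigr => i _.
have -> : AgA = \tr (gam *m (A *m gam *m A)) by rewrite !mulmxA.
rewrite /mxtrace; bigr => p _; rewrite mxE; bigr => j _.
by congr (_ * _); rewrite mxE; bigr => i _; rewrite mulrC.
Qed.

(** The left side is <dH, dtau> + Theta H^2 - (div A)(grad tau) - Theta |A|^2. Codazzi gives (div
    A)(grad tau) = <dH, dtau> + Theta Ric_h(N, N), and Gauss gives R_g = R_h - 2 Ric_h(N, N) + H^2 -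
    |A|^2. One of the two Ricci terms of Gauss remains. *)
Lemma gauss_codazzi_trace : \sum_i \sum_j gam i j * (dH i * t 0 j + H * A i j * Th
     - \sum_k nA i j k * (t *m gam) 0 k - Th * (A *m gam *m A) i j) =
  Th * (\sum_i \sum_j gam i j * ric Og i j - \sum_i \sum_j hi i j * ric Om i j
     + \sum_i \sum_j N 0 i * N 0 j * ric Om i j).
rewrite gaussR -/ricN.
have S i j : gam i j = gam j i by rewrite -{1}gamT mxE.
have T1 : \sum_i \sum_j gam i j * (dH i * t 0 j) = \sum_k (t *m gam) 0 k * dH k.
  bigr => i _; rewrite mxE mulr_suml; bigr => j _; rewrite S; ring.
have T2 : \sum_i \sum_j gam i j * (H * A i j * Th) = Th * H ^+ 2.
  transitivity (H * Th * \tr (gam *m A)); last by rewrite -/H; ring.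
  rewrite /mxtrace mulr_sumr; bigr => i _; rewrite mxE mulr_sumr.
  bigr => j _; have -> : A i j = A j i by rewrite -{1}AT mxE. ring.
have T3 : \sum_i \sum_j gam i j * (\sum_k nA i j k * (t *m gam) 0 k) =
    \sum_k (t *m gam) 0 k * dH k + Th * ricN.
  rewrite -trace2. transitivity (\sum_i \sum_j \sum_k (gam i j * (t *m gam) 0 k * nA k j i +
       gam i j * (t *m gam) 0 k * (U *m W i k *m h *m N^T) j 0)).
    bigr => i _; bigr => j _; rewrite mulr_sumr. bigr => k _; rewrite -codazzi.
    have -> : nA i j k = nA i k j by rewrite -{1}nAT mxE.
    have -> : nA k j i = nA k i j by rewrite -{1}nAT mxE. ring.
  under eq_bigr do under eq_bigr do rewrite big_split. under eq_bigr do rewrite big_split /=.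
  rewrite big_split /=; congr (_ + _). under eq_bigr do rewrite exchange_big /=.
  rewrite exchange_big /=; bigr => k _; rewrite dHE /mxtrace mulr_sumr.
  bigr => i _; rewrite [(gam *m nA k) i i]mxE mulr_sumr; bigr => j _; ring.
have T4 : \sum_i \sum_j gam i j * (Th * (A *m gam *m A) i j) = Th * AgA.
  have -> : AgA = \tr (gam *m (A *m gam *m A)) by rewrite !mulmxA.
  rewrite /mxtrace mulr_sumr; bigr => i _; rewrite mxE mulr_sumr.
  bigr => j _; have -> : (A *m gam *m A) i j = (A *m gam *m A) j i.
    have -> : A *m gam *m A = (A *m gam *m A)^T by rewrite !trmx_mul gamT AT !mulmxA.
    by rewrite mxE trmx_mul trmx_mul gamT AT mulmxA.
  ring.
transitivity (\sum_i \sum_j gam i j * (dH i * t 0 j) + \sum_i \sum_j gam i j * (H * A i j * Th)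
  - \sum_i \sum_j gam i j * (\sum_k nA i j k * (t *m gam) 0 k)
  - \sum_i \sum_j gam i j * (Th * (A *m gam *m A) i j)). rewrite -big_split -!sumrB; bigr => i _ /=.
  rewrite -big_split -!sumrB; bigr => j _ /=; ring.
rewrite T1 T2 T3 T4; ring.
Qed.

End Contraction.

(** * The divergence of a covector field *)

Section DetTrace.
Variables (A : set 'rV[R]_m.+1) (rA : regular A).

Lemma pd_trace p (G : 'rV[R]_m.+1 -> 'M[R]_p) i y : A y -> smx A G ->
  pd A (fun z => \tr (G z)) i y = \tr (dmx A G i y).
move=> Ay sG; rewrite /mxtrace pd_sum // => [|j _]; last exact: sG.
by bigr => j _; rewrite mxE.
Qed.

Lemma pd_prod (I : eqType) (r : seq I) (f : I -> 'rV[R]_m.+1 -> R) i y : uniq r -> A y ->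
  (forall j, sm A (f j)) -> pd A (fun z => \prod_(j <- r) f j z) i y =
  \sum_(j <- r) pd A (f j) i y * \prod_(l <- r | l != j) f l y.
move=> + Ay sf; elim: r => [|a r IH] /=.
  by move=> _; under [X in pd _ X]eq_fun do rewrite big_nil; rewrite big_nil pd_cst.
move=> /andP[ar ur]; under [X in pd _ X]eq_fun do rewrite big_cons.
rewrite pdM //; [|exact: sf|by apply: CkA_prod => j _; exact: sf].
rewrite IH // big_cons; congr (_ + _).
  rewrite big_cons eqxx /=; congr (_ * _); rewrite big_seq_cond [RHS]big_seq_cond.
  apply: eq_bigl => l; have [lr|] := boolP (l \in r); rewrite //= .
  by apply/esym/eqP => la; rewrite -la lr in ar.
rewrite mulr_sumr; apply: eq_big_seq => j jr.
rewrite big_cons; have -> : a != j by apply/eqP => aj; rewrite aj jr in ar.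
by ring.
Qed.

(** Jacobi's formula: [M k] is G with row k differentiated, and its determinant expands along that
    row into entries of the adjugate. *)
Lemma pd_det p (G : 'rV[R]_m.+1 -> 'M[R]_p) i y : A y -> smx A G -> G y \in unitmx ->
  pd A (fun z => \det (G z)) i y = \det (G y) * \tr (invmx (G y) *m dmx A G i y).
move=> Ay sG uG.
pose M (k : 'I_p) : 'M[R]_p := \matrix_(a, b) (if a == k then dmx A G i y a b else G y a b).
transitivity (\sum_k \det (M k)).
  rewrite /determinant pd_sum // => [|s _]; last first.
    by apply: CkAM; [exact: CkA_cst|apply: CkA_prod => l _; exact: sG].
  rewrite exchange_big /=; bigr => s _. rewrite pdZ //; last by apply: CkA_prod => l _; exact: sG.
  rewrite (pd_prod i (index_enum_uniq _) Ay); last by move=> j; exact: sG.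
  rewrite mulr_sumr; bigr => k _; congr (_ * _).
  rewrite [RHS](bigD1 k) //= [M k k _]mxE eqxx dmxE; congr (_ * _).
  by bigr => l /negbTE lk; rewrite mxE lk.
have -> : \det (G y) * \tr (invmx (G y) *m dmx A G i y) = \tr (\adj (G y) *m dmx A G i y).
  rewrite /invmx uG -scalemxAl mxtraceZ mulrA divff ?mul1r //. by rewrite -unitfE -unitmxE.
rewrite mxtrace_mulC /mxtrace; bigr => k _.
rewrite (expand_det_row _ k) mxE; bigr => l _.
rewrite [M k k l]mxE eqxx [\adj _ _ _]mxE; congr (_ * _).
rewrite /cofactor; congr (_ * \det _); apply/matrixP => a b; rewrite !mxE.
by rewrite eq_sym (negbTE (neq_lift _ _)).
Qed.

Variable g : 'rV[R]_m.+1 -> 'M[R]_m.+1.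
Hypotheses (sg : smx A g) (gT : forall y, A y -> (g y)^T = g y).
Hypothesis dg : forall y, A y -> 0 < \det (g y).

Let ug y : A y -> g y \in unitmx.
by move=> /dg d0; rewrite unitmxE unitfE gt_eqF. Qed.

(** g^{ij} nabla_i w_j. *)
Definition divcov (w : 'I_m.+1 -> 'rV[R]_m.+1 -> R) y : R :=
  \sum_i \sum_j invmx (g y) i j * (pd A (w j) i y - \sum_k chr A g i y j k * w k y).

(** The derivative of sqrt(det g) is a contracted Christoffel symbol; by the symmetry of these
    symbols it cancels one of the two terms in the derivative of g^-1, and the other term completes
    nabla_i w_j. *)
Lemma divcovE (w : 'I_m.+1 -> 'rV[R]_m.+1 -> R) y : A y -> (forall j, CkA 1 A (w j)) ->
  \sum_i pd A (fun z => sqrdet (g z) * \sum_j invmx (g z) i j * w j z) i y = sqrdet (g y) * divcov w y.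
move=> Ay sw; have sI : smx A (fun z => invmx (g z)) by apply: smx_inv.
have sD : CkA 1 A (fun z => \det (g z)) by exact: sm_det.
have sS : CkA 1 A (fun z => sqrdet (g z)) by apply: CkA_sqrt.
have dS i : pd A (fun z => sqrdet (g z)) i y = sqrdet (g y) * \tr (chr A g i y).
  have s0 : sqrdet (g y) != 0 by rewrite gt_eqF // sqrtr_gt0 dg.
  have E : pd A (fun z => \det (g z)) i y = 2 * sqrdet (g y) * pd A (fun z => sqrdet (g z)) i y.
    transitivity (pd A (fun z => sqrdet (g z) * sqrdet (g z)) i y).
      by apply: pd_eq => // z Az; rewrite -expr2 sqr_sqrtr // ltW // dg.
    by rewrite pdM //; ring.
  have := @pd_det _ g i y Ay sg (ug Ay); rewrite E (chr_metric gT ug i Ay).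
  rewrite mulmxDr mulmxA [invmx _ *m (_ *m _)]mulmxA mulVmx ?ug // mul1mx.
  rewrite mxtraceD mxtrace_tr -mulmxA mxtrace_mulC -mulmxA mulmxV ?ug // mulmx1.
  have dE : \det (g y) = sqrdet (g y) ^+ 2 by rewrite sqr_sqrtr // ltW // dg.
  have s2 : 2 * sqrdet (g y) != 0 by rewrite mulf_neq0.
  move=> E2; apply: (mulfI s2); rewrite E2 [X in X * _]dE; ring.
have sW i : CkA 1 A (fun z => \sum_j invmx (g z) i j * w j z).
  by apply: CkA_sum => j _; apply: CkAM => //; exact: sI.
have dI i j k : pd A (fun z => invmx (g z) i j) k y =
    - (invmx (g y) *m chr A g k y) i j - (invmx (g y) *m chr A g k y) j i.
  rewrite -dmxE dmx_inv // (chr_metric gT ug k Ay) mulmxDr mulmxDl.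
  rewrite [invmx _ *m (g y *m _)]mulmxA mulVmx ?ug // mul1mx -!mulmxA mulmxV ?ug // mulmx1.
  rewrite opprD !(mxDE, mxNE); congr (- _ - _).
  have -> : (chr A g k y)^T *m invmx (g y) = (invmx (g y) *m chr A g k y)^T.
    by rewrite trmx_mul invmx_sym ?gT.
  by rewrite mxE.
pose S := sqrdet (g y); pose G i j k := chr A g i y j k.
transitivity (S * \sum_i \sum_j (\tr (chr A g i y) * (invmx (g y) i j * w j y) +
    (- (\sum_k invmx (g y) i k * G i k j) - \sum_k invmx (g y) j k * G i k i) * w j y
    + invmx (g y) i j * pd A (w j) i y)).
  rewrite mulr_sumr; bigr => i _.
  rewrite pdM // dS pd_sum //; last by move=> j _; apply: CkAM => //; exact: sI.
  rewrite [RHS]mulr_sumr -/S [S * _ * _]mulr_sumr [S * (\sum_j pd _ _ _ _)]mulr_sumr -big_split.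
  bigr => j _ /=. rewrite pdM //; last exact: sI.
  rewrite dI [(_ *m _) i j]mxE [(_ *m _) j i]mxE /G; ring.
congr (_ * _); rewrite /divcov.
have T : \sum_i \sum_j (\sum_k invmx (g y) j k * G i k i) * w j y =
    \sum_i \sum_j \tr (chr A g i y) * (invmx (g y) i j * w j y).
  transitivity (\sum_j \sum_k \sum_i invmx (g y) j k * G i k i * w j y).
    rewrite exchange_big; bigr => j _ /=; rewrite exchange_big /=. by bigr => i _; rewrite mulr_suml.
  rewrite exchange_big; bigr => k _ /=; bigr => j _.
  rewrite /mxtrace mulr_suml; bigr => i _; rewrite /G (chr_torsion gT) //.
  have -> : invmx (g y) j k = invmx (g y) k j by rewrite -{1}(invmx_sym (gT Ay)) mxE. ring.
transitivity (\sum_i \sum_j (invmx (g y) i j * pd A (w j) i y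
    - \sum_k invmx (g y) i k * G i k j * w j y)).
  transitivity (\sum_i \sum_j (invmx (g y) i j * pd A (w j) i y
    - \sum_k invmx (g y) i k * G i k j * w j y) +
   (\sum_i \sum_j \tr (chr A g i y) * (invmx (g y) i j * w j y) -
    \sum_i \sum_j (\sum_k invmx (g y) j k * G i k i) * w j y)).
    rewrite -sumrB -big_split; bigr => i _ /=.
    rewrite -sumrB -big_split; bigr => j _ /=; rewrite -mulr_suml; ring.
  by rewrite T subrr addr0.
under eq_bigr do rewrite sumrB.
under [RHS]eq_bigr do under eq_bigr do rewrite mulrBr.
under [RHS]eq_bigr do rewrite sumrB.
rewrite !sumrB; congr (_ - _); bigr => i _; rewrite exchange_big /=.
bigr => j _; rewrite mulr_sumr; bigr => k _; rewrite /G; ring.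
Qed.

End DetTrace.

Definition jac A (u : 'rV[R]_m.+1 -> 'rV[R]_m.+1) y : 'M[R]_m.+1 :=
  \matrix_(i, k) pd A (fun z => u z 0 k) i y.
Definition grad A (f : 'rV[R]_m.+1 -> R) y : 'rV[R]_m.+1 := \row_i pd A f i y.

(* -2 times the mean curvature is the trace of the derivative of the induced
   metric in the direction of the normal: no Christoffel symbol is needed. *)
Definition mean_curv A B (u : 'rV[R]_m.+1 -> 'rV[R]_m.+1) (tau Th : 'rV[R]_m.+1 -> R)
    (N : 'rV[R]_m.+1 -> 'rV[R]_m.+1) (h g : 'rV[R]_m.+1 -> 'M[R]_m.+1) y : R :=
  - 2^-1 * \tr (invmx (g y) *m
    (jac A N y *m h (u y) *m (jac A u y)^T + (jac A N y *m h (u y) *m (jac A u y)^T)^T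
     + jac A u y *m (\sum_c N y 0 c *: dmx B h c (u y)) *m (jac A u y)^T
     + ((grad A Th y)^T *m grad A tau y + (grad A tau y)^T *m grad A Th y))).

(** * Hypersurfaces of a product, in one chart of each manifold *)

Section Hypersurface.
Variables (A B : set 'rV[R]_m.+1) (rA : regular A) (rB : regular B).
Variables (u : 'rV[R]_m.+1 -> 'rV[R]_m.+1) (AB : forall y, A y -> B (u y)).
Hypothesis su : forall j, sm A (fun y => u y 0 j).
Variables (tau Th : 'rV[R]_m.+1 -> R) (st : sm A tau) (sTh : sm A Th).
Variables (N : 'rV[R]_m.+1 -> 'rV[R]_m.+1) (sN : smx A N).
Variables (h g : 'rV[R]_m.+1 -> 'M[R]_m.+1).
Hypotheses (sh : smx B h) (hT : forall y, B y -> (h y)^T = h y).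
Hypothesis uh : forall y, B y -> h y \in unitmx.
Hypothesis gE : forall y, A y ->
  g y = jac A u y *m h (u y) *m (jac A u y)^T + (grad A tau y)^T *m grad A tau y.
Hypothesis ug : forall y, A y -> g y \in unitmx.
Hypothesis NN : forall y, A y -> (N y *m h (u y) *m (N y)^T) 0 0 + Th y ^+ 2 = 1.
Hypothesis NT : forall y, A y -> N y *m h (u y) *m (jac A u y)^T + Th y *: grad A tau y = 0.

Let U := jac A u.
Let t := grad A tau.

Let sU : smx A U.
by move=> i j k; under eq_fun do rewrite mxE; apply: sm_pd. Qed.

Let s_t : smx A t.
by move=> i j k; under eq_fun do rewrite mxE; apply: sm_pd. Qed.

Let gT y : A y -> (g y)^T = g y.
by move=> Ay; rewrite gE // trmxD !trmx_mul !trmxK hT ?mulmxA //; exact: AB.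
Qed.

Let shu : smx A (fun y => h (u y)).
exact: (smx_comp AB su sh). Qed.

Let sg : smx A g.
apply: (@smx_eq A _ _ (fun y => U y *m h (u y) *m (U y)^T + (t y)^T *m t y)).
  by move=> y /gE ->.
by apply: smxD; apply: smxM; [exact: smxM|exact: smxT|exact: smxT|].
Qed.

(** Connection matrix of the pull-back of TE by u, in the coordinate frame of E. *)
Definition pull_chr i y := \sum_a U y i a *: chr B h a (u y).

Lemma pull_chr_smooth i : smx A (pull_chr i).
apply: smx_sum => a; apply: smxZ; first exact: sU.
by apply: (smx_comp AB su); exact: (chr_smooth rB sh hT uh).
Qed.

Lemma d_pull_metric y i : A y ->
  dmx A (fun y => h (u y)) i y = pull_chr i y *m h (u y) + h (u y) *m (pull_chr i y)^T.
move=> Ay; rewrite (dmx_comp rA Ay i rB AB su sh) /pull_chr mulmx_suml.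
have -> : (\sum_a U y i a *: chr B h a (u y))^T = \sum_a U y i a *: (chr B h a (u y))^T.
  by apply/matrixP => b c; rewrite mxE !summxE; bigr => a _; rewrite !mxE.
rewrite mulmx_sumr -big_split; bigr => a _ /=.
rewrite (chr_metric hT uh a (AB Ay)) scalerDr -scalemxAl -scalemxAr.
by rewrite /U /jac mxE.
Qed.

Let quad y i j (F : 'I_m.+1 -> 'I_m.+1 -> 'M[R]_m.+1) := \sum_a \sum_b (U y i a * U y j b) *: F a b.

Let quadD y i j F G : quad y i j (fun a b => F a b + G a b) = quad y i j F + quad y i j G.
rewrite /quad -big_split; bigr => a _ /=; rewrite -big_split.
by bigr => b _ /=; rewrite scalerDr.
Qed.

Let quadN y i j F : quad y i j (fun a b => - F a b) = - quad y i j F.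
rewrite /quad -sumrN; bigr => a _ /=; rewrite -sumrN.
by bigr => b _ /=; rewrite scalerN.
Qed.

Let quad_swap y i j F : quad y j i F = quad y i j (fun a b => F b a).
rewrite /quad exchange_big; bigr => a _; bigr => b _ /=.
by rewrite mulrC.
Qed.

Let hess y i j := \sum_a pd A (pd A (fun z => u z 0 a) j) i y *: chr B h a (u y).

Let hess_sym y i j : A y -> hess y i j = hess y j i.
by move=> Ay; bigr => a _; rewrite pdC //; exact: su. Qed.

Let d_pull_chr i j y : A y -> dmx A (pull_chr j) i y =
  hess y i j + quad y i j (fun a b => dmx B (chr B h b) a (u y)).
move=> Ay; have sC b := chr_smooth rB sh hT uh b.
rewrite dmx_sum //; last first.
  by move=> a; apply: smxZ; [exact: sU|exact: (smx_comp AB su)].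
rewrite /quad exchange_big -big_split; bigr => b _ /=.
rewrite (dmxZ rA Ay i (sU j b) (smx_comp AB su (sC b))); congr (_ + _).
  by congr (_ *: _); apply: pd_eq => // z _; rewrite mxE.
rewrite (dmx_comp rA Ay i rB AB su (sC b)) scaler_sumr; bigr => a _.
by rewrite scalerA /U /jac !mxE mulrC.
Qed.

Let pull_chrM k l y : pull_chr k y *m pull_chr l y =
  quad y l k (fun a b => chr B h b (u y) *m chr B h a (u y)).
rewrite /pull_chr /quad mulmx_suml exchange_big; bigr => b _ /=.
rewrite mulmx_sumr; bigr => a _.
by rewrite -scalemxAl -scalemxAr scalerA mulrC.
Qed.

(** Naturality of the curvature: the second derivatives of u enter through [hess], which is
    symmetric in i and j, and drop out. *)
Lemma curv_pull i j y : A y -> curv A pull_chr i j y =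
  \sum_a \sum_b (U y i a * U y j b) *: curv B (chr B h) a b (u y).
move=> Ay; rewrite /curv -/(quad y i j (fun a b => _)) !d_pull_chr // !pull_chrM.
rewrite (hess_sym j i Ay) (quad_swap y i j (fun a b => dmx B (chr B h b) a (u y))).
rewrite (quad_swap y i j (fun a b => chr B h b (u y) *m chr B h a (u y))).
rewrite !quadD !quadN; move: (hess _ _ _) (quad _ _ _ _) (quad _ _ _ _) (quad _ _ _ _) (quad _ _ _ _).
by move=> *; mxlin.
Qed.

(** Rows: the images of the coordinate vectors of M, then N. Columns: the components along E, then
    along d/dt. [amb] is h + dt^2 along the map, [ind] is the Gram matrix of the frame, and
    [amb_chr] is the ambient connection, for which d/dt is parallel. *)
Definition frame y : 'M[R]_(m.+1 + 1) := block_mx (U y) (t y)^T (N y) (Th y)%:M.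
Definition amb y : 'M[R]_(m.+1 + 1) := block_mx (h (u y)) 0 0 1%:M.
Definition ind y : 'M[R]_(m.+1 + 1) := block_mx (g y) 0 0 1%:M.
Definition amb_chr i y : 'M[R]_(m.+1 + 1) := block_mx (pull_chr i y) 0 0 0.

Lemma frame_metric y : A y -> frame y *m amb y *m (frame y)^T = ind y.
move=> Ay; rewrite /frame /amb /ind tr_block_mx !mulmx_block trmxK tr_scalar_mx.
rewrite !mulmx0 !mulmx1 !addr0 !add0r !mul_mx_scalar !mul_scalar_mx -gE //.
have NT' : U y *m h (u y) *m (N y)^T + Th y *: (t y)^T = 0.
  have := congr1 trmx (NT Ay). rewrite trmxD trmx_mul trmxK trmx_mul (hT (AB Ay)) trmx0 mulmxA => <-.
  by congr (_ + _); apply/matrixP => a b; rewrite !mxE.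
rewrite NT' NT //; congr block_mx; apply/matrixP => a b; rewrite !ord1.
by rewrite mxDE mxZE [_%:M _ _]mxE [in RHS]mxE !eqxx mulr1n -expr2 NN.
Qed.

Lemma ind_unit y : A y -> ind y \in unitmx.
by move=> Ay; rewrite unitmxE det_ublock det1 mulr1 -unitmxE ug. Qed.

Lemma s_frame : smx A frame.
apply: smx_block => //; first exact: smxT.
move=> a b k; under eq_fun do rewrite mxE.
by case: (a == b); [exact: sTh|exact: CkA_cst].
Qed.

Lemma s_amb : smx A amb.
by apply: smx_block => //; exact: smx_cst. Qed.

Lemma s_amb_chr i : smx A (amb_chr i).
by apply: smx_block; [exact: pull_chr_smooth| | |]; exact: smx_cst. Qed.

Lemma d_amb y i : A y -> dmx A amb i y = amb_chr i y *m amb y + amb y *m (amb_chr i y)^T.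
move=> Ay; rewrite dmx_block !dmx_cst // d_pull_metric //.
rewrite /amb_chr /amb tr_block_mx !mulmx_block !trmx0 !(mulmx0, mul0mx, mulmx1, mul1mx, addr0).
by rewrite add_block_mx !addr0.
Qed.

Let cn := conn A frame amb ind amb_chr.

Let torsion_U i j k y : A y ->
  (dmx A U i y + U y *m pull_chr i y) j k = (dmx A U j y + U y *m pull_chr j y) i k.
move=> Ay; rewrite mxDE [RHS]mxDE; congr (_ + _).
  transitivity (pd A (pd A (fun z => u z 0 k) j) i y).
    by apply: etrans (dmxE _ _ _ _ _ _) _; apply: pd_eq => // z _; exact: mxE.
  rewrite pdC //; last exact: su.
  by apply: etrans _ (esym (dmxE _ _ _ _ _ _)); apply: pd_eq => // z _; rewrite mxE.
apply: etrans (mxE _ _ _ _) _; apply: etrans _ (esym (mxE _ _ _ _)).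
transitivity (\sum_b \sum_a U y j b * U y i a * chr B h a (u y) b k).
  bigr => b _; rewrite summxE mulr_sumr; bigr => a _. by rewrite mxZE mulrA.
rewrite exchange_big; bigr => b _; rewrite summxE mulr_sumr.
bigr => a _; rewrite mxZE (chr_torsion hT a b k (AB Ay)); ring.
Qed.

Let torsion_t i j k y : A y -> dmx A (fun z => (t z)^T) i y j k = dmx A (fun z => (t z)^T) j y i k.
move=> Ay; transitivity (pd A (pd A tau j) i y).
  by apply: etrans (dmxE _ _ _ _ _ _) _; apply: pd_eq => // z _; rewrite !mxE.
rewrite pdC //.
by apply: etrans _ (esym (dmxE _ _ _ _ _ _)); apply: pd_eq => // z _; rewrite !mxE.
Qed.

Let d_frame_block i y : A y -> dmx A frame i y + frame y *m amb_chr i y =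
  block_mx (dmx A U i y + U y *m pull_chr i y) (dmx A (fun z => (t z)^T) i y)
    (dmx A N i y + N y *m pull_chr i y) (dmx A (fun z => (Th z)%:M) i y).
by move=> Ay; rewrite dmx_block mulmx_block add_block_mx !mulmx0 !addr0. Qed.

Lemma conn_torsion i j y c : A y -> cn i y (lshift 1 j) c = cn j y (lshift 1 i) c.
move=> Ay; apply: etrans (mxE _ _ _ _) _; apply: etrans _ (esym (mxE _ _ _ _)).
bigr => k _; congr (_ * _).
rewrite !d_frame_block // -(splitK k); case: (fintype.split k) => k' /=.
  apply: etrans (block_mxEul _ _ _ _ _ _) _; apply: etrans _ (esym (block_mxEul _ _ _ _ _ _)).
  exact: torsion_U.
apply: etrans (block_mxEur _ _ _ _ _ _) _; apply: etrans _ (esym (block_mxEur _ _ _ _ _ _)).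
exact: torsion_t.
Qed.

(** The second fundamental form, read off the connection form as the N-component of the derivative
    of the j-th tangent vector in the direction i. *)
Definition sform y : 'M[R]_m.+1 := \matrix_(i, j) cn i y (lshift 1 j) (rshift m.+1 ord0).

Lemma sform_sym y : A y -> (sform y)^T = sform y.
by move=> Ay; apply/matrixP => i j; rewrite mxE [LHS]mxE [RHS]mxE; exact: conn_torsion.
Qed.

(** The derivative of [ind] constrains every block. The upper left one is metric and torsion-free,
    hence Levi-Civita; the off-diagonal ones determine each other; the corner is a 1 x 1 matrix
    equal to its own opposite. *)
Lemma conn_block i y : A y -> cn i y =
  block_mx (chr A g i y) (row i (sform y))^T (- row i (sform y) *m invmx (g y)) 0.
move=> Ay.
have M j : dmx A ind j y = cn j y *m ind y + ind y *m (cn j y)^T.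
  apply: d_metric => //; [exact: s_frame|exact: s_amb|exact: frame_metric|exact: ind_unit|].
  by move=> z k; exact: d_amb.
have E j : [/\ dmx A g j y = ulsubmx (cn j y) *m g y + g y *m (ulsubmx (cn j y))^T,
   dlsubmx (cn j y) *m g y + (ursubmx (cn j y))^T = 0 & drsubmx (cn j y) = 0].
  have := M j; rewrite dmx_block !dmx_cst // -[cn j y]submxK tr_block_mx /ind.
  rewrite !mulmx_block !(mulmx0, mul0mx, mulmx1, mul1mx, addr0, add0r) add_block_mx.
  move=> /eq_block_mx[E1 _ E3 E4]. rewrite block_mxKul block_mxKur block_mxKdl block_mxKdr; split=> //.
  have X : drsubmx (cn j y) = (drsubmx (cn j y))^T.
    by apply/matrixP => a b; rewrite !ord1 [RHS]mxE.
  move/eqP: E4; rewrite -X eq_sym -mulr2n -scaler_nat scaler_eq0 pnatr_eq0. by move=> /eqP.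
have [_ E3 E4] := E i.
have ur : ursubmx (cn i y) = (row i (sform y))^T.
  apply/matrixP => a b; rewrite ord1 [LHS]mxE [LHS]mxE [RHS]mxE [RHS]mxE [RHS]mxE.
  by congr (cn i y _ _); apply/val_inj.
rewrite -[LHS]submxK ur E4; congr block_mx.
  apply: (@chr_unique _ _ gT ug y (fun k => ulsubmx (cn k y)) Ay) => [j|j k l]; first by case: (E j).
  by rewrite [LHS]mxE [LHS]mxE [RHS]mxE [RHS]mxE; exact: conn_torsion.
move/eqP: E3; rewrite addr_eq0 ur trmxK => /eqP E3.
by rewrite -E3 mulmxK ?ug.
Qed.

Let s_sform : smx A sform.
have sc i : smx A (cn i).
  apply: s_conn => //; [exact: s_frame|exact: s_amb|exact: s_amb_chr|exact: frame_metric|].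
  exact: ind_unit.
by move=> i j k; under eq_fun do rewrite mxE; exact: sc.
Qed.

(** The four blocks are the Gauss formula, Hess tau = Theta A, the Weingarten equation and dTheta =
    - A(grad tau). The last column has no Christoffel term on the left because d/dt is parallel. *)
Let d_frame_eq i y : A y -> block_mx (dmx A U i y + U y *m pull_chr i y) (dmx A (fun z => (t z)^T) i y)
    (dmx A N i y + N y *m pull_chr i y) (dmx A (fun z => (Th z)%:M) i y) =
  block_mx (chr A g i y) (row i (sform y))^T (- row i (sform y) *m invmx (g y)) 0 *m frame y.
move=> Ay; rewrite -d_frame_block // -conn_block //.
rewrite (d_frame amb_chr frame_metric ind_unit i Ay) -/cn.
by rewrite subrK.
Qed.

Lemma hess_height i y : A y ->
  dmx A (fun z => (t z)^T) i y = chr A g i y *m (t y)^T + Th y *: (row i (sform y))^T.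
move=> Ay; have := d_frame_eq i Ay; rewrite /frame mulmx_block => /eq_block_mx[_ -> _ _].
by rewrite mul_mx_scalar.
Qed.

Lemma grad_angle y : A y -> (grad A Th y)^T = - (sform y *m invmx (g y) *m (t y)^T).
move=> Ay; apply/matrixP => i j; rewrite ord1.
have := d_frame_eq i Ay; rewrite /frame mulmx_block => /eq_block_mx[_ _ _].
rewrite mul0mx addr0 => /(congr1 (fun (M : 'M[R]_1) => M 0 0)).
rewrite dmxE (_ : pd A _ i y = pd A Th i y); last by apply: pd_eq => // z _; rewrite mxE.
move=> E; rewrite [LHS]mxE [LHS]mxE E !mulNmx !mxNE; congr (- _).
by rewrite -2!row_mul [LHS]mxE.
Qed.

Lemma weingarten i y : A y ->
  dmx A N i y + N y *m pull_chr i y = - row i (sform y) *m invmx (g y) *m U y.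
move=> Ay; have := d_frame_eq i Ay; rewrite /frame mulmx_block => /eq_block_mx[_ _ -> _].
by rewrite mul0mx addr0.
Qed.

Let curv_cn i j y : A y -> curv A cn i j y *m ind y =
  frame y *m curv A amb_chr i j y *m amb y *m (frame y)^T.
move=> Ay; have := @curv_frame A rA _ frame amb ind amb_chr s_frame s_amb s_amb_chr
  frame_metric ind_unit i j y Ay.
rewrite -/cn => E; rewrite -[frame y *m curv _ _ _ _ _]E -!mulmxA; congr (_ *m _).
by rewrite mulmxA frame_metric.
Qed.

(** The upper left block of the curvature identity is the Gauss equation, the upper right one the
    Codazzi equation. *)
Let curv_blocks i j y : A y -> let c := fun k z => - row k (sform z) *m invmx (g z) in
  [/\ (curv A (chr A g) i j y + (row j (sform y))^T *m c i y
        - (row i (sform y))^T *m c j y) *m g y = U y *m curv A pull_chr i j y *m h (u y) *m (U y)^T &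
      dmx A (fun z => (row j (sform z))^T) i y - dmx A (fun z => (row i (sform z))^T) j y
        + chr A g j y *m (row i (sform y))^T - chr A g i y *m (row j (sform y))^T =
      U y *m curv A pull_chr i j y *m h (u y) *m (N y)^T].
move=> Ay c; have := curv_cn i j Ay.
pose b k z := block_mx (chr A g k z) (row k (sform z))^T (c k z) (0 : 'M[R]_1).
have -> : curv A cn i j y = curv A b i j y.
  rewrite /curv !conn_block // (dmx_eq Ay i (fun z (Az : A z) => conn_block j Az)).
  by rewrite (dmx_eq Ay j (fun z (Az : A z) => conn_block i Az)).
rewrite {1}/curv /b !dmx_block !mulmx_block !opp_block_mx !add_block_mx.
have -> : curv A amb_chr i j y = block_mx (curv A pull_chr i j y) 0 0 0.
  rewrite /curv /amb_chr !dmx_block !mulmx_block !opp_block_mx !add_block_mx !dmx_cst //.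
  by congr block_mx; rewrite !(mulmx0, mul0mx, oppr0, addr0, add0r, subr0).
rewrite /ind /amb /frame tr_block_mx !mulmx_block.
rewrite !(mulmx0, mul0mx, addr0, add0r, subr0, mulmx1) => /eq_block_mx[E1 E2 _ _].
split; [rewrite -E1|rewrite -E2]; last by rewrite -!addrA.
congr (_ *m _); rewrite /curv; move: (_ *m _) (_ *m _) (_ *m _) (_ *m _) => *; mxlin.
Qed.

Definition mcurv y := \tr (invmx (g y) *m sform y).

(** By the Weingarten equation - A is the tangential part of the derivative of N plus a Christoffel
    term. After symmetrization the Christoffel symbols of h combine, by metric compatibility, into
    the derivative of h along N. *)
Lemma mean_curvE y : A y -> mean_curv A B u tau Th N h g y = mcurv y.
move=> Ay; rewrite /mean_curv -/U -/t.
pose K := \sum_b N y 0 b *: chr B h b (u y).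
have NP i : N y *m pull_chr i y = row i (U y *m K).
  apply/rowP => k; rewrite [RHS]mxE mxE [RHS]mxE.
  transitivity (\sum_b \sum_a U y i a * (N y 0 b * chr B h a (u y) b k)).
    bigr => b _; rewrite summxE mulr_sumr; bigr => a _. by rewrite mxZE; ring.
  rewrite exchange_big; bigr => a _; rewrite -mulr_sumr; congr (_ * _).
  rewrite summxE; bigr => b _; rewrite mxZE; congr (_ * _). exact: (chr_torsion hT a b k (AB Ay)).
have W : (jac A N y + U y *m K) *m h (u y) *m (U y)^T + (grad A Th y)^T *m t y = - sform y.
  apply/row_matrixP => i; rewrite raddfD /= !row_mul raddfD /= -NP.
  have -> : row i (jac A N y) = dmx A N i y by apply/rowP => k; rewrite !mxE.
  rewrite (weingarten i Ay) grad_angle // !mulNmx -!mulmxA.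
  rewrite raddfN /= !row_mul mulNmx -opprD raddfN /= -!mulmxA -!mulmxDr; congr (- _).
  by rewrite [U y *m (_ *m _)]mulmxA -gE // mulVmx ?ug // mulmx1.
have M : U y *m K *m h (u y) *m (U y)^T + (U y *m K *m h (u y) *m (U y)^T)^T =
    U y *m (\sum_c N y 0 c *: dmx B h c (u y)) *m (U y)^T.
  rewrite !trmx_mul trmxK (hT (AB Ay)) -!mulmxA -mulmxDr; congr (_ *m _).
  rewrite !mulmxA -mulmxDl; congr (_ *m _). rewrite /K mulmx_suml.
  have -> : (\sum_b N y 0 b *: chr B h b (u y))^T = \sum_b N y 0 b *: (chr B h b (u y))^T.
    by apply/matrixP => b c; rewrite mxE !summxE; bigr => a _; rewrite !mxE.
  rewrite mulmx_sumr -big_split; bigr => c _ /=.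
  by rewrite (chr_metric hT uh c (AB Ay)) scalerDr -scalemxAl -scalemxAr.
rewrite -M /mcurv.
have -> : jac A N y *m h (u y) *m (U y)^T =
    - sform y - (grad A Th y)^T *m t y - U y *m K *m h (u y) *m (U y)^T.
  by rewrite -W !mulmxDl; mxlin.
rewrite [(_ - _ - _)^T]trmxB trmxB trmxN sform_sym // [((grad A Th y)^T *m _)^T]trmx_mul trmxK.
have -> : forall S Z Y X : 'M[R]_m.+1, - S - Z - X + (- S - Y - X^T) + (X + X^T) + (Z + Y) = - (S + S).
  by move=> S Z Y X; mxlin.
by rewrite mulmxN (raddfN (@mxtrace R m.+1)) /= mulmxDr mxtraceD; field.
Qed.

(** Two blocks of the completeness relation [QP]: the tangent vectors and N resolve the identity of
    the horizontal space, and d/dt has no horizontal part. *)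
Let complete y : A y -> (U y)^T *m invmx (g y) *m U y = invmx (h (u y)) - (N y)^T *m N y /\
  t y *m invmx (g y) *m U y = - Th y *: N y.
move=> Ay.
have iE : invmx (ind y) = block_mx (invmx (g y)) 0 0 1%:M.
  apply: (@row_full_inj _ _ _ _ (ind y)).
    by rewrite row_full_unit ind_unit.
  rewrite mulmxV ?ind_unit // mulmx_block !(mulmx0, mul0mx, mulmx1, addr0, add0r).
  by rewrite mulmxV ?ug // -scalar_mx_block.
have := QP frame_metric ind_unit Ay; rewrite /frame_inv iE /amb /frame.
rewrite tr_block_mx !mulmx_block !(mulmx0, mul0mx, mulmx1, mul1mx, addr0, add0r) trmxK.
rewrite tr_scalar_mx (scalar_mx_block _ _ 1) => /eq_block_mx[E1 E2 _ _].
have hu : h (u y) \in unitmx by apply: uh; exact: AB.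
split.
  move: E1; rewrite -!mulmxA -mulmxDr => /(congr1 (mulmx (invmx (h (u y))))).
  by rewrite mulKmx // mulmx1 => <-; rewrite addrK.
move: E2; rewrite -!mulmxA -mulmxDr => /(congr1 (mulmx (invmx (h (u y))))).
rewrite mulKmx // mulmx0 mul_mx_scalar => /eqP; rewrite addr_eq0 => /eqP.
move=> /(congr1 trmx); rewrite !trmx_mul !trmxK invmx_sym ?gT // mulmxA => ->.
by apply/matrixP => a b; rewrite !mxE; ring.
Qed.

Let nabla i y := dmx A sform i y - chr A g i y *m sform y
   - sform y *m (chr A g i y)^T.

Let s_mcurv : sm A mcurv.
move=> k; rewrite /mcurv; apply: CkA_sum => i _.
have : smx A (fun y => invmx (g y) *m sform y) by apply: smxM; [exact: smx_inv|].
by apply.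
Qed.

Let d_mcurv k y : A y -> pd A mcurv k y = \tr (invmx (g y) *m nabla k y).
move=> Ay; have sI := smx_inv ug sg.
rewrite /mcurv pd_trace //; last exact: smxM.
rewrite (dmxM rA Ay k sI s_sform) (dmx_invmx rA sg gT ug _ Ay) /nabla !mulmxDr mulNmx mulmxDl !mulmxN.
rewrite !(mxtraceD, raddfN (@mxtrace R m.+1)) /= !mxtraceD.
rewrite [\tr (_^T *m _ *m _)]mxtrace_mulC [\tr (sform y *m _)]mxtrace_mulC.
rewrite -[(chr A g k y)^T *m invmx (g y) *m sform y]mulmxA.
rewrite [\tr ((chr A g k y)^T *m _)]mxtrace_mulC -!mulmxA; ring.
Qed.

(** Hess tau = Theta A and dTheta = - A(grad tau) turn the covariant derivative of H dtau + dTheta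
    into dH, A and nabla A (this is [Dw]); [gauss_codazzi_trace] then takes the trace. *)
Lemma divergence_identity y : A y -> divcov A g (fun j z => mcurv z * pd A tau j z + pd A Th j z) y =
  Th y * (\sum_i \sum_j invmx (g y) i j * ricci_coord A g y i j
    - \sum_i \sum_j invmx (h (u y)) i j * ricci_coord B h (u y) i j
    + \sum_i \sum_j N y 0 i * N y 0 j * ricci_coord B h (u y) i j).
move=> Ay; have By := AB Ay; have [hC hN] := complete Ay.
rewrite (ricci_curv gT Ay) (ricci_curv hT By).
have sI := smx_inv ug sg.
pose w j z := mcurv z * pd A tau j z + pd A Th j z.
have Dw i j : pd A (w j) i y - \sum_k chr A g i y j k * w k y =
    pd A mcurv i y * t y 0 j + mcurv y * sform y i j * Th y
     - \sum_k nabla i y j k * (t y *m invmx (g y)) 0 k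
     - Th y * (sform y *m invmx (g y) *m sform y) i j.
  have E1 : pd A (w j) i y = pd A mcurv i y * t y 0 j
      + mcurv y * ((chr A g i y *m (t y)^T) j 0 + Th y * sform y i j)
      + dmx A (fun z => - (sform z *m invmx (g z) *m (t z)^T)) i y j 0.
    have sa : CkA 1 A mcurv by exact: s_mcurv. have sb k : CkA 1 A (pd A tau k) by exact: sm_pd.
    have sc : CkA 1 A (pd A Th j) by exact: sm_pd.
    have sd : CkA 1 A (fun z => mcurv z * pd A tau j z) := CkAM sa (sb j). have sb' := sb j.
    rewrite /w pdD // pdM //; congr (_ * _ + _ * _ + _).
    - by rewrite mxE.
    - transitivity (dmx A (fun z => (t z)^T) i y j 0).
        by apply: etrans _ (esym (dmxE _ _ _ _ _ _)); apply: pd_eq => // z _; rewrite !mxE.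
      by rewrite hess_height // mxDE mxZE; congr (_ + _ * _); rewrite !mxE.
    - transitivity (dmx A (fun z => (grad A Th z)^T) i y j 0).
        by apply: etrans _ (esym (dmxE _ _ _ _ _ _)); apply: pd_eq => // z _; rewrite !mxE.
      by rewrite (dmx_eq Ay i grad_angle).
  have E2 : \sum_k chr A g i y j k * w k y = mcurv y * (chr A g i y *m (t y)^T) j 0
      - (chr A g i y *m sform y *m invmx (g y) *m (t y)^T) j 0.
    have -> : chr A g i y *m sform y *m invmx (g y) *m (t y)^T =
       - (chr A g i y *m (grad A Th y)^T) by rewrite grad_angle // mulmxN opprK !mulmxA.
    rewrite mxNE opprK mxE [X in _ = _ + X]mxE mulr_sumr -big_split; bigr => k _ /=.
    by rewrite /w !mxE; ring.
  have sSg : smx A (fun z => sform z *m invmx (g z)) by exact: smxM.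
  have stT : smx A (fun z => (t z)^T) by exact: smxT. rewrite E1 E2 dmxN //; last exact: smxM.
  rewrite (dmxM rA Ay i sSg stT) (dmxM rA Ay i s_sform sI) hess_height // (dmx_invmx rA sg gT ug _ Ay).
  have -> : \sum_k nabla i y j k * (t y *m invmx (g y)) 0 k = (nabla i y *m (invmx (g y) *m (t y)^T)) j 0.
    rewrite [RHS]mxE; bigr => k _; congr (_ * _). by rewrite -{2}(invmx_sym (gT Ay)) -trmx_mul [RHS]mxE.
  have -> : (sform y *m invmx (g y) *m sform y) i j =
     (sform y *m invmx (g y) *m (row i (sform y))^T) j 0.
    have -> : (sform y *m invmx (g y) *m sform y) i j = (sform y *m invmx (g y) *m sform y)^T i j.
      by rewrite !trmx_mul (invmx_sym (gT Ay)) sform_sym // mulmxA.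
    rewrite [LHS]mxE [LHS]mxE [RHS]mxE; bigr => l _; congr (_ * _).
    by rewrite -[in LHS]sform_sym // mxE [RHS]mxE [RHS]mxE.
  rewrite /nabla !(mulmxDl, mulmxDr, mulNmx, mulmxN, mulmxA) -?scalemxAr !(mxDE, mxNE, mxZE); ring.
rewrite /divcov; under eq_bigr do under eq_bigr do rewrite Dw.
have hu : h (u y) \in unitmx by apply: uh.
have S2 : (sform y)^T = sform y by exact: sform_sym.
have ST i : dmx A sform i y = (dmx A sform i y)^T.
  by rewrite -dmxT; apply: dmx_eq => // z Az; rewrite sform_sym.
have nT i : (nabla i y)^T = nabla i y.
  by rewrite /nabla !trmxB !trmx_mul trmxK -ST S2 addrAC.
have -> := @gauss_codazzi_trace m.+1 (h (u y)) (invmx (h (u y))) (invmx (g y)) (g y) (sform y)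
  (U y) (N y) (t y) (Th y) (fun a b => curv B (chr B h) a b (u y))
  (fun a b => curv A (chr A g) a b y) (fun i => nabla i y) (fun k => pd A mcurv k y)
  (fun i j => curv A pull_chr i j y) (fun a b => curv B (chr B h) a b (u y) *m h (u y))
  ((U y)^T *m invmx (g y) *m U y) (hT By) (mulmxV hu) (invmx_sym (gT Ay)) (mulmxV (ug Ay)) S2
  (fun i j => curv_pull i j Ay) (fun _ _ => erefl) erefl hC hN _ _ _ _ nT (fun k => d_mcurv k Ay).
- by congr (_ * (_ - _ + _)); bigr => i _; bigr => j _; rewrite [(\matrix_(_, _) _) _ _]mxE.
- move=> a b; apply: (curv_antisym rB sh (fun k => chr_smooth rB sh hT uh k)) => //.
  by move=> z k Bz; exact: chr_metric.
- move=> a b; rewrite /curv; mxlin.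
- move=> i j; have [<- _] := curv_blocks i j Ay; congr (_ *m _).
  by rewrite !mulNmx !mulmxN opprK.
- move=> i j k; have [_ <-] := curv_blocks i j Ay.
  have D a b : dmx A (fun z => (row a (sform z))^T) b y k 0 = dmx A sform b y a k.
    by rewrite !dmxE; apply: pd_eq => // z _; rewrite !mxE.
  have C2 : (chr A g i y *m sform y) j k = (chr A g j y *m sform y) i k.
    rewrite !mxE; bigr => l _; congr (_ * _); exact: chr_torsion.
  have C3 a b : (sform y *m (chr A g a y)^T) b k = (chr A g a y *m (row b (sform y))^T) k 0.
    rewrite tr_row S2 !mxE; bigr => l _; rewrite [(_^T) l k]mxE [(col _ _) _ _]mxE mulrC.
    by congr (_ * _); rewrite -[in LHS]S2 [LHS]mxE.
  by rewrite /nabla !(mxDE, mxNE) !D C2 !C3; ring.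
Qed.

End Hypersurface.
End MatrixCalculus.

(** * Integration in R^n *)

Section BorelSets.
Context {R : realType}.

Notation bor T := (g_sigma_algebraType (@open T)).

Lemma open_borel (T : ptopologicalType) (U : set T) : open U -> measurable (U : set (bor T)).
exact: sub_sigma_algebra. Qed.

Lemma closed_borel (T : ptopologicalType) (U : set T) : closed U -> measurable (U : set (bor T)).
by move=> cU; rewrite -[U]setCK; apply: measurableC; apply: open_borel; exact: closed_openC. Qed.

Lemma within_preimage_open (T S : topologicalType) (D : set T) (f : T -> S) (U : set S) :
  (forall x, D x -> f y @[y --> within D (nbhs x)] --> f x) -> open U ->
  exists2 V : set T, open V & D `&` f @^-1` U = D `&` V.
move=> cf oU; exists (\bigcup_(W in [set W : set T | open W /\ D `&` W `<=` f @^-1` U]) W).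
  by apply: bigcup_open => W [].
apply/seteqP; split=> x [Dx].
  move=> Ux; split=> //. have : nbhs (f x) U by exact: open_nbhs_nbhs.
  move=> /(cf _ Dx); rewrite nbhsE => -[W [oW Wx] WU].
  by exists W => //; split=> // y [Dy Wy]; exact: WU.
by move=> [W [oW WU] Wx]; split=> //; exact: WU.
Qed.

Lemma within_measurable (T S : ptopologicalType) (D : set T) (f : T -> S) :
  measurable (D : set (bor T)) -> (forall x, D x -> f y @[y --> within D (nbhs x)] --> f x) ->
  measurable_fun (D : set (bor T)) (f : bor T -> bor S).
move=> mD cf; apply: (@measurability _ _ (bor T) (bor S) D f (@open S) erefl).
move=> _ [U oU <-]; have [V oV ->] := within_preimage_open cf oU.
by apply: measurableI => //; exact: open_borel.
Qed.

Lemma within_measurable_real (T : ptopologicalType) (D : set T) (f : T -> R) :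
  measurable (D : set (bor T)) -> (forall x, D x -> f y @[y --> within D (nbhs x)] --> f x) ->
  measurable_fun (D : set (bor T)) f.
move=> mD cf; apply: (measurability _ (@RGenOInfty.measurableE R)).
move=> _ [_ [a ->] <-].
have [|V oV ->] := within_preimage_open cf (U := [set` `]a, +oo[]); first exact: interval_open.
by apply: measurableI => //; exact: open_borel.
Qed.

End BorelSets.

Notation bor T := (g_sigma_algebraType (@open T)).

Import HBNNSimple.

(** * Integration against a density *)

Section Density.
Context {R : realType} d d' (X : measurableType d) (Y : measurableType d').
Variables (mu : {measure set X -> \bar R}) (nu : {measure set Y -> \bar R}).
Variables (D : set X) (C : set Y) (mD : measurable D) (mC : measurable C).
Variables (T : Y -> X) (w : Y -> R).
Hypotheses (mT : measurable_fun C T) (mw : measurable_fun C w).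
Hypotheses (CD : forall y, C y -> D (T y)) (w0 : forall y, C y -> 0 <= w y).
Hypothesis muE : forall A, measurable A -> A `<=` D ->
  (mu A = \int[nu]_(y in C) (\1_A (T y) * w y)%:E)%E.

(** From sets to simple functions by linearity, then by monotone convergence along
    [nnsfun_approx]. *)
Lemma ge0_integral_density (f : X -> \bar R) : measurable_fun D f -> (forall x, D x -> 0 <= f x)%E ->
  (\int[mu]_(x in D) f x = \int[nu]_(y in C) (f (T y) * (w y)%:E))%E.
move=> mf f0; pose a := nnsfun_approx mD mf.
have mTa n : measurable_fun C (fun y => (a n (T y))).
  by apply: (measurable_comp measurableT) => //; exact: measurable_funPT.
have nn (b : {nnsfun X >-> R}) : (\int[mu]_(x in D) (b x)%:E = \int[nu]_(y in C) (b (T y) * w y)%:E)%E.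
  pose B r := b @^-1` [set r] `&` D.
  have mb r : measurable (b @^-1` [set r]) by exact: measurable_funPTI.
  have mB r : measurable (B r) by exact: measurableI.
  have mTb : measurable_fun C (b \o T) by apply: (measurable_comp measurableT).
  transitivity (\int[mu]_(x in D) (\sum_(r \in range b) (r * \1_(b @^-1` [set r]) x)%:E))%E.
    by apply: eq_integral => x _; rewrite fimfunE -fsumEFin.
  rewrite ge0_integral_fsum //; last first.
  - by move=> r x _; exact: nnfun_muleindic_ge0.
  - by move=> r; apply/measurable_EFinP; apply: measurable_funM => //; exact: measurable_indic.
  transitivity (\int[nu]_(y in C) (\sum_(r \in range b) (r * \1_(b @^-1` [set r]) (T y) * w y)%:E))%E; last first.
    apply: eq_integral => y _; rewrite fsumEFin // fimfunE; congr (_%:E).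
    by rewrite !fsbig_finite ?mulr_suml //; exact: fimfunP.
  rewrite ge0_integral_fsum //; last first.
  - move=> r y Cy; rewrite lee_fin mulr_ge0 ?w0 //.
    by have := nnfun_muleindic_ge0 b r (T y); rewrite lee_fin.
  - move=> r; apply/measurable_EFinP; apply: measurable_funM => //; apply: measurable_funM => //.
    by apply: (measurable_comp measurableT) => //; exact: measurable_indic.
  apply: eq_fsbigr => r /set_mem[z _ rz]. have r0 : 0 <= r by rewrite -rz.
  under eq_integral do rewrite EFinM.
  rewrite ge0_integralZl_EFin //; last exact/measurable_EFinP/measurable_indic.
  rewrite integral_indic // -/(B r) muE //; last by move=> x [].
  under [RHS]eq_integral do rewrite -mulrA EFinM. rewrite ge0_integralZl_EFin //; last first.
  - apply/measurable_EFinP; apply: measurable_funM => //.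
    by apply: (measurable_comp measurableT) => //; exact: measurable_indic.
  - by move=> y Cy; rewrite lee_fin mulr_ge0 ?w0. congr (_ * _)%E; apply: eq_integral => y /set_mem Cy.
  rewrite /B indicI; congr (_%:E); rewrite /= (_ : \1_D (T y) = 1) ?mulr1 //.
  by rewrite indicE mem_set //; exact: CD.
have La : (\int[mu]_(x in D) (a n x)%:E @[n --> \oo] --> \int[mu]_(x in D) f x)%E.
  rewrite (eq_integral (fun x => limn (fun n => (a n x)%:E))); last first.
    by move=> x /set_mem Dx; apply/esym/cvg_lim => //; exact: cvg_nnsfun_approx.
  apply: cvg_monotone_convergence => //.
  - by move=> n; apply/measurable_EFinP; exact: measurable_funTS.
  - by move=> n x _; rewrite lee_fin.
  - by move=> x _ k l kl; rewrite lee_fin; exact/lefP/nd_nnsfun_approx.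
have Lb : (\int[nu]_(y in C) (a n (T y) * w y)%:E @[n --> \oo] -->
    \int[nu]_(y in C) (f (T y) * (w y)%:E))%E.
  rewrite [X in _ --> X](eq_integral (fun y => limn (fun n => (a n (T y) * w y)%:E))); last first.
    move=> y /set_mem Cy; apply/esym/cvg_lim => //. under eq_fun do rewrite EFinM; apply: cvgeZr => //.
    by apply: cvg_nnsfun_approx => //; exact: CD.
  apply: cvg_monotone_convergence => //.
  - by move=> n; apply/measurable_EFinP; apply: measurable_funM.
  - by move=> n y Cy; rewrite lee_fin mulr_ge0 // w0.
  - move=> y Cy k l kl; rewrite lee_fin ler_wpM2r ?w0 //.
    exact/lefP/nd_nnsfun_approx.
apply: (cvg_unique _ La) => //.
by rewrite (_ : (fun n => _) = fun n => (\int[nu]_(y in C) (a n (T y) * w y)%:E)%E) //; apply/funext => n; exact: nn.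
Qed.

Lemma maxrM0 (a b : R) : 0 <= b -> Num.max a 0 * b = Num.max (a * b) 0.
move=> b0; have [a0|a0] := leP a 0; first by rewrite mul0r max_r // mulr_le0_ge0.
by rewrite max_l // mulr_ge0 // ltW.
Qed.

Lemma integral_density (f : X -> R) : measurable_fun D f ->
  (\int[mu]_(x in D) (f x)%:E = \int[nu]_(y in C) (f (T y) * w y)%:E)%E.
move=> mf; have mfE : measurable_fun D (EFin \o f) by exact/measurable_EFinP.
rewrite integralE [RHS]integralE; congr (_ - _)%E.
  rewrite ge0_integral_density //; last exact: measurable_funepos.
  apply: eq_integral => y /set_mem Cy; rewrite !funeposE -EFin_max -EFinM -EFin_max.
  by rewrite -maxrM0 ?w0.
rewrite ge0_integral_density //; last exact: measurable_funeneg.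
apply: eq_integral => y /set_mem Cy; rewrite !funenegE -!EFinN -EFin_max -EFinM -EFin_max.
by rewrite maxrM0 ?w0 // mulNr.
Qed.

End Density.

(** * Lebesgue measure on R^n *)

Section LebesgueRn.
Context {R : realType}.
Local Notation borV n := (bor 'rV[R]_n).
Local Notation leb := (@lebesgue_measure R).

Definition row_of k (p : R * 'rV[R]_k) : 'rV[R]_k.+1 := row_mx (p.1%:M : 'rV[R]_1) p.2.

Lemma row_of0 k t (y : 'rV[R]_k) : row_of (t, y) 0 ord0 = t.
have -> : ord0 = lshift k (ord0 : 'I_1) by apply: val_inj.
by apply: etrans (row_mxEl _ _ _ _) _; rewrite mxE eqxx mulr1n.
Qed.

Lemma row_ofS k t (y : 'rV[R]_k) j : row_of (t, y) 0 (lift ord0 j) = y 0 j.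
have -> : lift ord0 j = rshift 1 j by apply: val_inj.
exact: (row_mxEr (t%:M : 'rV_1) y).
Qed.

Lemma rV_eq_row k (x : 'rV[R]_k.+1) : x = row_of (x 0 ord0, \row_j x 0 (lift ord0 j)).
apply/rowP => i; case: (unliftP ord0 i) => [j|] ->; first by rewrite row_ofS mxE.
by rewrite row_of0.
Qed.

Lemma row_of_nbhs k t (y : 'rV[R]_k) (U : set 'rV[R]_k.+1) : open U -> U (row_of (t, y)) ->
  exists2 e : R, 0 < e & forall t' y', `|t - t'| < e -> ball y e y' -> U (row_of (t', y')).
move=> oU Uty; have : nbhs (row_of (t, y)) U by exact: open_nbhs_nbhs.
move=> /nbhs_ballP[e e0 He]; exists e => // t' y' tt' [_ yy']; apply: He; split=> // a b.
rewrite ord1; case: (unliftP ord0 b) => [j|] ->; last by rewrite !row_of0.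
by rewrite !row_ofS; exact: yy'.
Qed.

(** The point is that Borel sets of the space of rows lie in the product sigma-algebra: an open set
    is a countable union of products of a rational interval and an open set. *)
Lemma measurable_row_of k : measurable_fun setT (@row_of k : measurableTypeR R * borV k -> borV k.+1).
apply: (@measurability _ _ (measurableTypeR R * borV k)%type (borV k.+1) setT _ (@open _) erefl).
move=> _ [U oU <-]; rewrite setTI.
(* [V a b] is the largest open set whose product with the interval ]a, b[ is mapped into U. *)
pose V (a b : rat) := \bigcup_(W in [set W : set 'rV[R]_k | open W /\
  forall t y, ratr a < t < ratr b -> W y -> U (row_of (t, y))]) W.
have -> : @row_of k @^-1` U = \bigcup_(a : rat) \bigcup_(b : rat)
   ([set` `](ratr a), (ratr b)[ ] `*` V a b).
  apply/seteqP; split=> [[t y] /= Uty|[t y] [a _ [b _ [/= tab [W [_ WU] Wy]]]]]; last first.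
    by apply: WU => //; move: tab; rewrite in_itv.
  have [e e0 He] := row_of_nbhs oU Uty. have /rat_in_itvoo[a] : t - e < t by rewrite ltrBlDr ltrDl.
  rewrite in_itv /= => /andP[a1 a2]. have /rat_in_itvoo[b] : t < t + e by rewrite ltrDl.
  rewrite in_itv /= => /andP[b1 b2].
  exists a => //; exists b => //; split=> /=; first by rewrite in_itv /= a2 b1.
  exists (ball y e)°; last by apply: nbhsx_ballx. split; first exact: open_interior.
  move=> t' y' /andP[at' tb'] /interior_subset yy'; apply: He => //. by rewrite ltr_distlC; lra.
apply: bigcupT_measurable_rat => a; apply: bigcupT_measurable_rat => b.
apply: measurableX => //; apply: open_borel; apply: bigcup_open => W [] //.
Qed.

Lemma measurable_row_of_r k t : measurable_fun setT ((fun y => row_of (t, y)) : borV k -> borV k.+1).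
have H : measurable_fun setT ((@row_of k : (measurableTypeR R * borV k)%type -> borV k.+1) \o pair (t : measurableTypeR R)).
  by apply: measurableT_comp; [exact: measurable_row_of|exact: pair1_measurable].
exact: H.
Qed.

Definition cube n (c : R) : set 'rV[R]_n := [set x | forall i, `|x 0 i| <= c].

Lemma cube_row k c t (y : 'rV[R]_k) : cube c (row_of (t, y)) <-> `|t| <= c /\ cube c y.
split=> [H|[Ht Hy] i].
  split; first by have := H ord0; rewrite row_of0. by move=> j; have := H (lift ord0 j); rewrite row_ofS.
by case: (unliftP ord0 i) => [j|] ->; rewrite ?row_ofS ?row_of0.
Qed.

Lemma closed_cube n c : closed (@cube n c).
have -> : @cube n c = \bigcap_(i in [set: 'I_n]) [set x : 'rV[R]_n | `|x 0 i| <= c].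
  by apply/seteqP; split=> x H i; [move=> _|]; apply: H.
apply: closed_bigI => i _.
have : continuous (fun x : 'rV[R]_n => `|x 0 i|).
  by move=> x; exact: (continuous_comp (@rV_coord_continuous R n i x) (@norm_continuous _ _ _)).
by move=> cf; apply: (@closed_comp _ _ (fun x : 'rV[R]_n => `|x 0 i|) [set t | t <= c]) => [x _|]; [exact: cf|exact: closed_le].
Qed.

Lemma measurable_cube n c : measurable (cube c : set (borV n)).
by apply: closed_borel; exact: closed_cube. Qed.

Lemma lint0 n : lint (fun _ : 'rV[R]_n => 0%E) = 0%E.
by elim: n => [//|n IH] /=; rewrite integral0_eq. Qed.

Lemma eq_lint n (f g : 'rV[R]_n -> \bar R) : f =1 g -> lint f = lint g.
by move=> fg; congr lint; apply/funext. Qed.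

Lemma lint_cube n (c : R) : 0 <= c -> lint (fun x : 'rV[R]_n => (\1_(cube c) x)%:E) = ((2 * c) ^+ n)%:E.
move=> c0; elim: n => [|n IH] /=.
  by rewrite indicE mem_set // => i; case: i.
transitivity (\int[leb]_(t in [set: R]) (((2 * c) ^+ n) * \1_[set` `[- c, c]] t)%:E)%E.
  apply: eq_integral => t _; have [tc|tc] := boolP (`|t| <= c).
    rewrite (@eq_lint _ _ (fun y => (\1_(cube c) y)%:E)) ?IH.
      by rewrite indicE mem_set ?mulr1 //= in_itv /= -ler_norml.
    move=> y; rewrite !indicE; congr (_%:R%:E); congr nat_of_bool.
    apply/idP/idP => /set_mem H; apply/mem_set; first by case/cube_row: H. exact/cube_row.
  rewrite (@eq_lint _ _ (fun=> 0%E)) ?lint0.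
    rewrite indicE memNset ?mulr0 //= in_itv /= -ler_norml; exact/negP.
  move=> y; rewrite indicE memNset // => /cube_row[H _]; by rewrite H in tc.
under eq_integral do rewrite EFinM.
rewrite ge0_integralZl_EFin //; last first.
- by rewrite exprn_ge0 // mulr_ge0.
- exact/measurable_EFinP.
rewrite integral_indic //.
rewrite setIT.
have E : leb [set` `[- c, c]] = (2 * c)%:E.
  rewrite lebesgue_measure_itv /= lte_fin; case: ltP => [_|cc].
    by rewrite -EFinB; congr (_%:E); ring.
  by have -> : c = 0 by [lra|]; rewrite mulr0.
by rewrite -[X in (_ * X)%E]/(leb [set` `[- c, c]]) E -EFinM exprS mulrC.
Qed.

Section Step.
Variables (n : nat) (mu : {measure set (borV n) -> \bar R}) (sf : sigma_finite setT mu).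
Hypothesis muE : forall f : borV n -> \bar R, measurable_fun setT f -> (forall x, 0 <= f x)%E ->
  (\int[mu]_x f x = lint f)%E.

(** A copy of [mu] that mentions [sf], so that sigma-finiteness can be attached to it as a structure
    and product measures can be formed. *)
Definition sfm : set (borV n) -> \bar R := let _ := sf in mu.
HB.instance Definition _ := Measure.on sfm.
HB.instance Definition _ := Measure_isSigmaFinite.Build _ _ _ sfm sf.

Let mr := @measurable_row_of n.

Definition lebn_step : {measure set (borV n.+1) -> \bar R} :=
  measure_function_pushforward__canonical__measure_function_Measure (leb \x sfm)%E mr.

Lemma lebn_stepE (f : borV n.+1 -> \bar R) : measurable_fun setT f -> (forall x, 0 <= f x)%E ->
  (\int[lebn_step]_x f x = lint f)%E.
move=> mf f0; rewrite ge0_integral_pushforward // preimage_setT.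
rewrite fubini_tonelli1 //=; last first.
  exact: (measurableT_comp mf mr).
apply: eq_integral => t _; rewrite -muE //.
exact: (measurableT_comp mf (@measurable_row_of_r n t)).
Qed.

End Step.

Lemma cube_cover n : [set: 'rV[R]_n] = \bigcup_(i : nat) cube i%:R.
apply/seteqP; split=> // x _; pose c := \sum_i `|x 0 i|.
have c0 : 0 <= c by exact: sumr_ge0.
exists (Num.truncn c).+1 => // i; apply: le_trans (ltW (truncnS_gt _)).
by rewrite /c (bigD1 i) //= lerDl; exact: sumr_ge0.
Qed.

Lemma lint_sigma_finite n (mu : {measure set (borV n) -> \bar R}) :
  (forall f : borV n -> \bar R, measurable_fun setT f -> (forall x, 0 <= f x)%E ->
    (\int[mu]_x f x = lint f)%E) -> sigma_finite setT mu.
move=> muE; exists (fun i => cube i%:R); first exact: cube_cover.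
move=> i; split; first exact: measurable_cube.
rewrite -[X in mu X]setIT -integral_indic //; last exact: measurable_cube.
rewrite muE //; last by apply/measurable_EFinP; apply: measurable_indic; exact: measurable_cube.
by rewrite lint_cube // ltry.
Qed.

Lemma lebn_exists n : exists mu : {measure set (borV n) -> \bar R},
  forall f : borV n -> \bar R, measurable_fun setT f -> (forall x, 0 <= f x)%E ->
    (\int[mu]_x f x = lint f)%E.
elim: n => [|n [mu muE]].
  exists (dirac (0 : borV 0)) => f mf f0 /=. by rewrite integral_dirac // diracT mul1e.
exists (lebn_step (lint_sigma_finite muE)) => f mf f0.
exact: lebn_stepE.
Qed.

(** [lint] is a bare iterated integral, with no linearity or limit theorem of its own. [lebn] is a
    measure with the same integrals of nonnegative Borel functions. *)
Definition lebn n : set (borV n) -> \bar R := projT1 (cid (lebn_exists n)).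

Arguments lebn n : clear implicits.

HB.instance Definition _ n := Measure.on (lebn n).

Lemma lint_lebn n (f : borV n -> \bar R) : measurable_fun setT f -> (forall x, 0 <= f x)%E ->
  (lint f = \int[lebn n]_x f x)%E.
by move=> mf f0; rewrite (projT2 (cid (lebn_exists n))). Qed.

Lemma lebn_sigma_finite n : sigma_finite setT (lebn n).
by apply: lint_sigma_finite => f mf f0; rewrite lint_lebn. Qed.

HB.instance Definition _ n := Measure_isSigmaFinite.Build _ _ _ (lebn n) (lebn_sigma_finite n).

Lemma lebn_cube n (c : R) : 0 <= c -> (lebn n (cube c) = ((2 * c) ^+ n)%:E)%E.
move=> c0; rewrite -lint_cube // lint_lebn //.
  by rewrite integral_indic ?setIT //; exact: measurable_cube.
by apply/measurable_EFinP; apply: measurable_indic; exact: measurable_cube.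
Qed.

Section Slices.
Variable n : nat.
Local Notation prod := (leb \x lebn n)%E.
Local Notation P := (measurableTypeR R * borV n)%type.

Lemma ge0_integral_prod_row (f : borV n.+1 -> \bar R) :
  measurable_fun setT f -> (forall x, 0 <= f x)%E ->
  (\int[prod]_p f (row_of p) = \int[lebn n.+1]_x f x)%E.
move=> mf f0; rewrite -lint_lebn // fubini_tonelli1 //=; last first.
  exact: (measurableT_comp mf (@measurable_row_of n)).
apply: eq_integral => t _; rewrite lint_lebn //.
exact: (measurableT_comp mf (@measurable_row_of_r n t)).
Qed.

Lemma integral_prod_row (f : borV n.+1 -> \bar R) : measurable_fun setT f ->
  (\int[prod]_p f (row_of p) = \int[lebn n.+1]_x f x)%E.
move=> mf; rewrite integralE [RHS]integralE; congr (_ - _)%E.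
  rewrite -[RHS](ge0_integral_prod_row (measurable_funepos mf) (funepos_ge0 f)).
  by apply: eq_integral => p _; rewrite !funeposE.
rewrite -[RHS](ge0_integral_prod_row (measurable_funeneg mf) (funeneg_ge0 f)).
by apply: eq_integral => p _; rewrite !funenegE.
Qed.

Lemma integrable_prod_row (f : borV n.+1 -> \bar R) :
  (lebn n.+1).-integrable setT f -> prod.-integrable setT (f \o @row_of n).
move=> /integrableP[mf fi]; apply/integrableP; split.
  exact: (measurableT_comp mf (@measurable_row_of n)).
rewrite (ge0_integral_prod_row (f := fun x => `|f x|%E)) //.
exact: measurableT_comp.
Qed.

End Slices.

(** Bounded, measurable, of bounded support. The class is stable under slicing, so Fubini applies to
    f and to all its slices, and for such signed f the iterated integral [lint] is the integral. *)
Definition bms n (f : 'rV[R]_n -> R) : Prop :=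
  [/\ measurable_fun setT (f : borV n -> R), exists c, forall x, `|f x| <= c &
      exists2 c, 0 <= c & forall x, ~ cube c x -> f x = 0].

Lemma bms_integrable n f : bms f -> (lebn n).-integrable setT (EFin \o f).
move=> [mf [c fc] [k k0 fk]].
have mC := @measurable_cube n k.
have : (lebn n).-integrable (cube k) (EFin \o f).
  apply: measurable_bounded_integrable => //.
  - by apply: le_lt_trans (ltry ((2 * k) ^+ n)); rewrite -lebn_cube.
  - exact: measurable_funTS.
  - by exists c; split; [exact: num_real|] => M cM x _; exact: le_trans (fc x) (ltW cM).
move=> /(integrable_mkcond _ mC).1; congr (integrable _ _ _).
apply/funext => x; rewrite patchE; case: ifPn => // /negP xk /=.
by rewrite fk // => H; apply: xk; exact: mem_set.
Qed.

Lemma bms_slice n f t : @bms n.+1 f -> bms (fun y => f (row_of (t, y))).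
move=> [mf [c fc] [k k0 fk]]; split; last 2 first.
- by exists c => y.
- by exists k => // y Hy; apply: fk => /cube_row[].
exact: (measurableT_comp mf (@measurable_row_of_r n t)).
Qed.

Lemma lint_bms n f : bms f -> (lint (fun x => (f x)%:E) = \int[lebn n]_x (f x)%:E)%E.
elim: n f => [|n IH] f Hf.
  have [/measurable_EFinP mf _ _] := Hf.
  rewrite integralE /= -!lint_lebn //=; [|exact: measurable_funeneg|exact: measurable_funepos].
  rewrite funeposE funenegE -!EFinN -!EFin_max -EFinB; congr (_%:E).
  by case: (leP (f 0) 0) => H; case: (leP (- f 0) 0) => H'; lra.
have fi := bms_integrable Hf; have [/measurable_EFinP mf _ _] := Hf.
rewrite /= -(integral_prod_row mf) -(integral12_prod_meas1 (integrable_prod_row fi)).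
by apply: eq_integral => t _; rewrite IH //; exact: bms_slice.
Qed.

Lemma bms_fubini n f : @bms n.+1 f ->
  (\int[lebn n.+1]_x (f x)%:E = \int[lebn n]_y \int[leb]_t (f (row_of (t, y)))%:E)%E.
move=> Hf; have fi := bms_integrable Hf; have [/measurable_EFinP mf _ _] := Hf.
rewrite -integral_prod_row // -(integral12_prod_meas1 (integrable_prod_row fi)).
rewrite -(Fubini (integrable_prod_row fi)).
by [].
Qed.

End LebesgueRn.
Arguments lebn {R} n.

(** * The divergence theorem on R^n and on a half-space *)

Section Divergence.
Context {R : realType}.
Local Notation leb := (@lebesgue_measure R).
Local Notation borV n := (bor 'rV[R]_n).

Lemma compact_cube n (c : R) : compact (@cube R n c).
apply: bounded_closed_compact; last exact: closed_cube.
exists (Num.max c 0); split; first exact: num_real.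
move=> M; rewrite gt_max => /andP[cM M0] x xc.
apply: norm_rV_le => [|i]; [exact: ltW|exact: le_trans (xc i) (ltW cM)].
Qed.

Lemma within_cube_bounded n (A : set 'rV[R]_n) c (f : 'rV[R]_n -> R) : closed A -> CkA 0 A f ->
  (forall x, A x -> ~ cube c x -> f x = 0) -> exists K, forall x, A x -> `|f x| <= K.
move=> cA Cf f0; have cAc : compact (A `&` cube c).
  rewrite setIC; apply: compact_closedI => //; exact: compact_cube.
have cf : {within A `&` cube c, continuous f}.
  by apply: (@CkA_continuous _ _ 0); apply: CkA_sub Cf => x [].
have [M [Mr HM]] := compact_bounded (continuous_compact cf cAc).
exists (Num.max 0 (M + 1)) => x Ax; rewrite le_max.
have [xc|xc] := pselect (cube c x); last by rewrite f0 // normr0 lexx.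
by apply/orP; right; apply: HM; [rewrite ltrDl|exists x].
Qed.

Lemma bms_restrict n (A : set 'rV[R]_n) c (f : 'rV[R]_n -> R) : closed A -> CkA 0 A f -> 0 <= c ->
  (forall x, A x -> ~ cube c x -> f x = 0) -> bms (f \_ A).
move=> cA Cf c0 f0; split.
- apply/(measurable_restrictT _ _).1; first exact: closed_borel.
  apply: within_measurable_real; first exact: closed_borel. by move=> x Ax; exact: CkA_cvg Cf Ax.
- have [K HK] := within_cube_bounded cA Cf f0; exists (Num.max 0 K) => x.
  rewrite patchE le_max; case: ifPn => [/set_mem Ax|_]; last by rewrite normr0 lexx. by rewrite HK ?orbT.
- by exists c => // x xc; rewrite patchE; case: ifPn => // /set_mem Ax; exact: f0.
Qed.

Lemma pd_out_cube n (A : set 'rV[R]_n.+1) c (f : 'rV[R]_n.+1 -> R) i x : regular A ->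
  (forall x, A x -> ~ cube c x -> f x = 0) -> A x -> ~ cube c x -> pd A f i x = 0.
move=> rA f0 Ax xc.
have oC : open (~` @cube R n.+1 c) by apply: closed_openC; exact: closed_cube.
rewrite (@pd_local _ _ A A _ f (fun=> 0) i x oC xc) ?pd_cst // => y yc Ay; exact: f0.
Qed.

(** One family for both model spaces: R^n for the whole line, the half-space for the nonnegative
    reals. *)
Definition slab n (s : set R) : set 'rV[R]_n.+1 := [set x | s (x 0 ord0)].

Lemma slab_row n s t (y : 'rV[R]_n) : slab s (row_of (t, y)) = s t.
by rewrite /slab /= row_of0. Qed.

Lemma closed_slab n s : closed s -> closed (@slab n s).
move=> cs; apply: (@closed_comp _ _ (fun x : 'rV[R]_n.+1 => x 0 ord0) s) => // x _.
exact: rV_coord_continuous.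
Qed.

Lemma row_ofD n t d (y : 'rV[R]_n) : row_of (d + t, y) = d *: ev ord0 + row_of (t, y).
apply/rowP => i; rewrite mxDE mxZE.
case: (unliftP ord0 i) => [j|] ->.
  by rewrite !row_ofS mxE (_ : (lift ord0 j == ord0) = false) // andbF mulr0 add0r.
by rewrite !row_of0 mxE !eqxx mulr1.
Qed.

Lemma row_of_basisS n t (y : 'rV[R]_n) s j :
  row_of (t, y) + s *: ev (lift ord0 j) = row_of (t, y + s *: ev j).
apply/rowP => i; rewrite mxDE mxZE; case: (unliftP ord0 i) => [l|] ->.
  by rewrite !row_ofS !mxE !eqxx /= (inj_eq lift_inj).
by rewrite !row_of0 mxE (_ : (ord0 == lift ord0 j) = false) // andbF mulr0 addr0.
Qed.

Lemma row_of_cvg n (y : 'rV[R]_n) t : row_of (s, y) @[s --> t] --> row_of (t, y).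
have -> : (fun s => row_of (s, y)) = (fun s => s *: ev ord0 + row_of (0, y)).
  by apply/funext => s; rewrite -row_ofD addr0.
rewrite -[t in X in _ --> X]addr0 row_ofD.
by apply: cvgD; [apply: cvgZr_tmp|exact: cvg_cst].
Qed.

Lemma CkA_row n k s t (f : 'rV[R]_n.+1 -> R) : s t -> CkA k (slab s) f ->
  CkA k setT (fun y => f (row_of (t, y))).
move=> st Cf; apply: (@CkA_comp _ _ _ _ _ (slab s) f (fun y => row_of (t, y))) => //.
  by move=> y _; rewrite slab_row.
move=> j; case: (unliftP ord0 j) => [l|] ->.
  by under eq_fun do rewrite row_ofS; exact: CkA_coord.
by under eq_fun do rewrite row_of0; exact: CkA_cst.
Qed.

Lemma pd_row n s t (f : 'rV[R]_n.+1 -> R) j (y : 'rV[R]_n) : s t ->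
  pd (slab s) f (lift ord0 j) (row_of (t, y)) = pd setT (fun y => f (row_of (t, y))) j y.
move=> st; rewrite /pd.
have -> : (fun r : R => r^-1 * (f (row_of (t, y) + r *: ev (lift ord0 j)) - f (row_of (t, y)))) =
   (fun r => r^-1 * (f (row_of (t, y + r *: ev j)) - f (row_of (t, y)))).
  by apply/funext => r; rewrite row_of_basisS.
have -> // : [set r : R | r != 0 /\ slab s (row_of (t, y) + r *: ev (lift ord0 j))] =
  [set r : R | r != 0 /\ [set: 'rV_n] (y + r *: ev j)].
by apply/seteqP; split=> r [r0 _]; split=> //; rewrite row_of_basisS slab_row.
Qed.

Lemma ftc_row n s (f : 'rV[R]_n.+1 -> R) (y : 'rV[R]_n) a b : regular (@slab n s) ->
  CkA 1 (slab s) f -> a < b -> (forall t, a <= t <= b -> s t) ->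
  (\int[leb]_(t in `[a, b]) (pd (slab s) f ord0 (row_of (t, y)))%:E =
    (f (row_of (b, y)) - f (row_of (a, y)))%:E)%E.
move=> rS Cf ab sab; rewrite EFinB.
have cw (g : 'rV[R]_n.+1 -> R) k : CkA k (slab s) g -> forall t, a <= t <= b ->
    g (row_of (r, y)) @[r --> within `[a, b] (nbhs t)] --> g (row_of (t, y)).
  move=> Cg t tab; have St : slab s (row_of (t, y)) by rewrite slab_row; exact: sab.
  move=> P /(CkA_cvg Cg St); rewrite /within /= => /row_of_cvg H.
  change (nbhs t (fun r => `[a, b]%classic r -> P (g (row_of (r, y))))).
  have {}H : nbhs t (fun r => slab s (row_of (r, y)) -> P (g (row_of (r, y)))) := H.
  apply: filterS H => r H rab; apply: H; rewrite slab_row; apply: sab. by move: rab; rewrite /= in_itv.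
have cwi (g : 'rV[R]_n.+1 -> R) k : CkA k (slab s) g -> {within `[a, b], continuous (fun t => g (row_of (t, y)))}.
  move=> Cg; apply/subspace_continuousP => t; rewrite /= in_itv /= => tab; exact: cw Cg t tab.
have dF t : t \in `]a, b[ -> is_derive t 1 (fun t => f (row_of (t, y)))
    (pd (slab s) f ord0 (row_of (t, y))).
  rewrite in_itv /= => /andP[at_ tb].
  have St : slab s (row_of (t, y)) by rewrite slab_row; apply: sab; rewrite !ltW.
  have [U [F [oU Ut CF fF]]] := Cf _ St.
  have dF : derivable F (row_of (t, y)) (ev ord0) := (CF ord0).1 _ Ut.
  rewrite (pdE rS St oU Ut fF dF); apply: is_derive_cvg.
  have : h^-1 *: (F (h *: ev ord0 + row_of (t, y)) - F (row_of (t, y))) @[h --> (0 : R)^'] -->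
    'D_(ev ord0) F (row_of (t, y)) by exact: dF.
  apply: cvg_trans; apply: near_eq_cvg; rewrite /dnbhs. rewrite near_withinE; near=> h => h0 /=.
  have Uh : U (row_of (h + t, y)) by rewrite row_ofD addrC; near: h; exact: near_line.
  have Sh : slab s (row_of (h + t, y)).
    rewrite slab_row; apply: sab. have : `|h| < Num.min (t - a) (b - t).
      near: h; apply/nbhs_ballP.
      exists (Num.min (t - a) (b - t)) => [|z]; first by rewrite /= lt_min !subr_gt0 at_ tb.
      by rewrite /ball /= sub0r normrN.
    by rewrite lt_min => /andP[]; rewrite !ltr_norml => /andP[h1 h2] /andP[h3 h4]; lra.
  by rewrite (fF _ Sh Uh) (fF _ St Ut) row_ofD.
apply: (@continuous_FTC2 R (fun t => pd (slab s) f ord0 (row_of (t, y))) (fun t => f (row_of (t, y)))) => //.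
- exact: (cwi _ 0 (CkA_pd ord0 rS Cf)).
- split.
  + by move=> t tab; have [] := dF t tab.
  + have := cw _ _ Cf a; rewrite lexx (ltW ab) => /(_ isT); apply: cvg_trans; apply: cvg_app => P.
    move=> H; have {}H : nbhs a (fun r => `[a, b]%classic r -> P r) := H.
    change (nbhs a (fun r => a < r -> P r)).
    apply: filterS2 H (open_nbhs_nbhs (conj (@open_lt _ b) ab)) => r H rb ar; apply: H.
    by rewrite /= in_itv /= (ltW ar) ltW.
  + have := cw _ _ Cf b; rewrite lexx (ltW ab) => /(_ isT); apply: cvg_trans; apply: cvg_app => P.
    move=> H; have {}H : nbhs b (fun r => `[a, b]%classic r -> P r) := H.
    change (nbhs b (fun r => r < b -> P r)).
    apply: filterS2 H (open_nbhs_nbhs (conj (@open_gt _ a) ab)) => r H ar rb; apply: H.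
    by rewrite /= in_itv /= (ltW rb) ltW.
- by move=> t tab; rewrite derive1E; have [_ ->] := dF t tab.
Unshelve. all: by end_near. Qed.

Lemma bms_pd n s (f : 'rV[R]_n.+1 -> R) i c : closed s -> regular (@slab n s) ->
  CkA 1 (slab s) f -> 0 <= c -> (forall x, slab s x -> ~ cube c x -> f x = 0) ->
  bms (pd (slab s) f i \_ (slab s)).
move=> cs rS Cf c0 f0; apply: (bms_restrict (closed_slab cs) (CkA_pd i rS Cf) c0).
move=> x Sx xc; exact: (pd_out_cube i rS f0).
Qed.

(** Fubini and the fundamental theorem of calculus in coordinate 0, on an interval [a, b] that
    carries the support. The value at b vanishes since c < b; the value at a is the boundary term of
    a half-space and is 0 when a < - c. *)
Lemma integral_pd_normal n s (f : 'rV[R]_n.+1 -> R) c a b : closed s -> regular (@slab n s) ->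
  CkA 1 (slab s) f -> 0 <= c -> (forall x, slab s x -> ~ cube c x -> f x = 0) ->
  a < b -> (forall t, a <= t <= b -> s t) -> (forall t, s t -> `|t| <= c -> a <= t <= b) -> c < b ->
  (\int[lebn n.+1]_x ((pd (slab s) f ord0 \_ (slab s)) x)%:E =
   \int[lebn n]_y (- f (row_of (a, y)))%:E)%E.
move=> cs rS Cf c0 f0 ab sab sc cb; rewrite bms_fubini; last exact: bms_pd f0.
apply: eq_integral => y _.
transitivity (\int[leb]_(t in `[a, b]) (pd (slab s) f ord0 (row_of (t, y)))%:E)%E.
  rewrite [RHS]integral_mkcond; apply: eq_integral => t _; rewrite !patchE.
  case: ifPn => [/set_mem|/negP St]; last first.
    case: ifPn => // /set_mem /=; rewrite in_itv /= => /sab st.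
    by exfalso; apply: St; apply: mem_set; rewrite slab_row.
  rewrite slab_row => st; case: ifPn => // /negP tab; congr (_%:E).
  apply: (pd_out_cube _ rS f0); first by rewrite slab_row.
  move=> /cube_row[tc _]; apply: tab; apply: mem_set; rewrite /= in_itv /=; exact: sc.
rewrite ftc_row // (f0 (row_of (b, y))) ?sub0r //.
  by rewrite slab_row; apply: sab; rewrite lexx ltW.
by move=> /cube_row[+ _]; rewrite gtr0_norm ?(le_lt_trans c0) // leNgt cb.
Qed.

Lemma lintS n (f : 'rV[R]_n.+1 -> \bar R) : (lint f = \int[leb]_t lint (fun y => f (row_of (t, y))))%E.
by []. Qed.

(** A tangential derivative is a derivative within each slice t = const, so the case of one
    dimension less, taken as a hypothesis on g, kills every slice. *)
Lemma integral_pd_tangent n s (f : 'rV[R]_n.+2 -> R) c j : closed s -> regular (@slab n.+1 s) ->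
  (forall g : 'rV[R]_n.+1 -> R, CkA 1 setT g -> (forall x, ~ cube c x -> g x = 0) ->
    (\int[lebn n.+1]_x (pd setT g j x)%:E = 0)%E) ->
  CkA 1 (slab s) f -> 0 <= c -> (forall x, slab s x -> ~ cube c x -> f x = 0) ->
  (\int[lebn n.+2]_x ((pd (slab s) f (lift ord0 j) \_ (slab s)) x)%:E = 0)%E.
move=> cs rS IH Cf c0 f0; have B := bms_pd (lift ord0 j) cs rS Cf c0 f0.
rewrite -(lint_bms B) lintS; apply: integral0_eq => t _.
rewrite (lint_bms (bms_slice t B)); have [st|st] := pselect (s t); last first.
  apply: integral0_eq => y _; rewrite patchE memNset //; by rewrite slab_row.
rewrite -[RHS](IH (fun y => f (row_of (t, y)))); first last.
- by move=> y yc; apply: f0; [rewrite slab_row|move=> /cube_row[]].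
- exact: CkA_row Cf.
apply: eq_integral => y _; rewrite patchE mem_set ?slab_row //; congr (_%:E).
exact: pd_row.
Qed.

Lemma slabT n : slab setT = [set: 'rV[R]_n.+1].
by apply/seteqP; split. Qed.

Lemma regularT n : regular [set: 'rV[R]_n.+1].
by apply: open_regular; exact: openT. Qed.

Lemma integral_pdT n (f : 'rV[R]_n.+1 -> R) c i : 0 <= c -> CkA 1 setT f ->
  (forall x, ~ cube c x -> f x = 0) -> (\int[lebn n.+1]_x (pd setT f i x)%:E = 0)%E.
move=> c0; have cT : closed [set: R] by exact: closedT.
have N n' (g : 'rV[R]_n'.+1 -> R) : CkA 1 setT g -> (forall x, ~ cube c x -> g x = 0) ->
    (\int[lebn n'.+1]_x (pd setT g ord0 x)%:E = 0)%E.
  move=> Cf f0; have h1 : - (c + 1) < c + 1 by lra. have h2 : c < c + 1 by lra.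
  have h3 t : [set: R] t -> `|t| <= c -> - (c + 1) <= t <= c + 1 by move=> _; rewrite ler_norml; lra.
  have h4 x : slab [set: R] x -> ~ cube c x -> g x = 0 by move=> _; exact: f0.
  have h5 : regular (@slab n' [set: R]) by rewrite slabT; exact: regularT.
  have h6 : CkA 1 (slab [set: R]) g by rewrite slabT.
  have := integral_pd_normal cT h5 h6 c0 h4 h1 (fun _ _ => Logic.I) h3 h2.
  rewrite slabT patch_setT => ->; apply: integral0_eq => y _.
  rewrite f0 ?oppr0 // => /cube_row[]; rewrite normrN gtr0_norm; lra.
elim: n f i => [|n IH] f i Cf f0; first by rewrite (ord1 i); exact: N.
case: (unliftP ord0 i) => [j|] ->; last exact: N.
have h4 x : slab [set: R] x -> ~ cube c x -> f x = 0 by move=> _; exact: f0.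
have h5 : regular (@slab n.+1 [set: R]) by rewrite slabT; exact: regularT.
have h6 : CkA 1 (slab [set: R]) f by rewrite slabT.
have := integral_pd_tangent cT h5 (fun g => IH g j) h6 c0 h4.
by rewrite slabT patch_setT.
Qed.

Lemma half_slab n : half_space n = slab [set t : R | 0 <= t].
by []. Qed.

Lemma regular_half n : regular (@half_space R n).
by exists setT; [exact: openT|right; rewrite setTI]. Qed.

Lemma integral_pd_half n (f : 'rV[R]_n.+1 -> R) c i : 0 <= c -> CkA 1 (half_space n) f ->
  (forall x, half_space n x -> ~ cube c x -> f x = 0) ->
  (\int[lebn n.+1]_x ((pd (half_space n) f i \_ (half_space n)) x)%:E =
   if i == ord0 then \int[lebn n]_y (- f (row_of (0%R, y)))%:E else 0)%E.
move=> c0; rewrite half_slab => Cf f0.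
have cs : closed [set t : R | 0 <= t] by exact: closed_ge.
have rS : regular (slab [set t : R | 0 <= t]) := @regular_half n.
case: (unliftP ord0 i) Cf f0 rS => [j|] -> Cf f0 rS /=; last first.
  apply: (@integral_pd_normal _ _ _ c 0 (c + 1)) => //; [lra|by move=> t /andP[]| |lra].
  by move=> t /= t0; rewrite ger0_norm //; lra.
case: n {i} j f Cf f0 rS => [[]//|n] j f Cf f0 rS.
apply: (@integral_pd_tangent _ _ _ c) => // g Cg g0; exact: (integral_pdT _ c0).
Qed.

End Divergence.

(** * A C^1 step function *)

Section SmoothStep.
Context {R : realType}.

Definition posq (t : R) : R := if 0 < t then t ^+ 2 else 0.
Definition dposq (t : R) : R := if 0 < t then 2 * t else 0.

Lemma dposqE t : dposq t = t + `|t|.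
rewrite /dposq; case: ltP => t0; first by rewrite gtr0_norm //; ring.
by rewrite ler0_norm // subrr.
Qed.

Lemma continuous_dposq : continuous dposq.
have -> : dposq = (fun t => t + `|t|) by apply/funext => t; exact: dposqE.
by move=> t; apply: cvgD; [exact: cvg_id|exact: norm_continuous].
Qed.

Lemma posqE t : posq t = t * (t + `|t|) / 2.
rewrite /posq; case: ltP => t0; first by rewrite gtr0_norm //; field.
by rewrite ler0_norm // subrr mulr0 mul0r.
Qed.

Lemma is_derive_posq (t : R) : is_derive t 1 posq (dposq t).
have [t0|t0|<-] := ltgtP 0 t.
- have -> : dposq t = 2 * t by rewrite /dposq t0.
  have : is_derive t 1 (fun x : R => x ^+ 2) (2 * t).
    have := @is_deriveX R R id 2 t 1 1 (is_derive_id t 1). by rewrite /= expr1 -[_ *: _]/(_ * _) mulr1.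
  apply: near_eq_is_derive.
  have : nbhs t [set x | 0 < x] by apply: open_nbhs_nbhs; split=> //; exact: open_gt.
  by apply: filterS => x /= x0; rewrite /posq x0.
- have -> : dposq t = 0 by rewrite /dposq ltNge ltW.
  have : is_derive t 1 (fun x : R => 0 : R) 0 by exact: is_derive_cst. apply: near_eq_is_derive.
  have : nbhs t [set x | x < 0] by apply: open_nbhs_nbhs; split=> //; exact: open_lt.
  by apply: filterS => x /= x0; rewrite /posq ltNge ltW.
- have -> : dposq 0 = 0 by rewrite /dposq ltxx.
  apply: is_derive_cvg.
  have E : {near (0 : R)^', (fun h : R => (h + `|h|) / 2) =1 (fun h => h^-1 *: (posq (h + 0) - posq 0))}.
    rewrite /dnbhs near_withinE; near=> h => h0.
    by rewrite addr0 !posqE mul0r mul0r subr0 -[_ *: _]/(_ * _); field.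
  apply: cvg_trans (near_eq_cvg E) _.
  have : (fun h : R => (h + `|h|) / 2) @ (0 : R) --> (0 + `|0 : R|) / 2.
    by apply: cvgMr_tmp; apply: cvgD; [exact: cvg_id|exact: norm_continuous].
  by rewrite normr0 addr0 mul0r; exact: cvg_within_filter.
Unshelve. all: by end_near. Qed.

(** Quadratic spline with knots 0, 1/2 and 1: its derivative is the hat function of height 2 on
    [0, 1], whose integral is 1. *)
Definition step t := 2 * posq t - 4 * posq (t - 2^-1) + 2 * posq (t - 1).
Definition dstep t := 2 * dposq t - 4 * dposq (t - 2^-1) + 2 * dposq (t - 1).

Lemma is_derive_step (t : R) : is_derive t 1 step (dstep t).
have D a c : is_derive t 1 (fun s : R => a * posq (s - c)) (a * dposq (t - c)).
  have Ds : is_derive t 1 (fun s : R => s - c) (1 : R).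
    by have := is_deriveB (is_derive_id t (1 : R)) (is_derive_cst c t (1 : R)); rewrite subr0.
  have := is_deriveZ a (@is_derive1_comp R posq (fun s : R => s - c) t _ _ (is_derive_posq (t - c)) Ds).
  by rewrite /= -![_ *: _]/(_ * _) mulr1.
have := is_deriveD (is_deriveB (D 2 0) (D 4 2^-1)) (D 2 1); rewrite subr0 => H.
by have -> : step = (fun s => 2 * posq (s - 0)) - (fun s => 4 * posq (s - 2^-1)) + (fun s => 2 * posq (s - 1));
  [apply/funext => s; rewrite -[RHS]/(2 * posq (s - 0) - 4 * posq (s - 2^-1) + 2 * posq (s - 1)) subr0|].
Qed.

Lemma continuous_dstep : continuous dstep.
have C a c : continuous (fun t => a * dposq (t - c)).
  move=> t; apply: cvgM; first exact: cvg_cst.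
  apply: (@continuous_comp _ _ _ (fun t : R => t - c) dposq); last exact: continuous_dposq.
  by apply: cvgB; [exact: cvg_id|exact: cvg_cst].
move=> t; apply: cvgD (C 2 1 t); apply: cvgB (C 4 2^-1 t).
by have := C 2 0 t; under eq_fun do rewrite subr0.
Qed.

Lemma step_le0 t : t <= 0 -> step t = 0.
by rewrite /step /posq => t0; do 3 case: ltP => ?; lra. Qed.

Lemma step_ge1 t : 1 <= t -> step t = 1.
by rewrite /step /posq => t0; do 3 case: ltP => ?; nra. Qed.

Lemma step_ge0 t : 0 <= step t.
by rewrite /step /posq; do 3 case: ltP => ?; nra. Qed.

Lemma step_le1 t : step t <= 1.
by rewrite /step /posq; do 3 case: ltP => ?; nra. Qed.

Lemma dstep_ge0 t : 0 <= dstep t.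
by rewrite /dstep /dposq; do 3 case: ltP => ?; lra. Qed.

Lemma dstep_le0 t : t <= 0 -> dstep t = 0.
by rewrite /dstep /dposq => t0; do 3 case: ltP => ?; lra. Qed.

Lemma dstep_ge1 t : 1 <= t -> dstep t = 0.
by rewrite /dstep /dposq => t0; do 3 case: ltP => ?; lra. Qed.

(** A crude bound; the maximum is 2. *)
Lemma dstep_le t : dstep t <= 64.
by rewrite /dstep /dposq; do 3 case: ltP => ?; lra. Qed.

End SmoothStep.

Section Euclidean.
Context {R : realType} (n : nat).
Implicit Types (x y : 'rV[R]_n).

Lemma enorm_ge0 x : 0 <= enorm x. exact: sqrtr_ge0. Qed.

Lemma sqr_sum_ge0 x : 0 <= \sum_i x 0 i ^+ 2.
by apply: sumr_ge0 => i _; exact: sqr_ge0. Qed.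

Lemma enorm_sqr x : enorm x ^+ 2 = \sum_i x 0 i ^+ 2.
by rewrite sqr_sqrtr // sqr_sum_ge0. Qed.

Lemma coord_le_enorm x i : `|x 0 i| <= enorm x.
rewrite -sqrtr_sqr ler_wsqrtr // (bigD1 i) //= lerDl.
by apply: sumr_ge0 => j _; exact: sqr_ge0.
Qed.

Lemma enorm0 : enorm (0 : 'rV[R]_n) = 0.
by rewrite /enorm big1 ?sqrtr0 // => i _; rewrite mxE expr0n. Qed.

Lemma enorm_eq0 x : (enorm x == 0) = (x == 0).
apply/idP/eqP => [/eqP x0|->]; last by rewrite enorm0.
by apply/rowP => i; apply/eqP; rewrite mxE -normr_le0 -x0 coord_le_enorm.
Qed.

Lemma enorm_gt0 x : (0 < enorm x) = (x != 0).
by rewrite lt_neqAle enorm_ge0 andbT eq_sym enorm_eq0. Qed.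

Lemma enormZ c x : enorm (c *: x) = `|c| * enorm x.
rewrite /enorm -sqrtr_sqr -sqrtrM ?sqr_ge0 //; congr Num.sqrt.
by rewrite mulr_sumr; bigr => i _; rewrite mxE exprMn.
Qed.

Lemma continuous_enorm : continuous (@enorm R n).
move=> x; apply: (@cvg_comp _ _ _ (fun x : 'rV[R]_n => \sum_i x 0 i ^+ 2) (@Num.sqrt R) _
  (nbhs (\sum_i x 0 i ^+ 2))); last exact: sqrt_continuous.
apply: (cvg_sumr (nbhs_filter x)) => i; rewrite expr2.
have := @cvgM R 'rV[R]_n (nbhs x) (nbhs_filter x) _ _ _ _ (@rV_coord_continuous R n i x) (@rV_coord_continuous R n i x).
by [].
Qed.

Lemma closed_enorm_le c : closed [set x : 'rV[R]_n | enorm x <= c].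
apply: (@closed_comp _ _ (@enorm R n) [set t | t <= c]) => [x _|]; last exact: closed_le.
exact: continuous_enorm.
Qed.

Lemma closed_enorm_ge c : closed [set x : 'rV[R]_n | c <= enorm x].
apply: (@closed_comp _ _ (@enorm R n) [set t | c <= t]) => [x _|]; last exact: closed_ge.
exact: continuous_enorm.
Qed.

Lemma open_enorm_lt c : open [set x : 'rV[R]_n | enorm x < c].
apply: (@open_comp _ _ (@enorm R n) [set t | t < c]) => [x _|]; last exact: open_lt.
exact: continuous_enorm.
Qed.

Lemma open_enorm_gt c : open [set x : 'rV[R]_n | c < enorm x].
apply: (@open_comp _ _ (@enorm R n) [set t | c < t]) => [x _|]; last exact: open_gt.
exact: continuous_enorm.
Qed.

Lemma enorm_cube x c : enorm x <= c -> cube c x.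
by move=> xc i; exact: le_trans (coord_le_enorm x i) xc. Qed.

Definition punctured : set 'rV[R]_n := [set x | x != 0].

Lemma open_punctured : open punctured.
have -> : punctured = @enorm R n @^-1` [set t | 0 < t].
  by apply/seteqP; split=> x; rewrite /punctured /= enorm_gt0.
by apply: open_comp => [x _|]; [exact: continuous_enorm|exact: open_gt].
Qed.

Lemma CkA_enorm k : CkA k punctured (@enorm R n).
apply: CkA_sqrt => [x x0|]; last first.
  by apply: CkA_sum => i _; apply: CkAM.
by rewrite -enorm_sqr exprn_gt0 // enorm_gt0.
Qed.

End Euclidean.
Arguments punctured {R n}.

Section C1Composition.
Context {R : realType} (n : nat).

Lemma C1_unP (A : set 'rV[R]_n) (P : set R) (f : 'rV[R]_n -> R) (phi dphi : R -> R) :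
  open P -> (forall t : R, P t -> is_derive t 1 phi (dphi t)) ->
  (forall t : R, P t -> {for t, continuous dphi}) -> (forall x, A x -> P (f x)) -> CkA 1 A f ->
  CkA 1 A (fun x => phi (f x)).
move=> oP dp cp fP; apply: (@CkA_un _ _ 1 A P phi f oP fP) => U F oU UP CF i.
have D x : U x -> is_derive x (ev i) (phi \o F) (dphi (F x) * 'D_(ev i) F x).
  move=> Ux; have dFx : is_derive x (ev i) F ('D_(ev i) F x) by apply/derivableP; exact: (CF i).1.
  exact: (chain_scal (dp _ (UP _ Ux)) dFx).
split=> [x /D[] //|].
apply: (@Ck_eq _ _ 0 U (fun x => dphi (F x) * 'D_(ev i) F x)) => //.
  by move=> x /D[].
apply: CkM => //; last exact: (CF i).2.
move=> x Ux; apply: (@continuous_comp _ _ _ F dphi); last exact: cp (UP _ Ux).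
exact: C1_continuous oU CF _ Ux.
Qed.

Lemma C1_un A (f : 'rV[R]_n -> R) (phi dphi : R -> R) :
  (forall t : R, is_derive t 1 phi (dphi t)) -> continuous dphi -> CkA 1 A f ->
  CkA 1 A (fun x => phi (f x)).
move=> dp cp; exact: (C1_unP (@openT R) (fun t _ => dp t) (fun t _ => cp t) (fun _ _ => Logic.I)).
Qed.

End C1Composition.

Section C1Partial.
Context {R : realType} (n : nat).

Lemma pd_unP A (P : set R) (f : 'rV[R]_n.+1 -> R) (phi dphi : R -> R) i x :
  (forall t : R, P t -> is_derive t 1 phi (dphi t)) -> P (f x) -> regular A -> A x -> CkA 1 A f ->
  pd A (fun x => phi (f x)) i x = dphi (f x) * pd A f i x.
move=> dp Px rA Ax Cf; have [U [F [oU Ux CF EF dF]]] := CkA_ext Cf rA Ax.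
have dFx : is_derive x (ev i) F ('D_(ev i) F x) by apply/derivableP; exact: (CF i).1.
have FP : P (F x) by rewrite -EF.
have [D E] := chain_scal (dp _ FP) dFx.
rewrite (pdE rA Ax oU Ux _ D); last by move=> y Ay Uy; rewrite EF.
by rewrite E dF // EF.
Qed.

Lemma pd_un A (f : 'rV[R]_n.+1 -> R) (phi dphi : R -> R) i x :
  (forall t : R, is_derive t 1 phi (dphi t)) -> regular A -> A x -> CkA 1 A f ->
  pd A (fun x => phi (f x)) i x = dphi (f x) * pd A f i x.
by move=> dp; exact: (pd_unP (P := setT) _ (fun t _ => dp t) Logic.I). Qed.

Lemma CkA_derivable A (f : 'rV[R]_n.+1 -> R) i x : open A -> CkA 1 A f -> A x ->
  is_derive x (ev i) f (pd A f i x).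
move=> oA Cf Ax; have rA := open_regular oA.
have [U [F [oU Ux CF EF dF]]] := CkA_ext Cf rA Ax.
rewrite dF //; apply: (@near_eq_is_derive _ _ _ F).
  have : nbhs x (A `&` U) by apply: open_nbhs_nbhs; split; [exact: openI|].
  by apply: filterS => y [Ay Uy]; rewrite EF.
by apply/derivableP; exact: (CF i).1.
Qed.

Lemma pd_enorm i x : x != 0 -> pd punctured (@enorm R n.+1) i x = x 0 i / enorm x.
move=> x0; have rP := open_regular (@open_punctured R n.+1).
have E0 : enorm x != 0 by rewrite enorm_eq0.
have : pd punctured (fun x => enorm x * enorm x) i x = 2 * x 0 i.
  rewrite (@pd_eq _ _ _ _ (fun x : 'rV[R]_n.+1 => \sum_j x 0 j * x 0 j)) //; last first.
    by move=> y _; rewrite -expr2 enorm_sqr.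
  rewrite pd_sum // => [|j _]; last by apply: CkAM.
  rewrite (bigD1 i) //= big1 => [|j ji]; rewrite pdM ?pd_coord //; try exact: CkA_coord.
    by rewrite eqxx mul1r mulr1 addr0; ring.
  by rewrite eq_sym (negbTE ji) mul0r mulr0 addr0.
have Ce := @CkA_enorm R n.+1 1.
rewrite pdM // => E; apply: (mulIf E0); rewrite divfK //; lra.
Qed.

(** O and the complement of K cover A': on the former the extension is f, on the latter it is 0. *)
Lemma CkA_extend0 k (A A' O K : set 'rV[R]_n) (f : 'rV[R]_n -> R) : A = A' `&` O -> open O ->
  closed K -> K `&` A' `<=` O -> (forall x, A x -> ~ K x -> f x = 0) -> CkA k A f -> CkA k A' (f \_ A).
move=> AE oO cK KO f0 Cf x A'x; have [Ox|Ox] := pselect (O x).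
  have Ax : A x by rewrite AE. have [U [F [oU Ux CF EF]]] := Cf x Ax.
  exists (U `&` O), F; split=> //; [exact: openI|by apply: Ck_sub CF => y []|].
  move=> y A'y [Uy Oy]; have Ay : A y by rewrite AE. by rewrite patchE mem_set // EF.
exists (~` K), (fun=> 0); split=> //; [exact: closed_openC|by move=> Kx; apply: Ox; apply: KO|exact: Ck_cst|].
move=> y A'y Ky; rewrite patchE; case: ifPn => // /set_mem Ay; exact: f0.
Qed.

End C1Partial.

(** * Integrals of bounded functions of bounded support *)

Section BoundedIntegrals.
Context {R : realType} (n : nat).
Implicit Types (f g : 'rV[R]_n -> R).
Local Notation II f := (\int[lebn n]_x f x).

Lemma bmsD f g : bms f -> bms g -> bms (fun x => f x + g x).
move=> [mf [a fa] [c c0 fc]] [mg [b gb] [d d0 gd]]; split.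
- exact: measurable_funD.
- by exists (a + b) => x; apply: le_trans (ler_normD _ _) _; exact: lerD.
- exists (Num.max c d) => [|x xcd]; first by rewrite le_max c0.
  rewrite fc ?gd ?addr0 // => H; apply: xcd => i; rewrite le_max; first by rewrite (H i) orbT.
  by rewrite (H i).
Qed.

Lemma bmsZ a f : bms f -> bms (fun x => a * f x).
move=> [mf [b fb] [c c0 fc]]; split.
- by apply: measurable_funM => //; exact: measurable_cst.
- by exists (`|a| * b) => x; rewrite normrM ler_wpM2l.
- by exists c => // x xc; rewrite fc ?mulr0.
Qed.

Lemma bms0 : bms (fun _ : 'rV[R]_n => 0).
by split; [exact: measurable_cst|exists 0 => x; rewrite normr0|exists 0].
Qed.

Lemma bms_sum (I : Type) (r : seq I) (f : I -> 'rV[R]_n -> R) :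
  (forall i, bms (f i)) -> bms (fun x => \sum_(i <- r) f i x).
move=> Hf; elim: r => [|i r IH].
  by under eq_fun do rewrite big_nil; exact: bms0.
by under eq_fun do rewrite big_cons; exact: bmsD.
Qed.

Lemma bms_norm f : bms f -> bms (fun x => `|f x|).
move=> [mf [b fb] [c c0 fc]]; split.
- exact: measurableT_comp.
- by exists b => x; rewrite normr_id.
- by exists c => // x xc; rewrite fc ?normr0.
Qed.

Lemma bms_indic (A : set 'rV[R]_n) f : measurable (A : set (bor 'rV[R]_n)) -> bms f -> bms (f \_ A).
move=> mA [mf [b fb] [c c0 fc]]; split.
- by apply/(measurable_restrictT _ _).1 => //; exact: measurable_funTS.
- exists b => x; rewrite patchE; case: ifP => // _; rewrite normr0.
  exact: le_trans (fb x).
- by exists c => // x xc; rewrite patchE; case: ifP => // _; exact: fc.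
Qed.

Lemma IID f g : bms f -> bms g -> II (fun x => f x + g x) = II f + II g.
by move=> Hf Hg; rewrite RintegralD //; exact: bms_integrable. Qed.

Lemma IIB f g : bms f -> bms g -> II (fun x => f x - g x) = II f - II g.
by move=> Hf Hg; rewrite RintegralB //; exact: bms_integrable. Qed.

Lemma IIZ a f : bms f -> II (fun x => a * f x) = a * II f.
by move=> Hf; rewrite RintegralZl //; exact: bms_integrable. Qed.

Lemma II_sum (I : Type) (r : seq I) (f : I -> 'rV[R]_n -> R) :
  (forall i, bms (f i)) -> II (fun x => \sum_(i <- r) f i x) = \sum_(i <- r) II (f i).
move=> Hf; elim: r => [|i r IH].
  rewrite big_nil (eq_Rintegral _ (g := fun=> 0)) ?Rintegral_cst ?mul0r // => x _. by rewrite big_nil.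
rewrite big_cons -IH -IID //; last exact: bms_sum.
by apply: eq_Rintegral => x _; rewrite big_cons.
Qed.

Lemma II_le f g : bms f -> bms g -> (forall x, f x <= g x) -> II f <= II g.
by move=> Hf Hg fg; apply: le_Rintegral => //; exact: bms_integrable. Qed.

Lemma II_norm f : bms f -> `|II f| <= II (fun x => `|f x|).
by move=> Hf; apply: le_normr_Rintegral => //; exact: bms_integrable. Qed.

Lemma II_eq f g : f =1 g -> II f = II g.
by move=> fg; apply: eq_Rintegral => x _. Qed.

Lemma bms_cube c : 0 <= c -> bms (fun x : 'rV[R]_n => \1_(cube c) x : R).
move=> c0; split.
- by apply: measurable_indic; exact: measurable_cube.
- exists 1 => x; rewrite indicE; case: (_ \in _); by rewrite ?normr1 ?normr0.
- by exists c => // x xc; rewrite indicE memNset.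
Qed.

Lemma II_cube c : 0 <= c -> II (\1_(cube c) : 'rV[R]_n -> R) = (2 * c) ^+ n.
move=> c0; rewrite /Rintegral integral_indic ?setIT //; last exact: measurable_cube.
exact: (congr1 fine (lebn_cube n c0)).
Qed.

Lemma II_bound f K c : bms f -> 0 <= c -> (forall x, `|f x| <= K) ->
  (forall x, ~ cube c x -> f x = 0) -> `|II f| <= K * (2 * c) ^+ n.
move=> Hf c0 fK fc; apply: le_trans (II_norm Hf) _; rewrite -II_cube //.
rewrite -IIZ; last exact: bms_cube.
apply: II_le => [||x]; [exact: bms_norm|by apply: bmsZ; exact: bms_cube|].
have [xc|xc] := pselect (cube c x); first by rewrite indicE mem_set // mulr1.
by rewrite fc // normr0 indicE memNset // mulr0.
Qed.

Lemma cube_bounded c f : CkA 0 setT f -> exists2 K, 0 <= K & forall x, cube c x -> `|f x| <= K.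
move=> Cf; have cf : {within cube c, continuous f}.
  by apply: (@CkA_continuous _ _ 0); apply: CkA_sub Cf.
have [M [Mr HM]] := compact_bounded (continuous_compact cf (@compact_cube R n c)).
exists (Num.max 0 (M + 1)) => [|x xc]; first by rewrite le_max lexx.
by rewrite le_max; apply/orP; right; apply: HM; [rewrite ltrDl|exists x].
Qed.

End BoundedIntegrals.
Notation II f := (\int[lebn _]_x f x).

Section OpenRestriction.
Context {R : realType} (n : nat).

Lemma bms_restrict_open (A : set 'rV[R]_n) c K (f : 'rV[R]_n -> R) : open A -> CkA 0 A f ->
  0 <= c -> (forall x, A x -> `|f x| <= K) -> (forall x, A x -> ~ cube c x -> f x = 0) -> bms (f \_ A).
move=> oA Cf c0 fK f0; split.
- apply/(measurable_restrictT _ _).1; first exact: open_borel.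
  by apply: within_measurable_real; [exact: open_borel|move=> x Ax; exact: CkA_cvg Cf Ax].
- exists (Num.max 0 K) => x; rewrite patchE le_max; case: ifPn => [/set_mem Ax|_].
    by rewrite fK ?orbT.
  by rewrite normr0 lexx.
- by exists c => // x xc; rewrite patchE; case: ifPn => // /set_mem Ax; exact: f0.
Qed.

Lemma C0_un A (f : 'rV[R]_n -> R) (phi : R -> R) : continuous phi -> CkA 0 A f ->
  CkA 0 A (fun x => phi (f x)).
move=> cp; apply: (@CkA_un _ _ 0 A setT phi f (@openT R)) => // U F oU _ CF x Ux.
by apply: (@continuous_comp _ _ _ F phi); [exact: CF|exact: cp].
Qed.

End OpenRestriction.

Section Lipschitz.
Context {R : realType} (n : nat).

Lemma cube_norm c (x : 'rV[R]_n) : 0 <= c -> cube c x <-> `|x| <= c.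
move=> c0; split=> [xc|xc i]; first exact: norm_rV_le.
exact: le_trans (coord_le_norm _ _) xc.
Qed.

Lemma cube_lipschitz c (f : 'rV[R]_n.+1 -> R) : 0 <= c -> CkA 1 setT f ->
  exists2 L, 0 <= L & forall x y : 'rV[R]_n.+1, `|x| <= c -> `|y| <= c -> `|f x - f y| <= L * `|x - y|.
move=> c0 Cf; have rT := @regularT R n.
(* The mean value points lie within |x - y| <= 2 c of y, hence in the cube of size 3 c. *)
have /choice[K HK] : forall i, exists K, 0 <= K /\ forall x, cube (3 * c) x -> `|pd setT f i x| <= K.
  by move=> i; have [K K0 H] := cube_bounded (3 * c) (CkA_pd i rT Cf); exists K.
exists (\sum_i K i) => [|x y xc yc]; first by apply: sumr_ge0 => i _; have [] := HK i.
have [z zx ->] := @mvt_box _ _ f y x (`|x - y| + 1) (fun w _ i => @ex_derive _ _ _ _ _ _ _ (CkA_derivable i openT Cf (Logic.I : setT w)))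
  ltac:(by rewrite ltrDl).
apply: le_trans (ler_norm_sum _ _ _) _; rewrite mulr_suml; apply: ler_sum => i _.
have [_ E] := CkA_derivable i openT Cf (Logic.I : setT (z i)).
rewrite E mulrC normrM; apply: ler_pM => //.
  have [_ HKi] := HK i; apply: HKi => j; apply: le_trans (coord_le_norm _ _) _.
  have := zx i; have := ler_normD (z i - y) y; rewrite subrK; have := ler_normB x y; lra.
by apply: le_trans (coord_le_norm (x - y) i); rewrite !mxE.
Qed.

End Lipschitz.

Section SphereExtension.
Context {R : realType} (m : nat).
Local Notation P := (@punctured R m.+1).

Lemma closed_point0 : closed [set (0 : 'rV[R]_m.+1)].
have -> : [set (0 : 'rV[R]_m.+1)] = cube 0; last exact: closed_cube.
apply/seteqP; split=> [_ -> i|x x0]; first by rewrite mxE normr0.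
by apply/rowP => i; apply/eqP; rewrite mxE -normr_le0.
Qed.

Lemma CkA_ray k (A : set 'rV[R]_m.+1) (f : 'rV[R]_m.+1 -> R) r :
  (forall x, P x -> A ((r / enorm x) *: x)) -> CkA k A f -> CkA k P (fun x => f ((r / enorm x) *: x)).
move=> PA Cf; apply: (@CkA_comp _ _ _ _ _ A f (fun x => (r / enorm x) *: x)) => // j.
apply: (@CkA_eq _ _ _ _ (fun x => r * (enorm x)^-1 * x 0 j)) => [x _|]; first by rewrite mxE.
apply: CkAM; [apply: CkAM; [exact: CkA_cst|]|exact: CkA_coord].
by apply: CkAV; [move=> x x0; rewrite enorm_eq0|exact: CkA_enorm].
Qed.

Lemma enorm_ray r x : 0 < r -> P x -> enorm ((r / enorm x) *: x) = r.
move=> r0 Px; have e0 : 0 < enorm x by rewrite enorm_gt0.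
by rewrite enormZ gtr0_norm ?divr_gt0 // divfK // gt_eqF.
Qed.

(** At the origin r / enorm x is 0 by convention, so the integrand takes there the value f 0. This
    value must be bounded as well, and continuity can be asked only off the origin. *)
Lemma bms_sphere (f : 'rV[R]_m.+1 -> R) r K : 0 < r -> CkA 0 P (fun x => f ((r / enorm x) *: x)) ->
  (forall x, enorm x = r -> `|f x| <= K) -> `|f 0| <= K ->
  bms (fun x => if enorm x <= r then f ((r / enorm x) *: x) else 0).
move=> r0 Cp fK f0K; set h := fun x => _; set p := fun x => _ in Cp.
have mB : measurable ([set x : 'rV[R]_m.+1 | enorm x <= r] : set (bor 'rV[R]_m.+1)).
  by apply: closed_borel; exact: closed_enorm_le.
have m1 : measurable ([set (0 : 'rV[R]_m.+1)] : set (bor 'rV[R]_m.+1)).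
  by apply: closed_borel; exact: closed_point0.
have hE : h = (fun x => ((p \_ P) \_ [set x | enorm x <= r]) x + f 0 * \1_[set (0 : 'rV[R]_m.+1)] x).
  apply/funext => x; rewrite /h !patchE indicE; have [->|x0] := eqVneq x 0.
    rewrite enorm0 (ltW r0) scaler0 (mem_set (A := [set 0])) // mulr1 mem_set; last by rewrite /= enorm0 ltW.
    by rewrite memNset ?add0r // /punctured /= eqxx.
  rewrite (memNset (A := [set 0])) ?mulr0 ?addr0; last exact/eqP.
  case: ifPn => xr; last by rewrite memNset //; exact/negP. by rewrite mem_set // mem_set.
have K0 : 0 <= K by exact: le_trans (normr_ge0 _) f0K.
split.
- rewrite hE; apply: measurable_funD; last first.
    by apply: measurable_funM => //; exact: measurable_indic.
  apply/(measurable_restrictT _ _).1 => //; apply: measurable_funTS.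
  apply/(measurable_restrictT _ _).1; first exact: open_borel (@open_punctured R m.+1).
  apply: within_measurable_real; first exact: open_borel (@open_punctured R m.+1).
  by move=> x Px; exact: CkA_cvg Cp Px.
- exists K => x; rewrite /h; case: ifP => // _; last by rewrite normr0.
  have [->|x0] := eqVneq x 0; first by rewrite scaler0. by apply: fK; exact: enorm_ray.
- exists r; [exact: ltW|move=> x xc]; rewrite /h; case: ifPn => // /enorm_cube.
  by [].
Qed.

End SphereExtension.

(** * The divergence theorem on balls *)

Section BallDivergence.
Context {R : realType} (m : nat).
Hypothesis m0 : (0 < m)%N.
Local Notation P := (@punctured R m.+1).
Implicit Types (x y : 'rV[R]_m.+1).

Let oP : open P := @open_punctured R m.+1.
Let rP : regular P := open_regular oP.
Let rT : regular [set: 'rV[R]_m.+1] := @regularT R m.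

Lemma lebn_point0 : lebn m.+1 [set (0 : 'rV[R]_m.+1)] = 0%E.
apply/eqP; rewrite eq_le measure_ge0 andbT; apply/lee_addgt0Pr => e e0; rewrite add0e.
pose c := Num.min 1 (e / 2) / 2.
have c0 : 0 < c by rewrite divr_gt0 // lt_min ltr01 divr_gt0.
apply: (@le_trans _ _ (lebn m.+1 (cube c))).
  apply: le_measure; rewrite ?inE.
  - by apply: closed_borel; exact: closed_point0.
  - exact: measurable_cube.
  - by move=> _ -> i; rewrite mxE normr0 ltW.
have -> := lebn_cube m.+1 (ltW c0); rewrite lee_fin exprS.
have c1 : 2 * c <= 1 by rewrite /c mulrC divfK // ge_min lexx.
have ce : 2 * c <= e / 2 by rewrite /c mulrC divfK // ge_min lexx orbT.
apply: (@le_trans _ _ (2 * c)); last by lra.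
have c2 : 0 <= 2 * c by rewrite mulr_ge0 // ltW.
by apply: ler_piMr => //; apply: exprn_ile1.
Qed.

Lemma II_punctured (f : 'rV[R]_m.+1 -> R) : bms f -> II (f \_ P) = II f.
move=> Hf; have mP : measurable (P : set (bor 'rV[R]_m.+1)) by exact: open_borel.
have HfP := bms_indic mP Hf.
apply/eqP; rewrite eq_sym -subr_eq0 -IIB //; apply/eqP.
have m1 : measurable ([set (0 : 'rV[R]_m.+1)] : set (bor 'rV[R]_m.+1)).
  by apply: closed_borel; exact: closed_point0.
transitivity (\int[lebn m.+1]_(x in [set (0 : 'rV[R]_m.+1)]) f x); last first.
  rewrite /Rintegral (@null_set_integral _ _ _ (lebn m.+1)) //.
  - by apply/measurable_EFinP; apply: measurable_funTS; case: Hf.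
  - exact: lebn_point0.
rewrite [RHS]Rintegral_mkcond; apply: eq_Rintegral => x _; rewrite !patchE.
have [->|x0] := eqVneq x 0.
  by rewrite (memNset (A := P)) ?subr0 ?mem_set // /punctured /= eqxx.
by rewrite (mem_set (A := P)) // memNset ?subrr //; exact/eqP.
Qed.

Variables (Y : 'I_m.+1 -> 'rV[R]_m.+1 -> R) (r : R).
Hypotheses (CY : forall i, CkA 1 setT (Y i)) (r0 : 0 < r).

Let f x := \sum_i Y i x * (x 0 i / r).
Let p x := f ((r / enorm x) *: x).
Let W i x := Y i x - p x * (x 0 i / r).
(** The divergence of W off the origin: p is homogeneous of degree 0, so Euler's relation leaves (m
    + 1) p as the divergence of p x. *)
Let g x := \sum_i pd setT (Y i) i x - m.+1%:R / r * p x.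

Let CYP i : CkA 1 P (Y i). exact: CkA_sub (CY i). Qed.

Let Cf : CkA 1 setT f.
apply: CkA_sum => i _; apply: CkAM => //; apply: CkAM => //.
Qed.

Let Cinv : CkA 1 P (fun x => (enorm x)^-1).
by apply: CkAV; [move=> x x0; rewrite enorm_eq0|exact: CkA_enorm]. Qed.

Let Cray j : CkA 1 P (fun x => ((r / enorm x) *: x) 0 j).
apply: (@CkA_eq _ _ _ _ (fun x => r * (enorm x)^-1 * x 0 j)) => [x _|]; first by rewrite mxE.
by apply: CkAM; [apply: CkAM; [exact: CkA_cst|]|exact: CkA_coord].
Qed.

Let Cp : CkA 1 P p.
exact: (@CkA_comp _ _ _ _ _ setT f (fun x => (r / enorm x) *: x)). Qed.

Let euler x : P x -> \sum_i x 0 i * pd P p i x = 0.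
move=> x0; have e0 : enorm x != 0 by rewrite enorm_eq0.
have Ce := @CkA_enorm R m.+1 1.
have dr i j : pd P (fun x => ((r / enorm x) *: x) 0 j) i x =
    r * ((i == j)%:R / enorm x - x 0 j * x 0 i / enorm x ^+ 3).
  have dI : pd P (fun x => (enorm x)^-1) i x = - x 0 i / enorm x ^+ 3.
    have : pd P (fun x => (enorm x)^-1 * enorm x) i x = 0.
      rewrite (@pd_eq _ _ P _ (fun=> 1)) ?pd_cst // => y y0; rewrite mulVf // enorm_eq0 //.
    rewrite pdM // pd_enorm // => E; apply: (mulIf e0); rewrite (_ : _ * _ = - ((enorm x)^-1 * (x 0 i / enorm x))); last by lra.
    by move: (enorm x) e0 => e e0; field.
  rewrite (@pd_eq _ _ P _ (fun x => r * ((enorm x)^-1 * x 0 j))) //; last by move=> y _; rewrite mxE mulrA.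
  have Cj := @CkA_coord R m.+1 1 P j. rewrite pdZ //; last exact: CkAM.
  by rewrite pdM // dI pd_coord //; field.
have rr j : \sum_i x 0 i * pd P (fun x => ((r / enorm x) *: x) 0 j) i x = 0.
  transitivity (r * (x 0 j / enorm x - x 0 j * (\sum_i x 0 i ^+ 2) / enorm x ^+ 3)); last first.
    by rewrite -enorm_sqr; field.
  rewrite mulr_sumr mulr_suml. have -> : x 0 j / enorm x = \sum_i x 0 i * ((i == j)%:R / enorm x).
    rewrite (bigD1 j) //= eqxx big1 ?addr0 ?mul1r // => i /negbTE ->. by rewrite mul0r mulr0.
  rewrite -sumrB mulr_sumr; bigr => i _; rewrite dr; ring.
have dp i : pd P p i x = \sum_j pd setT f j ((r / enorm x) *: x) *
    pd P (fun x => ((r / enorm x) *: x) 0 j) i x.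
  exact: (@pd_comp _ _ _ P setT f (fun x => (r / enorm x) *: x)).
under eq_bigr do rewrite dp mulr_sumr.
rewrite exchange_big big1 //= => j _.
transitivity (pd setT f j ((r / enorm x) *: x) *
   \sum_i x 0 i * pd P (fun x => ((r / enorm x) *: x) 0 j) i x).
  by rewrite mulr_sumr; bigr => i _; ring.
by rewrite rr mulr0.
Qed.

Let CxR i : CkA 1 P (fun x => x 0 i / r).
by apply: CkAM => //. Qed.

Let CW i : CkA 1 P (W i).
by apply: CkAB => //; exact: CkAM. Qed.

Let pdT i x : P x -> pd P (Y i) i x = pd setT (Y i) i x.
by move=> Px; apply: (@pd_local _ _ P setT P). Qed.

Let divW x : P x -> \sum_i pd P (W i) i x = g x.
move=> Px; rewrite /W /g.
transitivity (\sum_i (pd setT (Y i) i x - (r^-1 * (x 0 i * pd P p i x) + r^-1 * p x))).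
  bigr => i _; have Cpx : CkA 1 P (fun x => p x * (x 0 i / r)) by exact: CkAM.
  rewrite pdB // pdT // pdM // (@pd_eq _ _ P (fun y => y 0 i / r) (fun y => r^-1 * y 0 i)) //; last by move=> y _; rewrite mulrC.
  have Cc := @CkA_coord R m.+1 1 P i. by rewrite pdZ // pd_coord // eqxx mulr1; ring.
rewrite sumrB big_split -mulr_sumr euler //= mulr0 add0r sumr_const card_ord -mulr_natl.
by rewrite -mulr_natl; congr (_ - _); ring.
Qed.

(** The integral of div (chi W). The support of chi lies in a closed set that avoids the origin,
    where W is singular, so the field extends by 0 to R^n. *)
Let cutoff_identity (chi : 'rV[R]_m.+1 -> R) (K : set 'rV[R]_m.+1) c : CkA 1 P chi -> closed K ->
  K `<=` P -> K `<=` cube c -> 0 <= c -> (forall x, P x -> ~ K x -> chi x = 0) ->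
  II ((fun x => chi x * g x + \sum_i pd P chi i x * W i x) \_ P) = 0.
move=> Cc cK KP Kc c0 chi0.
have CF i : CkA 1 setT ((fun x => chi x * W i x) \_ P).
  apply: (@CkA_extend0 _ _ _ P setT P K) => //; [by rewrite setTI|by move=> x [/KP]| |exact: CkAM].
  by move=> x Px Kx; rewrite chi0 // mul0r.
have F0 i x : ~ cube c x -> ((fun x => chi x * W i x) \_ P) x = 0.
  move=> xc; rewrite patchE; case: ifPn => // /set_mem Px; rewrite chi0 ?mul0r //. by move=> /Kc.
have Z i : II (fun x => pd setT ((fun x => chi x * W i x) \_ P) i x) = 0.
  by rewrite /Rintegral (integral_pdT i c0 (CF i) (F0 i)).
transitivity (\sum_i II (fun x => pd setT ((fun x => chi x * W i x) \_ P) i x)); last by rewrite big1.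
rewrite -II_sum; last first.
  move=> i; have := @bms_restrict R _ setT c _ closedT (CkA_pd i rT (CF i)) c0.
  rewrite patch_setT; apply => x _ xc; apply: (@pd_out_cube _ _ setT c) => // y _; exact: F0.
apply: II_eq => x; rewrite patchE; case: ifPn => [/set_mem Px|/negP Px].
  rewrite -divW // mulr_sumr -big_split; bigr => i _ /=.
  rewrite [RHS](@pd_local _ _ setT P P _ (fun x => chi x * W i x)) //; last first.
    by move=> y Py _; rewrite patchE mem_set.
  by rewrite pdM //; ring.
rewrite big1 // => i _; have x0 : ~ K x by move=> /KP Px'; apply: Px; exact: mem_set.
rewrite (@pd_local _ _ setT setT (~` K) _ (fun=> 0)) ?pd_cst //; first exact: closed_openC.
by move=> y Ky _; rewrite patchE; case: ifPn => // /set_mem Py; rewrite chi0 // mul0r.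
Qed.

Let omega x := \sum_i W i x * (x 0 i / enorm x).

Let nx1 x i : P x -> `|x 0 i / enorm x| <= 1.
move=> Px; have e0 : 0 < enorm x by rewrite enorm_gt0.
by rewrite normrM normfV (gtr0_norm e0) ler_pdivrMr // mul1r coord_le_enorm.
Qed.

Let ray_cube x : P x -> cube r ((r / enorm x) *: x).
move=> Px; have e0 : 0 < enorm x by rewrite enorm_gt0.
apply: enorm_cube; rewrite enormZ gtr0_norm ?divr_gt0 // divfK // gt_eqF //.
Qed.

Let bounds : exists2 B, 0 <= B & forall x, P x -> enorm x <= r + 1 -> `|g x| <= B /\ `|omega x| <= B.
have [Bf Bf0 HBf] := cube_bounded r (CkAW Cf).
have /choice[BY HBY] : forall i, exists K, 0 <= K /\ forall x, cube (r + 1) x ->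
    `|Y i x| <= K /\ `|pd setT (Y i) i x| <= K.
  move=> i; have [K1 K10 H1] := cube_bounded (r + 1) (CkAW (CY i)).
  have [K2 K20 H2] := cube_bounded (r + 1) (CkA_pd i rT (CY i)).
  exists (K1 + K2); split=> [|x xc]; first exact: addr_ge0.
  split; [apply: le_trans (H1 _ xc) _|apply: le_trans (H2 _ xc) _]; lra.
have SB : 0 <= \sum_i BY i by apply: sumr_ge0 => i _; have [] := HBY i.
have c0 : 0 <= m.+1%:R * Bf * ((r + 1) / r).
  have c2 : 0 <= (r + 1) / r by rewrite divr_ge0 ?addr_ge0 // ltW.
  by rewrite mulr_ge0 // mulr_ge0 // ler0n.
have c1 : 0 <= m.+1%:R / r * Bf by rewrite !mulr_ge0 // invr_ge0 ltW.
exists (\sum_i BY i + m.+1%:R / r * Bf + m.+1%:R * Bf * ((r + 1) / r)) => [|x Px xr].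
  by rewrite !addr_ge0.
have xc := enorm_cube xr; have pB : `|p x| <= Bf by apply: HBf; exact: ray_cube.
split.
  apply: le_trans (ler_normB _ _) _; rewrite -[leLHS]addr0; apply: lerD => //; apply: lerD.
    apply: le_trans (ler_norm_sum _ _ _) _; apply: ler_sum => i _. by have [_ /(_ _ xc)[]] := HBY i.
  have c3 : 0 <= m.+1%:R / r by rewrite divr_ge0 // ltW.
  by rewrite normrM (ger0_norm c3); apply: ler_wpM2l.
apply: (@le_trans _ _ (\sum_i (BY i + Bf * ((r + 1) / r)))); last first.
  by rewrite big_split /= sumr_const card_ord -[_ *+ _]mulr_natl mulrA; lra.
apply: le_trans (ler_norm_sum _ _ _) _; apply: ler_sum => i _.
rewrite normrM; apply: (@le_trans _ _ `|W i x|).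
  by rewrite ler_piMr // nx1.
apply: le_trans (ler_normB _ _) _; apply: lerD; first by have [_ /(_ _ xc)[]] := HBY i.
rewrite normrM; apply: ler_pM => //; rewrite normrM normfV (gtr0_norm r0).
by rewrite ler_wpM2r ?invr_ge0 ?(ltW r0) //; exact: le_trans (xc i).
Qed.

(** On |x| = r the function p is the radial component of Y, so omega, the radial component of W,
    vanishes there; Y being Lipschitz on cubes, omega is of the order of the distance to the
    sphere. *)
Let near_sphere : exists2 L, 0 <= L & forall x, P x -> r <= enorm x -> enorm x <= r + 1 ->
  `|omega x| <= L * (enorm x - r).
have c0 : 0 <= r + 1 by rewrite addr_ge0 // ltW.
have /choice[K HK] : forall i, exists K, [/\ 0 <= K, forall x y : 'rV[R]_m.+1,
    `|x| <= r + 1 -> `|y| <= r + 1 -> `|Y i x - Y i y| <= K * `|x - y| &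
    forall x, cube (r + 1) x -> `|Y i x| <= K * r].
  move=> i; have [K1 K10 H1] := cube_lipschitz c0 (CY i).
  have [K2 K20 H2] := cube_bounded (r + 1) (CkAW (CY i)).
  exists (K1 + K2 / r); split=> [|x y xc yc|x xc].
  - by rewrite addr_ge0 // divr_ge0 // ltW.
  - apply: le_trans (H1 _ _ xc yc) _; apply: ler_wpM2r => //.
    by rewrite lerDl divr_ge0 // ltW.
  - apply: le_trans (H2 _ xc) _; rewrite mulrDl divfK ?gt_eqF // lerDr mulr_ge0 //; exact: ltW.
exists (\sum_i 2 * K i) => [|x Px rx xr].
  by apply: sumr_ge0 => i _; have [] := HK i => ? _ _; rewrite mulr_ge0.
have e0 : 0 < enorm x by rewrite enorm_gt0.
have -> : omega x = \sum_i (Y i x - enorm x / r * Y i ((r / enorm x) *: x)) * (x 0 i / enorm x).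
  have pE : p x = \sum_i Y i ((r / enorm x) *: x) * (x 0 i / enorm x).
    bigr => i _; rewrite mxE; congr (_ * _). by move: (enorm x) e0 => e e0; field; rewrite !gt_eqF.
  rewrite /omega; transitivity (\sum_i Y i x * (x 0 i / enorm x) - enorm x / r * p x).
    have -> : enorm x / r * p x = \sum_i p x * (x 0 i / r) * (x 0 i / enorm x).
      transitivity (p x / r / enorm x * enorm x ^+ 2); first by field; rewrite !gt_eqF.
      by rewrite enorm_sqr mulr_sumr; bigr => i _; field; rewrite !gt_eqF.
    by rewrite -sumrB; bigr => i _; rewrite /W mulrBl.
  by rewrite pE mulr_sumr -sumrB; bigr => i _; ring.
rewrite mulr_suml; apply: le_trans (ler_norm_sum _ _ _) _; apply: ler_sum => i _.
have [K0 H1 H2] := HK i.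
rewrite normrM; apply: le_trans (ler_piMr _ (nx1 i Px)) _ => //.
have yc : cube (r + 1) ((r / enorm x) *: x).
  by move=> j; apply: le_trans (ray_cube Px j) _; rewrite lerDl.
have xc := enorm_cube xr.
have xn : `|x| <= r + 1 by apply: norm_rV_le.
have yn : `|(r / enorm x) *: x| <= r + 1 by apply: norm_rV_le.
have -> : Y i x - enorm x / r * Y i ((r / enorm x) *: x) =
  (Y i x - Y i ((r / enorm x) *: x)) - ((enorm x - r) / r) * Y i ((r / enorm x) *: x).
  by field; rewrite gt_eqF.
apply: le_trans (ler_normB _ _) _; rewrite (_ : 2 * K i * (enorm x - r) = K i * (enorm x - r) + K i * (enorm x - r)); last by ring.
apply: lerD.
  apply: le_trans (H1 _ _ xn yn) _; apply: ler_wpM2l => //.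
  apply: norm_rV_le => [|j]; first by rewrite subr_ge0.
  have -> : (x - (r / enorm x) *: x) 0 j = (enorm x - r) * (x 0 j / enorm x).
    by rewrite !mxE; field; rewrite gt_eqF.
  by rewrite normrM ger0_norm ?subr_ge0 // ler_piMr ?subr_ge0 // nx1.
have c3 : 0 <= (enorm x - r) / r by rewrite divr_ge0 ?subr_ge0 // ltW.
rewrite normrM (ger0_norm c3); apply: le_trans (ler_wpM2l c3 (H2 _ yc)) _.
by rewrite (_ : _ / r * (K i * r) = K i * (enorm x - r)) //; field; rewrite gt_eqF.
Qed.

Let inn e x := step (2 * enorm x / e - 1).
Let out e x := step ((enorm x - r) / e).
(** 0 for |x| <= e / 2, 1 between e and r, 0 again beyond r + e. [H1] collects the bulk term and the
    derivative of the outer cutoff, [H2] the derivative of the inner one. *)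
Let chi e x := inn e x * (1 - out e x).
Let H1 e x := chi e x * g x - inn e x * (dstep ((enorm x - r) / e) / e) * omega x.
Let H2 e x := dstep (2 * enorm x / e - 1) * (2 / e) * (1 - out e x) * omega x.

Let Cen : CkA 1 P (@enorm R m.+1). exact: CkA_enorm. Qed.
Let Carg1 e : CkA 1 P (fun x => 2 * enorm x / e - 1).
apply: CkAB => //.
by apply: CkAM; [apply: CkAM => //; exact: CkA_cst|exact: CkA_cst].
Qed.
Let Carg2 e : CkA 1 P (fun x => (enorm x - r) / e).
by apply: CkAM; [apply: CkAB => //; exact: CkA_cst|exact: CkA_cst]. Qed.
Let Cinn e : CkA 1 P (inn e).
exact: (C1_un is_derive_step (@continuous_dstep R) (Carg1 e)). Qed.
Let Cout e : CkA 1 P (out e).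
exact: (C1_un is_derive_step (@continuous_dstep R) (Carg2 e)). Qed.
Let C1out e : CkA 1 P (fun x => 1 - out e x).
by apply: CkAB => //. Qed.
Let Cchi e : CkA 1 P (chi e).
by apply: CkAM. Qed.
Let Comega : CkA 0 P omega.
apply: CkA_sum => i _; apply: CkAM; first exact: CkAW (CW i).
by apply: CkAM; [exact: CkA_coord|exact: CkAW Cinv].
Qed.
Let Cg : CkA 0 P g.
apply: CkAB; last by apply: CkAM; [exact: CkA_cst|exact: CkAW Cp].
by apply: CkA_sum => i _; apply: CkA_sub (CkA_pd i rT (CY i)).
Qed.
Let CH1 e : CkA 0 P (H1 e).
apply: CkAB; apply: CkAM => //; first exact: CkAW (Cchi e).
apply: CkAM; first exact: CkAW (Cinn e).
apply: CkAM => //.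
exact: (C0_un (@continuous_dstep R) (CkAW (Carg2 e))).
Qed.
Let CH2 e : CkA 0 P (H2 e).
apply: CkAM => //; apply: CkAM; last exact: CkAW (C1out e).
by apply: CkAM; [exact: (C0_un (@continuous_dstep R) (CkAW (Carg1 e)))|exact: CkA_cst].
Qed.

Let inn0 e x : 0 < e -> enorm x <= e / 2 -> inn e x = 0.
by move=> e0 xe; apply: step_le0; rewrite subr_le0 ler_pdivrMr // mul1r; lra. Qed.
Let out1 e x : 0 < e -> r + e <= enorm x -> out e x = 1.
by move=> e0 xe; apply: step_ge1; rewrite ler_pdivlMr // mul1r; lra. Qed.

Let pd_chi e i x : P x -> 0 < e -> pd P (chi e) i x =
  (dstep (2 * enorm x / e - 1) * (2 / e) * (1 - out e x)
   - inn e x * (dstep ((enorm x - r) / e) / e)) * (x 0 i / enorm x).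
move=> Px e0; have d1 : pd P (fun x => 2 * enorm x / e - 1) i x = 2 / e * (x 0 i / enorm x).
  rewrite (@pd_eq _ _ P _ (fun x => 2 / e * enorm x + (- 1))) //; last by move=> y _; ring.
  have Ca : CkA 1 P (fun x => 2 / e * enorm x) by apply: CkAM => //.
  have Cb := @CkA_cst R m.+1 1 P (- 1). by rewrite pdD // pd_cst // addr0 pdZ // pd_enorm.
have d2 : pd P (fun x => (enorm x - r) / e) i x = e^-1 * (x 0 i / enorm x).
  rewrite (@pd_eq _ _ P _ (fun x => e^-1 * enorm x + (- r / e))) //; last by move=> y _; ring.
  have Ca : CkA 1 P (fun x => e^-1 * enorm x) by apply: CkAM => //.
  have Cb := @CkA_cst R m.+1 1 P (- r / e). by rewrite pdD // pd_cst // addr0 pdZ // pd_enorm.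
have Cc := @CkA_cst R m.+1 1 P 1.
rewrite /chi pdM // pdB // pd_cst // (pd_un i is_derive_step rP Px (Carg1 e)).
by rewrite (pd_un i is_derive_step rP Px (Carg2 e)) d1 d2 /inn; ring.
Qed.

Let identity e : 0 < e -> e <= r -> II ((fun x => H1 e x + H2 e x) \_ P) = 0.
move=> e0 er; pose K := [set x : 'rV[R]_m.+1 | e / 2 <= enorm x] `&` [set x | enorm x <= r + e].
rewrite -(@cutoff_identity (chi e) K (r + e)) //.
- apply: II_eq => x; rewrite !patchE; case: ifPn => // /set_mem Px.
  rewrite /H1 /H2 -addrA; congr (_ + _); rewrite /omega !mulr_sumr -sumrN -big_split.
  by bigr => i _ /=; rewrite pd_chi //; ring.
- by apply: closedI; [exact: closed_enorm_ge|exact: closed_enorm_le].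
- by move=> x [/= ex _]; rewrite /punctured /= -enorm_gt0; apply: lt_le_trans ex; rewrite divr_gt0.
- by move=> x [_ /enorm_cube].
- by lra.
- move=> x Px Kx; rewrite /chi; have [xe|xe] := leP (enorm x) (e / 2).
    by rewrite inn0 // mul0r.
  have [xr|xr] := leP (enorm x) (r + e); last by rewrite out1 ?subrr ?mulr0 // ltW.
  by exfalso; apply: Kx; split=> //=; exact: ltW.
Qed.

(** [H1] is bounded uniformly in e, because the slope of order 1 / e of the outer cutoff meets omega
    = O(|x| - r) on a shell of width e. [H2] is O(1 / e) on a cube of size e, so its integral is
    O(e). Dominated convergence as e tends to 0 leaves the integral of g over the ball. *)
Let zero_flux : II (g \_ (P `&` [set x | enorm x <= r])) = 0.
have [B B0 HB] := bounds; have [L L0 HL] := near_sphere.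
(* 128 B is the bound 64 on [dstep], times the 2 of the inner slope 2 / e, times the bound B on
   omega. *)
have [T T0 TE] : exists2 T : R, 0 <= T & T = 128 * B by exists (128 * B) => //; exact: mulr_ge0 (ler0n R 128) B0.
have [D D0 DE] : exists2 D : R, 0 <= D & D = 4 * T by exists (4 * T) => //; exact: mulr_ge0 (ler0n R 4) T0.
(* For e <= d the identity applies (e <= r), the bounds on |x| <= r + 1 cover the supports, and (2
   e)^k <= 1. *)
pose d := Num.min r 1 / 2.
have [d0 dr d1] : [/\ 0 < d, d <= r & d <= 2^-1].
  have m1 : 0 < Num.min r 1 by rewrite lt_min r0 ltr01.
  have q1 : Num.min r 1 <= r by rewrite ge_min lexx.
  have q2 : Num.min r 1 <= 1 by rewrite ge_min lexx orbT.
  by rewrite /d; move: (Num.min r 1) m1 q1 q2 => q *; split; lra.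
have step01 t : `|step t : R| <= 1 by rewrite ger0_norm ?step_ge0 ?step_le1.
have step02 t : `|1 - step t : R| <= 1.
  by rewrite ger0_norm ?subr_ge0 ?step_le1 // lerBlDr lerDl step_ge0.
have suppH1 e x : 0 < e -> e <= d -> r + e < enorm x -> H1 e x = 0.
  move=> e0 ed xr; rewrite /H1 /chi out1 ?(ltW xr) // subrr mulr0 mul0r.
  rewrite dstep_ge1 ?mul0r ?mulr0 ?mul0r ?subrr // ler_pdivlMr // mul1r; lra.
have bndH1 e x : 0 < e -> e <= d -> P x -> `|H1 e x| <= B + 64 * L.
  move=> e0 ed Px; have [xr|xr] := leP (enorm x) (r + e); last first.
    by rewrite suppH1 // normr0 addr_ge0 // mulr_ge0.
  have xr1 : enorm x <= r + 1 by lra. have [gB _] := HB x Px xr1.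
  apply: le_trans (ler_normB _ _) _; apply: lerD.
    rewrite normrM; apply: le_trans (ler_piMl _ _) gB => //.
    by rewrite normrM; apply: mulr_ile1 => //; [exact: step01|exact: step02].
  have [xr'|xr'] := leP (enorm x) r.
    rewrite dstep_le0 ?mul0r ?mulr0 ?mul0r ?normr0 ?mulr_ge0 //.
    by rewrite mulr_le0_ge0 ?invr_ge0 ?subr_le0 // ltW.
  have oL := HL x Px (ltW xr') xr1.
  rewrite normrM normrM; apply: (@le_trans _ _ (1 * (64 / e) * (L * (enorm x - r)))).
    apply: ler_pM => //. apply: ler_pM => //; first exact: step01.
    rewrite ger0_norm; last by rewrite divr_ge0 ?dstep_ge0 ?ltW.
    by rewrite ler_wpM2r ?dstep_le // invr_ge0 ltW.
  have -> : 1 * (64 / e) * (L * (enorm x - r)) = 64 * L * ((enorm x - r) / e) by ring.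
  by rewrite ler_piMr ?mulr_ge0 // ler_pdivrMr // mul1r; lra.
have suppH2 e x : 0 < e -> ~ cube e x -> H2 e x = 0.
  move=> e0 xe; rewrite /H2; have [xe'|xe'] := leP (enorm x) e.
    by exfalso; exact: xe (enorm_cube xe').
  rewrite dstep_ge1 ?mul0r // lerBrDr ler_pdivlMr //; lra.
have bndH2 e x : 0 < e -> e <= d -> P x -> `|H2 e x| <= T / e.
  move=> e0 ed Px; have [xe|xe] := leP (enorm x) e; last first.
    rewrite /H2 dstep_ge1 ?mul0r ?normr0; first by rewrite divr_ge0 // ltW.
    by rewrite lerBrDr ler_pdivlMr //; lra.
  have xr1 : enorm x <= r + 1 by lra. have [_ oB] := HB x Px xr1.
  rewrite normrM; apply: (@le_trans _ _ (64 * (2 / e) * 1 * B)); last first.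
    by rewrite TE le_eqVlt; apply/orP; left; apply/eqP; ring.
  apply: ler_pM => //; rewrite normrM; apply: ler_pM => //; last exact: step02.
  rewrite ger0_norm; last by rewrite mulr_ge0 ?dstep_ge0 // divr_ge0 // ltW.
  by rewrite ler_wpM2r ?dstep_le // divr_ge0 // ltW.
have bH1 e : 0 < e -> e <= d -> bms (H1 e \_ P).
  move=> e0 ed; apply: (@bms_restrict_open _ _ _ (r + e) (B + 64 * L)) => //; first by lra.
    by move=> x Px; exact: bndH1.
  move=> x Px xc; apply: suppH1 => //; rewrite ltNge; apply/negP => /enorm_cube; exact: xc.
have bH2 e : 0 < e -> e <= d -> bms (H2 e \_ P).
  move=> e0 ed; apply: (@bms_restrict_open _ _ _ e (T / e)) => //; first exact: ltW.
    by move=> x Px; exact: bndH2.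
  by move=> x Px; exact: suppH2.
have smallH1 e : 0 < e -> e <= d -> `|II (H1 e \_ P)| <= D * e.
  move=> e0 ed; have I0 := identity e0 (le_trans ed dr).
  have {I0} I0 : II (H1 e \_ P) + II (H2 e \_ P) = 0.
    rewrite -I0 -IID //; [|exact: bH1|exact: bH2]; apply: II_eq => x; rewrite !patchE.
    by case: ifP => // _; rewrite addr0.
  have -> : II (H1 e \_ P) = - II (H2 e \_ P) by lra.
  rewrite normrN; apply: le_trans (@II_bound _ _ _ (T / e) e (bH2 e e0 ed) (ltW e0) _ _) _.
  - move=> x; rewrite patchE; case: ifPn => [/set_mem Px|_]; first exact: bndH2.
    by rewrite normr0 divr_ge0 // ltW.
  - by move=> x xe; rewrite patchE; case: ifP => // _; exact: suppH2.
  (* The dimension is at least 2: the volume (2 e)^(m+1) of the cube absorbs the factor 1 / e and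
     still leaves a factor e. *)
  - case: m m0 => // k _; rewrite exprS exprS.
    have e2 : 0 <= 2 * e by rewrite mulr_ge0 // ltW.
    have ee : (2 * e) ^+ k <= 1 by apply: exprn_ile1 => //; lra.
    have -> : T / e * (2 * e * (2 * e * (2 * e) ^+ k)) = D * e * (2 * e) ^+ k.
      by rewrite DE; move: ((2 * e) ^+ k) => q; field; rewrite gt_eqF.
    by apply: ler_piMr => //; apply: mulr_ge0 => //; exact: ltW.
pose e_ k : R := d * harmonic k.
have h01 k : 0 < (harmonic k : R) <= 1.
  by rewrite /harmonic /= invr_gt0 ltr0n /= invf_le1 ?ltr0n // ler1n.
have e0 k : 0 < e_ k by rewrite mulr_gt0 //; case/andP: (h01 k).
have ed k : e_ k <= d by rewrite ler_piMr ?(ltW d0) //; case/andP: (h01 k).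
have ce : e_ @ \oo --> (0 : R).
  by rewrite -[0](mulr0 d); apply: cvgMl_tmp; exact: cvg_harmonic.
have esmall (a : R) : 0 < a -> \forall k \near \oo, e_ k < a.
  move=> a0; have /cvgrPdist_lt/(_ a a0) := ce. by apply: filterS => k; rewrite sub0r normrN gtr0_norm.
set G := g \_ _.
have bG : bms G.
  have mB : measurable ([set x : 'rV[R]_m.+1 | enorm x <= r] : set (bor 'rV[R]_m.+1)).
    by apply: closed_borel; exact: closed_enorm_le.
  have mPB : measurable (P `&` [set x : 'rV[R]_m.+1 | enorm x <= r] : set (bor 'rV[R]_m.+1)).
    by apply: measurableI => //; exact: open_borel.
  split.
  - apply/(measurable_restrictT _ _).1 => //; apply: within_measurable_real => // x Px.
    exact: (CkA_cvg (CkA_sub (@subIsetl _ P _) Cg) Px).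
  - exists B => x; rewrite /G patchE; case: ifPn => [/set_mem[Px xr]|_]; last by rewrite normr0.
    have xr1 : enorm x <= r + 1 by apply: le_trans xr _; rewrite lerDl. by have [] := HB x Px xr1.
  - exists r; [exact: ltW|move=> x xc]; rewrite /G patchE; case: ifPn => // /set_mem[_ /enorm_cube].
    by [].
have cvgI : II (H1 (e_ k) \_ P) @[k --> \oo] --> II G.
  have fin k : (\int[lebn m.+1]_x ((H1 (e_ k) \_ P) x)%:E)%E = (II (H1 (e_ k) \_ P))%:E.
    by rewrite fineK //; apply: integrable_fin_num => //; exact: bms_integrable (bH1 _ (e0 k) (ed k)).
  have finG : (\int[lebn m.+1]_x (G x)%:E)%E = (II G)%:E.
    by rewrite fineK //; apply: integrable_fin_num => //; exact: bms_integrable bG.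
  have c0 : 0 <= r + 1 by rewrite addr_ge0 // ltW.
  have [M M0 ME] : exists2 M : R, 0 <= M & M = B + 64 * L.
    by exists (B + 64 * L) => //; exact: addr_ge0 B0 (mulr_ge0 (ler0n R 64) L0).
  have [| | | | |_ _] := @dominated_convergence _ _ R (lebn m.+1) setT measurableT
    (fun k x => ((H1 (e_ k) \_ P) x)%:E) (fun x => (G x)%:E) (fun x => (M * \1_(cube (r + 1)) x)%:E).
  - by move=> k; apply/measurable_EFinP; case: (bH1 _ (e0 k) (ed k)).
  - by apply/measurable_EFinP; case: bG.
  - apply/aeW => x _; apply: cvg_near_cst.
    have [Px|Px] := pselect (P x); last first.
      by apply: nearW => k; rewrite /G !patchE !memNset // => -[].
    have ex : 0 < enorm x by rewrite enorm_gt0. have [xr|xr] := leP (enorm x) r.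
      have := esmall _ ex; apply: filterS => k ek.
      rewrite /G !patchE !mem_set //; congr (_%:E); rewrite /H1 /chi /inn /out.
      rewrite step_ge1; last by rewrite lerBrDr ler_pdivlMr ?e0 //; lra.
      have a0 : (enorm x - r) / e_ k <= 0 by rewrite mulr_le0_ge0 ?invr_ge0 ?subr_le0 // ltW ?e0.
      by rewrite step_le0 // dstep_le0 // subr0 !mul1r mul0r mul0r subr0.
    have xr0 : 0 < enorm x - r by rewrite subr_gt0. have := esmall _ xr0; apply: filterS => k ek.
    rewrite /G !patchE mem_set // memNset => [|[_ /=]]; last by rewrite leNgt xr.
    by rewrite suppH1 ?e0 ?ed //; lra.
  - have Hb : bms (fun x : 'rV[R]_m.+1 => M * \1_(cube (r + 1)) x) by apply: bmsZ; exact: bms_cube.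
    exact: (bms_integrable Hb).
  - apply/aeW => x k _; rewrite lee_fin patchE; case: ifPn => [/set_mem Px|_]; last first.
      by rewrite normr0 mulr_ge0.
    have [xc|xc] := pselect (cube (r + 1) x).
      by rewrite indicE mem_set // mulr1 ME; exact: bndH1.
    rewrite suppH1 ?normr0 ?mulr_ge0 ?e0 ?ed // ltNge; apply/negP => /enorm_cube xc'; apply: xc => i.
    apply: le_trans (xc' i) _; have := ed k; have := d1; lra.
  rewrite finG => /fine_cvgP[_]; apply: cvg_trans; apply: near_eq_cvg.
  by apply: nearW => k /=; rewrite fin.
apply/eqP; rewrite -normr_le0; apply/ler_addgt0Pr => a a0; rewrite add0r.
have a1 : 0 < a / (D + 1) by rewrite divr_gt0 // ltr_wpDl.
have : II (H1 (e_ k) \_ P) @[k --> \oo] --> (0 : R).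
  apply/cvgrPdist_lt => b b0; have b1 : 0 < b / (D + 1) by rewrite divr_gt0 // ltr_wpDl.
  have := esmall _ b1; apply: filterS => k ek; rewrite sub0r normrN.
  apply: le_lt_trans (smallH1 _ (e0 k) (ed k)) _.
  have : e_ k * (D + 1) < b by rewrite -ltr_pdivlMr // ltr_wpDl. by have := e0 k; nra.
by move=> /(cvg_unique (@Rhausdorff R) cvgI) ->; rewrite normr0 ltW.
Qed.

Let h x := if enorm x <= r then f ((r / enorm x) *: x) else 0.

Let bms_h : bms h.
have [K K0 HK] := cube_bounded r (CkAW Cf).
apply: (@bms_sphere _ _ f r K r0 (CkAW Cp)) => [x /eqP|].
  by rewrite eq_le => /andP[/enorm_cube xr _]; exact: HK.
by apply: HK => i; rewrite mxE normr0 ltW.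
Qed.

(* The difference of [Y] and of the field [p(x) x / r], where [p] is the radial
   component of [Y] on the sphere extended with homogeneity [0], is tangent to
   the sphere, so that the limit of its flux through thin shells vanishes. *)
Lemma ball_divergence :
  II ((fun x => \sum_i pd setT (Y i) i x) \_ [set x | enorm x <= r]) = sphere_int r f.
set Bl := [set x | _].
have mB : measurable (Bl : set (bor 'rV[R]_m.+1)).
  by apply: closed_borel; exact: closed_enorm_le.
have bD : bms ((fun x => \sum_i pd setT (Y i) i x) \_ Bl).
  apply: (@bms_restrict _ _ _ r); [exact: closed_enorm_le| |exact: ltW|by move=> x /enorm_cube].
  by apply: CkA_sum => i _; apply: CkA_sub (CkA_pd i rT (CY i)).
rewrite /sphere_int (lint_bms bms_h) -/(Rintegral _ _ _) -(II_punctured bms_h) -(II_punctured bD).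
have mP : measurable (P : set (bor 'rV[R]_m.+1)) by exact: open_borel.
apply/eqP; rewrite -subr_eq0 -IIZ -?IIB; try by [exact: bms_indic|apply: bmsZ; exact: bms_indic].
apply/eqP; rewrite -[RHS]zero_flux; apply: II_eq => x; rewrite !patchE in_setI.
case: (x \in P); last by rewrite mulr0 subr0.
rewrite /h /=; have [xr|xr] := boolP (enorm x <= r).
  by rewrite mem_set.
by rewrite memNset ?mulr0 ?subr0 //; exact/negP.
Qed.

End BallDivergence.

Section RadialFunctions.
Context {R : realType} (m : nat).
Local Notation X := (@exterior R m.+1).
Local Notation n := (m.+1%:R : R).

Lemma open_exterior : open X.
exact: open_enorm_gt. Qed.

Lemma exterior_punctured : X `<=` @punctured R m.+1.
by move=> x /= x1; rewrite /punctured /= -enorm_gt0; apply: lt_trans x1. Qed.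

Lemma CkA_enormX k : CkA k X (@enorm R m.+1).
exact: CkA_sub exterior_punctured (CkA_enorm (n := m.+1) k). Qed.

Lemma pd_enormX i x : X x -> pd X (@enorm R m.+1) i x = x 0 i / enorm x.
move=> Xx; rewrite -pd_enorm; last exact: exterior_punctured.
apply: (@pd_local _ _ X punctured X _ _ i x open_exterior) => // y Xy.
by split=> // _; exact: exterior_punctured.
Qed.

Let pos := [set t : R | 0 < t].

Lemma continuous_powR b (t : R) : pos t -> {for t, continuous (fun s : R => s `^ b)}.
move=> t0; have [D _] := is_derive1_powR b t0.
by apply: differentiable_continuous; exact/derivable1_diffP.
Qed.

Lemma CkA_powR b : CkA 1 X (fun x => enorm x `^ b).
have dp (t : R) : pos t -> is_derive t 1 (fun s : R => s `^ b) (b * t `^ (b - 1)).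
  by move=> t0; exact: is_derive1_powR.
refine (@C1_unP R _ X pos (@enorm R m.+1) (fun s => s `^ b) (fun t => b * t `^ (b - 1)) (@open_gt R 0) dp _ _ _) => [t t0|x Xx|].
- by apply: cvgMl_tmp; exact: continuous_powR.
- by rewrite /pos /= enorm_gt0; exact: exterior_punctured.
- exact: CkA_enormX.
Qed.

Lemma pd_powR b i x : X x ->
  pd X (fun x => enorm x `^ b) i x = b * enorm x `^ (b - 1) * (x 0 i / enorm x).
move=> Xx; have dp (t : R) : pos t -> is_derive t 1 (fun s : R => s `^ b) (b * t `^ (b - 1)).
  by move=> t0; exact: is_derive1_powR.
have x0 : pos (enorm x) by rewrite /pos /= enorm_gt0; exact: exterior_punctured.
by rewrite (pd_unP i dp x0 (open_regular open_exterior) Xx (CkA_enormX 1)) pd_enormX.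
Qed.

(** The field x |x|^b bounds the integral of |x|^b over an annulus by a flux, in place of polar
    coordinates. *)
Lemma div_powR b x : X x -> \sum_i pd X (fun x => x 0 i * enorm x `^ b) i x = (n + b) * enorm x `^ b.
move=> Xx; have rX := open_regular open_exterior.
have e0 : 0 < enorm x by rewrite enorm_gt0; exact: exterior_punctured.
have Cb := CkA_powR b.
transitivity (\sum_i (enorm x `^ b + b * enorm x `^ (b - 1) / enorm x * x 0 i ^+ 2)).
  bigr => i _; have Ci := @CkA_coord R m.+1 1 X i.
  by rewrite pdM // pd_coord // eqxx mul1r pd_powR //; congr (_ + _); rewrite expr2; ring.
rewrite big_split /= -mulr_sumr -enorm_sqr sumr_const card_ord -(mulr_natl (enorm x `^ b)) mulrDl; congr (_ + _).
have -> : enorm x `^ b = enorm x `^ (b - 1) * enorm x.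
  by rewrite -{3}(powRr1 (ltW e0)) -powRD ?subrK // (gt_eqF e0) implybT.
by field; rewrite gt_eqF.
Qed.

End RadialFunctions.

(** * Fluxes through spheres in the exterior domain *)

Section Flux.
Context {R : realType} (m : nat).
Hypothesis m0 : (0 < m)%N.
Local Notation X := (@exterior R m.+1).
Local Notation n := (m.+1%:R : R).
Implicit Types (Y Z : 'I_m.+1 -> 'rV[R]_m.+1 -> R).

Let oX : open X := @open_exterior R m.
Let rX : regular X := open_regular oX.
Let rT : regular [set: 'rV[R]_m.+1] := @regularT R m.

Definition flux Y (r : R) : R := sphere_int r (fun x => \sum_i Y i x * (x 0 i / r)).

Definition annulus (r1 r2 : R) : set 'rV[R]_m.+1 := [set x | r1 < enorm x <= r2].

Lemma measurable_annulus r1 r2 : measurable (annulus r1 r2 : set (bor 'rV[R]_m.+1)).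
have -> : annulus r1 r2 = [set x | r1 < enorm x] `&` [set x | enorm x <= r2].
  by apply/seteqP; split=> x /= => [/andP[]//|[h1 h2]]; apply/andP.
by apply: measurableI; [apply: open_borel; exact: open_enorm_gt|apply: closed_borel; exact: closed_enorm_le].
Qed.

Lemma bms_annulus (f : 'rV[R]_m.+1 -> R) r1 r2 : 1 < r1 -> CkA 0 X f -> bms (f \_ (annulus r1 r2)).
move=> r1_gt Cf; pose A := [set x : 'rV[R]_m.+1 | r1 <= enorm x] `&` [set x | enorm x <= r2].
have AX : A `<=` X by move=> x [/= h _]; exact: lt_le_trans h.
have cA : closed A by apply: closedI; [exact: closed_enorm_ge|exact: closed_enorm_le].
have := @bms_restrict _ _ A (Num.max 0 r2) f cA (CkA_sub AX Cf).
rewrite le_max lexx => /(_ isT) H.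
have B : bms (f \_ A).
  apply: H => x [_ /= xr] xc; exfalso; apply: xc; apply: enorm_cube. by rewrite le_max xr orbT.
have -> : f \_ (annulus r1 r2) = (f \_ A) \_ (annulus r1 r2).
  apply/funext => x; rewrite !patchE; case: ifPn => // /set_mem /= /andP[h1 h2].
  by rewrite mem_set //; split=> //=; exact: ltW.
by apply: bms_indic => //; exact: measurable_annulus.
Qed.

(** Fields are controlled on the exterior domain only. f 0 is the value that [sphere_int] meets at
    the center of the ball; for the integrand of a flux it is 0. *)
Let sphere_facts (f : 'rV[R]_m.+1 -> R) r : 1 < r -> CkA 0 X f -> f 0 = 0 ->
  exists2 K, 0 <= K & CkA 0 punctured (fun x => f ((r / enorm x) *: x)) /\
    forall x, enorm x = r -> `|f x| <= K.
move=> r1 Cf f0; have r0 : 0 < r by exact: lt_trans r1.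
pose A := [set x : 'rV[R]_m.+1 | r <= enorm x] `&` [set x | enorm x <= r].
have AX : A `<=` X by move=> x [/= h _]; exact: lt_le_trans h.
have cA : closed A by apply: closedI; [exact: closed_enorm_ge|exact: closed_enorm_le].
have [|K HK] := @within_cube_bounded _ _ A r f cA (CkA_sub AX Cf).
  by move=> x [_ /= /enorm_cube].
exists (Num.max 0 K); first by rewrite le_max lexx.
split; last by move=> x xr; rewrite le_max HK ?orbT //; split; rewrite /= xr.
by apply: (CkA_ray _ Cf) => x Px; rewrite /exterior /= enorm_ray.
Qed.

Lemma sphere_int_bound (f : 'rV[R]_m.+1 -> R) r K : 1 < r -> CkA 0 X f -> f 0 = 0 -> 0 <= K ->
  (forall x, enorm x = r -> `|f x| <= K) -> `|sphere_int r f| <= n / r * (K * (2 * r) ^+ m.+1).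
move=> r1 Cf f0 K0 fK; have r0 : 0 < r by exact: lt_trans r1.
have [K' K'0 [Cp fK']] := sphere_facts r1 Cf f0.
have f0K : `|f 0| <= K by rewrite f0 normr0.
have B := bms_sphere r0 Cp fK f0K.
rewrite /sphere_int (lint_bms B) normrM ger0_norm; last by rewrite divr_ge0 // ltW.
apply: ler_wpM2l; first by rewrite divr_ge0 // ltW.
apply: (II_bound B (ltW r0)) => x.
  case: ifP => // _; last by rewrite normr0. have [->|x0] := eqVneq x 0; first by rewrite scaler0.
  by apply: fK; exact: enorm_ray.
by move=> xc; case: ifPn => // /enorm_cube.
Qed.

Lemma sphere_intD (f g : 'rV[R]_m.+1 -> R) r : 1 < r -> CkA 0 X f -> f 0 = 0 ->
  CkA 0 X g -> g 0 = 0 -> sphere_int r (fun x => f x + g x) = sphere_int r f + sphere_int r g.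
move=> r1 Cf f0 Cg g0; have r0 : 0 < r by exact: lt_trans r1.
have [K K0 [Cp fK]] := sphere_facts r1 Cf f0.
have [L L0 [Cq gL]] := sphere_facts r1 Cg g0.
have f0K : `|f 0| <= K by rewrite f0 normr0.
have g0L : `|g 0| <= L by rewrite g0 normr0.
have B1 := bms_sphere r0 Cp fK f0K; have B2 := bms_sphere r0 Cq gL g0L.
have B3 := bmsD B1 B2.
rewrite /sphere_int -mulrDr; congr (_ * _).
rewrite (lint_bms B1) (lint_bms B2) -/(Rintegral _ _ _) -IID //.
rewrite /Rintegral -(lint_bms B3); congr (fine _); apply: eq_lint => x.
by case: ifP => // _; rewrite addr0.
Qed.

Lemma eq_sphere_int (f g : 'rV[R]_m.+1 -> R) r : 0 < r -> f 0 = g 0 ->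
  (forall x, enorm x = r -> f x = g x) -> sphere_int r f = sphere_int r g.
move=> r0 fg0 fg; rewrite /sphere_int; congr (_ * fine _); apply: eq_lint => x.
case: ifP => // _; have [->|x0] := eqVneq x 0; first by rewrite scaler0 fg0.
by rewrite fg // enorm_ray.
Qed.

Lemma CkA_radial k Y r : (forall i, CkA k X (Y i)) -> CkA k X (fun x => \sum_i Y i x * (x 0 i / r)).
move=> CY; apply: CkA_sum => i _; apply: CkAM => //.
by apply: CkAM => //.
Qed.

Lemma radial0 Y r : \sum_i Y i 0 * ((0 : 'rV[R]_m.+1) 0 i / r) = 0.
by rewrite big1 // => i _; rewrite mxE mul0r mulr0. Qed.

Lemma fluxD Y Z r : 1 < r -> (forall i, CkA 0 X (Y i)) -> (forall i, CkA 0 X (Z i)) ->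
  flux (fun i x => Y i x + Z i x) r = flux Y r + flux Z r.
move=> r1 CY CZ; rewrite /flux -sphere_intD //; try exact: radial0; try exact: CkA_radial.
by congr (sphere_int _ _); apply/funext => x; rewrite -big_split; bigr => i _; rewrite mulrDl.
Qed.

Lemma flux_bound Y r K : 1 < r -> (forall i, CkA 0 X (Y i)) -> 0 <= K ->
  (forall x, enorm x = r -> forall i, `|Y i x| <= K) -> `|flux Y r| <= n / r * (n * K * (2 * r) ^+ m.+1).
move=> r1 CY K0 YK; have r0 : 0 < r by exact: lt_trans r1.
apply: sphere_int_bound => //; [exact: CkA_radial|exact: radial0|exact: mulr_ge0|].
move=> x xr; apply: le_trans (ler_norm_sum _ _ _) _.
apply: (@le_trans _ _ (\sum_(i < m.+1) K)); last by rewrite sumr_const card_ord -[leLHS]mulr_natl.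
apply: ler_sum => i _; rewrite normrM -[leRHS]mulr1; apply: ler_pM => //; first exact: YK.
by rewrite normrM normfV (gtr0_norm r0) ler_pdivrMr // mul1r -xr coord_le_enorm.
Qed.

(** Cut off inside |x| < r1, the field extends by 0 to R^n without change on the annulus and on its
    two spheres; the formula is the difference of the divergence theorems on two balls. *)
Lemma annulus_divergence Y r1 r2 : 1 < r1 -> r1 <= r2 -> (forall i, CkA 1 X (Y i)) ->
  flux Y r2 - flux Y r1 = II ((fun x => \sum_i pd X (Y i) i x) \_ (annulus r1 r2)).
move=> r1_gt r12 CY.
(* The cutoff rises over the middle third of the interval from 1 to r1. *)
pose a := 1 + (r1 - 1) / 3; pose d := (r1 - 1) / 3.
have [d0 a1 ad] : [/\ 0 < d, 1 < a & a + d < r1] by rewrite /a /d; split; lra.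
pose psi (x : 'rV[R]_m.+1) : R := step ((enorm x - a) / d).
have Carg : CkA 1 X (fun x => (enorm x - a) / d).
  by apply: CkAM; [apply: CkAB; [exact: CkA_enormX|exact: CkA_cst]|exact: CkA_cst].
have Cpsi : CkA 1 X psi by exact: (C1_un is_derive_step (@continuous_dstep R) Carg).
pose K := [set x : 'rV[R]_m.+1 | a <= enorm x].
have KX : K `<=` X by move=> x /= h; exact: lt_le_trans h.
pose Z i := (fun x => psi x * Y i x) \_ X.
have CZ i : CkA 1 setT (Z i).
  apply: (@CkA_extend0 _ _ _ X setT X K) => //; [by rewrite setTI|exact: closed_enorm_ge|by move=> x [/KX]| |exact: CkAM].
  move=> x Xx /negP; rewrite -ltNge => xa; rewrite /psi step_le0 ?mul0r //.
  by rewrite mulr_le0_ge0 ?invr_ge0 ?(ltW d0) // subr_le0 ltW.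
pose U := [set x : 'rV[R]_m.+1 | a + d < enorm x].
have oU : open U by exact: open_enorm_gt.
have ZU i x : U x -> Z i x = Y i x.
  move=> Ux; have Xx : X x by apply: lt_trans Ux; lra.
  by rewrite /Z patchE mem_set // /psi step_ge1 ?mul1r // ler_pdivlMr // mul1r; move: Ux; rewrite /U /=; lra.
have fluxZ r : r1 <= r -> flux Y r = flux Z r.
  move=> r1r; apply: eq_sphere_int; [lra|by rewrite !radial0|].
  by move=> x xr; bigr => i _; rewrite ZU // /U /= xr; lra.
have r10 : 0 < r1 by lra.
have r20 : 0 < r2 by lra.
rewrite !fluxZ // /flux -!ball_divergence //.
have CD : CkA 0 setT (fun x => \sum_i pd setT (Z i) i x).
  by apply: CkA_sum => i _; exact: CkA_pd.
have B r : 0 < r -> bms ((fun x => \sum_i pd setT (Z i) i x) \_ [set x | enorm x <= r]).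
  move=> r0; apply: (@bms_restrict _ _ _ r); [exact: closed_enorm_le|exact: CkA_sub CD|exact: ltW|].
  by move=> x /enorm_cube.
rewrite -IIB; [|exact: B|exact: B]; apply: II_eq => x; rewrite !patchE.
have [x1|x1] := leP (enorm x) r1.
  have -> : (x \in annulus r1 r2) = false by apply: memNset => /= /andP[]; rewrite ltNge x1.
  by rewrite !mem_set ?subrr //=; exact: le_trans r12.
rewrite (memNset (A := [set x | enorm x <= r1])) /=; last by rewrite leNgt x1.
rewrite subr0; have [x2|x2] := leP (enorm x) r2; last first.
  have -> : (x \in annulus r1 r2) = false by apply: memNset => /= /andP[_]; rewrite leNgt x2.
  by rewrite memNset //= leNgt x2.
have -> : (x \in annulus r1 r2) by apply/mem_set/andP.
rewrite mem_set //=.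
have Ux : U x by rewrite /U /=; lra.
bigr => i _; apply: (@pd_local _ _ setT X U) => //.
  by move=> y Uy; split=> // _; apply: lt_trans Uy; lra.
by move=> y Uy _; exact: ZU.
Qed.

End Flux.

(** * Decay at infinity and convergence of fluxes *)

Section Decay.
Context {R : realType} (m : nat).
Hypothesis m0 : (0 < m)%N.
Local Notation X := (@exterior R m.+1).
Local Notation n := (m.+1%:R : R).
Implicit Types (f g : 'rV[R]_m.+1 -> R) (Y Z : 'I_m.+1 -> 'rV[R]_m.+1 -> R).

Lemma decaysP s f : decays s f <->
  exists K R0, [/\ 0 <= K, 1 < R0 & forall x, R0 <= enorm x -> `|f x| <= K * enorm x `^ (- s)].
split=> [[K [M [_ HM]]]|[K [R0 [K0 R1 H]]]].
  exists (Num.max K 0), (Num.max M 1 + 1); split.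
  - by rewrite le_max lexx orbT.
  - by rewrite ltr_pwDr // le_max lexx orbT.
  - move=> x xM; have Mx : M < enorm x.
      apply: lt_le_trans xM; apply: (@le_lt_trans _ _ (Num.max M 1)); last by rewrite ltrDl.
      by rewrite le_max lexx.
    apply: le_trans (HM _ Mx x erefl) _; apply: ler_wpM2r; first exact: powR_ge0. by rewrite le_max lexx.
exists K, R0; split; first exact: num_real.
by move=> r Rr x xr; rewrite -xr; apply: H; rewrite xr ltW.
Qed.

Lemma powR_small (e b : R) : 0 < b -> 0 < e -> exists2 R0 : R, 1 < R0 & forall r, R0 <= r -> r `^ (- b) <= e.
move=> b0 e0; have R1 : 0 < e^-1 `^ b^-1 by rewrite powR_gt0 // invr_gt0.
exists (1 + e^-1 `^ b^-1) => [|r rR]; first by rewrite ltrDl.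
have r0 : 0 < r by apply: lt_le_trans rR; rewrite addr_gt0.
rewrite powRN -[leRHS]invrK lef_pV2 ?posrE ?powR_gt0 ?invr_gt0 //.
rewrite -[leLHS]powRr1 ?invr_ge0 ?(ltW e0) // -(mulVf (lt0r_neq0 b0)) powRrM.
apply: ge0_ler_powR; rewrite ?nnegrE ?(ltW b0) ?(ltW R1) ?(ltW r0) //.
by apply: le_trans rR; rewrite lerDr.
Qed.

Lemma flux_small Y a : m%:R < a -> (forall i, CkA 0 X (Y i)) -> (forall i, decays a (Y i)) ->
  flux Y r @[r --> +oo] --> (0 : R).
move=> ma CY dY; have /choice[K HK] : forall i, exists KR : R * R, [/\ 0 <= KR.1, 1 < KR.2 &
    forall x, KR.2 <= enorm x -> `|Y i x| <= KR.1 * enorm x `^ (- a)].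
  by move=> i; have /decaysP[K [R0 H]] := dY i; exists (K, R0).
(* The constant that [flux_bound] produces; the 1 only makes it positive. *)
pose C := n * (\sum_i (K i).1) * 2 ^+ m.+1 * n + 1.
have S0 : 0 <= \sum_i (K i).1 by apply: sumr_ge0 => i _; have [] := HK i.
have C0 : 0 < C.
  have h2 : 0 <= (2 : R) ^+ m.+1 by exact: exprn_ge0.
  by rewrite ltr_pwDr // mulr_ge0 // mulr_ge0 // mulr_ge0.
apply/cvgrPdist_le => e e0.
have [R0 R01 HR0] := @powR_small (e / C) (a - m%:R) (ltac:(by rewrite subr_gt0)) (divr_gt0 e0 C0).
pose R2 := R0 + \sum_i (K i).2.
have Ki i : (K i).2 <= R2.
  rewrite /R2 (bigD1 i) //= addrCA lerDl addr_ge0 ?(ltW (lt_trans ltr01 R01)) //.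
  by apply: sumr_ge0 => j _; have [_ + _] := HK j; move=> h; exact: ltW (lt_trans ltr01 h).
have R0R2 : R0 <= R2.
  by rewrite lerDl; apply: sumr_ge0 => j _; have [_ + _] := HK j; move=> h; exact: ltW (lt_trans ltr01 h).
exists R2; split; first exact: num_real.
move=> r R2r; have rR0 : R0 <= r by exact: le_trans R0R2 (ltW R2r).
have r1 : 1 < r by exact: lt_le_trans rR0.
have r0 : 0 < r by exact: lt_trans r1.
rewrite sub0r normrN.
have B : forall x, enorm x = r -> forall i, `|Y i x| <= (\sum_i (K i).1) * r `^ (- a).
  move=> x xr i; have [K0 _ H] := HK i; rewrite -xr; apply: le_trans (H x _) _.
    by rewrite xr; apply: le_trans (Ki i) (ltW R2r).
  apply: ler_wpM2r; first exact: powR_ge0.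
  by rewrite (bigD1 i) //= lerDl; apply: sumr_ge0 => j _; have [] := HK j.
apply: le_trans (flux_bound r1 CY (mulr_ge0 S0 (powR_ge0 _ _)) B) _.
have E : r `^ (- a) = r `^ (- (a - m%:R)) * (r ^+ m)^-1.
  rewrite -powR_invn ?(ltW r0) // -powRD ?(gt_eqF r0) ?implybT //; congr (_ `^ _); ring.
have -> : n / r * (n * ((\sum_i (K i).1) * r `^ (- a)) * (2 * r) ^+ m.+1) =
   n * (\sum_i (K i).1) * 2 ^+ m.+1 * n * r `^ (- (a - m%:R)).
  rewrite E exprMn exprS. have rm : r ^+ m != 0 by rewrite expf_neq0 // gt_eqF.
  rewrite [r ^+ m.+1]exprS; move: (r ^+ m) (2 ^+ m) rm (gt_eqF r0) => p q p0 /negbT r_n0.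
  by field; rewrite p0 r_n0.
apply: (@le_trans _ _ (C * r `^ (- (a - m%:R)))).
  by apply: ler_wpM2r; [exact: powR_ge0|rewrite lerDl].
by rewrite mulrC -ler_pdivlMr //; exact: HR0.
Qed.

(** Cauchy condition for integrals over annuli. It is stable under sums, so it accommodates both an
    integrable scalar curvature and an error term known only by its decay. *)
Definition tail_small f := forall e : R, 0 < e -> exists2 R0 : R, 1 < R0 &
  forall r1 r2, R0 <= r1 -> r1 <= r2 -> `|II (f \_ (annulus r1 r2))| <= e.

Lemma tail_smallD f g : CkA 0 X f -> CkA 0 X g -> tail_small f -> tail_small g ->
  tail_small (fun x => f x + g x).
move=> Cf Cg tf tg e e0; have e2 : 0 < e / 2 by rewrite divr_gt0.
have [Rf Rf1 Hf] := tf _ e2; have [Rg Rg1 Hg] := tg _ e2.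
exists (Num.max Rf Rg) => [|r1 r2]; first by rewrite lt_max Rf1.
rewrite ge_max => /andP[h1 h2] r12; have r1_gt : 1 < r1 by exact: lt_le_trans h1.
rewrite (_ : II _ = II (f \_ (annulus r1 r2)) + II (g \_ (annulus r1 r2))); last first.
  rewrite -IID; [|exact: bms_annulus|exact: bms_annulus]; apply: II_eq => x; rewrite !patchE.
  by case: ifP => // _; rewrite addr0.
apply: le_trans (ler_normD _ _) _; rewrite [e]splitr; apply: lerD; [exact: Hf|exact: Hg].
Qed.

(** The field Y = x |x|^(-a) has divergence (n - a) |x|^(-a). Its flux is nonnegative, so (a - n)
    times the integral of |x|^(-a) over the annulus is at most the flux through the inner sphere,
    which is O(r1^(n - a)). *)
Lemma tail_decay f a : n < a -> CkA 0 X f -> decays a f -> tail_small f.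
move=> na Cf /decaysP[K [R1 [K0 R11 HK]]] e e0.
have an0 : 0 < a - n by rewrite subr_gt0.
pose D := n * (n * 2 ^+ m.+1) / (a - n) * K + 1.
have D0 : 0 < D.
  by rewrite ltr_pwDr // mulr_ge0 // divr_ge0 ?(ltW an0) // mulr_ge0 // mulr_ge0 // exprn_ge0.
have [R0 R01 HR0] := powR_small an0 (divr_gt0 e0 D0).
exists (Num.max R0 R1) => [|r1 r2]; first by rewrite lt_max R01.
rewrite ge_max => /andP[h0 h1] r12; have r1_gt : 1 < r1 by exact: lt_le_trans h0.
have r10 : 0 < r1 by exact: lt_trans r1_gt.
pose q x : R := enorm (x : 'rV[R]_m.+1) `^ (- a).
have Cq : CkA 1 X q by exact: CkA_powR.
have Bq := bms_annulus r2 r1_gt (CkAW Cq); have Bf := bms_annulus r2 r1_gt Cf.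
have fq : `|II (f \_ (annulus r1 r2))| <= K * II (q \_ (annulus r1 r2)).
  apply: le_trans (II_norm Bf) _; rewrite -IIZ //.
  apply: II_le; [exact: bms_norm|exact: bmsZ|move=> x]; rewrite !patchE.
  case: ifPn => [/set_mem/andP[x1 _]|_]; last by rewrite normr0 mulr0.
  by apply: HK; exact: le_trans h1 (ltW x1).
pose Y i x : R := (x : 'rV[R]_m.+1) 0 i * q x.
have CY i : CkA 1 X (Y i) by apply: CkAM => //.
have dY : II ((fun x => \sum_i pd X (Y i) i x) \_ (annulus r1 r2)) = (n - a) * II (q \_ (annulus r1 r2)).
  rewrite -IIZ //; apply: II_eq => x; rewrite !patchE; case: ifPn => [/set_mem/andP[x1 _]|_].
    by rewrite div_powR //; exact: lt_trans x1.
  by rewrite mulr0.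
have := annulus_divergence m0 r1_gt r12 CY; rewrite dY => E.
have f2 : 0 <= flux Y r2.
  have r2_gt : 1 < r2 by exact: lt_le_trans r12. have r20 : 0 < r2 by exact: lt_trans r2_gt.
  rewrite /flux /sphere_int mulr_ge0 ?divr_ge0 ?(ltW r20) // fine_ge0 //.
  have g0 x : 0 <= \sum_i Y i x * (x 0 i / r2).
    apply: sumr_ge0 => i _; rewrite /Y mulrAC mulrA -mulrA mulr_ge0 //; last first.
      by rewrite mulr_ge0 ?invr_ge0 ?(ltW r20) // powR_ge0.
    by rewrite -expr2 sqr_ge0.
  rewrite lint_bms.
    by apply: integral_ge0 => x _; rewrite lee_fin; case: ifP.
  have CR : CkA 0 X (fun x => \sum_i Y i x * (x 0 i / r2)) by apply: CkA_radial => i; exact: CkAW (CY i).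
  apply: (@bms_sphere _ _ (fun x => \sum_i Y i x * (x 0 i / r2)) r2 (n * (r2 * r2 `^ (- a))) r20).
  - by apply: (CkA_ray _ CR) => x Px; rewrite /exterior /= enorm_ray.
  - move=> x xr; apply: le_trans (ler_norm_sum _ _ _) _.
    apply: (@le_trans _ _ (\sum_(i < m.+1) (r2 * r2 `^ (- a)))); last by rewrite sumr_const card_ord -[leLHS]mulr_natl.
    apply: ler_sum => i _; rewrite normrM -[leRHS]mulr1 /Y /q xr; apply: ler_pM => //.
      by rewrite normrM (ger0_norm (powR_ge0 _ _)) ler_wpM2r ?powR_ge0 // -xr coord_le_enorm.
    by rewrite normrM normfV (gtr0_norm r20) ler_pdivrMr // mul1r -xr coord_le_enorm.
  - by rewrite radial0 normr0 mulr_ge0 // mulr_ge0 ?powR_ge0 // ltW.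
have fb : `|flux Y r1| <= n / r1 * (n * (r1 * r1 `^ (- a)) * (2 * r1) ^+ m.+1).
  apply: flux_bound => // [i||x xr i]; first exact: CkAW (CY i).
    by rewrite mulr_ge0 ?powR_ge0 // ltW.
  by rewrite /Y /q xr normrM (ger0_norm (powR_ge0 _ _)) ler_wpM2r ?powR_ge0 // -xr coord_le_enorm.
have Ea : r1 `^ (- a) = r1 `^ (- (a - n)) * (r1 ^+ m.+1)^-1.
  rewrite -powR_invn ?(ltW r10) // -powRD ?(gt_eqF r10) ?implybT //; congr (_ `^ _); ring.
have I1 : II (q \_ (annulus r1 r2)) <= n * (n * 2 ^+ m.+1) / (a - n) * r1 `^ (- (a - n)).
  have : (a - n) * II (q \_ (annulus r1 r2)) <= n * (n * 2 ^+ m.+1) * r1 `^ (- (a - n)).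
    have : flux Y r1 <= n * (n * 2 ^+ m.+1) * r1 `^ (- (a - n)).
      apply: le_trans (ler_norm _) (le_trans fb _); rewrite Ea exprMn le_eqVlt; apply/orP; left; apply/eqP.
      have rm : r1 ^+ m.+1 != 0 by rewrite expf_neq0 // gt_eqF.
      move: (r1 ^+ m.+1) (2 ^+ m.+1) rm (gt_eqF r10) => p w p0 /negbT r_n0. by field; rewrite p0 r_n0.
    by move: E f2; lra.
  by rewrite -ler_pdivlMl // => h; apply: le_trans h _; rewrite le_eqVlt; apply/orP; left; apply/eqP; ring.
apply: le_trans fq _; apply: le_trans (ler_wpM2l K0 I1) _.
apply: (@le_trans _ _ (D * r1 `^ (- (a - n)))).
  rewrite [leLHS]mulrA; apply: ler_wpM2r; first exact: powR_ge0. by rewrite /D [K * _]mulrC lerDl.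
by rewrite mulrC -ler_pdivlMr //; exact: HR0.
Qed.

(** Dominated convergence for |f| restricted to |x| > k; one large k controls every annulus beyond
    it. *)
Lemma tail_integrable f : CkA 0 X f -> (lebn m.+1).-integrable (X : set (bor 'rV[R]_m.+1)) (EFin \o f) ->
  tail_small f.
move=> Cf fi e e0.
have mX : measurable (X : set (bor 'rV[R]_m.+1)) by apply: open_borel; exact: open_exterior.
pose A k := [set x : 'rV[R]_m.+1 | (k%:R : R) < enorm x].
have mA k : measurable (A k `&` X : set (bor 'rV[R]_m.+1)).
  by apply: measurableI => //; apply: open_borel; exact: open_enorm_gt.
have [mf _] := integrableP _ _ _ fi.
have mR : measurable_fun (X : set (bor 'rV[R]_m.+1)) f by exact/measurable_EFinP.
pose g k x : R := `|f x| * \1_(A k) x.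
have mg k : measurable_fun (X : set (bor 'rV[R]_m.+1)) (fun x => (g k x)%:E).
  apply/measurable_EFinP; apply: measurable_funM; first exact: measurableT_comp.
  by apply: measurable_indic; apply: open_borel; exact: open_enorm_gt.
have [||||_ _] := @dominated_convergence _ _ R (lebn m.+1) X mX
  (fun k x => (g k x)%:E) (fun=> 0%E) (fun x => `|(f x)%:E|%E) mg.
- exact: measurable_cst.
- apply/aeW => x Xx; apply: cvg_near_cst; exists (Num.truncn (enorm x)).+1 => // k /= kx.
  rewrite /g indicE memNset ?mulr0 //= => kx'.
  have : enorm x < k%:R by apply: lt_le_trans (truncnS_gt _) _; rewrite ler_nat. by rewrite ltNge ltW.
- exact: integrable_abse.
- apply/aeW => x k Xx; rewrite lee_fin /g ger0_norm ?mulr_ge0 //.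
  by rewrite ler_piMr // indicE; case: (_ \in _).
rewrite integral0 => /fine_cvgP[fin /cvgrPdist_lt/(_ e e0) lim].
have [k [kfin klim]] : exists k, (\int[lebn m.+1]_(x in X) (g k x)%:E)%E \is a fin_num /\
    `|0 - fine (\int[lebn m.+1]_(x in X) (g k x)%:E)%E| < e.
  by have [k _ Hk] := filterI fin lim; exists k; have := Hk k (leqnn k).
exists (k%:R + 2) => [|r1 r2 kr1 r12]; first by have := ler0n R k; lra.
have r1_gt : 1 < r1 by have := ler0n R k; lra.
have Bf := bms_annulus r2 r1_gt Cf.
apply: le_trans (II_norm Bf) _; apply: ltW; move: klim.
have g0 : (0 <= \int[lebn m.+1]_(x in X) (g k x)%:E)%E.
  by apply: integral_ge0 => x _; rewrite lee_fin mulr_ge0.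
rewrite sub0r normrN ger0_norm ?fine_ge0 //; apply: le_lt_trans.
have -> : II (fun x => `|(f \_ (annulus r1 r2)) x|) = fine (\int[lebn m.+1]_x `|((f \_ (annulus r1 r2)) x)%:E|)%E by [].
apply: fine_le => //.
  by have := integrable_fin_num measurableT (bms_integrable (bms_norm Bf)).
rewrite [leRHS]integral_mkcond; apply: ge0_le_integral => //.
- by apply: measurableT_comp => //; apply/measurable_EFinP; case: Bf.
- by apply/(measurable_restrictT _ _).1.
- move=> x _; rewrite /g !patchE; case: ifPn => [/set_mem/andP[x1 _]|_]; last first.
    by rewrite abse0; case: ifP => // _; rewrite lee_fin mulr_ge0.
  rewrite mem_set; last by apply: lt_trans x1.
  by rewrite indicE mem_set ?mulr1 //= /A /=; have := ler0n R k; lra.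
Qed.

Lemma flux_cvg Y : (forall i, CkA 1 X (Y i)) -> tail_small (fun x => \sum_i pd X (Y i) i x) ->
  cvg (flux Y r @[r --> +oo]).
move=> CY tY; apply/cauchy_cvgP/cauchy_ballP => e e0.
have e2 : 0 < e / 3 by rewrite divr_gt0.
have [R0 R01 H] := tY _ e2.
exists (flux Y @` [set r | R0 < r], flux Y @` [set r | R0 < r]).
  by split; exists R0; (split; [exact: num_real|]) => r Rr; exists r.
move=> [_ _] [[r /= Rr <-] [t /= Rt <-]]; rewrite /ball /=.
wlog rt : r t Rr Rt / r <= t.
  by move=> W; have [|/ltW] := leP r t; [exact: W|rewrite distrC; exact: W].
have r1 : 1 < r by exact: lt_trans Rr.
rewrite distrC (annulus_divergence m0 r1 rt CY).
by apply: le_lt_trans (H _ _ (ltW Rr) rt) _; lra.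
Qed.

End Decay.

(** * Charts and hypersurfaces *)

Section Charts.
Context {R : realType} (m : nat) (M : manifold R m).
Implicit Types (c d e : chart R m M) (U W : set M).

Definition coimg c U : set 'rV[R]_m.+1 := co c @` (dom c `&` U).

Lemma of_coordK c p : atlas c -> dom c p -> pt c (co c p) = p.
by move=> /atlas_chart[_ _ + _ _]; exact. Qed.

Lemma dom_cod c p : dom c p -> cod c (co c p).
by exists p. Qed.

Lemma cod_dom c x : atlas c -> cod c x -> dom c (pt c x).
by move=> ac [p cp <-]; rewrite of_coordK. Qed.

Lemma to_coordK c x : atlas c -> cod c x -> co c (pt c x) = x.
by move=> ac [p cp <-]; rewrite of_coordK. Qed.

Lemma coimgP c U x : atlas c -> coimg c U x <-> cod c x /\ U (pt c x).
move=> ac; split=> [[p [cp Up] <-]|[cx Ux]]; first by rewrite of_coordK //; split=> //; exact: dom_cod.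
by exists (pt c x); [split=> //; exact: cod_dom|exact: to_coordK].
Qed.

Lemma coimg_to c U p : dom c p -> U p -> coimg c U (co c p).
by exists p. Qed.

Lemma open_dom c : atlas c -> open (dom c).
by move=> /atlas_chart[]. Qed.

Lemma regular_cod c : atlas c -> regular (cod c).
by move=> /atlas_chart[_ [W oW E] _ _ _]; exists W. Qed.

Lemma coimg_open c U : atlas c -> open U -> exists2 W : set 'rV[R]_m.+1,
  open W & coimg c U = cod c `&` W.
move=> ac oU; have [_ _ _ _ /subspace_continuousP cf] := atlas_chart ac.
have [W oW E] := within_preimage_open cf oU.
exists W => //; rewrite -E; apply/seteqP; split=> x; first by move=> /(coimgP _ _ ac).
by move=> [? ?]; apply/(coimgP _ _ ac).
Qed.

Lemma regular_coimg c U : atlas c -> open U -> regular (coimg c U).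
move=> ac oU; have [W oW ->] := coimg_open ac oU.
by apply: regular_openI => //; exact: regular_cod.
Qed.

Lemma pd_coimg c U f i x : atlas c -> open U -> coimg c U x -> pd (coimg c U) f i x = pd (cod c) f i x.
move=> ac oU; have [W oW ->] := coimg_open ac oU => -[cx Wx].
by apply: (@pd_local _ _ _ _ W) => // y Wy; split=> [[]|].
Qed.

Lemma CkA_coimg k c U f : atlas c -> open U -> CkA k (cod c) f -> CkA k (coimg c U) f.
by move=> ac oU; apply: CkA_sub => x /(coimgP _ _ ac)[]. Qed.

Lemma trans_sm c d : atlas c -> atlas d -> forall j, sm (coimg c (dom d)) (fun x => co d (pt c x) 0 j).
by move=> ac ad j k; apply: smooth_CkA; have [] := atlas_compatible ac ad j. Qed.

Lemma trans_coimg c d W x : atlas c -> atlas d -> coimg c (dom d `&` W) x -> coimg d W (co d (pt c x)).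
by move=> ac ad /(coimgP _ _ ac)[cx [dx Wx]]; exact: coimg_to. Qed.

Definition dcf c (f : M -> R) x : 'rV[R]_m.+1 := \row_i pd (cod c) (fun y => f (pt c y)) i x.
Definition dcv c n (F : M -> 'rV[R]_n) x : 'M[R]_(m.+1, n) :=
  \matrix_(i, k) pd (cod c) (fun y => F (pt c y) 0 k) i x.

Lemma pd_change c d W f i x : atlas c -> atlas d -> open W -> coimg c (dom d `&` W) x ->
  CkA 1 (coimg d W) (fun y => f (pt d y)) -> pd (cod c) (fun y => f (pt c y)) i x =
  \sum_j jacobian c d x i j * pd (cod d) (fun y => f (pt d y)) j (co d (pt c x)).
move=> ac ad oW xA Cf; set A := coimg c _ in xA.
have oDW : open (dom d `&` W) by apply: openI => //; exact: open_dom.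
have rA : regular A by exact: regular_coimg.
have rB : regular (coimg d W) by exact: regular_coimg.
have Ct j : CkA 1 A (fun y => co d (pt c y) 0 j).
  by apply: CkA_sub (trans_sm ac ad j 1) => y /(coimgP _ _ ac)[cy [dy _]]; apply/(coimgP _ _ ac).
rewrite -(pd_coimg _ _ ac oDW xA).
have E y : A y -> f (pt c y) = f (pt d (co d (pt c y))).
  by move=> /(coimgP _ _ ac)[cy [dy _]]; rewrite of_coordK.
rewrite (pd_eq i xA E).
rewrite (@pd_comp _ _ _ A (coimg d W) (fun y => f (pt d y)) (fun y => co d (pt c y))) //; last first.
  by move=> y; exact: trans_coimg.
bigr => j _; rewrite mulrC mxE (pd_coimg _ _ ac oDW xA) (pd_coimg _ _ ad oW) //.
exact: trans_coimg xA.
Qed.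

Lemma dcf_change c d W f x : atlas c -> atlas d -> open W -> coimg c (dom d `&` W) x ->
  CkA 1 (coimg d W) (fun y => f (pt d y)) -> dcf c f x = dcf d f (co d (pt c x)) *m (jacobian c d x)^T.
move=> ac ad oW xA Cf; apply/rowP => i; rewrite mxE (pd_change i ac ad oW xA Cf) mxE.
by bigr => j _; rewrite mulrC; congr (_ * _); rewrite [RHS]mxE.
Qed.

Lemma dcv_change c d W n (F : M -> 'rV[R]_n) x : atlas c -> atlas d -> open W ->
  coimg c (dom d `&` W) x -> (forall k, CkA 1 (coimg d W) (fun y => F (pt d y) 0 k)) ->
  dcv c F x = jacobian c d x *m dcv d F (co d (pt c x)).
move=> ac ad oW xA CF; apply/matrixP => i k.
rewrite mxE (pd_change (f := fun p => F p 0 k) i ac ad oW xA (CF k)) [RHS]mxE.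
by bigr => j _; congr (_ * _); rewrite [RHS]mxE.
Qed.

Lemma jacobian_comp c d e x : atlas c -> atlas d -> atlas e -> coimg c (dom d `&` dom e) x ->
  jacobian c e x = jacobian c d x *m jacobian d e (co d (pt c x)).
move=> ac ad ae xA; apply: (dcv_change ac ad (open_dom ae) xA) => k.
exact: (trans_sm ad ae k 1).
Qed.

Lemma jacobian1 c x : atlas c -> cod c x -> jacobian c c x = 1%:M.
move=> ac cx; have rc := regular_cod ac; apply/matrixP => i j; rewrite !mxE.
rewrite (@pd_eq _ _ (cod c) _ (fun y => y 0 j)) ?pd_coord //.
by move=> y cy; rewrite to_coordK.
Qed.

Lemma jacobian_inv c d x : atlas c -> atlas d -> coimg c (dom d) x ->
  jacobian c d x *m jacobian d c (co d (pt c x)) = 1%:M.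
move=> ac ad /(coimgP _ _ ac)[cx dx]; rewrite -jacobian_comp ?jacobian1 //.
by apply/(coimgP _ _ ac); split=> //; split=> //; exact: cod_dom.
Qed.

Lemma jacobian_unit c d x : atlas c -> atlas d -> coimg c (dom d) x -> jacobian c d x \in unitmx.
by move=> ac ad /(jacobian_inv ac ad)/mulmx1_unit[]. Qed.

Lemma coef_change c d (g : metric_field M) x : atlas c -> atlas d -> coimg c (dom d) x ->
  coef c g x = jacobian c d x *m coef d g (co d (pt c x)) *m (jacobian c d x)^T.
move=> ac ad /(coimgP _ _ ac)[cx dx]; rewrite /coef of_coordK //.
set q := pt c x; have aq := chart_at_atlas q; have dq := chart_at_dom q.
rewrite (@jacobian_comp c d (chart_at q)) //; last by apply/(coimgP _ _ ac).
by rewrite trmx_mul !mulmxA.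
Qed.

Lemma coef_self (g : metric_field M) p : coef (chart_at p) g (co (chart_at p) p) = g p.
have ap := chart_at_atlas p; have dp := chart_at_dom p.
rewrite /coef of_coordK // jacobian1 ?mul1mx ?trmx1 ?mulmx1 //; exact: dom_cod.
Qed.

Lemma vec_in_change c d q v : atlas c -> atlas d -> dom c q -> dom d q ->
  vec_in d q v = vec_in c q v *m jacobian c d (co c q).
move=> ac ad cq dq; have aq := chart_at_atlas q; have qq := chart_at_dom q.
rewrite /vec_in -mulmxA; congr (_ *m _).
rewrite (@jacobian_comp _ c d) ?of_coordK //.
by apply/coimgP => //; rewrite of_coordK //; split=> //; exact: dom_cod.
Qed.

Lemma vec_in_self (q : M) v : vec_in (chart_at q) q v = v.
by rewrite /vec_in jacobian1 ?mulmx1 //; [exact: chart_at_atlas|apply: dom_cod; exact: chart_at_dom]. Qed.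

Lemma dot_vec_in c (g : metric_field M) q v w : atlas c -> dom c q ->
  vec_in c q v *m coef c g (co c q) *m (vec_in c q w)^T = v *m g q *m w^T.
move=> ac cq; have aq := chart_at_atlas q; have qq := chart_at_dom q.
rewrite /coef of_coordK // /vec_in.
set J := jacobian (chart_at q) c _; set J' := jacobian c (chart_at q) _.
have JJ : J *m J' = 1%:M.
  have := @jacobian_inv (chart_at q) c (co (chart_at q) q) aq ac (coimg_to qq cq). by rewrite of_coordK.
have E : v *m J *m (J' *m g q *m J'^T) = v *m (J *m J') *m g q *m J'^T by rewrite !mulmxA.
by rewrite E JJ mulmx1 trmx_mul !mulmxA -[_ *m J'^T *m _]mulmxA -trmx_mul JJ trmx1 mulmx1.
Qed.

Lemma to_coord_cvg c p : atlas c -> dom c p -> co c q @[q --> p] --> co c p.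
move=> ac cp; have [oc _ _ /subspace_continuousP cf _] := atlas_chart ac.
move=> U HU; have := cf p cp U HU; rewrite /within /=.
have : nbhs p (dom c) by exact: open_nbhs_nbhs.
by apply: filterS2 => q cq H; exact: H.
Qed.

End Charts.

Section ChartMaps.
Context {R : realType} (m : nat) (M E : manifold R m) (u : M -> E).
Hypothesis su : smooth_map u.
Implicit Types (c d : chart R m M) (e : chart R m E).

Lemma open_preim (V : set E) : open V -> open (u @^-1` V).
by move=> oV; apply: open_comp => // x _; have [cu _] := su; exact: cu. Qed.

Lemma map_sm c e : atlas c -> atlas e ->
  forall j, sm (coimg c (u @^-1` dom e)) (fun x => co e (u (pt c x)) 0 j).
by move=> ac ae j k; apply: smooth_CkA; have [_ H] := su; exact: H. Qed.

Lemma dcv_target c e e' x : atlas c -> atlas e -> atlas e' -> coimg c (u @^-1` (dom e `&` dom e')) x ->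
  dcv c (fun p => co e' (u p)) x = dcv c (fun p => co e (u p)) x *m jacobian e e' (co e (u (pt c x))).
move=> ac ae ae' xA; set A := coimg c _ in xA.
have oe := open_dom ae; have oe' := open_dom ae'.
have oW : open (u @^-1` (dom e `&` dom e')) by apply: open_preim; exact: openI.
have rA : regular A by exact: regular_coimg.
have rB : regular (coimg e (dom e')) by exact: regular_coimg.
have AB y : A y -> coimg e (dom e') (co e (u (pt c y))).
  by move=> /(coimgP _ _ ac)[cy [ey ey']]; exact: coimg_to.
have Cu j : CkA 1 A (fun y => co e (u (pt c y)) 0 j).
  by apply: CkA_sub (map_sm ac ae j 1) => y /(coimgP _ _ ac)[cy [ey _]]; apply/coimgP.
apply/matrixP => i k; rewrite mxE -(pd_coimg _ _ ac oW xA).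
have EE y : A y -> co e' (u (pt c y)) 0 k = co e' (pt e (co e (u (pt c y)))) 0 k.
  by move=> /(coimgP _ _ ac)[cy [ey _]]; rewrite of_coordK.
rewrite (pd_eq i xA EE).
rewrite (@pd_comp _ _ _ A (coimg e (dom e')) (fun y => co e' (pt e y) 0 k)
  (fun y => co e (u (pt c y)))) //; last exact: (trans_sm ae ae' k 1).
rewrite [RHS]mxE; bigr => j _.
by rewrite mulrC !mxE (pd_coimg _ _ ac oW xA) (pd_coimg _ _ ae oe') //; exact: AB.
Qed.

Lemma diff_mapE c e x : atlas c -> atlas e -> coimg c (u @^-1` dom e) x -> let q := pt c x in
  dcv c (fun p => co e (u p)) x = jacobian c (chart_at q) x *m diff_map u q
    *m jacobian (chart_at (u q)) e (co (chart_at (u q)) (u q)).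
move=> ac ae /(coimgP _ _ ac)[cx ex] q; have cq := cod_dom ac cx.
have aq := chart_at_atlas q; have qq := chart_at_dom q.
have auq := chart_at_atlas (u q); have uqq := chart_at_dom (u q).
have oe := open_dom ae; have ouq := open_dom auq.
have oU := open_preim oe; have oU' := open_preim ouq.
have xA : coimg c (dom (chart_at q) `&` u @^-1` dom e) x by apply/(coimgP _ _ ac).
rewrite (dcv_change ac aq oU xA); last by move=> k; exact: (map_sm aq ae k 1).
rewrite -mulmxA; congr (_ *m _); rewrite -/q.
rewrite (@dcv_target (chart_at q) (chart_at (u q)) e) ?of_coordK //.
by apply: coimg_to.
Qed.

Lemma diff_funE c (f : M -> R) x : smooth_fun f -> atlas c -> cod c x ->
  let q := pt c x in dcf c f x = diff_fun f q *m (jacobian c (chart_at q) x)^T.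
move=> sf ac cx q; have cq := cod_dom ac cx.
have aq := chart_at_atlas q; have qq := chart_at_dom q.
have xA : coimg c (dom (chart_at q) `&` setT) x by apply/(coimgP _ _ ac).
rewrite (dcf_change ac aq openT xA) //.
apply: CkA_coimg => //; first exact: openT.
exact: smooth_CkA (sf _ aq).
Qed.

End ChartMaps.

(** * Invariance of the coordinate formula for the mean curvature *)

Section Invariance.
Context {R : realType} (m : nat).
Implicit Types (A B O : set 'rV[R]_m.+1).

Lemma pdI n (A O : set 'rV[R]_n) f i x : open O -> A x -> O x -> pd (A `&` O) f i x = pd A f i x.
by move=> oO Ax Ox; apply: (@pd_local R n _ _ O) => // y Oy; split=> [[]|]. Qed.

Lemma christoffelI A O G k i j x : open O -> A x -> O x ->
  christoffel (A `&` O) G k i j x = christoffel A G k i j x.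
by move=> oO Ax Ox; rewrite /christoffel; congr (_ * _); bigr => l _; rewrite !pdI. Qed.

Lemma ricci_coordI A O G x : open O -> A x -> O x -> ricci_coord (A `&` O) G x = ricci_coord A G x.
move=> oO Ax Ox; apply/matrixP => i j; rewrite !mxE; congr (_ + _).
  bigr => k _; congr (_ - _); rewrite -(pdI _ _ oO Ax Ox);
  by apply: pd_eq => // y [Ay Oy]; apply: christoffelI.
by bigr => k _; bigr => l _; rewrite !christoffelI.
Qed.

Lemma mean_curvI A B O P u t Th N h g x : open O -> A x -> O x -> open P -> B (u x) -> P (u x) ->
  mean_curv (A `&` O) (B `&` P) u t Th N h g x = mean_curv A B u t Th N h g x.
move=> oO Ax Ox oP Bx Px; rewrite /mean_curv.
have jE (v : 'rV[R]_m.+1 -> 'rV[R]_m.+1) : jac (A `&` O) v x = jac A v x.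
  by apply/matrixP => i k; rewrite !mxE pdI.
have gE (f : 'rV[R]_m.+1 -> R) : grad (A `&` O) f x = grad A f x by apply/rowP => i; rewrite !mxE pdI.
have hE c : dmx (B `&` P) h c (u x) = dmx B h c (u x) by apply/matrixP => i k; rewrite !mxE pdI.
by rewrite !jE !gE; under eq_bigr => c _ do rewrite hE.
Qed.

Lemma jac_comp A B (k v v' : 'rV[R]_m.+1 -> 'rV[R]_m.+1) x : regular A -> regular B -> A x ->
  (forall y, A y -> B (k y)) -> (forall j, CkA 1 A (fun y => k y 0 j)) ->
  (forall j, CkA 1 B (fun y => v' y 0 j)) -> (forall y, A y -> v y = v' (k y)) ->
  jac A v x = jac A k x *m jac B v' (k x).
move=> rA rB Ax AB Ck Cv E; apply/matrixP => i l; rewrite !mxE.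
rewrite (@pd_eq _ _ A _ (fun y => v' (k y) 0 l)) //; last by move=> y Ay; rewrite E.
rewrite (@pd_comp _ _ _ A B (fun y => v' y 0 l) k) //.
by bigr => j _; rewrite !mxE mulrC.
Qed.

Lemma grad_comp A B (k : 'rV[R]_m.+1 -> 'rV[R]_m.+1) f f' x : regular A -> regular B -> A x ->
  (forall y, A y -> B (k y)) -> (forall j, CkA 1 A (fun y => k y 0 j)) ->
  CkA 1 B f' -> (forall y, A y -> f y = f' (k y)) -> grad A f x = grad B f' (k x) *m (jac A k x)^T.
move=> rA rB Ax AB Ck Cv E; apply/rowP => i; rewrite !mxE.
rewrite (@pd_eq _ _ A _ (fun y => f' (k y))) // (@pd_comp _ _ _ A B f' k) //.
by bigr => j _; rewrite !mxE mulrC.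
Qed.

Lemma invmx_mul p (X Y : 'M[R]_p) : X \in unitmx -> Y \in unitmx -> invmx (X *m Y) = invmx Y *m invmx X.
move=> uX uY; have uXY : X *m Y \in unitmx by rewrite unitmx_mul uX.
apply: (can_inj (mulKmx uXY)); rewrite mulmxV // -mulmxA (mulmxA Y) mulmxV // mul1mx mulmxV //.
Qed.

(** Every term is bilinear in the coordinate vectors of M: the bracket becomes J L J^T while g
    becomes J g' J^T, and the trace does not see J. *)
Lemma mean_curv_source A B A' (k u u' : 'rV[R]_m.+1 -> 'rV[R]_m.+1) t t' Th Th'
    (N N' : 'rV[R]_m.+1 -> 'rV[R]_m.+1) h g g' x :
  regular A -> regular A' -> A x -> (forall y, A y -> A' (k y)) ->
  (forall j, CkA 1 A (fun y => k y 0 j)) ->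
  (forall j, CkA 1 A' (fun y => u' y 0 j)) -> CkA 1 A' t' -> CkA 1 A' Th' ->
  (forall j, CkA 1 A' (fun y => N' y 0 j)) ->
  (forall y, A y -> u y = u' (k y)) -> (forall y, A y -> t y = t' (k y)) ->
  (forall y, A y -> Th y = Th' (k y)) -> (forall y, A y -> N y = N' (k y)) ->
  jac A k x \in unitmx -> g' (k x) \in unitmx -> g x = jac A k x *m g' (k x) *m (jac A k x)^T ->
  mean_curv A B u t Th N h g x = mean_curv A' B u' t' Th' N' h g' (k x).
move=> rA rA' Ax AA Ck Cu Ct CT CN uE tE TE NE uJ ug gE; rewrite /mean_curv.
rewrite (jac_comp rA rA' Ax AA Ck Cu uE) (jac_comp rA rA' Ax AA Ck CN NE).
rewrite (grad_comp rA rA' Ax AA Ck Ct tE) (grad_comp rA rA' Ax AA Ck CT TE).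
rewrite uE // NE // gE; move: (jac A k x) uJ => J uJ.
set U := jac A' u' _; set V := jac A' N' _; set h0 := h _; set D := \sum_c _.
set a := grad _ Th' _; set b := grad _ t' _.
have uJT : J^T \in unitmx by rewrite unitmx_tr.
rewrite !invmx_mul ?unitmx_mul ?uJ //; congr (_ * _).
set L := (X in _ = \tr (_ *m X)).
rewrite (_ : _ + _ = J *m L *m J^T); last first.
  by rewrite /L !(mulmxDr, mulmxDl) !trmx_mul !trmxK !mulmxA.
by rewrite -!mulmxA mxtrace_mulC -!mulmxA mulmxV // mulmx1 !mulmxA mulmxKV.
Qed.

(** The Jacobian K of the change of chart varies. The derivative of N' = N K contains U Q, where Q
    is the derivative of K along N by symmetry of second derivatives; the derivative of h = K h' K^T
    along N contains the same Q, and the two sides match. *)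
Lemma mean_curv_target A B B' k u u' t Th N N' h h' g x :
  regular A -> regular B -> regular B' -> A x -> (forall y, A y -> B (u y)) ->
  (forall y, B y -> B' (k y)) -> (forall j, sm A (fun y => u y 0 j)) ->
  (forall j, sm B (fun y => k y 0 j)) -> smx A N -> smx B' h' -> (forall y, B' y -> (h' y)^T = h' y) ->
  (forall y, A y -> u' y = k (u y)) -> (forall y, A y -> N' y = N y *m jac B k (u y)) ->
  (forall y, B y -> h y = jac B k y *m h' (k y) *m (jac B k y)^T) ->
  mean_curv A B u t Th N h g x = mean_curv A B' u' t Th N' h' g x.
move=> rA rB rB' Ax AB BB su sk sN sh h'T uE NE hE; rewrite /mean_curv.
have Bx := AB _ Ax.
have sK : smx B (jac B k).
  by move=> i j l; apply: (CkA_eq _ (sm_pd i rB (sk j) l)) => y By; rewrite mxE.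
have sKu : smx A (fun y => jac B k (u y)) by exact: smx_comp sK.
have shk : smx B (fun y => h' (k y)) by exact: smx_comp sh.
set U := jac A u x; set K := jac B k (u x); set h0 := h' (k (u x)).
pose Q := \sum_c N x 0 c *: dmx B (jac B k) c (u x).
have EU : jac A u' x = U *m K by apply: (jac_comp (B := B)) => // j; [exact: (su j 1)|exact: (sk j 1)].
have EV : jac A N' x = jac A N x *m K + U *m Q.
  apply/matrixP => i l; rewrite mxE (@pd_eq _ _ A _ (fun y => (N y *m jac B k (u y)) 0 l)) //; last first.
    by move=> y Ay; rewrite NE.
  rewrite -(dmxE A (fun y => N y *m jac B k (u y)) i x 0 l) (dmxM rA Ax i sN sKu) !mxDE.
  congr (_ + _); first by rewrite !mxE; bigr => j _; rewrite !mxE.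
  rewrite (dmx_comp rA Ax i rB AB su sK) !mxE.
  rewrite (eq_bigr (fun j => \sum_a N x 0 j * (U i a * pd B (fun y => jac B k y j l) a (u x)))); last first.
    by move=> j _; rewrite summxE mulr_sumr; bigr => a _; rewrite !mxE.
  rewrite exchange_big; bigr => a _; rewrite summxE mulr_sumr; bigr => j _.
  rewrite [in RHS]mxE [in RHS]mxE mulrCA; congr (_ * (_ * _)); first by rewrite [LHS]mxE.
  rewrite [RHS]mxE.
  rewrite (@pd_eq _ _ B _ (pd B (fun y => k y 0 l) j)) //; last by move=> y By; rewrite mxE.
  rewrite (pdC _ _ rB Bx (sk l 2)); apply: pd_eq => // y By; by rewrite mxE.
have ED : \sum_c N x 0 c *: dmx B h c (u x) =
    Q *m h0 *m K^T + K *m (\sum_d N' x 0 d *: dmx B' h' d (k (u x))) *m K^T + K *m h0 *m Q^T.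
  have E c : dmx B h c (u x) = dmx B (jac B k) c (u x) *m h0 *m K^T
      + K *m (\sum_d K c d *: dmx B' h' d (k (u x))) *m K^T
      + K *m h0 *m (dmx B (jac B k) c (u x))^T.
    rewrite (dmx_eq (H := fun y => jac B k y *m h' (k y) *m (jac B k y)^T) Bx c hE).
    rewrite (dmxM rB Bx c (smxM sK shk) (smxT sK)) (dmxM rB Bx c sK shk) dmxT.
    rewrite (dmx_comp rB Bx c rB' BB sk sh) !mulmxDl; congr (_ + _ *m _ *m _ + _).
    by bigr => d _; rewrite !mxE.
  under eq_bigr => c _ do rewrite E !scalerDr. rewrite !big_split /=; congr (_ + _ + _).
  - by rewrite /Q !mulmx_suml; bigr => c _; rewrite !scalemxAl.
  - rewrite (eq_bigr (fun c => K *m (N x 0 c *: (\sum_d K c d *: dmx B' h' d (k (u x)))) *m K^T)); last first.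
      by move=> c _; rewrite -scalemxAr -scalemxAl.
    rewrite -mulmx_suml -mulmx_sumr; congr (_ *m _ *m _).
    rewrite (eq_bigr (fun c => \sum_d N x 0 c *: (K c d *: dmx B' h' d (k (u x))))); last first.
      by move=> c _; exact: (@scaler_sumr _ ('M[R]_m.+1 : lmodType R)).
    rewrite exchange_big; bigr => d _; rewrite NE // mxE scaler_suml. by bigr => c _; rewrite scalerA.
  - rewrite /Q linear_sum mulmx_sumr; bigr => c _.
    by rewrite linearZ /= scalemxAr.
rewrite EU EV ED (hE _ Bx) uE // -/K -/h0; congr (_ * _); congr (\tr (_ *m (_ + _))).
set D' := \sum_d _.
have h0T : h0^T = h0 by apply: h'T; apply: BB.
rewrite !(mulmxDr, mulmxDl) !trmx_mul !trmxD !trmx_mul !trmxK !mulmxA h0T; mxlin.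
Qed.

End Invariance.

(** * Riemannian metrics in charts *)

Section Riemannian.
Context {R : realType}.

Lemma dotE n (G : 'M[R]_n) v w : dot G v w = \sum_i \sum_j v 0 i * w 0 j * G i j.
rewrite /dot mxE exchange_big; bigr => j _; rewrite !mxE mulr_suml; bigr => i _.
by rewrite mulrAC.
Qed.

Lemma dot_scalar n (a : R) (v : 'rV[R]_n) : dot a%:M v v = a * enorm v ^+ 2.
rewrite /dot mul_mx_scalar -scalemxAl mxE enorm_sqr; congr (_ * _).
by rewrite mxE; bigr => i _; rewrite mxE expr2.
Qed.

(** The segment from G to the identity consists of positive definite matrices, so det has no zero on
    it; were det G <= 0, the intermediate value theorem for polynomials would give one. *)
Lemma posdef_det n (G : 'M[R]_n) : (forall v, v != 0 -> 0 < dot G v v) -> 0 < \det G.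
move=> pG; rewrite ltNge; apply/negP => dG.
pose P := (1 - 'X) *: map_mx polyC G + 'X%:M.
have PE t : (\det P).[t] = \det ((1 - t) *: G + t%:M).
  rewrite -[LHS]/(horner_eval t _) -det_map_mx; congr (\det _).
  apply/matrixP => i j; rewrite /P !mxE /= /horner_eval.
  by case: (i == j); rewrite ?mulr1n ?mulr0n ?hornerE.
have [] := @poly_ivt _ (\det P) 0 1 ler01.
  by rewrite !PE subr0 scale1r subrr scale0r add0r raddf0 addr0 dG det1 ler01.
move=> t /andP[t0 t1] /rootP; rewrite PE => /eqP /det0P[v v0].
move=> E; have : dot ((1 - t) *: G + t%:M) v v = 0 by rewrite /dot E mul0mx mxE.
have -> : dot ((1 - t) *: G + t%:M) v v = (1 - t) * dot G v v + t * enorm v ^+ 2.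
  by rewrite -dot_scalar /dot mulmxDr mulmxDl mxE -scalemxAr -scalemxAl mxE.
have := pG _ v0; have : 0 < enorm v ^+ 2 by rewrite exprn_gt0 // enorm_gt0.
move: (dot G v v) (enorm v ^+ 2) => a b b0 a0 /eqP; apply/negP; rewrite gt_eqF //.
have [t'|t'] := ltP 0 t; first by rewrite ltr_wpDl ?mulr_ge0 ?mulr_gt0 ?subr_ge0 // ltW.
have -> : t = 0 by apply/eqP; rewrite eq_le t' t0.
by rewrite subr0 mul1r mul0r addr0.
Qed.

Variables (m : nat) (M : manifold R m) (g : metric_field M).

(* Weaker than riemannian: the C^k extensions past the boundary may depend on k. *)
Definition smooth_metric : Prop := [/\ forall p, (g p)^T = g p, forall p v, v != 0 -> 0 < dot (g p) v v &
      forall c, atlas c -> smx (cod c) (coef c g)].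

Lemma riemannian_smooth : riemannian g -> smooth_metric.
by case=> gT gp sg; split=> // c ac i j k; apply: smooth_CkA; exact: sg. Qed.

Hypothesis rg : smooth_metric.
Implicit Types (c d : chart R m M).

Lemma coef_sym c x : (coef c g x)^T = coef c g x.
by case: rg => gT _ _; rewrite /coef !trmx_mul trmxK gT mulmxA. Qed.

Lemma coef_pos c x v : atlas c -> cod c x -> v != 0 -> 0 < dot (coef c g x) v v.
move=> ac cx v0; set q := pt c x; have cq := cod_dom ac cx.
have uJ : jacobian c (chart_at q) x \in unitmx.
  apply: jacobian_unit => //; first exact: chart_at_atlas.
  by apply/(coimgP _ _ ac); split=> //; exact: chart_at_dom.
rewrite /dot /coef -/q !mulmxA -(mulmxA _ _ v^T) -trmx_mul.
case: rg => _ pg _; apply: pg; apply: contraNneq v0 => E.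
by rewrite -(mulmxK uJ v) E mul0mx.
Qed.

Lemma coef_det c x : atlas c -> cod c x -> 0 < \det (coef c g x).
by move=> ac cx; apply: posdef_det => v; exact: coef_pos. Qed.

Lemma coef_unit c x : atlas c -> cod c x -> coef c g x \in unitmx.
by move=> ac cx; rewrite unitmxE unitfE gt_eqF ?coef_det. Qed.

Lemma coef_sm c : atlas c -> smx (cod c) (coef c g).
by case: rg => _ _; exact. Qed.

End Riemannian.

Section LocalCharts.
Context {R : realType} (m : nat).

Lemma coimg_dom (M : manifold R m) (c : chart R m M) : coimg c (dom c) = cod c.
by rewrite /coimg setIid. Qed.

Lemma coimg_sm (M : manifold R m) (c : chart R m M) U f : atlas c -> open U ->
  sm (cod c) f -> sm (coimg c U) f.
by move=> ac oU sf k; apply: CkA_coimg. Qed.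

Lemma coimg_cod (M : manifold R m) (c : chart R m M) U x : atlas c -> coimg c U x -> cod c x.
by move=> ac /(coimgP _ _ ac)[]. Qed.

Lemma ricci_coimg (M : manifold R m) (c : chart R m M) U G x : atlas c -> open U -> coimg c U x ->
  ricci_coord (coimg c U) G x = ricci_coord (cod c) G x.
move=> ac oU; have [W oW ->] := coimg_open ac oU => -[cx Wx].
by rewrite ricci_coordI.
Qed.

Lemma mean_curv_coimg (M E : manifold R m) (c : chart R m M) (e : chart R m E) U V
    (u : 'rV[R]_m.+1 -> 'rV[R]_m.+1) t Th N h g x :
  atlas c -> atlas e -> open U -> open V -> coimg c U x -> coimg e V (u x) ->
  mean_curv (coimg c U) (coimg e V) u t Th N h g x = mean_curv (cod c) (cod e) u t Th N h g x.
move=> ac ae oU oV; have [W oW ->] := coimg_open ac oU; have [W' oW' ->] := coimg_open ae oV.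
by move=> [cx Wx] [ex Wx']; rewrite mean_curvI.
Qed.

Lemma trans_jac (M : manifold R m) (c d : chart R m M) U x : atlas c -> open U -> coimg c U x ->
  jac (coimg c U) (fun y => co d (pt c y)) x = jacobian c d x.
by move=> ac oU xU; apply/matrixP => i j; rewrite !mxE pd_coimg. Qed.

Variables (M : manifold R m) (g : metric_field M).
Hypothesis rg : smooth_metric g.

(* Special case of the divergence identity: a chart transition, tau = 0, Theta = 1, N = 0. *)
Lemma scal_chart (c : chart R m M) x : atlas c -> cod c x ->
  \sum_i \sum_j invmx (coef c g x) i j * ricci_coord (cod c) (coef c g) x i j = scal g (pt c x).
move=> ac cx; set q := pt c x; pose d := chart_at q.
have ad : atlas d := chart_at_atlas q; have dq : dom d q := chart_at_dom q.
have od := open_dom ad; have oc := open_dom ac.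
set A := coimg c (dom d); set B := coimg d (dom c).
have rA : regular A by exact: regular_coimg.
have rB : regular B by exact: regular_coimg.
pose k y := co d (pt c y).
have Ax : A x by apply/(coimgP _ _ ac).
have AB y : A y -> B (k y).
  move=> /(coimgP _ _ ac)[cy dy]; apply/(coimgP _ _ ad); split; first exact: dom_cod.
  by rewrite /k of_coordK //; exact: cod_dom.
have kx : k x = co d q by [].
have sk := trans_sm ac ad.
have s0 a : sm A (fun=> a) by move=> l; exact: CkA_cst.
have N0 : smx A (fun=> 0 : 'rV[R]_m.+1) by move=> i j l; apply: CkA_cst.
have sB : smx B (coef d g) by move=> i j; apply: coimg_sm => //; exact: coef_sm.
have sT y : B y -> (coef d g y)^T = coef d g y by move=> _; exact: coef_sym.
have uB y : B y -> coef d g y \in unitmx by move=> /(coimg_cod ad); exact: coef_unit.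
have uA y : A y -> coef c g y \in unitmx by move=> /(coimg_cod ac); exact: coef_unit.
have g0 y : A y -> grad A (fun=> 0) y = 0.
  by move=> Ay; apply/rowP => i; rewrite !mxE pd_cst.
have gE y : A y -> coef c g y = jac A k y *m coef d g (k y) *m (jac A k y)^T
    + (grad A (fun=> 0) y)^T *m grad A (fun=> 0) y.
  by move=> Ay; rewrite g0 // trmx0 mul0mx addr0 trans_jac // -coef_change.
have NN y : A y -> ((0 : 'rV[R]_m.+1) *m coef d g (k y) *m (0 : 'rV[R]_m.+1)^T) 0 0 + 1 ^+ 2 = 1 :> R.
  by move=> _; rewrite !mul0mx mxE add0r expr1n.
have NT y : A y -> (0 : 'rV[R]_m.+1) *m coef d g (k y) *m (jac A k y)^T + (1 : R) *: grad A (fun=> 0) y = 0.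
  by move=> Ay; rewrite g0 // !mul0mx scaler0 addr0.
have := divergence_identity rA rB AB sk (s0 0) (s0 1) N0 sB sT uB gE uA NN NT Ax.
set w := fun j z => _.
have w0 j z : A z -> w j z = 0 by move=> Az; rewrite /w !pd_cst // mulr0 addr0.
rewrite /divcov big1 => [|i _]; last first.
  apply: big1 => j _; rewrite (@pd_eq _ _ A _ (fun=> 0)) ?pd_cst //; last by move=> z; exact: w0.
  by rewrite big1 ?subr0 ?mulr0 // => l _; rewrite w0 // mulr0.
rewrite mul1r [X in _ + X]big1 ?addr0; last by move=> i _; apply: big1 => j _; rewrite mxE !mul0r.
move=> /esym/eqP; rewrite subr_eq0 => /eqP.
have -> : ricci_coord A (coef c g) x = ricci_coord (cod c) (coef c g) x by exact: ricci_coimg.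
have -> : ricci_coord B (coef d g) (k x) = ricci_coord (cod d) (coef d g) (k x).
  by apply: ricci_coimg => //; exact: AB.
by move=> ->; rewrite kx /d coef_self.
Qed.

End LocalCharts.

(** * The hypersurface and its field in charts *)

Section Hyper.
Context {R : realType} (m : nat) (M E : manifold R m) (I : interval R).
Variables (h : metric_field E) (u : M -> E) (tau : M -> R).
Variables (Nt : M -> 'rV[R]_m.+1) (Theta : M -> R).
Hypotheses (hh : smooth_metric h) (himm : immersion I u tau) (hN : unit_normal h u tau Nt Theta).
Implicit Types (c d : chart R m M) (e : chart R m E).
Let g := induced_metric h u tau.

Definition map_in c e (y : 'rV[R]_m.+1) := co e (u (pt c y)).
Definition fun_in c (f : M -> R) (y : 'rV[R]_m.+1) := f (pt c y).
Definition normal_in c e (y : 'rV[R]_m.+1) := vec_in e (u (pt c y)) (Nt (pt c y)).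
Definition dom2 c e := coimg c (u @^-1` dom e).

Lemma su : smooth_map u. by case: himm. Qed.

Lemma dom2P c e x : atlas c -> dom2 c e x <-> cod c x /\ dom e (u (pt c x)).
by move=> ac; exact: coimgP. Qed.

Lemma open_dom2 e : atlas e -> open (u @^-1` dom e).
by move=> ae; apply: (open_preim su); exact: open_dom. Qed.

Lemma regular_dom2 c e : atlas c -> atlas e -> regular (dom2 c e).
by move=> ac ae; apply: regular_coimg => //; exact: open_dom2. Qed.

Lemma dom2_map c e y : atlas c -> dom2 c e y -> cod e (map_in c e y).
by move=> ac /(dom2P _ _ ac)[cy ey]; exact: dom_cod. Qed.

Lemma fun_sm c f : smooth_fun f -> atlas c -> sm (cod c) (fun_in c f).
by move=> sf ac k; apply: smooth_CkA; exact: sf. Qed.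

Lemma fun_sm2 c e f : smooth_fun f -> atlas c -> atlas e -> sm (dom2 c e) (fun_in c f).
by move=> sf ac ae; apply: coimg_sm => //; [exact: open_dom2|exact: fun_sm]. Qed.

Lemma normal_sm c e : atlas c -> atlas e -> smx (dom2 c e) (normal_in c e).
by case: hN => sN _ _ _ ac ae i j k; rewrite ord1; apply: smooth_CkA; exact: sN. Qed.

Lemma tau_sm : smooth_fun tau. by case: himm. Qed.
Lemma Theta_sm : smooth_fun Theta. by case: hN. Qed.

Lemma jac_map c e x : atlas c -> atlas e -> dom2 c e x ->
  jac (dom2 c e) (map_in c e) x = dcv c (fun p => co e (u p)) x.
by move=> ac ae xA; apply/matrixP => i j; rewrite !mxE pd_coimg //; exact: open_dom2.
Qed.

Lemma grad_fun c e f x : atlas c -> atlas e -> dom2 c e x -> grad (dom2 c e) (fun_in c f) x = dcf c f x.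
by move=> ac ae xA; apply/rowP => i; rewrite !mxE pd_coimg //; exact: open_dom2. Qed.

Lemma coef_target e q : atlas e -> dom e q -> let K := jacobian (chart_at q) e (co (chart_at q) q) in
  h q = K *m coef e h (co e q) *m K^T.
move=> ae eq K; have aq := chart_at_atlas q; have qq := chart_at_dom q.
rewrite -[LHS]coef_self (coef_change h aq ae) ?of_coordK //.
exact: coimg_to.
Qed.

Lemma induced_in c e y : atlas c -> atlas e -> dom2 c e y ->
  coef c g y = jac (dom2 c e) (map_in c e) y *m coef e h (map_in c e y)
      *m (jac (dom2 c e) (map_in c e) y)^T
    + (grad (dom2 c e) (fun_in c tau) y)^T *m grad (dom2 c e) (fun_in c tau) y.
move=> ac ae yA; have [cy ey] := (dom2P e y ac).1 yA.
rewrite jac_map // grad_fun // (diff_mapE su ac ae yA) (diff_funE tau_sm ac cy).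
rewrite /coef /g /induced_metric; set q := pt c y.
rewrite (coef_target ae ey); set J := jacobian c _ y.
by rewrite !trmx_mul trmxK !(mulmxDr, mulmxDl) !mulmxA.
Qed.

Lemma normal_norm c e y : atlas c -> atlas e -> dom2 c e y ->
  (normal_in c e y *m coef e h (map_in c e y) *m (normal_in c e y)^T) 0 0 + fun_in c Theta y ^+ 2 = 1.
move=> ac ae /(dom2P _ _ ac)[cy ey]; rewrite /normal_in /map_in dot_vec_in //.
by case: hN => _ _ E1 _; exact: E1.
Qed.

Lemma normal_tangent c e y : atlas c -> atlas e -> dom2 c e y ->
  normal_in c e y *m coef e h (map_in c e y) *m (jac (dom2 c e) (map_in c e) y)^T
    + fun_in c Theta y *: grad (dom2 c e) (fun_in c tau) y = 0.
move=> ac ae yA; have [cy ey] := (dom2P e y ac).1 yA.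
rewrite jac_map // grad_fun // (diff_mapE su ac ae yA) (diff_funE tau_sm ac cy).
set q := pt c y; have hq := coef_target ae ey.
rewrite /normal_in /vec_in -/q; move: hq; rewrite -/q /map_in -/q.
set K := jacobian _ e _; set h' := coef e h _ => hq; set J := jacobian c _ y.
have -> : Nt q *m K *m h' *m (J *m diff_map u q *m K)^T + fun_in c Theta y *: (diff_fun tau q *m J^T)
   = (Nt q *m h (u q) *m (diff_map u q)^T + Theta q *: diff_fun tau q) *m J^T.
  by rewrite hq !trmx_mul mulmxDl -scalemxAl !mulmxA.
suff -> : Nt q *m h (u q) *m (diff_map u q)^T + Theta q *: diff_fun tau q = 0 by rewrite mul0mx.
case: hN => _ _ _ NE; apply/rowP => i; rewrite [RHS]mxE; have := NE q i; rewrite /dot mxDE mxZE => <-.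
by congr (_ + _); rewrite tr_row colE mulmxA -colE !mxE.
Qed.

Lemma induced_dot p v : dot (g p) v v = dot (h (u p)) (v *m diff_map u p) (v *m diff_map u p)
  + ((v *m (diff_fun tau p)^T) 0 0) ^+ 2.
rewrite /dot /g /induced_metric mulmxDr mulmxDl mxDE; congr (_ + _).
  by rewrite trmx_mul !mulmxA.
rewrite expr2 !mulmxA -(mulmxA _ (diff_fun _ _)).
rewrite [LHS]mxE big_ord1; congr (_ * _).
by rewrite !mxE; bigr => j _; rewrite !mxE mulrC.
Qed.

Lemma induced_pos p v : v != 0 -> 0 < dot (g p) v v.
move=> v0; have [_ _ _ rf] := himm; have {}rf := rf p; rewrite induced_dot.
have [pE|E0] := eqVneq (v *m diff_map u p) 0; last first.
  by case: hh => _ ph _; rewrite ltr_wpDr ?sqr_ge0 // ph.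
rewrite pE /dot !mul0mx mxE add0r exprn_even_gt0 //=.
apply: contraNneq v0 => t0; apply/eqP; apply: (row_free_inj rf).
rewrite mul0mx mul_mx_row pE [v *m _ ^T](_ : _ = 0) ?row_mx0 //.
by apply/rowP => i; rewrite ord1 t0 mxE.
Qed.

Lemma chartsE c y : atlas c -> cod c y -> exists2 e, atlas e & dom2 c e y.
move=> ac cy; exists (chart_at (u (pt c y))); first exact: chart_at_atlas.
by apply/(dom2P _ _ ac); split=> //; exact: chart_at_dom.
Qed.

Lemma sm_cod2 c f : atlas c -> (forall e, atlas e -> sm (dom2 c e) f) -> sm (cod c) f.
move=> ac sf k; apply: CkA_local => y cy; have [e ae yA] := chartsE ac cy.
have [W oW E'] := coimg_open ac (open_dom2 ae); exists W; split=> //.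
  by move: yA; rewrite /dom2 E' => -[].
by rewrite -E'; exact: sf.
Qed.

Lemma induced_sm2 c e : atlas c -> atlas e -> smx (dom2 c e) (coef c g).
move=> ac ae; have rA := regular_dom2 ac ae; have sU := map_sm su ac ae.
apply: (smx_eq (G := fun y => jac (dom2 c e) (map_in c e) y *m coef e h (map_in c e y)
      *m (jac (dom2 c e) (map_in c e) y)^T
    + (grad (dom2 c e) (fun_in c tau) y)^T *m grad (dom2 c e) (fun_in c tau) y)).
  by move=> y yA; rewrite -induced_in.
have sJ : smx (dom2 c e) (jac (dom2 c e) (map_in c e)).
  by move=> i j k; apply: (CkA_eq _ (sm_pd i rA (sU j) k)) => y By; rewrite mxE.
have sG : smx (dom2 c e) (grad (dom2 c e) (fun_in c tau)).
  by move=> i j k; apply: (CkA_eq _ (sm_pd j rA (fun_sm2 tau_sm ac ae) k)) => y By; rewrite mxE.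
apply: smxD; last by apply: smxM => //; exact: smxT.
apply: smxM; last exact: smxT.
apply: smxM => //; apply: (smx_comp (B := cod e)) => //; last exact: coef_sm.
by move=> y; exact: dom2_map.
Qed.

Lemma induced_smooth : smooth_metric g.
split; last 1 first.
- by move=> c ac i j; apply: sm_cod2 => // e ae; exact: induced_sm2.
- move=> p; rewrite /g /induced_metric trmxD !trmx_mul !trmxK.
  by case: hh => hT _ _; rewrite hT mulmxA.
- exact: induced_pos.
Qed.

Definition mean_curv_in c e := mean_curv (cod c) (cod e) (map_in c e)
  (fun_in c tau) (fun_in c Theta) (normal_in c e) (coef e h) (coef c g).

Lemma mean_curv_inE c e V x : atlas c -> atlas e -> open V -> V `<=` u @^-1` dom e -> coimg c V x ->
  mean_curv_in c e x = mean_curv (coimg c V) (cod e) (map_in c e)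
    (fun_in c tau) (fun_in c Theta) (normal_in c e) (coef e h) (coef c g) x.
move=> ac ae oV Ve xA; have [cx Vx] := (coimgP _ _ ac).1 xA; have oe := open_dom ae.
rewrite -[in RHS](coimg_dom e) mean_curv_coimg //.
by apply/(coimgP _ _ ae); rewrite /map_in of_coordK; [split; [apply: dom_cod|]|..] => //; exact: Ve.
Qed.

(** The chart of E is changed first with c fixed, and the chart of M afterwards; V is the part of M
    where all four charts are available. *)
Lemma mean_curv_in_change c c' e e' p : atlas c -> atlas c' -> atlas e -> atlas e' ->
  dom c p -> dom c' p -> dom e (u p) -> dom e' (u p) ->
  mean_curv_in c e (co c p) = mean_curv_in c' e' (co c' p).
move=> ac ac' ae ae' cp cp' ep ep'; set x := co c p.
have [oc oc'] := (open_dom ac, open_dom ac'); have [oe oe'] := (open_dom ae, open_dom ae').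
have cx : cod c x by exact: dom_cod.
have xp : pt c x = p by rewrite /x of_coordK.
pose V := dom c' `&` u @^-1` (dom e `&` dom e').
have oV : open V by apply: openI => //; apply: (open_preim su); exact: openI.
have xV : coimg c V x by apply/(coimgP _ _ ac); rewrite xp.
have rV : regular (coimg c V) by exact: regular_coimg.
have xe : dom2 c e x by apply/(dom2P _ _ ac); rewrite xp.
have xe' : dom2 c e' x by apply/(dom2P _ _ ac); rewrite xp.
have sV f (d : chart R m E) : atlas d -> V `<=` u @^-1` dom d -> sm (dom2 c d) f -> sm (coimg c V) f.
  move=> ad Vd sf k; apply: CkA_sub (sf k) => y /(coimgP _ _ ac)[cy Vy].
  by apply/(dom2P _ _ ac); split=> //; exact: Vd.
have Ve : V `<=` u @^-1` dom e by move=> y [_ []].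
have Ve' : V `<=` u @^-1` dom e' by move=> y [_ []].
transitivity (mean_curv_in c e' x).
  rewrite (mean_curv_inE ac ae oV Ve xV) (mean_curv_inE ac ae' oV Ve' xV).
  have ex : coimg e (dom e') (map_in c e x).
    by apply/(coimgP _ _ ae); rewrite /map_in xp of_coordK //; split=> //; exact: dom_cod.
  rewrite -[cod e](coimg_dom e).
  have E1 : mean_curv (coimg c V) (coimg e (dom e)) (map_in c e) (fun_in c tau)
     (fun_in c Theta) (normal_in c e) (coef e h) (coef c g) x =
   mean_curv (coimg c V) (coimg e (dom e')) (map_in c e) (fun_in c tau)
     (fun_in c Theta) (normal_in c e) (coef e h) (coef c g) x.
    rewrite !mean_curv_coimg // coimg_dom; exact: coimg_cod ex.
  apply: (etrans E1); clear E1; apply: (mean_curv_target (k := fun y => co e' (pt e y))).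
  - exact: rV.
  - exact: regular_coimg.
  - exact: regular_cod.
  - exact: xV.
  - move=> y /(coimgP _ _ ac)[cy [_ [ey ey']]]; apply/(coimgP _ _ ae).
    by rewrite /map_in of_coordK //; split=> //; exact: dom_cod.
  - by move=> y /(coimgP _ _ ae)[ey ey']; exact: dom_cod.
  - by move=> j; apply: (sV _ _ ae Ve); exact: (map_sm su ac ae).
  - by move=> j; exact: trans_sm.
  - by move=> a b; apply: (sV _ _ ae Ve); exact: normal_sm.
  - exact: coef_sm.
  - by move=> y _; exact: coef_sym.
  - by move=> y /(coimgP _ _ ac)[cy [_ [ey _]]]; rewrite /map_in of_coordK.
  - move=> y /(coimgP _ _ ac)[cy [_ [ey ey']]]; rewrite /normal_in /map_in trans_jac //; last first.
      by apply/(coimgP _ _ ae); rewrite of_coordK //; split=> //; exact: dom_cod.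
    by rewrite (@vec_in_change _ _ _ e).
  - by move=> y ye; rewrite trans_jac // -coef_change.
rewrite (mean_curv_inE ac ae' oV Ve' xV).
have x'V : dom2 c' e' (co c' p) by apply/(dom2P _ _ ac'); rewrite of_coordK //; split=> //; exact: dom_cod.
rewrite (mean_curv_inE ac' ae' (open_dom2 ae') (fun _ => id) x'V).
have kx : co c' p = co c' (pt c x) by rewrite xp.
rewrite kx -/(dom2 c' e').
have kV y : coimg c V y -> dom2 c' e' (co c' (pt c y)).
  move=> /(coimgP _ _ ac)[cy [c'y [_ ey']]]; apply/(dom2P _ _ ac').
  by rewrite of_coordK //; split=> //; exact: dom_cod.
have xc' : coimg c (dom c') x by apply/(coimgP _ _ ac); rewrite xp.
apply: (@mean_curv_source _ _ _ _ _ (fun y => co c' (pt c y))).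
- exact: rV.
- exact: regular_dom2.
- exact: xV.
- exact: kV.
- by move=> j; apply: CkA_sub (trans_sm ac ac' j 1) => y /(coimgP _ _ ac)[cy [c'y _]]; apply/(coimgP _ _ ac).
- by move=> j; exact: (map_sm su ac' ae' j 1).
- exact: (fun_sm2 tau_sm ac' ae' 1).
- exact: (fun_sm2 Theta_sm ac' ae' 1).
- by move=> j; exact: (normal_sm ac' ae' 0 j 1).
- by move=> y /(coimgP _ _ ac)[cy [c'y _]]; rewrite /map_in of_coordK.
- by move=> y /(coimgP _ _ ac)[cy [c'y _]]; rewrite /fun_in of_coordK.
- by move=> y /(coimgP _ _ ac)[cy [c'y _]]; rewrite /fun_in of_coordK.
- by move=> y /(coimgP _ _ ac)[cy [c'y _]]; rewrite /normal_in of_coordK.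
- by rewrite trans_jac //; exact: jacobian_unit.
- by apply: coef_unit => //; [exact: induced_smooth|apply: (coimg_cod (U := u @^-1` dom e')) => //; exact: kV].
- by rewrite trans_jac // -coef_change.
Qed.

Lemma sm_mean_curv_in c e : atlas c -> atlas e -> sm (dom2 c e) (mean_curv_in c e).
move=> ac ae; have rA := regular_dom2 ac ae; have sU := map_sm su ac ae.
have sJ (v : 'rV[R]_m.+1 -> 'rV[R]_m.+1) : (forall j, sm (dom2 c e) (fun y => v y 0 j)) -> smx (dom2 c e) (jac (dom2 c e) v).
  by move=> sv i j k; apply: (CkA_eq _ (sm_pd i rA (sv j) k)) => y By; rewrite mxE.
have sG f : sm (dom2 c e) f -> smx (dom2 c e) (grad (dom2 c e) f).
  by move=> sf i j k; apply: (CkA_eq _ (sm_pd j rA (sf) k)) => y By; rewrite mxE.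
have sN := normal_sm ac ae; have sh := coef_sm hh ae.
have rB := regular_cod ae.
have sgi : smx (dom2 c e) (fun y => invmx (coef c g y)).
  apply: smx_inv; last exact: induced_sm2.
  by move=> y /(coimg_cod ac); apply: coef_unit => //; exact: induced_smooth.
have sJU := sJ _ sU; have sJN := sJ _ (sN 0).
have sc p q (G : 'rV[R]_m.+1 -> 'M[R]_(p, q)) : smx (cod e) G -> smx (dom2 c e) (fun y => G (map_in c e y)).
  by apply: smx_comp => // y; exact: dom2_map.
have sT := sG _ (fun_sm2 tau_sm ac ae); have sTh := sG _ (fun_sm2 Theta_sm ac ae).
have sL : smx (dom2 c e) (fun y => invmx (coef c g y) *m
   (jac (dom2 c e) (normal_in c e) y *m coef e h (map_in c e y) *m (jac (dom2 c e) (map_in c e) y)^T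
   + (jac (dom2 c e) (normal_in c e) y *m coef e h (map_in c e y) *m (jac (dom2 c e) (map_in c e) y)^T)^T
     + jac (dom2 c e) (map_in c e) y *m
       (\sum_k normal_in c e y 0 k *: dmx (cod e) (coef e h) k (map_in c e y))
        *m (jac (dom2 c e) (map_in c e) y)^T
     + ((grad (dom2 c e) (fun_in c Theta) y)^T *m grad (dom2 c e) (fun_in c tau) y
       + (grad (dom2 c e) (fun_in c tau) y)^T *m grad (dom2 c e) (fun_in c Theta) y))).
  have sNhU : smx (dom2 c e) (fun y => jac (dom2 c e) (normal_in c e) y
      *m coef e h (map_in c e y) *m (jac (dom2 c e) (map_in c e) y)^T).
    by apply: smxM; [apply: smxM => //; exact: sc|exact: smxT].
  apply: smxM => //; apply: smxD; [apply: smxD; [apply: smxD => //; exact: smxT|]|].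
    apply: smxM; [apply: smxM => //|exact: smxT].
    by apply: smx_sum => k; apply: smxZ; [exact: (sN 0 k)|apply: (sc _ _ (dmx (cod e) (coef e h) k)); exact: smx_dmx].
  by apply: smxD; apply: smxM => //; exact: smxT.
move=> k; apply: (@CkA_eq _ _ k _ (mean_curv (dom2 c e) (cod e) (map_in c e)
  (fun_in c tau) (fun_in c Theta) (normal_in c e) (coef e h) (coef c g))).
  by move=> y yA; rewrite -(mean_curv_inE ac ae (open_dom2 ae) (fun _ => id)).
by apply: CkAM; [exact: CkA_cst|apply: CkA_sum => i _; exact: sL].
Qed.

(** Each point uses its own pair of charts. Smoothness of H comes from [HE], which reads it near a
    point in one fixed pair. *)
Definition H p := mean_curv_in (chart_at p) (chart_at (u p)) (co (chart_at p) p).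

Lemma HE c e y : atlas c -> atlas e -> dom2 c e y -> H (pt c y) = mean_curv_in c e y.
move=> ac ae /(dom2P _ _ ac)[cy ey]; set q := pt c y.
rewrite -[y in RHS](to_coordK ac cy); apply: mean_curv_in_change => //;
  do ?[exact: chart_at_atlas|exact: chart_at_dom]; exact: cod_dom.
Qed.

Lemma H_sm c : atlas c -> sm (cod c) (fun_in c H).
move=> ac; apply: sm_cod2 => // e ae k; apply: (CkA_eq _ (sm_mean_curv_in ac ae k)) => y yA.
by rewrite /fun_in (HE ac ae yA).
Qed.

Definition form_in c (j : 'I_m.+1) y :=
  fun_in c H y * pd (cod c) (fun_in c tau) j y + pd (cod c) (fun_in c Theta) j y.

(** The vector field dual to the covector field, multiplied by sqrt(det g): its coordinate
    divergence is the divergence times the volume density. *)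
Definition field_in c (i : 'I_m.+1) y :=
  sqrdet (coef c g y) * \sum_j invmx (coef c g y) i j * form_in c j y.

Lemma form_sm c j : atlas c -> sm (cod c) (form_in c j).
move=> ac; have rc := regular_cod ac => k.
apply: CkAD; first apply: CkAM; first exact: H_sm.
  exact: (sm_pd j rc (fun_sm tau_sm ac)).
exact: (sm_pd j rc (fun_sm Theta_sm ac)).
Qed.

Lemma field_sm c i : atlas c -> sm (cod c) (field_in c i).
move=> ac k; have sg := coef_sm induced_smooth ac; apply: CkAM.
  by apply: CkA_sqrt => [y cy|]; [apply: coef_det => //; exact: induced_smooth|exact: sm_det].
apply: CkA_sum => j _; apply: CkAM; last exact: form_sm.
by apply: smx_inv => // y cy; apply: coef_unit => //; exact: induced_smooth.
Qed.

Definition defect p := Theta p * (scal g p - scal h (u p) + dot (ricci h (u p)) (Nt p) (Nt p)).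

(** The local identity concerns the trace of the second fundamental form in the charts c and e; [HE]
    and [mean_curvE] identify it with the function H. The curvature terms are read in the base
    charts through [scal_chart] and through the choice of e. *)
Lemma field_divergence c x : atlas c -> cod c x -> \sum_i pd (cod c) (field_in c i) i x =
  sqrdet (coef c g x) * defect (pt c x).
move=> ac cx; set q := pt c x; pose e := chart_at (u q).
have ae : atlas e := chart_at_atlas (u q); have eq : dom e (u q) := chart_at_dom (u q).
have xA : dom2 c e x by apply/(dom2P _ _ ac).
have oA := open_dom2 ae; have rA := regular_dom2 ac ae; have rB := regular_cod ae.
have sg : smx (dom2 c e) (coef c g) by exact: induced_sm2.
have sU := map_sm su ac ae; have sN := normal_sm ac ae; have sh := coef_sm hh ae.
have st := fun_sm2 tau_sm ac ae; have sTh := fun_sm2 Theta_sm ac ae.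
have gT y : dom2 c e y -> (coef c g y)^T = coef c g y by move=> _; exact: (coef_sym induced_smooth).
have hT y : cod e y -> (coef e h y)^T = coef e h y by move=> _; exact: coef_sym.
have dg y : dom2 c e y -> 0 < \det (coef c g y).
  by move=> /(coimg_cod ac); apply: coef_det => //; exact: induced_smooth.
have ug y : dom2 c e y -> coef c g y \in unitmx.
  by move=> /(coimg_cod ac); apply: coef_unit => //; exact: induced_smooth.
have uh y : cod e y -> coef e h y \in unitmx by exact: coef_unit.
have AB y : dom2 c e y -> cod e (map_in c e y) by exact: dom2_map.
have gE y := @induced_in c e y ac ae.
have NN y := @normal_norm c e y ac ae.
have NT y := @normal_tangent c e y ac ae.
have DI := divergence_identity rA rB AB sU st sTh sN sh hT uh gE ug NN NT xA.
have wE j z : dom2 c e z -> form_in c j z =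
   mcurv (dom2 c e) (cod e) (map_in c e) (fun_in c tau) (fun_in c Theta) (normal_in c e)
     (coef e h) (coef c g) z * pd (dom2 c e) (fun_in c tau) j z + pd (dom2 c e) (fun_in c Theta) j z.
  move=> zA; rewrite /form_in /fun_in (HE ac ae zA) (mean_curv_inE ac ae oA (fun _ => id)) //.
  rewrite (mean_curvE rA rB AB sU st sTh sN sh hT uh gE ug NN NT zA).
  by rewrite [in RHS]pd_coimg // [in RHS]pd_coimg.
have sw j : CkA 1 (dom2 c e) (form_in c j) by exact: (coimg_sm ac oA (form_sm j ac)).
under eq_bigr => i _ do rewrite -(pd_coimg _ _ ac oA xA).
rewrite (divcovE rA sg gT dg xA sw); congr (_ * _).
rewrite (_ : divcov _ _ _ _ = divcov (dom2 c e) (coef c g) (fun j z =>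
   mcurv (dom2 c e) (cod e) (map_in c e) (fun_in c tau) (fun_in c Theta) (normal_in c e)
     (coef e h) (coef c g) z * pd (dom2 c e) (fun_in c tau) j z + pd (dom2 c e) (fun_in c Theta) j z) x); last first.
  rewrite /divcov; bigr => i _; bigr => j _; congr (_ * (_ - _)).
    by apply: pd_eq => // z zA; exact: wE.
  by bigr => k _; rewrite wE.
have E1 : \sum_i \sum_j invmx (coef c g x) i j * ricci_coord (dom2 c e) (coef c g) x i j = scal g q.
  by rewrite -(scal_chart induced_smooth ac cx) ricci_coimg.
have E2 : \sum_i \sum_j invmx (coef e h (map_in c e x)) i j *
    ricci_coord (cod e) (coef e h) (map_in c e x) i j = scal h (u q).
  have ux : map_in c e x = co e (u q) by [].
  have hx : coef e h (co e (u q)) = h (u q) := coef_self h (u q).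
  rewrite ux hx /scal /ricci -/e; reflexivity.
have E3 : \sum_i \sum_j normal_in c e x 0 i * normal_in c e x 0 j *
    ricci_coord (cod e) (coef e h) (map_in c e x) i j = dot (ricci h (u q)) (Nt q) (Nt q).
  have ux : map_in c e x = co e (u q) by []. have nx : normal_in c e x = Nt q by exact: vec_in_self.
  rewrite ux nx dotE /ricci -/e; reflexivity.
apply: (etrans DI).
exact: (congr2 *%R erefl (congr2 +%R (congr2 (fun a b : R => a - b) E1 E2) E3)).
Qed.

End Hyper.

(** * Boundary points and integrals in charts *)

Section Extrema.
Context {R : realType} (m : nat).
Implicit Types (A O : set 'rV[R]_m.+1).

Lemma pd_min A (f : 'rV[R]_m.+1 -> R) i x : open A -> CkA 1 A f -> A x ->
  (forall y, A y -> f x <= f y) -> pd A f i x = 0.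
move=> oA Cf Ax fmin; pose F (s : R) := f (x + s *: ev i).
have /nbhs_ballP[e /= e0 eA] := near_line i oA Ax.
have At (s : R) : s \in `]-e, e[%R -> A (x + s *: ev i).
  rewrite in_itv /= => /andP[es se]; apply: eA. by rewrite /ball /= sub0r normrN ltr_norml es.
have dF (s : R) : s \in `]-e, e[%R -> is_derive s 1 F (pd A f i (x + s *: ev i)).
  move=> /At As; have D := CkA_derivable i oA Cf As.
  rewrite -(@derive_val _ _ _ _ _ _ _ D); apply: is_derive_line; exact: ex_derive.
have z0 : (0 : R) \in `]-e, e[%R by rewrite in_itv /= oppr_lt0 e0.
have D0 : is_derive (0 : R) 1 F 0.
  apply: (@derive1_at_min _ F (- e) e 0) => //; first by rewrite gt0_cp.
    by move=> s /dF D; exact: ex_derive.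
  by move=> s /At As; rewrite /F scale0r addr0; exact: fmin.
have := @derive_val _ _ _ _ _ _ _ (dF 0 z0); rewrite (@derive_val _ _ _ _ _ _ _ D0).
by rewrite scale0r addr0.
Qed.

(** Meant for coordinate 0 of a change of charts at a boundary point, where it attains its minimum
    0. *)
Lemma pd_normal_ge0 A (f : 'rV[R]_m.+1 -> R) x : regular A -> A `<=` half_space m -> CkA 1 A f ->
  A x -> x 0 ord0 = 0 -> (forall y, A y -> f x <= f y) -> 0 <= pd A f ord0 x.
move=> rA AH Cf Ax x0 fmin; have PF := pd_filter ord0 rA Ax.
apply: (limr_ge (F := within _ _)); last first.
  rewrite near_withinE; apply: nearW => s [s0 As]. rewrite mulr_ge0 ?subr_ge0 ?fmin // invr_ge0.
  by have := AH _ As; rewrite /half_space /= !mxE x0 add0r !eqxx mulr1.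
by apply/cvg_ex; exists (pd A f ord0 x); exact: pd_cvg.
Qed.

End Extrema.

Section Boundary.
Context {R : realType} (m : nat) (M : manifold R m).
Implicit Types (c d : chart R m M).

(* If co d p were on the face of the half-space, coordinate 0 of d would be minimal at an interior point
   of cod c, and its differential there would vanish. *)
Lemma interior_cod c d p : atlas c -> atlas d -> dom c p -> dom d p ->
  (cod c)° (co c p) -> (cod d)° (co d p).
move=> ac ad cp dp ci; have [_ [W oW [dO|dO]] _ _ _] := atlas_chart ad.
  by rewrite dO ((interior_id _).1 oW) // -dO; exact: dom_cod.
have : cod d (co d p) by exact: dom_cod.
rewrite dO => -[Op]; rewrite /half_space /= le_eqVlt => /orP[/eqP p0|p0]; last first.
  rewrite interiorI ((interior_id _).1 oW) //; split=> //.
  have oP : open [set x : 'rV[R]_m.+1 | 0 < x 0 ord0].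
    apply: (@open_comp _ _ (fun x : 'rV[R]_m.+1 => x 0 ord0) [set t | 0 < t]); last exact: open_gt.
    by move=> y _; exact: rV_coord_continuous.
  suff : [set x : 'rV[R]_m.+1 | 0 < x 0 ord0] `<=` (half_space m)° by exact.
  by rewrite -open_subsetE // => x /ltW.
exfalso; set x := co c p.
have xd : coimg c (dom d) x by exact: coimg_to.
have [W' oW' cW] := coimg_open ac (open_dom ad).
pose A := (cod c)° `&` W'.
have oA : open A by apply: openI => //; exact: open_interior.
have Ac : A `<=` coimg c (dom d) by rewrite cW => y [/interior_subset cy Wy].
have Ax : A x by split=> //; move: xd; rewrite cW => -[].
pose f y := co d (pt c y) 0 ord0.
have xp : pt c x = p by rewrite /x of_coordK.
have Cf : CkA 1 A f by apply: CkA_sub (trans_sm ac ad ord0 1) => y /Ac.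
have z : jacobian c d x *m delta_mx ord0 0 = 0 :> 'cV_m.+1.
  rewrite -colE; apply/colP => i; rewrite mxE mxE [RHS]mxE. rewrite (@pd_local _ _ _ A A f f i x) //.
  - apply: pd_min => // y /Ac /(coimgP _ _ ac)[cy dy]; rewrite /f xp -p0.
    by have := dom_cod dy; rewrite dO => -[].
  - by move=> y Ay; split=> // _; have /(coimgP _ _ ac)[] := Ac _ Ay.
  - exact: dom_cod.
have /mulKmx := jacobian_unit ac ad xd => /(_ _ (delta_mx ord0 0 : 'cV_m.+1)).
rewrite z mulmx0 => /matrixP /(_ ord0 0); rewrite !mxE !eqxx => /eqP.
by rewrite eq_sym oner_eq0.
Qed.

Lemma boundaryP c p : atlas c -> dom c p -> boundary M p <-> ~ (cod c)° (co c p).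
move=> ac cp; have ap := chart_at_atlas p; have pp := chart_at_dom p.
by split=> bp ci; apply: bp; [exact: (interior_cod ac)|exact: (interior_cod ap ac)].
Qed.

Lemma boundary_cod c p : atlas c -> dom c p -> boundary M p -> co c p 0 ord0 = 0.
move=> ac cp /(boundaryP ac cp) bp; have cx := dom_cod cp.
have [_ [W oW [cO|cO]] _ _ _] := atlas_chart ac.
  by exfalso; apply: bp; rewrite cO ((interior_id _).1 oW) // -cO.
move: cx; rewrite cO => -[Wx]; rewrite /half_space /= le_eqVlt => /orP[/eqP //|x0].
exfalso; apply: bp; rewrite cO interiorI ((interior_id _).1 oW) //; split=> //.
have oP : open [set x : 'rV[R]_m.+1 | 0 < x 0 ord0].
  apply: (@open_comp _ _ (fun x : 'rV[R]_m.+1 => x 0 ord0) [set t | 0 < t]); last exact: open_gt.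
  by move=> y _; exact: rV_coord_continuous.
suff : [set x : 'rV[R]_m.+1 | 0 < x 0 ord0] `<=` (half_space m)° by exact.
by rewrite -open_subsetE // => y /ltW.
Qed.

Lemma boundary_half c p : atlas c -> dom c p -> boundary M p ->
  exists2 O : set 'rV[R]_m.+1, open O & cod c = O `&` half_space m.
move=> ac cp /(boundaryP ac cp) bp; have [_ [W oW [cO|cO]] _ _ _] := atlas_chart ac; last by exists W.
by exfalso; apply: bp; rewrite cO ((interior_id _).1 oW) // -cO; exact: dom_cod.
Qed.

Lemma open_no_boundary c p : atlas c -> open (cod c) -> dom c p -> ~ boundary M p.
by move=> ac oc cp /(boundaryP ac cp); apply; rewrite ((interior_id _).1 oc) //; exact: dom_cod.
Qed.

Lemma cod_boundary c O x : atlas c -> cod c = O `&` half_space m -> cod c x ->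
  x 0 ord0 = 0 -> boundary M (pt c x).
move=> ac cO cx x0; apply/(boundaryP ac (cod_dom ac cx)); rewrite to_coordK // => ci.
have N : \forall s \near (0 : R), (cod c)° (x + s *: ev ord0).
  by apply: near_line => //; exact: open_interior.
have /nbhs_ballP[e /= e0 eA] := N.
have /interior_subset : (cod c)° (x + (- (e / 2)) *: ev ord0).
  by apply: eA; rewrite /ball /= sub0r opprK gtr0_norm ?divr_gt0 // ltr_pdivrMr // ltr_pMr // ltr1n.
rewrite cO => -[_]; rewrite /half_space /= !mxE x0 !eqxx add0r mulr1 oppr_ge0 leNgt.
by rewrite divr_gt0.
Qed.

Lemma closed_boundary : closed (boundary M).
rewrite -[boundary M]setCK closedC openE => p; rewrite /= => bp.
have ap := chart_at_atlas p; have pp := chart_at_dom p.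
have ci : (cod (chart_at p))° (co (chart_at p) p) by apply: contrapT.
have oi : open_nbhs (co (chart_at p) p) (cod (chart_at p))°.
  by split=> //; exact: open_interior.
have N : \forall q \near p, (cod (chart_at p))° (co (chart_at p) q).
  exact: to_coord_cvg ap pp _ (open_nbhs_nbhs oi).
have D : nbhs p (dom (chart_at p)) by apply: open_nbhs_nbhs; split=> //; exact: open_dom.
by apply: (filterS2 _ _ N D) => q qi qd /(boundaryP ap qd); exact.
Qed.

End Boundary.

Section ChartIntegrals.
Context {R : realType} (m : nat) (M : manifold R m).
Implicit Types (c d : chart R m M) (K : set M).

Lemma measurable_cod c : atlas c -> measurable (cod c : set (bor 'rV[R]_m.+1)).
move=> ac; have [_ [W oW [->|->]] _ _ _] := atlas_chart ac; first exact: open_borel.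
apply: measurableI; first exact: open_borel.
by apply: closed_borel; rewrite half_slab; apply: closed_slab; exact: closed_ge.
Qed.

Lemma compact_image c K : atlas c -> compact K -> K `<=` dom c -> compact (co c @` K).
move=> ac cK Kc; have [_ _ _ cf _] := atlas_chart ac.
by apply: continuous_compact => //; apply: continuous_subspaceW cf.
Qed.

Lemma image_in_cube c K : atlas c -> compact K -> K `<=` dom c ->
  exists2 r : R, 0 <= r & co c @` K `<=` cube r.
move=> ac cK Kc; have /compact_bounded [r [_ Br]] := compact_image ac cK Kc.
exists (`|r| + 1); first by rewrite addr_ge0.
move=> x Kx; apply/cube_norm; rewrite ?addr_ge0 //.
by apply: Br => //; rewrite (le_lt_trans (ler_norm r)) // ltrDl.
Qed.

(* A chart image sits in a closed model space (R^n or a half-space), on which a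
   function with compact support in the image extends by zero. *)
Lemma extend_cod c K k (F : 'rV[R]_m.+1 -> R) : atlas c -> compact K -> K `<=` dom c ->
  (forall x, cod c x -> ~ K (pt c x) -> F x = 0) -> CkA k (cod c) F ->
  forall A O : set 'rV[R]_m.+1, open O -> cod c = A `&` O -> CkA k A (F \_ (cod c)).
move=> ac cK Kc F0 CF A O' oO cA.
apply: (CkA_extend0 cA oO (K := co c @` K)) => //.
- by apply: compact_closed; [exact: norm_hausdorff|exact: compact_image].
- move=> x [[q Kq <-] Ax]; have := dom_cod (Kc _ Kq); by rewrite cA => -[].
- by move=> x cx nK; apply: F0 => // Kx; apply: nK; exists (pt c x) => //; exact: to_coordK.
Qed.

Lemma model_cod c : atlas c -> exists A, exists2 O : set 'rV[R]_m.+1, open O &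
  [/\ cod c = A `&` O, closed A & A = setT \/ A = half_space m].
move=> ac; have [_ [W oW [cW|cW]] _ _ _] := atlas_chart ac.
  by exists setT, W => //; rewrite setTI; split=> //; left.
exists (half_space m), W => //; rewrite setIC; split=> //; last by right.
by rewrite half_slab; apply: closed_slab; exact: closed_ge.
Qed.

Lemma patch_patch T (A B : set T) (F : T -> R) : A `<=` B -> (F \_ A) \_ B = F \_ A.
move=> AB; apply/funext => x; rewrite /patch.
case: (pselect (A x)) => xA; last by rewrite (memNset xA); case: ifP.
by rewrite (mem_set (AB _ xA)) (mem_set xA).
Qed.

Lemma chart_bms c K (F : 'rV[R]_m.+1 -> R) : atlas c -> compact K -> K `<=` dom c ->
  (forall x, cod c x -> ~ K (pt c x) -> F x = 0) -> CkA 0 (cod c) F -> bms (F \_ (cod c)).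
move=> ac cK Kc F0 CF; have [A [W oW [cA clA _]]] := model_cod ac.
have [r r0 Kr] := image_in_cube ac cK Kc.
have := extend_cod ac cK Kc F0 CF oW cA => CA.
rewrite -(patch_patch F (B := A)); last by rewrite cA => x [].
apply: (bms_restrict clA CA r0) => x Ax nr; rewrite /patch; case: ifP => // /set_mem cx.
apply: F0 => // Kx; apply: nr; apply: Kr; exists (pt c x) => //; exact: to_coordK.
Qed.

(** The measures on M are specified by [lint]. Measurability of the inverse chart T turns this
    iterated integral into an integral against [lebn], which is the form of the density
    hypothesis. *)
Lemma lint_density k (dd : measure_display) (X : measurableType dd) (C B : set (bor 'rV[R]_k))
    (T : bor 'rV[R]_k -> X) (w : bor 'rV[R]_k -> R) (A : set X) :
  measurable C -> measurable_fun C T -> measurable_fun C w -> measurable A ->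
  (forall y, C y -> 0 <= w y) -> B `<=` C -> (forall y, C y -> B y <-> A (T y)) ->
  lint (fun y => (\1_B y * w y)%:E) = (\int[lebn k]_(y in C) (\1_A (T y) * w y)%:E)%E.
move=> mC mT mw mA w0 BC BA.
have m1 : measurable_fun C (fun y => \1_A (T y) * w y).
  have m2 : measurable_fun setT (\1_A : X -> R) by exact: measurable_indic.
  by apply: measurable_funM => //; apply: (measurable_comp measurableT _ m2 mT).
rewrite [RHS]integral_mkcond -lint_lebn; last 2 first.
- by apply/(measurable_restrictT _ mC); exact/measurable_EFinP.
- by move=> x; rewrite /patch; case: ifP => // /set_mem /w0 wx; rewrite lee_fin mulr_ge0.
apply: eq_lint => x; rewrite /patch; case: ifP => [/set_mem Cx|/negbT nC].
  congr (_ * _)%:E; rewrite !indicE; congr (_%:R); congr (nat_of_bool _).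
  by apply/idP/idP => /set_mem H; apply/mem_set; apply/(BA x Cx).
by rewrite indicE memNset ?mul0r // => /BC Cx; move/negP: nC; apply; exact: mem_set.
Qed.

(** f vanishes off D and its transport to R^k, times the density, is bounded of bounded support;
    integrability follows by applying the density formula to |f|. *)
Lemma density_integral k (dd : measure_display) (X : measurableType dd) (mu : {measure set X -> \bar R})
    (D : set X) (C : set (bor 'rV[R]_k)) (T : bor 'rV[R]_k -> X) (w : bor 'rV[R]_k -> R) (f : X -> R) :
  measurable D -> measurable C -> measurable_fun C T -> measurable_fun C w ->
  (forall y, C y -> D (T y)) -> (forall y, C y -> 0 <= w y) -> (forall A, measurable A -> A `<=` D ->
     mu A = \int[lebn k]_(y in C) (\1_A (T y) * w y)%:E)%E ->
  measurable_fun D f -> (forall x, ~ D x -> f x = 0) -> bms ((fun y => f (T y) * w y) \_ C) ->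
  mu.-integrable setT (EFin \o f) /\ \int[mu]_x f x = \int[lebn k]_y ((fun y => f (T y) * w y) \_ C) y.
move=> mD mC mT mw CD w0 muE mf f0 bf.
have fD : f = f \_ D.
  by apply/funext => x; rewrite /patch; case: ifP => // /negbT /negP xD; apply: f0 => Dx; apply: xD; exact: mem_set.
have mfT : measurable_fun setT f by rewrite fD; apply/(measurable_restrictT _ mD).
have ED (F : R -> R) : F 0 = 0 -> (\int[mu]_x (F (f x))%:E = \int[mu]_(x in D) (F (f x))%:E)%E.
  move=> F0; rewrite [RHS]integral_mkcond; apply: eq_integral => x _; rewrite /patch.
  by case: ifP => // /negbT /negP xD; rewrite f0 ?F0 // => Dx; apply: xD; exact: mem_set.
have EC (F : R -> R) : F 0 = 0 -> (forall a b, 0 <= b -> F (a * b) = F a * b) ->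
   (\int[lebn k]_(y in C) ((F (f (T y))) * w y)%:E =
    \int[lebn k]_y (F (((fun y => f (T y) * w y) \_ C) y))%:E)%E.
  move=> F0 FM; rewrite integral_mkcond; apply: eq_integral => y _; rewrite /patch.
  by case: ifP => [/set_mem Cy|_]; rewrite ?F0 // FM // w0.
have mF (F : R -> R) : measurable_fun setT F -> measurable_fun D (fun x => F (f x)).
  by move=> mF; apply: (measurable_comp measurableT).
split; last first.
  rewrite /Rintegral; congr (fine _); apply: (etrans (ED id erefl)).
  apply: (etrans (integral_density mD mC mT mw CD w0 muE mf)). exact: (EC id erefl (fun _ _ _ => erefl)).
apply/integrableP; split; first exact/measurable_EFinP.
rewrite (_ : \int[mu]_x _ = \int[mu]_x (`|f x|)%:E)%E; last by apply: eq_integral => x _.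
rewrite (ED (fun a => `|a|)) ?normr0 //.
rewrite (integral_density mD mC mT mw CD w0 muE) ?(EC (fun a => `|a|)) ?normr0 //; last 2 first.
- by move=> a b b0; rewrite normrM (ger0_norm b0).
- by apply: mF; exact: normr_measurable.
by have /bms_norm/bms_integrable/integrableP[_] := bf; under eq_integral do rewrite /= normr_id.
Qed.

Variables (g : metric_field M) (rg : smooth_metric g).
Variables (dM : {measure set (borel M) -> \bar R}) (hdM : volume_measure g dM).

Lemma measurable_of_coord c : atlas c ->
  measurable_fun (cod c : set (bor 'rV[R]_m.+1)) (pt c : bor 'rV[R]_m.+1 -> bor M).
move=> ac; have [_ _ _ _ /subspace_continuousP cf] := atlas_chart ac.
by apply: within_measurable => //; exact: measurable_cod.
Qed.

Lemma measurable_dom c : atlas c -> measurable (dom c : set (bor M)).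
by move=> ac; apply: open_borel; exact: open_dom. Qed.

Lemma CkA_measurable_cod c (F : 'rV[R]_m.+1 -> R) : atlas c -> CkA 0 (cod c) F ->
  measurable_fun (cod c : set (bor 'rV[R]_m.+1)) F.
move=> ac CF; apply: within_measurable_real; first exact: measurable_cod.
by move=> x cx; exact: (CkA_cvg CF cx).
Qed.

Lemma to_coord_within c D (F : 'rV[R]_m.+1 -> R) p : atlas c -> D `<=` dom c -> D p ->
  CkA 0 (cod c) F -> F (co c q) @[q --> within D (nbhs p)] --> F (co c p).
move=> ac Dc Dp CF U HU; have := CkA_cvg CF (dom_cod (Dc _ Dp)) HU.
rewrite /= {1}/nbhs /= /within /= => HF.
have := to_coord_cvg ac (Dc _ Dp) HF; rewrite /nbhs /=.
by apply: filterS => q /= Hq Dq; apply: Hq; apply: dom_cod; exact: Dc.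
Qed.

Lemma volume_lebn c : atlas c -> forall A : set (borel M), measurable A -> (A : set M) `<=` dom c ->
  (dM A = \int[lebn m.+1]_(y in cod c) (\1_A (pt c y) * sqrdet (coef c g y))%:E)%E.
move=> ac A mA Ac; rewrite (hdM ac mA Ac).
pose w := (fun x => sqrdet (coef c g x)) : bor 'rV[R]_m.+1 -> R.
have mw : measurable_fun (cod c : set (bor 'rV[R]_m.+1)) w.
  apply: CkA_measurable_cod => //; apply: CkA_sqrt => [x cx|]; first exact: coef_det.
  exact: (sm_det (coef_sm rg ac) 0).
apply: (lint_density (measurable_cod ac) (measurable_of_coord ac) mw) => // [y _|y [q Aq <-]|y cy].
- exact: sqrtr_ge0.
- by apply: dom_cod; exact: Ac.
split; first by move=> [q Aq <-]; rewrite of_coordK //; exact: Ac.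
by move=> Ay; exists (pt c y) => //; exact: to_coordK.
Qed.

Lemma volume_chart c K (f : M -> R) : atlas c -> compact K -> K `<=` dom c ->
  (forall p, ~ K p -> f p = 0) -> CkA 0 (cod c) (fun x => f (pt c x)) ->
  dM.-integrable setT (EFin \o f) /\ \int[dM]_p f p = \int[lebn m.+1]_x
     ((fun x => f (pt c x) * sqrdet (coef c g x)) \_ (cod c)) x.
move=> ac cK Kc f0 Cf.
have Cw : CkA 0 (cod c) (fun x => sqrdet (coef c g x)).
  apply: CkA_sqrt => [x cx|]; first exact: coef_det. exact: (sm_det (coef_sm rg ac) 0).
apply: (density_integral (D := dom c : set (borel M))) => //.
- exact: measurable_dom.
- exact: measurable_cod.
- exact: measurable_of_coord.
- exact: CkA_measurable_cod.
- by move=> y; exact: cod_dom.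
- exact: volume_lebn.
- apply: within_measurable_real; first exact: measurable_dom.
  move=> p cp; have := to_coord_within ac (fun _ => id) cp Cf; rewrite of_coordK //.
  apply: cvg_trans; apply: near_eq_cvg; rewrite near_withinE; apply: nearW => q cq. by rewrite of_coordK.
- by move=> p np; apply: f0 => /Kc.
- apply: (chart_bms ac cK Kc); last exact: CkAM.
  by move=> x cx nK; rewrite f0 // mul0r.
Qed.

End ChartIntegrals.

Section BoundaryIntegrals.
Context {R : realType} (m : nat) (M : manifold R m).
Implicit Types (c d : chart R m M) (K : set M).
Variables (g : metric_field M) (rg : smooth_metric g).
Variables (dG : {measure set (borel M) -> \bar R}) (hdG : boundary_measure g dG).

(** In a boundary chart index 0 is the transversal direction; what remains is the Gram matrix of the
    directions tangent to the boundary. *)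
Definition face n (G : 'M[R]_n.+1) : 'M[R]_n := row' ord0 (col' ord0 G).

Lemma face_det c x : atlas c -> cod c x -> 0 < \det (face (coef c g x)).
move=> ac cx; apply: posdef_det => v v0.
pose w : 'rV[R]_m.+1 := row_of (0, v).
have w00 : w 0 ord0 = 0 by exact: row_of0.
have wS j : w 0 (lift ord0 j) = v 0 j by exact: row_ofS.
have -> : dot (face (coef c g x)) v v = dot (coef c g x) w w.
  rewrite !dotE [RHS]big_ord_recl [X in _ = X + _]big1 ?add0r; last by move=> j _; rewrite w00 !mul0r.
  bigr => i _; rewrite [RHS]big_ord_recl w00 mulr0 mul0r add0r. by bigr => j _; rewrite !wS !mxE.
apply: coef_pos => //; apply: contraNneq v0 => w0; apply/eqP/rowP => j.
by rewrite -wS w0 !mxE.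
Qed.

Lemma face_sm c : atlas c -> sm (cod c) (fun x => \det (face (coef c g x))).
move=> ac; apply: sm_det => i j k.
by apply: (CkA_eq _ (coef_sm rg ac (lift ord0 i) (lift ord0 j) k)) => x _; rewrite !mxE.
Qed.

Definition face_cod c : set 'rV[R]_m := [set y | cod c (row_of (0, y))].

Variables (c : chart R m M) (W : set 'rV[R]_m.+1).
Hypotheses (ac : atlas c) (oW : open W) (cW : cod c = W `&` half_space m).
Let B := dom c `&` boundary M.
Let T (y : bor 'rV[R]_m) : bor M := pt c (row_of (0, y)).

Let face_codE : face_cod c = (fun y => row_of (0, y)) @^-1` W.
rewrite /face_cod cW; apply/seteqP; split=> y /=; first by case.
by move=> Wy; split=> //; rewrite /half_space /= row_of0.
Qed.

Let mF : measurable (face_cod c : set (bor 'rV[R]_m)).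
rewrite face_codE -[X in measurable X]setTI; apply: (measurable_row_of_r 0) => //.
exact: open_borel.
Qed.

Let mB : measurable (B : set (bor M)).
by apply: measurableI; [exact: measurable_dom|apply: closed_borel; exact: closed_boundary]. Qed.

Let FT y : face_cod c y -> B (T y).
move=> cy; split; first exact: cod_dom.
by apply: (cod_boundary ac cW) => //; rewrite row_of0.
Qed.

Let BT q : B q -> co c q = row_of (0, \row_j co c q 0 (lift ord0 j)).
by case=> cq bq; rewrite {1}[LHS]rV_eq_row (boundary_cod ac cq bq). Qed.

Let mr : measurable_fun (face_cod c : set (bor 'rV[R]_m)) (fun y => row_of (0, y) : bor 'rV[R]_m.+1).
exact: measurable_funS (measurable_row_of_r 0). Qed.

Let mrow (F : 'rV[R]_m.+1 -> R) : CkA 0 (cod c) F ->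
  measurable_fun (face_cod c : set (bor 'rV[R]_m)) (fun y => F (row_of (0, y))).
move=> CF; apply: (measurable_comp (measurable_cod ac) _ (CkA_measurable_cod ac CF) mr).
by move=> x [y cy <-].
Qed.

Let mT : measurable_fun (face_cod c : set (bor 'rV[R]_m)) T.
apply: (measurable_comp (measurable_cod ac) _ (measurable_of_coord ac) mr).
by move=> x [y cy <-].
Qed.

Let w (y : bor 'rV[R]_m) := Num.sqrt (\det (face (coef c g (row_of (0, y))))).

Let Cw : CkA 0 (cod c) (fun x => sqrdet (face (coef c g x))).
by apply: CkA_sqrt => [x cx|]; [exact: face_det|exact: (face_sm ac 0)]. Qed.

Let boundary_lebn (A : set (borel M)) : measurable A -> (A : set M) `<=` B ->
  (dG A = \int[lebn m]_(y in face_cod c) (\1_A (T y) * w y)%:E)%E.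
move=> mA AB; have [_ hG] := hdG; rewrite (hG c ac A mA AB).
have r0 (y : 'rV[R]_m) : (row_mx (0 : 'rV[R]_1) y : 'rV[R]_m.+1) = row_of (0, y).
  by rewrite /row_of /= raddf0.
have H1 : [set y | (co c @` (A : set M)) (row_of (0, y))] `<=` face_cod c.
  by move=> y /= [q Aq qE]; rewrite /face_cod /= -qE; apply: dom_cod; exact: (AB _ Aq).1.
apply: etrans (lint_density (w := w) mF mT (mrow Cw) mA (fun y _ => sqrtr_ge0 _) H1 _).
  by apply: eq_lint => y; cbv zeta; rewrite r0.
move=> y cy; split=> [[q Aq qE]|Ay]; first by rewrite /T -qE of_coordK //; exact: (AB _ Aq).1.
by exists (T y) => //; exact: to_coordK.
Qed.

(** f is controlled on the boundary only, so its regularity there is borrowed from a function F on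
    the chart image that agrees with it on the face. *)
Lemma boundary_chart K (f : M -> R) (F : 'rV[R]_m.+1 -> R) : compact K -> K `<=` dom c ->
  (forall p, ~ K p -> f p = 0) -> CkA 0 (cod c) F -> (forall x, cod c x -> ~ K (pt c x) -> F x = 0) ->
  (forall x, cod c x -> x 0 ord0 = 0 -> F x = f (pt c x)) -> dG.-integrable (Gamma_ M) (EFin \o f) /\
  \int[dG]_(p in (Gamma_ M)) f p = \int[lebn m]_y
     ((fun x => F x * sqrdet (face (coef c g x))) \_ (cod c)) (row_of (0, y)).
move=> cK Kc f0 CF F0 Ff; have mbd : measurable (Gamma_ M).
  by apply: closed_borel; exact: closed_boundary.
have [r r0 Kr] := image_in_cube ac cK Kc.
pose G := (fun x => F x * sqrdet (face (coef c g x))) \_ (cod c).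
pose f' := f \_ (boundary M).
have Gf y : ((fun y => f' (T y) * w y) \_ (face_cod c)) y = G (row_of (0, y)).
  rewrite /G /patch; case: ifP => [/set_mem cy|/negbT ny]; last first.
    by rewrite memNset // => cy; move/negP: ny; apply; exact: mem_set.
  rewrite (mem_set (A := cod c) cy) Ff ?row_of0 // /f' /patch mem_set //. exact: (FT cy).2.
have bG : bms ((fun y => f' (T y) * w y) \_ (face_cod c)).
  rewrite (_ : _ \_ _ = (fun y => G (row_of (0, y))) \_ setT); last first.
    by apply/funext => y; rewrite Gf patchT // inE.
  have cA : cod c = half_space m `&` W by rewrite setIC. have CG : CkA 0 (half_space m) G.
    apply: (extend_cod ac cK Kc _ _ oW cA); last exact: CkAM. by move=> x cx nK; rewrite F0 // mul0r.
  apply: (bms_restrict closedT _ r0).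
    by apply: (@CkA_row R _ 0 [set t | 0 <= t]) => //=; rewrite -half_slab.
  move=> y _ ny; rewrite /G /patch; case: ifP => // /set_mem cy; rewrite F0 ?mul0r // => Ky.
  apply: ny => i; have /= := Kr (row_of (0, y)) _ (lift ord0 i); rewrite row_ofS; apply.
  by exists (T y) => //; exact: to_coordK.
have mw : measurable_fun (face_cod c : set (bor 'rV[R]_m)) w by exact: mrow Cw.
have mf : measurable_fun (B : set (bor M)) f'.
  apply: within_measurable_real => // p Bp. have := to_coord_within ac (@subIsetl _ _ _) Bp CF.
  have Fq q : B q -> F (co c q) = f' q.
    move=> [cq bq]; rewrite Ff ?of_coordK //; [|exact: dom_cod|exact: boundary_cod].
    by rewrite /f' /patch mem_set.
  rewrite Fq //; apply: cvg_trans; apply: near_eq_cvg; rewrite near_withinE; apply: nearW => q Bq.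
  by rewrite Fq.
have f'0 p : ~ B p -> f' p = 0.
  move=> nB; rewrite /f' /patch; case: ifP => // /set_mem bp; apply: f0 => Kp; apply: nB.
  by split=> //; exact: Kc.
have w0 y : face_cod c y -> 0 <= w y by move=> _; exact: sqrtr_ge0.
have [i1 i2] := density_integral mB mF mT mw FT w0 boundary_lebn mf f'0 bG.
split.
  have := integrableS measurableT mbd (@subsetT _ _) i1. apply: eq_integrable => // p /set_mem bp.
  by rewrite /= /f' /patch mem_set.
rewrite -(II_eq Gf) -i2 /Rintegral integral_mkcond; congr (fine _).
apply: eq_integral => p _; rewrite /f' /patch; by case: ifP.
Qed.

End BoundaryIntegrals.

(** * Cutoff functions on a manifold *)

Section Bumps.
Context {R : realType} (m : nat) (M : manifold R m).
Implicit Types (c d : chart R m M) (f : M -> R).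

Definition C1fun f : Prop := forall c, atlas c -> CkA 1 (cod c) (fun x => f (pt c x)).

Lemma C1funD f1 f2 : C1fun f1 -> C1fun f2 -> C1fun (fun p => f1 p + f2 p).
by move=> h1 h2 c ac; apply: CkAD; [exact: h1|exact: h2]. Qed.

Lemma C1funM f1 f2 : C1fun f1 -> C1fun f2 -> C1fun (fun p => f1 p * f2 p).
by move=> h1 h2 c ac; apply: CkAM; [exact: h1|exact: h2]. Qed.

Lemma C1funB f1 f2 : C1fun f1 -> C1fun f2 -> C1fun (fun p => f1 p - f2 p).
by move=> h1 h2 c ac; apply: CkAB; [exact: h1|exact: h2]. Qed.

Lemma C1fun_cst (a : R) : C1fun (fun=> a).
by move=> c ac; exact: CkA_cst. Qed.

Lemma C1fun_extend c K (F : 'rV[R]_m.+1 -> R) (a : R) f : atlas c -> closed K ->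
  K `<=` dom c -> CkA 1 (cod c) F ->
  (forall q, dom c q -> f q = F (co c q)) -> (forall q, ~ K q -> f q = a) -> C1fun f.
move=> ac clK Kc CF fF fa d ad; apply: CkA_local => y dy; set q := pt d y.
case: (pselect (dom c q)) => cq.
  have [W oW dW] := coimg_open ad (open_dom ac); exists W; split=> //.
    by have : coimg d (dom c) y by [apply/(coimgP _ _ ad)]; rewrite dW => -[].
  rewrite -dW; apply: (CkA_eq (f := fun x => F (co c (pt d x)))).
    by move=> x /(coimgP _ _ ad)[dx cx]; rewrite fF.
  apply: (CkA_comp (B := cod c) _ CF); last by move=> j; exact: (trans_sm ad ac j 1).
  by move=> x /(coimgP _ _ ad)[dx cx]; exact: dom_cod.
have oK : open (~` K) by exact: closed_openC.
have [W oW dW] := coimg_open ad oK; exists W; split=> //.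
  have : coimg d (~` K) y by apply/(coimgP _ _ ad); split=> // /Kc. by rewrite dW => -[].
rewrite -dW; apply: (CkA_eq (f := fun=> a)) => //.
by move=> x /(coimgP _ _ ad)[dx nK]; rewrite fa.
Qed.

Lemma chart_bump (p : M) : exists W K, exists2 chi : M -> R,
  [/\ open W, W p, compact K & K `<=` dom (chart_at p)] &
  [/\ C1fun chi, forall q, ~ K q -> chi q = 0 & forall q, W q -> chi q = 1].
set c := chart_at p; have ac : atlas c := chart_at_atlas p; have cp : dom c p := chart_at_dom p.
pose x0 := co c p; have cx0 : cod c x0 by exact: dom_cod.
have [A [W0 oW0 [cA clA _]]] := model_cod ac.
have [r r0 rO] : exists2 r : R, 0 < r & forall z : 'rV[R]_m.+1, `|z - x0| < r -> W0 z.
  by apply: open_ball => //; move: cx0; rewrite cA => -[].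
(* The bump will be 1 within e of the center and supported within 2 e < r, inside the open set that
   defines the chart image. *)
pose e := r / 3; have e0 : 0 < e by rewrite divr_gt0.
pose B := [set z : 'rV[R]_m.+1 | enorm (z - x0) <= 2 * e].
have BO : B `<=` W0.
  move=> z Bz; apply: rO; apply: (@le_lt_trans _ _ (2 * e)); last by rewrite /e; lra.
  by apply: norm_rV_le => [|j]; [rewrite mulr_ge0 // ltW|exact: (le_trans (coord_le_enorm _ _))].
have cont : continuous (fun z : 'rV[R]_m.+1 => enorm (z - x0)).
  move=> z; apply: (@continuous_comp _ _ _ (fun z : 'rV[R]_m.+1 => z - x0) (@enorm R m.+1)).
    exact: (cvgB (FF := nbhs_filter z) cvg_id (cvg_cst x0)).
  exact: continuous_enorm.
have clB : closed B.
  by apply: (@closed_comp _ _ (fun z : 'rV[R]_m.+1 => enorm (z - x0)) [set t | t <= 2 * e]) => [z _|];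
     [exact: cont|exact: closed_le].
have cAB : compact (A `&` B).
  have [b b0 Bb] : exists2 b, 0 <= b & B `<=` cube b.
    exists (2 * e + `|x0|); first by rewrite addr_ge0 // mulr_ge0 // ltW.
    move=> z Bz i; rewrite -[z](subrK x0) mxE (le_trans (ler_normD _ _)) // lerD ?coord_le_norm //.
    exact: le_trans (coord_le_enorm _ _) Bz.
  apply: (subclosed_compact _ (@compact_cube R m.+1 b)); first exact: closedI. by move=> z [_ /Bb].
have ABc : A `&` B `<=` cod c by rewrite cA => z [Az /BO].
pose K := pt c @` (A `&` B).
have cK : compact K.
  have [_ _ _ _ cf] := atlas_chart ac.
  by apply: continuous_compact => //; apply: continuous_subspaceW cf.
have Kc : K `<=` dom c by move=> q [z /ABc cz <-]; exact: cod_dom.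
pose W := dom c `&` co c @^-1` [set z | enorm (z - x0) < e].
have oW : open W.
  have [_ _ _ /subspace_continuousP cf _] := atlas_chart ac.
  have [V oV E] : exists2 V, open V & W = dom c `&` V.
    apply: (within_preimage_open (S := 'rV[R]_m.+1) cf).
    by apply: (@open_comp _ _ (fun z : 'rV[R]_m.+1 => enorm (z - x0)) [set t | t < e]) => [z _|];
     [exact: cont|exact: open_lt].
  by rewrite E; apply: openI => //; exact: open_dom.
have Wp : W p by split=> //=; rewrite subrr enorm0.
(* A polynomial rather than a function of the distance, so that it is smooth at the center: s >= 1
   within e of it and s <= 0 beyond 2 e. *)
pose s (z : 'rV[R]_m.+1) := 2 - (\sum_i (z 0 i - x0 0 i) ^+ 2) / e ^+ 2.
have sE z : s z = 2 - enorm (z - x0) ^+ 2 / e ^+ 2.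
  by rewrite enorm_sqr /s; congr (_ - _ / _); bigr => i _; rewrite !mxE.
have Cs : CkA 1 (cod c) (fun z => step (s z)).
  apply: (C1_un is_derive_step continuous_dstep); apply: CkAB => //. apply: CkAM => //.
  apply: CkA_sum => i _; under eq_fun do rewrite expr2.
  by apply: CkAM; apply: CkAB; do ?[exact: CkA_cst|exact: CkA_coord].
pose chi := (fun q => step (s (co c q))) \_ (dom c).
have chi0 q : ~ K q -> chi q = 0.
  move=> nK; rewrite /chi /patch; case: ifP => // /set_mem cq; apply: step_le0. have nB : ~ B (co c q).
    move=> Bq; apply: nK; exists (co c q); last by rewrite of_coordK.
    by split=> //; have := dom_cod cq; rewrite cA => -[].
  have {}nB : 2 * e < enorm (co c q - x0) by rewrite ltNge; apply/negP.
  rewrite sE subr_le0 ler_pdivlMr ?exprn_gt0 //; have e00 := ltW e0.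
  apply: (@le_trans _ _ ((2 * e) ^+ 2)); last by rewrite lerXn2r ?nnegrE ?enorm_ge0 ?mulr_ge0 // ltW.
  have E2 : 0 <= e * e := mulr_ge0 e00 e00. by rewrite !expr2; lra.
exists W, K; exists chi => //; split=> //.
- apply: (C1fun_extend (K := K) (a := 0) ac _ Kc Cs) => //.
    by apply: compact_closed => //; exact: space_hausdorff.
  by move=> q cq; rewrite /chi /patch mem_set.
- move=> q [cq /= nq]; rewrite /chi /patch mem_set //; apply: step_ge1.
  rewrite sE; have : enorm (co c q - x0) ^+ 2 / e ^+ 2 <= 1; last by lra.
  rewrite ler_pdivrMr ?exprn_gt0 // mul1r lerXn2r ?nnegrE ?enorm_ge0 //; exact: ltW.
Qed.

End Bumps.

(** * Connectedness of shells *)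

Section Shells.
Context {R : realType} (m : nat).
Hypothesis m0 : (0 < m)%N.
Notation P := (@punctured R m.+1).

Lemma connected_segment (x y : 'rV[R]_m.+1) :
  connected [set x + t *: (y - x) | t in [set t : R | 0 <= t <= 1]].
apply: connected_continuous_connected.
  have -> : [set t : R | 0 <= t <= 1] = [set` `[0, 1]%R] by apply/seteqP; split=> t /=; rewrite in_itv.
  exact: segment_connected.
apply: continuous_subspaceT => t; apply: cvg_rV => j.
rewrite [_ 0 j](_ : _ = x 0 j + t * (y - x) 0 j); last by rewrite !mxE.
have -> : (fun s : R => (x + s *: (y - x)) 0 j) = (fun s => x 0 j + s * (y - x) 0 j).
  by apply/funext => s; rewrite !mxE.
by apply: cvgD; [exact: cvg_cst|apply: cvgM; [exact: cvg_id|exact: cvg_cst]].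
Qed.

Lemma punctured_connected : connected P.
pose i0 : 'I_m.+1 := ord0; pose i1 : 'I_m.+1 := lift ord0 (Ordinal m0).
have i01 : i0 != i1 by [].
have seg (x y : 'rV[R]_m.+1) : (forall t, 0 <= t <= 1 -> x + t *: (y - x) != 0) ->
    exists C : set 'rV[R]_m.+1, [/\ connected C, C x, C y & C `<=` P].
  move=> H; exists [set x + t *: (y - x) | t in [set t : R | 0 <= t <= 1]]; split.
  - exact: connected_segment.
  - by exists 0; rewrite /= ?lexx ?ler01 // scale0r addr0.
  - by exists 1; rewrite /= ?lexx ?ler01 // scale1r addrC subrK.
  - by move=> _ [t t01 <-]; exact: H.
(* x and y are joined through z, with z off the lines spanned by x and by y *)
pose e : 'rV[R]_m.+1 := ev i0.
have e0 : P e by apply/eqP => /matrixP /(_ 0 i0); rewrite !mxE !eqxx => /eqP; rewrite oner_eq0.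
have step1 y : P y -> exists C : set 'rV[R]_m.+1, [/\ connected C, C e, C y & C `<=` P].
  move=> y0; case: (pselect (forall t, 0 <= t <= 1 -> e + t *: (y - e) != 0)) => [/seg //|].
  move=> /existsNP [t] /not_implyP [t01 /negP/negPn/eqP E]. have yi j : j != i0 -> y 0 j = 0.
    move=> j0; have /matrixP /(_ 0 j) := E; rewrite !mxE eqxx (negbTE j0) /= add0r subr0 => /eqP.
    rewrite mulf_eq0 => /orP[/eqP t0|/eqP //].
    by move: E; rewrite t0 scale0r addr0 => /eqP; rewrite (negbTE e0).
  pose z : 'rV[R]_m.+1 := ev i1.
  have [C1 [c1 C1e C1z C1P]] : exists C : set 'rV[R]_m.+1, [/\ connected C, C e, C z & C `<=` P].
    apply: seg => s s01; apply/eqP => H.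
    have /matrixP /(_ 0 i1) := H; rewrite !mxE !eqxx eq_sym (negbTE i01) /= add0r subr0 mulr1 => s0.
    by move: H; rewrite s0 scale0r addr0 => /eqP; rewrite (negbTE e0).
  have [C2 [c2 C2z C2y C2P]] : exists C : set 'rV[R]_m.+1, [/\ connected C, C z, C y & C `<=` P].
    apply: seg => s s01; apply/eqP => H. have i10 : i1 != i0 by rewrite eq_sym.
    have /matrixP /(_ 0 i1) := H; rewrite !mxE !eqxx (yi _ i10) /= sub0r mulrN mulr1 => /eqP.
    rewrite subr_eq0 => /eqP s1; move: H; rewrite -s1 scale1r addrC subrK => y00.
    by move: y0; rewrite /punctured /= y00 eqxx.
  exists (C1 `|` C2); split; [|by left|by right|by move=> w [/C1P|/C2P]].
  by apply: connectedU => //; exists z.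
pose Cy y := if pselect (P y) is left Py then projT1 (cid (step1 y Py)) else [set e].
have CP y : P y -> [/\ connected (Cy y), Cy y e, Cy y y & Cy y `<=` P].
  by move=> Py; rewrite /Cy; case: pselect => // Py'; exact: (projT2 (cid (step1 y Py'))).
have -> : P = \bigcup_(y in P) Cy y.
  apply/seteqP; split=> [y Py|x [y Py]]; first by exists y => //; have [] := CP y Py.
  by have [_ _ _] := CP y Py; apply.
apply: bigcup_connected; first by exists e => y Py; have [] := CP y Py.
by move=> y Py; have [] := CP y Py.
Qed.

(** A shell is the image of the punctured space, connected in dimension at least 2, under x ->
    rho(|x|) x / |x|. *)
Lemma shell_connected (rho : R -> R) : (forall t, 0 < t -> {for t, continuous rho}) ->
  (forall t, 0 < t -> 0 < rho t) -> connected [set y : 'rV[R]_m.+1 | exists2 t, 0 < t & enorm y = rho t].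
move=> cr r0; pose F (x : 'rV[R]_m.+1) := (rho (enorm x) / enorm x) *: x.
have -> : [set y : 'rV[R]_m.+1 | exists2 t, 0 < t & enorm y = rho t] = F @` P.
  apply/seteqP; split=> [y [t t0 yt]|_ [x Px <-]].
    have y0 : enorm y != 0 by rewrite yt gt_eqF ?r0. have Ex : enorm ((t / enorm y) *: y) = t.
      by rewrite enormZ ger0_norm ?divr_ge0 ?enorm_ge0 1?ltW // divfK.
    exists ((t / enorm y) *: y); first by rewrite /punctured /= -enorm_eq0 Ex gt_eqF.
    have t0' : t != 0 by rewrite gt_eqF. by rewrite /F Ex scalerA mulrA divfK // -yt mulfV // scale1r.
  have x0 : 0 < enorm x by rewrite enorm_gt0.
  exists (enorm x) => //; rewrite /F enormZ ger0_norm ?divr_ge0 1?ltW ?r0 // divfK //. by rewrite gt_eqF.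
apply: (connected_continuous_connected punctured_connected).
apply: continuous_in_subspaceT => x /set_mem Px.
have x0 : 0 < enorm x by rewrite enorm_gt0.
have ce : (fun y : 'rV[R]_m.+1 => enorm y) @ x --> enorm x by exact: continuous_enorm.
apply: (@cvg_rV _ _ _ (nbhs_filter x)) => j.
have FE y : F y 0 j = rho (enorm y) / enorm y * y 0 j by rewrite /F !mxE.
rewrite FE; under eq_fun do rewrite FE.
apply: (cvgM (FF := nbhs_filter x)); last exact: rV_coord_continuous.
apply: (cvgM (FF := nbhs_filter x)); first by apply: cvg_comp ce _; exact: cr.
by apply: (cvgV (FF := nbhs_filter x)) => //; rewrite gt_eqF.
Qed.

Lemma outer_connected r : 0 <= r -> connected [set y : 'rV[R]_m.+1 | r < enorm y].
move=> r0; have -> : [set y : 'rV[R]_m.+1 | r < enorm y] = [set y | exists2 t, 0 < t & enorm y = r + t].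
  apply/seteqP; split=> y /=; first by move=> ry; exists (enorm y - r); rewrite ?subr_gt0 // addrC subrK.
  by move=> [t t0 ->]; rewrite ltrDl.
apply: (shell_connected (rho := fun t => r + t)) => t t0; last by rewrite ltr_wpDl.
by apply: cvgD; [exact: cvg_cst|exact: cvg_id].
Qed.

Lemma inner_connected a b : 0 <= a -> a < b -> connected [set y : 'rV[R]_m.+1 | a < enorm y < b].
move=> a0 ab; have ba : 0 < b - a by rewrite subr_gt0.
(* t -> t / (1 + t) maps the positive reals onto ]0, 1[; the radius |y| comes from t = (|y| - a) /
   (b - |y|). *)
have -> : [set y : 'rV[R]_m.+1 | a < enorm y < b] =
    [set y | exists2 t, 0 < t & enorm y = a + (b - a) * (t / (1 + t))].
  apply/seteqP; split=> y /=.
    move=> /andP[ay yb]; have y1 : 0 < enorm y - a by rewrite subr_gt0.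
    have y2 : 0 < b - enorm y by rewrite subr_gt0.
    exists ((enorm y - a) / (b - enorm y)); first by rewrite divr_gt0.
    have n1 : b - enorm y != 0 by rewrite gt_eqF. have n2 : b - a != 0 by rewrite gt_eqF.
    have n3 : b - enorm y + (enorm y - a) != 0 by rewrite subrKA. by field; rewrite n1 n3.
  move=> [t t0 ->]; have t1 : 0 < 1 + t by rewrite ltr_wpDr // ltW.
  rewrite ltrDl mulr_gt0 ?divr_gt0 //= -ltrBrDl -[ltRHS]mulr1 ltr_pM2l // ltr_pdivrMr // mul1r.
  by rewrite ltrDr.
apply: (shell_connected (rho := fun t => a + (b - a) * (t / (1 + t)))) => t t0; last first.
  have t1 : 0 < 1 + t by rewrite ltr_wpDr // ltW. by rewrite ltr_wpDl // mulr_gt0 ?divr_gt0.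
have t1 : 1 + t != 0 by rewrite gt_eqF // ltr_wpDr // ltW.
apply: cvgD; first exact: cvg_cst.
apply: cvgM; first exact: cvg_cst.
apply: cvgM; first exact: cvg_id.
by apply: cvgV => //; apply: cvgD; [exact: cvg_cst|exact: cvg_id].
Qed.

End Shells.

(** * Compactness of the truncations *)

Section Truncation.
Context {R : realType} (m : nat) (M : manifold R m).
Hypothesis m0 : (0 < m)%N.
Notation X := (@exterior R m.+1).
Variables (g : metric_field M) (rg : smooth_metric g).
Variables (dM : {measure set (borel M) -> \bar R}) (hdM : volume_measure g dM).
Variable theta : chart R m M.
Hypotheses (ath : atlas theta) (cth : cod theta = X) (core_compact : compact (~` dom theta)).
Hypothesis core_nonempty : exists p, ~ dom theta p.
Hypothesis vol_large : exists2 R1 : R, 1 < R1 &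
  forall x, R1 <= enorm x -> 2^-1 <= sqrdet (coef theta g x).

Let thX x : X x -> cod theta x. by rewrite cth. Qed.

Definition in_shell (J : set 'rV[R]_m.+1) : set M := [set p | dom theta p /\ J (co theta p)].

Lemma in_shellE J : J `<=` X -> in_shell J = pt theta @` J.
move=> JX; apply/seteqP; split=> [p [tp Jp]|_ [x Jx <-]].
  by exists (co theta p) => //; exact: of_coordK.
have cx := thX (JX _ Jx); split; first exact: cod_dom.
by rewrite to_coordK.
Qed.

Lemma in_shell_connected J : J `<=` X -> connected J -> connected (in_shell J).
move=> JX cJ; rewrite in_shellE //; apply: connected_continuous_connected => //.
have [_ _ _ _ cf] := atlas_chart ath; apply: continuous_subspaceW cf.
by rewrite cth.
Qed.

Lemma in_shell_compact J : J `<=` X -> compact J -> compact (in_shell J).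
move=> JX cJ; rewrite in_shellE //; apply: continuous_compact => //.
have [_ _ _ _ cf] := atlas_chart ath; apply: continuous_subspaceW cf.
by rewrite cth.
Qed.

Lemma in_shell_open J : open J -> open (in_shell J).
move=> oJ; have [_ _ _ /subspace_continuousP cf _] := atlas_chart ath.
have [V oV E] := within_preimage_open cf oJ.
have -> : in_shell J = dom theta `&` V by rewrite -E.
by apply: openI => //; exact: open_dom.
Qed.

Lemma compact_ball_annulus a b : compact [set x : 'rV[R]_m.+1 | a <= enorm x <= b].
have -> : [set x : 'rV[R]_m.+1 | a <= enorm x <= b] = [set x | a <= enorm x] `&` [set x | enorm x <= b].
  by apply/seteqP; split=> x /=; [move/andP|move=> [-> ->]].
apply: (subclosed_compact _ (@compact_cube R m.+1 b)).
  by apply: closedI; [exact: closed_enorm_ge|exact: closed_enorm_le].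
by move=> x [_ /enorm_cube].
Qed.

Lemma finite_measure_cover (s : seq M) (W : M -> set M) :
  (forall p, open (W p)) -> (forall p, (dM (W p : set (borel M)) < +oo)%E) ->
  exists2 U : set M, open U /\ (forall p q, p \in s -> W p q -> U q) &
    (dM (U : set (borel M)) < +oo)%E /\ (forall q, U q -> exists2 p, p \in s & W p q).
move=> oW fW; elim: s => [|p s [U [oU WU] [fU UW]]].
  exists set0; first by split; [exact: open0|]. by split=> //; rewrite measure0.
exists (W p `|` U).
  split; first exact: openU. move=> p' q; rewrite inE => /orP[/eqP ->|ps] Wq; first by left.
  by right; apply: WU Wq.
split; last first.
  move=> q [Wq|/UW[p' ps Wq]]; first by exists p => //; rewrite mem_head.
  by exists p' => //; rewrite inE ps orbT.
apply: (@le_lt_trans _ _ (dM (W p : set (borel M)) + dM (U : set (borel M)))%E).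
  by apply: measureU2; exact: open_borel.
by rewrite lte_add_pinfty.
Qed.

(** The bump function at p is integrable, being continuous with compact support in a chart, and it
    dominates the indicator of W. *)
Lemma small_neighbourhood p : exists W K : set M,
  [/\ open W, W p, compact K, W `<=` K & (dM (W : set (borel M)) < +oo)%E].
have [W [K [chi [oW Wp cK Kc] [Cchi chi0 chi1]]]] := chart_bump p.
exists W, K; split=> //.
  move=> q Wq; apply: contrapT => nK; have := chi1 _ Wq; rewrite chi0 // => /eqP.
  by rewrite eq_sym oner_eq0.
have [+ _] := volume_chart rg hdM (chart_at_atlas p) cK Kc chi0 (CkAW (Cchi _ (chart_at_atlas p))).
move=> /integrableP[mchi]; apply: le_lt_trans.
have mW : measurable (W : set (borel M)) by exact: open_borel.
have -> : dM (W : set (borel M)) = (\int[dM]_q (\1_(W : set (borel M)) q)%:E)%E.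
  by rewrite integral_indic // setIT.
apply: ge0_le_integral => //.
- by apply/measurable_EFinP; exact: measurable_indic.
- by apply: measurableT_comp mchi.
move=> q _ /=; rewrite indicE lee_fin; case: (pselect (W q)) => Wq.
  by rewrite mem_set // chi1 // normr1.
by rewrite (memNset Wq); exact: normr_ge0.
Qed.

(* Outside a compact set the end is exhausted: the outer shell has infinite volume, so it is
   not contained in a relatively compact neighbourhood of the core; the inner one is, because
   otherwise the core would be open. *)
Lemma core_neighbourhood : exists2 R0 : R, 1 < R0 & exists2 U : set M, open U /\ ~` dom theta `<=` U &
  (forall p, dom theta p -> R0 < enorm (co theta p) -> ~ U p) /\
  (forall r, R0 <= r -> compact (@truncation R m M theta r)).
have [W /choice [K WK]] := choice small_neighbourhood.
have [s _ Cs] : finite_subset_cover [set: M] W (~` dom theta).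
  move: core_compact; rewrite compact_cover; apply; first by move=> p _; have [] := WK p.
  by move=> p _; exists p => //; have [] := WK p.
have oW p : open (W p) by have [] := WK p.
have fW p : (dM (W p : set (borel M)) < +oo)%E by have [] := WK p.
have [U [oU WU] [fU UW]] := finite_measure_cover (finmap.enum_fset s) oW fW.
have CU : ~` dom theta `<=` U.
  by move=> q /Cs [p ps Wq]; apply: WU Wq.
pose L : set M := [set q | exists2 p, p \in finmap.enum_fset s & K p q].
have cL : compact L.
  rewrite /L; elim: (finmap.enum_fset s) => [|p l IH].
    have -> : [set q : M | exists2 p, p \in [::] & K p q] = set0 by apply/seteqP; split=> q // [].
    exact: compact0.
  have -> : [set q : M | exists2 p', p' \in p :: l & K p' q] = K p `|` [set q | exists2 p', p' \in l & K p' q].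
    apply/seteqP; split=> q.
      by move=> [p' + Kq]; rewrite inE => /orP[/eqP <-|pl]; [left|right; exists p'].
    by move=> [Kq|[p' pl Kq]]; [exists p; rewrite ?mem_head|exists p'; rewrite ?inE ?pl ?orbT].
  by apply: compactU => //; have [] := WK p.
have UL : U `<=` L by move=> q /UW[p ps Wq]; exists p => //; have [_ _ _ + _] := WK p; apply.
have clL : closed L by apply: compact_closed => //; exact: space_hausdorff.
(* B is a compact subset of the end, so |x| on it ranges over a compact subset of ]1, +oo[; this
   yields the radii a > 1 and b. *)
pose B := L `&` ~` U.
have cB : compact B.
  by apply: (subclosed_compact _ cL); [apply: closedI => //; exact: open_closedC|move=> q []].
have Bt : B `<=` dom theta by move=> q [_ nU]; apply: contrapT => /CU.
have cBx := compact_image ath cB Bt.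
have cT : compact (@enorm R m.+1 @` (co theta @` B)).
  by apply: continuous_compact => //; apply: continuous_subspaceT; exact: continuous_enorm.
have [b Bb] : exists b : R, co theta @` B `<=` [set x | enorm x <= b].
  have /compact_bounded [r [_ Br]] := cT; exists (r + 1) => x Bx.
  apply: le_trans (ler_norm _) _; apply: (Br (r + 1)); first by rewrite ltrDl. by exists x.
have [a a1 Ba] : exists2 a : R, 1 < a & co theta @` B `<=` [set x | a <= enorm x].
  have clT : closed (@enorm R m.+1 @` (co theta @` B)) by apply: compact_closed => //; exact: Rhausdorff.
  have BX x : (co theta @` B) x -> 1 < enorm x.
    by move=> [q Bq <-]; have := dom_cod (Bt _ Bq); rewrite cth.
  have nb : nbhs (1 : R) (~` (@enorm R m.+1 @` (co theta @` B))).
    apply: open_nbhs_nbhs; split; first exact: closed_openC.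
    by move=> [x Bx x1]; have := BX _ Bx; rewrite x1 ltxx.
  have /nbhs_ballP[e /= e0 eT] := nb; exists (1 + e); first by rewrite ltrDl.
  move=> x Bx /=; rewrite leNgt; apply/negP => xe; apply: (eT (enorm x)); last by exists x.
  by rewrite /ball /= distrC gtr0_norm ?subr_gt0 ?BX // ltrBlDl.
have [R1 R11 HR1] := vol_large.
pose R0 := Num.max (Num.max b R1) a.
(* Off B the open set U and the closed set L coincide, so U meets the connected shell in an open and
   closed part. *)
have dich J : J `<=` X -> connected J -> (forall x, J x -> ~ (co theta @` B) x) ->
    in_shell J `<=` U \/ in_shell J `&` U = set0.
  move=> JX cJ JB; have := in_shell_connected JX cJ.
  have [->|/set0P Une] := eqVneq (in_shell J `&` U) set0; first by right.
  move=> /(_ (in_shell J `&` U) Une) H; left. have E : in_shell J `&` U = in_shell J.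
    apply: H; first by exists U. exists L => //; apply/seteqP; split=> q [Jq]; first by move=> /UL.
    move=> Lq; split=> //; apply: contrapT => nU; case: Jq => tq Jq. by apply: (JB _ Jq); exists q.
  by rewrite -E => q [].
have outer : in_shell [set x | R0 < enorm x] `&` U = set0.
  have JX : [set x : 'rV[R]_m.+1 | R0 < enorm x] `<=` X.
    by move=> x /=; apply: lt_trans; rewrite !lt_max R11 orbT.
  have JC : connected [set x : 'rV[R]_m.+1 | R0 < enorm x].
    by apply: outer_connected => //; rewrite !le_max (ltW (lt_trans ltr01 R11)) orbT.
  have JB (x : 'rV[R]_m.+1) : R0 < enorm x -> ~ (co theta @` B) x.
    move=> xR /Bb /=; apply/negP; rewrite -ltNge; apply: le_lt_trans xR. by rewrite !le_max lexx.
  have [JU|//] := dich _ JX JC JB; exfalso; pose S := in_shell [set x | R0 < enorm x].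
  have oS : open S by apply: in_shell_open; exact: open_enorm_gt.
  have mS : measurable (S : set (borel M)) by exact: open_borel.
  have fS : (dM (S : set (borel M)) < +oo)%E.
    by apply: le_lt_trans fU; apply: le_measure => //; rewrite inE //; exact: open_borel.
  have R00 : 0 <= R0 by rewrite !le_max (ltW (lt_trans ltr01 R11)) orbT.
  have St : (S : set M) `<=` dom theta by move=> q [].
  have mA : measurable ([set x : 'rV[R]_m.+1 | R0 < enorm x] : set (bor 'rV[R]_m.+1)).
    by apply: open_borel; exact: open_enorm_gt.
  (* In the cube of size k, the part with |x| > R0 has volume density at least 1/2 and the rest lies
     in the cube of size R0; this is incompatible with a finite volume of S when k is large. *)
  have key (k : R) : 0 <= k -> (((2 * k) ^+ m.+1)%:E <= 2%:E * dM (S : set (borel M)) + ((2 * R0) ^+ m.+1)%:E)%E.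
    move=> k0; rewrite -!lebn_cube //.
    pose A : set (bor 'rV[R]_m.+1) := cube k `&` [set x | R0 < enorm x].
    have mAk : measurable A by apply: measurableI => //; exact: measurable_cube.
    apply: (@le_trans _ _ (lebn m.+1 A + lebn m.+1 (cube R0))%E).
      apply: le_trans (measureU2 _ mAk (measurable_cube R0)). apply: le_measure; rewrite ?inE //.
      - exact: measurable_cube.
      - by apply: measurableU => //; exact: measurable_cube.
      - move=> x kx; have [xR|xR] := ltP R0 (enorm x); first by left.
        by right; exact: enorm_cube.
    rewrite leeD2r //. have : (2^-1%:E * lebn m.+1 A <= dM (S : set (borel M)))%E.
      rewrite (volume_lebn rg hdM ath mS St) integral_mkcond.
      have -> : lebn m.+1 A = (\int[lebn m.+1]_x (\1_A x)%:E)%E by rewrite integral_indic // setIT.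
      rewrite -ge0_integralZl //; last by apply/measurable_EFinP; exact: measurable_indic.
      apply: ge0_le_integral => //.
      - by apply/measurable_EFinP; apply: measurable_funM => //; exact: measurable_indic.
      - have mC := measurable_cod ath.
        apply/(measurable_restrictT _ mC); apply/measurable_EFinP; apply: measurable_funM.
          apply: (measurable_comp measurableT _ _ (measurable_of_coord ath)) => //.
        apply: (CkA_measurable_cod ath); apply: CkA_sqrt => [x cx|]; first exact: (coef_det rg).
        exact: (sm_det (coef_sm rg ath) 0).
      move=> x _; rewrite indicE; case: (pselect (A x)) => [[kx xR]|nA]; last first.
        by rewrite (memNset nA) mule0 /patch; case: ifP.
      have xX : X x by apply: lt_trans xR; rewrite !lt_max R11 orbT. have tx := thX xX.
      rewrite (mem_set (A := A)) // mule1 /patch (mem_set (A := cod theta)) //.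
      rewrite indicE mem_set; last first.
        by split; [exact: (cod_dom ath (thX xX))|rewrite /= to_coordK //; exact: thX].
      rewrite mul1r lee_fin; apply: HR1; apply: le_trans (ltW xR). by rewrite !le_max lexx orbT.
    have : dM (S : set (borel M)) != -oo%E by rewrite -ltNye; apply: lt_le_trans (measure_ge0 _ _).
    move: fS; case: (dM _) => [v||] // _ _.
    have : lebn m.+1 A != -oo%E by rewrite -ltNye; apply: lt_le_trans (measure_ge0 _ _).
    case: (lebn m.+1 A) => [w||] //.
      by move=> _; rewrite -!EFinM !lee_fin; lra.
    by rewrite gt0_muley // lte_fin.
  pose v := fine (dM (S : set (borel M))); have v0 : 0 <= v by exact: fine_ge0.
  have vE : dM (S : set (borel M)) = v%:E by rewrite fineK // ge0_fin_numE.
  have p0 : 0 <= (2 * R0) ^+ m.+1 by rewrite exprn_ge0 // mulr_ge0.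
  (* Then 2 k > 2 v + (2 R0)^(m+1), while (2 k)^(m+1) >= 2 k since 2 k >= 1. *)
  pose k := v + (2 * R0) ^+ m.+1 + 1; have k0 : 0 <= k by rewrite /k !addr_ge0.
  have := key k k0; rewrite vE -EFinM -EFinD lee_fin leNgt => /negP; apply.
  apply: (@lt_le_trans _ _ (2 * k)); first by rewrite /k; lra. by apply: ler_eXnr => //; rewrite /k; lra.
have inner : in_shell [set x | 1 < enorm x < a] `<=` U.
  have JX : [set x : 'rV[R]_m.+1 | 1 < enorm x < a] `<=` X by move=> x /andP[].
  have JC : connected [set x : 'rV[R]_m.+1 | 1 < enorm x < a] by exact: inner_connected.
  have JB (x : 'rV[R]_m.+1) : 1 < enorm x < a -> ~ (co theta @` B) x.
    by move=> /andP[_ xa] /Ba /=; rewrite leNgt xa.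
  (* The core would be U minus the compact annulus a <= |x| <= R0. Being open, closed and nonempty
     it would be all of M, although the end is not empty. *)
  have [//|J0] := dich _ JX JC JB; exfalso. have oC : open (~` dom theta).
    have -> : ~` dom theta = U `&` ~` in_shell [set x | a <= enorm x <= R0].
      apply/seteqP; split=> [q nq|q [Uq nq] tq].
        by split; [exact: CU|move=> []].
      have x1 : 1 < enorm (co theta q) by have := dom_cod tq; rewrite cth.
      have [xa|xa] := ltP (enorm (co theta q)) a.
        have : (in_shell [set x | 1 < enorm x < a] `&` U) q by split=> //; split=> //=; rewrite x1.
        by rewrite J0.
      have [xR|xR] := ltP R0 (enorm (co theta q)); last first.
        by apply: nq; split=> //=; rewrite xa.
      have : (in_shell [set x | R0 < enorm x] `&` U) q by []. by rewrite outer.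
    apply: openI => //; apply: closed_openC; apply: compact_closed; first exact: space_hausdorff.
    apply: in_shell_compact; last exact: compact_ball_annulus.
    by move=> x /andP[xa _]; exact: lt_le_trans xa.
  have : ~` dom theta = setT.
    apply: space_connected.
    - exact: core_nonempty.
    - by exists (~` dom theta); rewrite ?setTI.
    - exists (~` dom theta); rewrite ?setTI //; apply: compact_closed => //; exact: space_hausdorff.
  move=> CT; pose e : 'rV[R]_m.+1 := ev ord0. have e0 : enorm e != 0.
    by rewrite enorm_eq0; apply/eqP => /matrixP /(_ 0 ord0); rewrite !mxE !eqxx => /eqP; rewrite oner_eq0.
  have x1 : X ((2 / enorm e) *: e).
    by rewrite /exterior /= enormZ ger0_norm ?divr_ge0 ?enorm_ge0 // divfK // ltr1n.
  have : (~` dom theta) (pt theta ((2 / enorm e) *: e)) by rewrite CT.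
  by apply; exact: (cod_dom ath (thX x1)).
exists R0; first by rewrite lt_max a1 orbT.
exists U => //; split.
  move=> p tp xR Up; have : (in_shell [set x | R0 < enorm x] `&` U) p by []. by rewrite outer.
move=> r rR; apply: (subclosed_compact (B := L `|` in_shell [set x | a <= enorm x <= r])).
- rewrite /truncation; apply: open_closedC.
  have -> : [set p | dom theta p /\ r < enorm (co theta p)] = in_shell [set x | r < enorm x] by [].
  by apply: in_shell_open; exact: open_enorm_gt.
- apply: compactU => //; apply: in_shell_compact; last exact: compact_ball_annulus.
  by move=> x /andP[xa _]; exact: lt_le_trans xa.
- move=> q; rewrite /truncation /= => nq; case: (pselect (dom theta q)) => tq; last by left; apply: UL; exact: CU.
  have x1 : 1 < enorm (co theta q) by have := dom_cod tq; rewrite cth.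
  have [xa|xa] := ltP (enorm (co theta q)) a.
    by left; apply: UL; apply: inner; split=> //=; rewrite x1.
  right; split=> //=; rewrite xa /= leNgt; apply/negP => rx; exact: nq.
Qed.

End Truncation.

(** * Stokes' formula *)

Section Stokes.
Context {R : realType} (m : nat) (M : manifold R m).
Variables (g : metric_field M) (rg : smooth_metric g).
Variables (dM : {measure set (borel M) -> \bar R}) (hdM : volume_measure g dM).
Variables (dG : {measure set (borel M) -> \bar R}) (hdG : boundary_measure g dG).
(* V is sqrt (det g) times a vector field with divergence F and boundary flux - b, and
   D zeta is its derivative of zeta. *)
Variables (V : chart R m M -> 'I_m.+1 -> 'rV[R]_m.+1 -> R) (F b : M -> R) (D : (M -> R) -> M -> R).
Implicit Types (c d : chart R m M).
Hypothesis VC : forall c i, atlas c -> CkA 1 (cod c) (V c i).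
Hypothesis divV : forall c x, atlas c -> cod c x ->
  \sum_i pd (cod c) (V c i) i x = sqrdet (coef c g x) * F (pt c x).
Hypothesis derV : forall c x f, atlas c -> cod c x -> C1fun f ->
  \sum_i pd (cod c) (fun y => f (pt c y)) i x * V c i x = sqrdet (coef c g x) * D f (pt c x).
Hypothesis bV : forall c x, atlas c -> cod c x -> boundary M (pt c x) ->
  - V c ord0 x = b (pt c x) * sqrdet (face (coef c g x)).

(** Integrability is part of the formula because the localized pieces are added afterwards. *)
Definition stokes_for (f : M -> R) : Prop := [/\ dM.-integrable setT (EFin \o (fun p => f p * F p)),
      dM.-integrable setT (EFin \o D f), dG.-integrable (Gamma_ M) (EFin \o (fun p => f p * b p)) &
      \int[dM]_p (f p * F p) + \int[dM]_p D f p = \int[dG]_(p in (Gamma_ M)) (f p * b p)].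

Let rM c : atlas c -> regular (cod c) := @regular_cod _ _ _ c.

Let sq c x := sqrdet (coef c g x).

Let sq_gt0 c x : atlas c -> cod c x -> 0 < sq c x.
by move=> ac cx; rewrite sqrtr_gt0; exact: coef_det. Qed.

Let sqC c : atlas c -> CkA 0 (cod c) (sq c).
move=> ac; apply: CkA_sqrt => [x cx|]; first exact: coef_det.
exact: (sm_det (coef_sm rg ac) 0).
Qed.

Let by_chart (P : M -> Prop) : (forall c x, atlas c -> cod c x -> P (pt c x)) -> forall p, P p.
move=> H p; have ap := chart_at_atlas p; have pp := chart_at_dom p.
by rewrite -(of_coordK ap pp); apply: H => //; exact: dom_cod.
Qed.

Lemma derD f1 f2 p : C1fun f1 -> C1fun f2 -> D (fun q => f1 q + f2 q) p = D f1 p + D f2 p.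
move=> C1 C2; move: p; apply: by_chart => c x ac cx; apply: (mulfI (lt0r_neq0 (sq_gt0 ac cx))).
rewrite mulrDr -!derV //; last exact: C1funD.
rewrite -big_split /=; bigr => i _; rewrite -mulrDl; congr (_ * _).
by apply: pdD => //; [exact: rM|exact: C1|exact: C2].
Qed.

Lemma stokesD f1 f2 : C1fun f1 -> C1fun f2 -> stokes_for f1 -> stokes_for f2 ->
  stokes_for (fun p => f1 p + f2 p).
move=> C1 C2 [a1 b1 c1 e1] [a2 b2 c2 e2].
have mb : measurable (Gamma_ M) by apply: closed_borel; exact: closed_boundary.
have E1 : (fun p => (f1 p + f2 p) * F p) = (fun p => f1 p * F p + f2 p * F p).
  by apply/funext => p; rewrite mulrDl.
have E2 : D (fun p => f1 p + f2 p) = (fun p => D f1 p + D f2 p).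
  by apply/funext => p; rewrite derD.
have E3 : (fun p => (f1 p + f2 p) * b p) = (fun p => f1 p * b p + f2 p * b p).
  by apply/funext => p; rewrite mulrDl.
rewrite /stokes_for E1 E2 E3; split.
- exact: (integrableD measurableT a1 a2).
- exact: (integrableD measurableT b1 b2).
- exact: (integrableD mb c1 c2).
- by rewrite !RintegralD // -e1 -e2; ring.
Qed.

(** Extended by 0, f V is a C^1 field of bounded support on R^n or on a half-space, where the
    integral of its divergence is 0 or an integral over the face. *)
Lemma chart_stokes c K f : atlas c -> compact K -> K `<=` dom c ->
  (forall p, ~ K p -> f p = 0) -> C1fun f -> stokes_for f.
move=> ac cK Kc f0 Cf; have rc := rM ac.
pose z x := f (pt c x); have Cz : CkA 1 (cod c) z by exact: Cf.
have z0 x : ~ K (pt c x) -> z x = 0 by exact: f0.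
have clK : closed K by apply: compact_closed => //; exact: space_hausdorff.
have oK : open (~` K) by exact: closed_openC.
have dz0 d i x : atlas d -> cod d x -> ~ K (pt d x) -> pd (cod d) (fun y => f (pt d y)) i x = 0.
  move=> ad cx nK; have xK : coimg d (~` K) x by apply/(coimgP _ _ ad).
  rewrite -(pd_coimg _ _ ad oK xK) (@pd_eq _ _ _ _ (fun=> 0)) ?pd_cst //; first exact: regular_coimg.
  by move=> y /(coimgP _ _ ad)[_ nKy]; exact: f0.
have CF : CkA 0 (cod c) (fun x => F (pt c x)).
  apply: (CkA_eq (f := fun x => (\sum_i pd (cod c) (V c i) i x) * (sq c x)^-1)).
    by move=> x cx; rewrite divV // mulrAC divff ?mul1r // (lt0r_neq0 (sq_gt0 ac cx)).
  apply: CkAM; first by apply: CkA_sum => i _; apply: CkA_pd => //; exact: VC.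
  by apply: CkAV; [move=> x cx; exact: (lt0r_neq0 (sq_gt0 ac cx))|exact: sqC].
have CD : CkA 0 (cod c) (fun x => D f (pt c x)).
  apply: (CkA_eq (f := fun x => (\sum_i pd (cod c) z i x * V c i x) * (sq c x)^-1)).
    by move=> x cx; rewrite derV // mulrAC divff ?mul1r // (lt0r_neq0 (sq_gt0 ac cx)).
  apply: CkAM; first apply: CkA_sum => i _.
    by apply: CkAM; [exact: CkA_pd|apply: CkAW; exact: VC].
  by apply: CkAV; [move=> x cx; exact: (lt0r_neq0 (sq_gt0 ac cx))|exact: sqC].
have Df0 : forall p, ~ K p -> D f p = 0.
  apply: by_chart => d x ad cx nK; have /esym := derV ad cx Cf.
  rewrite big1 => [/eqP|i _]; last by rewrite dz0 ?mul0r.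
  by rewrite mulf_eq0 (negbTE (lt0r_neq0 (sq_gt0 ad cx))) => /eqP.
have [i1 e1] : dM.-integrable setT (EFin \o (fun p => f p * F p)) /\
    \int[dM]_p (f p * F p) = \int[lebn m.+1]_x ((fun x => z x * F (pt c x) * sq c x) \_ (cod c)) x.
  apply: (volume_chart rg hdM (f := fun p => f p * F p) ac cK Kc).
    by move=> p nK; rewrite f0 // mul0r.
  by apply: CkAM => //; exact: CkAW.
have [i2 e2] := volume_chart rg hdM (f := D f) ac cK Kc Df0 CD.
have [A [W0 oW0 [cA clA AE]]] := model_cod ac.
have rA : regular A by case: AE => ->; [exact: regularT|exact: regular_half].
pose zV i x := z x * V c i x.
have CzV i : CkA 1 (cod c) (zV i) by apply: CkAM => //; exact: VC.
have zV0 i x : cod c x -> ~ K (pt c x) -> zV i x = 0.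
  by move=> _ nK; rewrite /zV z0 // mul0r.
pose G i := zV i \_ (cod c).
have CG i : CkA 1 A (G i) by exact: (extend_cod ac cK Kc (zV0 i) (CzV i) oW0 cA).
pose H i x := pd (cod c) z i x * V c i x + z x * pd (cod c) (V c i) i x.
(* Off the chart image, G vanishes near every point because the image of the compact set K is
   closed. *)
have GH i : pd A (G i) i \_ A = H i \_ (cod c).
  apply/funext => x; rewrite /patch; case: (pselect (A x)) => Ax; last first.
    by rewrite memNset // memNset // cA => -[].
  rewrite (mem_set Ax); case: (pselect (cod c x)) => cx.
    rewrite (mem_set cx) /H -pdM //; last exact: VC. apply: (pd_local (U := W0)) => //.
    - by move: cx; rewrite cA => -[].
    - by move=> y Wy; rewrite cA; split=> [Ay|[]].
    - by move=> y Wy Ay; rewrite /G /patch mem_set // cA.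
  rewrite memNset //. have oKx : open (~` (co c @` K)).
    by apply: closed_openC; apply: compact_closed; [exact: norm_hausdorff|exact: compact_image].
  rewrite (@pd_local _ _ A A (~` (co c @` K)) _ (fun=> 0)) ?pd_cst //.
    by move=> -[q Kq qx]; apply: cx; rewrite -qx; apply: dom_cod; exact: Kc.
  move=> y nKy _; rewrite /G /patch; case: ifP => // /set_mem cy; apply: zV0 => // Ky.
  by apply: nKy; exists (pt c y) => //; exact: to_coordK.
have [r r0 Kr] := image_in_cube ac cK Kc.
have G0 i x : ~ cube r x -> G i x = 0.
  move=> nr; rewrite /G /patch; case: ifP => // /set_mem cx; apply: zV0 => // Kx; apply: nr; apply: Kr.
  by exists (pt c x) => //; exact: to_coordK.
have bH i : bms (H i \_ (cod c)).
  apply: (chart_bms ac cK Kc).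
    by move=> x cx nK; rewrite /H dz0 // z0 // !mul0r addr0.
  by apply: CkAD; apply: CkAM; do ?[exact: CkA_pd|by apply: CkAW|apply: CkA_pd => //; exact: VC|apply: CkAW; exact: VC].
have sumH : \int[dM]_p (f p * F p) + \int[dM]_p D f p = \sum_i \int[lebn m.+1]_x (H i \_ (cod c)) x.
  rewrite e1 e2 -IID; last 2 first.
  - apply: (chart_bms ac cK Kc); first by move=> x cx nK; rewrite z0 // !mul0r.
    by apply: CkAM; [apply: CkAM => //; exact: CkAW|exact: sqC].
  - apply: (chart_bms ac cK Kc); first by move=> x cx nK; rewrite Df0 // !mul0r.
    by apply: CkAM => //; exact: sqC.
  rewrite -II_sum //; apply: II_eq => x; rewrite /patch; case: ifP => [/set_mem cx|_]; last first.
    by rewrite addr0 big1.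
  by rewrite [RHS]big_split /= -mulr_sumr divV // (derV ac cx Cf) -/(sq c x); ring.
have mb : measurable (Gamma_ M) by apply: closed_borel; exact: closed_boundary.
(* A chart modelled on R^n contains no boundary point and yields no boundary term; on a half-space
   only coordinate 0 contributes. *)
case: AE => AE.
  have bd0 p : boundary M p -> f p = 0.
    move=> bp; apply: f0 => Kp; apply: (open_no_boundary ac _ (Kc _ Kp) bp). by rewrite cA AE setTI.
  have E3 : {in (Gamma_ M), (fun p => f p * b p) =1 (fun=> 0)}.
    by move=> p /set_mem bp; rewrite bd0 // mul0r.
  split=> //.
    apply: (@eq_integrable _ _ _ dG _ mb (EFin \o (fun=> 0))) => [p pb|]; last exact: integrable0.
    by rewrite /= E3.
  rewrite sumH (eq_Rintegral dG E3) Rintegral_cst // mul0r big1 // => i _.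
  rewrite (II_eq (g := pd setT (G i) i)); last by move=> x; rewrite -GH AE /patch mem_set.
  rewrite /Rintegral (integral_pdT i r0) //; first by rewrite -AE. exact: G0.
pose s x := sqrdet (face (coef c g x)).
have s0 x : cod c x -> 0 < s x by move=> cx; rewrite sqrtr_gt0; exact: face_det.
have Cs : CkA 0 (cod c) s.
  by apply: CkA_sqrt => [x cx|]; [exact: face_det|exact: (face_sm rg ac 0)].
have cO : cod c = W0 `&` half_space m by rewrite cA AE setIC.
(* The boundary integrand has to come from a function on the whole chart image: - f V^0 / s, which
   equals f b on the face by [bV]. *)
have [i3 e3] : dG.-integrable (Gamma_ M) (EFin \o (fun p => f p * b p)) /\
  \int[dG]_(p in (Gamma_ M)) (f p * b p) = \int[lebn m]_y
     ((fun x => - zV ord0 x / s x * s x) \_ (cod c)) (row_of (0, y)).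
  apply: (boundary_chart rg hdG ac oW0 cO cK Kc).
  - by move=> p nK; rewrite f0 // mul0r.
  - apply: CkAM; first by apply: CkAN; exact: CkAW.
    by apply: CkAV => // x cx; exact: (lt0r_neq0 (s0 x cx)).
  - by move=> x cx nK; rewrite zV0 // oppr0 mul0r.
  - move=> x cx x0; have bx := cod_boundary ac cO cx x0.
    by rewrite /zV -mulrN bV // -/(s x) mulrA mulfK // (lt0r_neq0 (s0 x cx)).
split=> //; rewrite sumH e3 (bigD1 ord0) //= [X in _ + X]big1 ?addr0 => [|i i0].
  rewrite -GH AE /Rintegral (integral_pd_half ord0 r0) ?eqxx //; first last.
  - by move=> x _; exact: G0.
  - by rewrite -AE.
  congr (fine _); apply: eq_integral => y _; rewrite /G /patch; case: ifP => [/set_mem cy|_].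
    by rewrite mulfVK // (lt0r_neq0 (s0 _ cy)).
  by rewrite oppr0.
rewrite -GH AE /Rintegral (integral_pd_half i r0) ?(negbTE i0) //; first by rewrite -AE.
by move=> x _; exact: G0.
Qed.

(** In place of a partition of unity: induction on a finite list of bumps covering the support, with
    f = f chi + f (1 - chi). The first piece lives in one chart, and the second vanishes where chi
    is 1, so the remaining bumps cover it. *)
Lemma stokes (C : set M) f : compact C -> (forall p, ~ C p -> f p = 0) -> C1fun f -> stokes_for f.
move=> cC f0 Cf.
pose U (p : M) : set M := projT1 (cid (chart_bump p)).
have UP (p : M) := projT2 (cid (chart_bump p)).
have [s _ Cs] : finite_subset_cover [set: M] U C.
  move: cC; rewrite compact_cover; apply; first by move=> p _; have [K [chi [? _ _ _] _]] := UP p.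
  by move=> p _; exists p => //; have [K [chi [_ ? _ _] _]] := UP p.
have {}f0 q : f q != 0 -> exists2 p, p \in finmap.enum_fset s & U p q.
  move=> fq; have Cq : C q by apply: contrapT => nC; move: fq; rewrite f0 // eqxx.
  by have [p ps Up] := Cs _ Cq; exists p.
move: (finmap.enum_fset s) f f0 Cf => l {cC Cs s C}; elim: l => [|p l IH] f f0 Cf.
  have fz q : f q = 0 by apply/eqP; apply: contraT => /f0[].
  by apply: (@chart_stokes (chart_at point) set0) => //; [exact: chart_at_atlas|exact: compact0].
have [K [chi [oU Up cK Kc] [Cchi chi0 chi1]]] := UP p.
have E : f = (fun q => f q * chi q + f q * (1 - chi q)) by apply/funext => q; ring.
have C2 : C1fun (fun q => f q * (1 - chi q)).
  by apply: C1funM => //; apply: C1funB => //; exact: C1fun_cst.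
rewrite E; apply: stokesD => //; first exact: C1funM.
  apply: (chart_stokes (chart_at_atlas p) cK Kc); last exact: C1funM.
  by move=> q nK; rewrite chi0 // mulr0.
apply: IH => // q fq; have {}fq : f q != 0 /\ ~ U p q.
  split; first by apply: contraNneq fq => ->; rewrite mul0r.
  by move=> Uq; move: fq; rewrite chi1 // subrr mulr0 eqxx.
have [p' + Up'] := f0 _ fq.1; rewrite inE => /orP[/eqP pE|p'l]; last by exists p'.
by exfalso; apply: fq.2; rewrite -pE.
Qed.

Hypothesis m0 : (0 < m)%N.
Variable theta : chart R m M.
Hypotheses (ath : atlas theta) (cth : cod theta = @exterior R m.+1).
Hypothesis core_compact : compact (~` dom theta).
Hypothesis core_nonempty : exists p, ~ dom theta p.
Hypothesis vol_large : exists2 R1 : R, 1 < R1 &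
  forall x, R1 <= enorm x -> 2^-1 <= sqrdet (coef theta g x).

Notation X := (@exterior R m.+1).
Notation n := (m.+1).
Notation ann := (@annulus R m).
Notation II f := (\int[lebn _]_x f x).
Let rX : regular X := open_regular (@open_exterior R m).
Let w (x : 'rV[R]_n) := sqrdet (coef theta g x).

Lemma derivative_locally_constant (W : set M) (f : M -> R) (a : R) p :
  open W -> C1fun f -> (forall q, W q -> f q = a) -> W p -> D f p = 0.
move=> oW Cf fa Wp; have ac := chart_at_atlas p; have cp := chart_at_dom p.
set c := chart_at p in ac cp; have cx := dom_cod cp.
have px : pt c (co c p) = p by exact: of_coordK.
have /esym := derV ac cx Cf; rewrite px big1 => [/eqP|i _].
  by rewrite mulf_eq0 sqrtr_eq0 leNgt coef_det //= => /eqP.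
have xW : coimg c W (co c p) by apply/(coimgP _ _ ac); rewrite px.
rewrite -(pd_coimg _ _ ac oW xW) (@pd_eq _ _ _ _ (fun=> a)) ?pd_cst ?mul0r //; first exact: regular_coimg.
by move=> y /(coimgP _ _ ac)[_ /fa].
Qed.

Let w0 x : X x -> 0 < w x. by move=> Xx; rewrite sqrtr_gt0 coef_det // cth. Qed.

Let wC : CkA 0 X w.
rewrite -cth; apply: CkA_sqrt => [x cx|]; first exact: coef_det.
exact: (sm_det (coef_sm rg ath) 0).
Qed.

Let VX i : CkA 1 X (V theta i). by rewrite -cth; exact: VC. Qed.

Let divC : CkA 0 X (fun x => \sum_i pd X (V theta i) i x).
by apply: CkA_sum => i _; exact: CkA_pd. Qed.

Let FX x : X x -> F (pt theta x) = (\sum_i pd X (V theta i) i x) / w x.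
move=> Xx; have := divV ath (x := x); rewrite cth => -> //.
by rewrite mulrAC divff ?mul1r // (lt0r_neq0 (w0 Xx)).
Qed.

Let FC : CkA 0 X (fun x => F (pt theta x)).
apply: (CkA_eq (f := fun x => (\sum_i pd X (V theta i) i x) * (w x)^-1)); first by move=> x /FX.
by apply: CkAM => //; apply: CkAV => // x /w0 /lt0r_neq0.
Qed.

Let annX a r : 1 < a -> ann a r `<=` X.
by move=> a1 x /andP[xa _]; exact: lt_trans xa. Qed.

(** phi may jump across the two spheres that bound the annulus; it is measurable as the indicator of
    a shell times a continuous function. *)
Lemma annulus_integral (a r : R) (phi : M -> R) (G : 'rV[R]_n -> R) : 1 < a -> CkA 0 X G ->
  (forall p, dom theta p -> phi p * w (co theta p) = (G \_ (ann a r)) (co theta p)) ->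
  (forall p, ~ dom theta p -> phi p = 0) ->
  dM.-integrable setT (EFin \o phi) /\ \int[dM]_p phi p = II (G \_ (ann a r)).
move=> a1 CG phiw phi0.
have mX : measurable (X : set (bor 'rV[R]_n)) by exact: open_borel (@open_exterior R m).
have wE y : X y -> phi (pt theta y) * w y = (G \_ (ann a r)) y.
  move=> Xy; have cy : cod theta y by rewrite cth.
  by rewrite -[in RHS](to_coordK ath cy) -phiw ?to_coordK //; exact: cod_dom.
have E : (fun y => phi (pt theta y) * w y) \_ X = G \_ (ann a r).
  apply/funext => y; rewrite {1}/patch; case: ifP => [/set_mem /wE //|/negbT nX].
  by rewrite /patch memNset // => /annX - /(_ a1) Xy; move: nX; rewrite mem_set.
rewrite -E; apply: (density_integral (D := dom theta : set (borel M))) => //.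
- exact: measurable_dom.
- by rewrite -cth; exact: measurable_of_coord.
- by rewrite -cth; apply: CkA_measurable_cod => //; rewrite cth.
- by move=> y Xy; apply: cod_dom => //; rewrite cth.
- by move=> y /w0 /ltW.
- by rewrite -cth => A mA At; exact: volume_lebn.
- pose S := in_shell theta [set x | a < enorm x] `\` in_shell theta [set x | r < enorm x].
  have mS : measurable (S : set (borel M)).
    by apply: measurableD; apply: (@open_borel M); apply: in_shell_open => //; exact: open_enorm_gt.
  have CGw : CkA 0 (cod theta) (fun x => G x / w x).
    by rewrite cth; apply: CkAM => //; apply: CkAV => // x /w0 /lt0r_neq0.
  apply: (eq_measurable_fun (fun p => \1_(S : set (borel M)) p * (G (co theta p) / w (co theta p)))).
    move=> p /set_mem tp; have := phiw p tp. have Xp : X (co theta p) by rewrite -cth; exact: dom_cod.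
    have SE : (p \in S) = (co theta p \in ann a r).
      apply/idP/idP => /set_mem.
        move=> [[_ xa] nr]; apply/mem_set/andP; split=> //; rewrite leNgt; apply/negP => xr; exact: nr.
      move=> /andP[xa xr]; apply/mem_set; split; first by split. by move=> [_ /=]; rewrite ltNge xr.
    rewrite indicE SE /patch; have /lt0r_neq0 wn := w0 Xp.
    by case: ifP => _ pw; apply: (mulIf wn); rewrite pw ?mul0r // mul1r divfK.
  apply: measurable_funM; first by apply: measurable_funTS; exact: measurable_indic.
  apply: within_measurable_real; first exact: measurable_dom.
  by move=> p tp; exact: (to_coord_within ath (fun _ => id) tp CGw).
- by rewrite E; exact: bms_annulus.
Qed.

(* Stokes' formula for 1 - z, where z is a radial cutoff from a to r, and the divergence theorem
   for z V between the spheres of radius a and r. *)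
Lemma truncated_stokes : exists R0 : R, forall r, R0 < r ->
  dG.-integrable (Gamma_ M) (EFin \o b) /\ [/\ 1 < r, measurable (@truncation R m M theta r),
      dM.-integrable (truncation theta r) (EFin \o F) & \int[dM]_(p in truncation theta r) F p =
      \int[dG]_(p in (Gamma_ M)) b p + flux (V theta) r].
have [R0 R01 [U [oU CU] [UR cT]]] :=
  core_neighbourhood m0 rg hdM ath cth core_compact core_nonempty vol_large.
exists (R0 + 1) => r rR0; pose a := R0 + 1.
have [a1 ar aR] : [/\ 1 < a, a < r & R0 < a] by split; rewrite /a; lra.
have ra : 0 < r - a by rewrite subr_gt0.
have r1 : 1 < r by lra.
(* K is closed in M, not only in the end: its complement is the union of an open shell and of U,
   which covers the core and avoids |x| > R0. Hence zeta, which is 1 off K, is C^1 across the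
   core. *)
pose K : set M := in_shell theta [set x | a <= enorm x].
have KE : ~` K = U `|` in_shell theta [set x | enorm x < a].
  apply/seteqP; split=> p.
    move=> nK; case: (pselect (dom theta p)) => tp; last by left; exact: CU.
    by right; split=> //=; rewrite ltNge; apply/negP => xa; apply: nK.
  move=> [Up [tp xa]|[_ xa] [_]]; last by rewrite /= leNgt xa. exact: UR tp (lt_le_trans aR xa) Up.
have oI J : open J -> open (in_shell theta J) by exact: in_shell_open.
have oK : open (~` K) by rewrite KE; apply: openU => //; apply: oI; exact: open_enorm_lt.
have clK : closed K by rewrite -[K]setCK; exact: open_closedC.
pose z (x : 'rV[R]_n) : R := step ((enorm x - a) / (r - a)).
pose zeta (p : M) : R := if pselect (dom theta p) then 1 - z (co theta p) else 1.
have zlow (x : 'rV[R]_n) : enorm x <= a -> z x = 0.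
  by move=> xa; apply: step_le0; rewrite pmulr_lle0 ?invr_gt0 // subr_le0.
have zup (x : 'rV[R]_n) : r <= enorm x -> z x = 1.
  by move=> xr; apply: step_ge1; rewrite ler_pdivlMr // mul1r lerD2r.
have zetaE p : dom theta p -> zeta p = 1 - z (co theta p).
  by move=> tp; rewrite /zeta; case: pselect.
have zeta1 p : (~` K) p -> zeta p = 1.
  rewrite /zeta; case: pselect => // tp nK; rewrite zlow ?subr0 //.
  by rewrite leNgt; apply/negP => xa; apply: nK; split=> //; exact: ltW.
have CN : CkA 1 X (fun x => (enorm x - a) / (r - a)).
  by apply: CkAM; [apply: CkAB; [exact: CkA_enormX|exact: CkA_cst]|exact: CkA_cst].
have Cz : CkA 1 X z by apply: C1_un CN => //; [exact: is_derive_step|exact: continuous_dstep].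
have dz i x : X x -> pd X z i x = dstep ((enorm x - a) / (r - a)) * (pd X (@enorm R n) i x / (r - a)).
  move=> Xx; rewrite (pd_un i is_derive_step rX Xx CN) pdM // ?pd_cst // ?mulr0 ?addr0; last first.
    by apply: CkAB => //; exact: CkA_enormX.
  by rewrite pdB // ?pd_cst ?subr0 //; exact: CkA_enormX.
have dz0 i x : X x -> ~ ann a r x -> pd X z i x = 0.
  move=> Xx na; rewrite dz //; have [xa|xa] := leP (enorm x) a.
    by rewrite dstep_le0 ?mul0r // pmulr_lle0 ?invr_gt0 // subr_le0.
  have [xr|xr] := leP (enorm x) r; first by case: na; rewrite /annulus /= xa xr.
  by rewrite dstep_ge1 ?mul0r // ler_pdivlMr // mul1r lerD2r ltW.
have C1z : CkA 1 X (fun x => 1 - z x) by apply: CkAB => //.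
have Czeta : C1fun zeta.
  apply: (C1fun_extend (c := theta) (K := K) (F := fun x => 1 - z x) (a := 1)) => //.
  - by move=> p [].
  - by rewrite cth.
have zeta0 p : ~ truncation theta r p -> zeta p = 0.
  move=> /contrapT [tp xr]; by rewrite zetaE // zup ?subrr // ltW.
have cTr : compact (truncation theta r : set M) by apply: cT; lra.
have [iF iD ib st] := stokes cTr zeta0 Czeta.
have mT : measurable (truncation theta r).
  by apply: (@closed_borel M); apply: compact_closed => //; exact: space_hausdorff.
have bt p : boundary M p -> ~ dom theta p.
  by move=> bp tp; apply: (open_no_boundary ath _ tp bp); rewrite cth; exact: open_exterior.
have bE : \int[dG]_(p in (Gamma_ M)) (zeta p * b p) = \int[dG]_(p in (Gamma_ M)) b p.
  apply: eq_Rintegral => p /set_mem bp. by rewrite zeta1 ?mul1r // => -[tp _]; exact: bt bp tp.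
have Dz x : X x -> D zeta (pt theta x) * w x = - \sum_i pd X z i x * V theta i x.
  move=> Xx; have cx : cod theta x by rewrite cth.
  rewrite mulrC -(derV ath cx Czeta) cth -sumrN; bigr => i _; rewrite -mulNr; congr (_ * _).
  rewrite (@pd_eq _ _ _ _ (fun x => 1 - z x)) // => [|y Xy]; last first.
    by rewrite zetaE ?to_coordK ?cth //; apply: cod_dom; rewrite ?cth.
  by rewrite pdB // ?pd_cst ?sub0r //; exact: CkA_cst.
have D0 p : ~ dom theta p -> D zeta p = 0.
  by move=> np; apply: (derivative_locally_constant oK Czeta zeta1) => -[].
pose dzV x := \sum_i pd X z i x * V theta i x.
have dzVC : CkA 0 X dzV.
  by apply: CkA_sum => i _; apply: CkAM; [exact: CkA_pd|exact: CkAW].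
have Xto p : dom theta p -> X (co theta p) by rewrite -cth; exact: dom_cod.
have [i1 e1] : dM.-integrable setT (EFin \o D zeta) /\
    \int[dM]_p D zeta p = II ((fun x => - dzV x) \_ (ann a r)).
  apply: annulus_integral => //; first exact: CkAN.
  move=> p tp; rewrite -{1}(of_coordK ath tp) Dz; last exact: Xto.
  rewrite /patch; case: ifP => // /negbT nx; rewrite big1 ?oppr0 // => i _.
  by rewrite dz0 ?mul0r //; [exact: Xto|move=> ax; move: nx; rewrite mem_set].
pose S : set M := in_shell theta (ann a r).
(* f restores, between the radii a and r, the part z F that the cutoff zeta removes from F; nothing
   is restored beyond r. *)
pose f (p : M) : R := \1_S p * (z (co theta p) * F p).
have SE p : dom theta p -> (p \in S) = (co theta p \in ann a r).
  by move=> tp; apply/idP/idP => /set_mem; [move=> [_ ?]|move=> ?]; exact/mem_set.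
pose divV' x := \sum_i pd X (V theta i) i x.
have CzV : CkA 0 X (fun x => z x * divV' x) by apply: CkAM => //; exact: CkAW.
have [i2 e2] : dM.-integrable setT (EFin \o f) /\
    \int[dM]_p f p = II ((fun x => z x * divV' x) \_ (ann a r)).
  apply: annulus_integral => // [p tp|p np]; last first.
    by rewrite /f indicE memNset ?mul0r // => -[].
  rewrite /f indicE (SE p tp) /patch; case: ifP => _; last by rewrite !mul0r.
  have wn := lt0r_neq0 (w0 (Xto p tp)).
  by rewrite mul1r -{2}(of_coordK ath tp) FX; [rewrite -mulrA divfK|exact: Xto].
have FE p : (F \_ (truncation theta r)) p = zeta p * F p + f p.
  rewrite /f indicE /patch; case: (pselect (dom theta p)) => tp; last first.
    rewrite (memNset (A := S)); last by move=> []. rewrite mem_set; last by move=> [].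
    by rewrite zeta1 ?mul1r ?mul0r ?addr0 // => -[].
  rewrite (SE p tp) (zetaE p tp); have [xr|xr] := leP (enorm (co theta p)) r.
    rewrite mem_set; last by move=> [_ /=]; rewrite ltNge xr. have [xa|xa] := leP (enorm (co theta p)) a.
      by rewrite zlow // subr0 mul1r memNset ?mul0r ?addr0 // /annulus /= ltNge xa.
    rewrite mem_set ?mul1r; first by ring. by rewrite /annulus /= xa xr.
  rewrite memNset; last by move=> nT; apply: nT.
  rewrite memNset; last by rewrite /annulus /= (leNgt _ r) xr andbF.
  by rewrite zup ?ltW // subrr !mul0r addr0.
have iFT : dM.-integrable setT (EFin \o (F \_ (truncation theta r))).
  by rewrite (_ : EFin \o _ = (EFin \o (fun p => zeta p * F p)) \+ (EFin \o f));
    [exact: integrableD|apply/funext => p /=; rewrite FE].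
split.
  apply: eq_integrable ib => [|p /set_mem bp /=].
    by apply: (@closed_borel M); exact: closed_boundary.
  by rewrite zeta1 ?mul1r // => -[tp _]; exact: bt bp tp.
split=> //.
  by apply/(integrable_mkcond _ mT); rewrite restrict_EFin.
rewrite Rintegral_mkcond (@eq_Rintegral _ _ _ dM setT (fun p => zeta p * F p + f p)); last by move=> p _.
rewrite RintegralD //; have -> : \int[dM]_p (zeta p * F p) =
    \int[dG]_(p in (Gamma_ M)) b p - \int[dM]_p D zeta p.
  by rewrite -bE -st addrK.
pose Y i x := z x * V theta i x.
have CY i : CkA 1 X (Y i) by exact: CkAM.
have CY0 i : CkA 0 X (Y i) by exact: CkAW.
have Ya : flux Y a = 0.
  apply/eqP; rewrite -normr_le0; have := flux_bound (K := 0) a1 CY0 (lexx 0).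
  rewrite mulr0 !mul0r mulr0; apply => x xa i; by rewrite /Y zlow ?xa // mul0r normr0.
have Yr : flux Y r = flux (V theta) r.
  apply: eq_sphere_int; first by lra.
    by rewrite !radial0.
  by move=> x xr; bigr => i _; rewrite /Y zup ?xr // mul1r.
have := annulus_divergence m0 a1 (ltW ar) CY; rewrite Ya Yr subr0 => ->.
rewrite e1 e2 -addrA; congr (_ + _); rewrite addrC -IIB; last 2 first.
- exact: bms_annulus.
- by apply: bms_annulus => //; exact: CkAN.
apply: II_eq => x; rewrite /patch; case: ifP => [/set_mem /(annX a1) Xx|_]; last by rewrite subr0.
rewrite opprK /divV' /dzV mulr_sumr -big_split; bigr => i _ /=.
by rewrite /Y pdM // addrC.
Qed.

End Stokes.

(** * The field on the boundary *)

Section PointAlgebra.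
Context {R : realType}.

(** |grad tau|^2 + Theta^2 = |d/dt|^2: the last diagonal entry of the completeness relation of the
    frame. *)
Lemma gradient_norm n (U h g : 'M[R]_n) (N t : 'rV[R]_n) (Th : R) :
  g = U *m h *m U^T + t^T *m t -> h^T = h -> g \in unitmx ->
  N *m h *m U^T + Th *: t = 0 -> (N *m h *m N^T) 0 0 + Th ^+ 2 = 1 ->
  (t *m invmx g *m t^T) 0 0 + Th ^+ 2 = 1.
move=> gE hT ug NT NN.
pose P := block_mx U t^T N (Th%:M : 'M[R]_1).
pose amb := block_mx h 0 0 (1%:M : 'M[R]_1).
pose ind := block_mx g 0 0 (1%:M : 'M[R]_1).
have PP : P *m amb *m P^T = ind.
  rewrite /P /amb /ind tr_block_mx !mulmx_block trmxK tr_scalar_mx.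
  rewrite !mulmx0 !mulmx1 !addr0 !add0r !mul_mx_scalar !mul_scalar_mx -gE.
  have -> : U *m h *m N^T + Th *: t^T = 0.
    have := congr1 trmx NT; rewrite trmxD trmx_mul trmxK trmx_mul hT trmx0 mulmxA => <-.
    by congr (_ + _); apply/matrixP => a b; rewrite !mxE.
  rewrite NT; congr block_mx; apply/matrixP => a b; rewrite !ord1.
  by rewrite mxDE mxZE [_%:M _ _]mxE [in RHS]mxE !eqxx mulr1n -expr2 NN.
pose jnd := block_mx (invmx g) 0 0 (1%:M : 'M[R]_1).
have : P *m (amb *m P^T *m jnd) = 1%:M.
  rewrite !mulmxA PP /ind /jnd mulmx_block !(mulmx0, mul0mx, mulmx1, addr0, add0r).
  by rewrite mulmxV // -scalar_mx_block.
move=> /mulmx1C; rewrite /amb /P /jnd tr_block_mx !mulmx_block.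
rewrite !(mulmx0, mul0mx, mulmx1, mul1mx, addr0, add0r) trmxK tr_scalar_mx.
rewrite (scalar_mx_block _ _ 1) => /eq_block_mx[_ _ _ /matrixP/(_ 0 0)].
by rewrite mxDE mul_scalar_mx mxZE !mxE !eqxx !mulr1n -expr2.
Qed.

Lemma sum_ord0 n (F : 'I_n.+1 -> R) : \sum_i F i = F ord0 + \sum_(a < n) F (lift ord0 a).
exact: big_ord_recl. Qed.

Section Face.
Variables (n : nat) (g A : 'M[R]_n.+1) (T th : 'rV[R]_n.+1).
Hypotheses (gT : g^T = g) (ug : g \in unitmx) (AT : A^T = A).
Hypotheses (T0 : forall a, T 0 (lift ord0 a) = 0) (th0 : forall a, th 0 (lift ord0 a) = 0).
Hypothesis thE : th^T = - (A *m invmx g *m T^T).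
Hypothesis T1 : (T *m invmx g *m T^T) 0 0 = 1.
Let gi := invmx g.

Let giT i j : gi i j = gi j i.
by have /matrixP /(_ j i) := invmx_sym gT; rewrite mxE. Qed.

Let AT' i j : A i j = A j i. by rewrite -[in LHS]AT mxE. Qed.

Lemma face_normal : gi ord0 ord0 * T 0 ord0 ^+ 2 = 1.
rewrite -T1 mxE sum_ord0 big1 ?addr0 => [|a _]; last by rewrite !mxE T0 mulr0.
rewrite [_^T _ _]mxE mxE sum_ord0 big1 ?addr0 => [|a _]; last by rewrite T0 mul0r.
by rewrite -/gi; ring.
Qed.

Let T00 : T 0 ord0 != 0.
by apply/eqP => E; have := face_normal; rewrite E expr0n mulr0 => /eqP; rewrite eq_sym oner_eq0. Qed.

Let gi00 : gi ord0 ord0 != 0.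
by apply/eqP => E; have := face_normal; rewrite E mul0r => /eqP; rewrite eq_sym oner_eq0. Qed.

Let S : 'M[R]_n := \matrix_(a, b) (gi (lift ord0 a) (lift ord0 b)
   - gi (lift ord0 a) ord0 * gi (lift ord0 b) ord0 / gi ord0 ord0).

(** [S] is the Schur complement in g^-1 of its entry of index (0, 0). *)
Lemma face_inv : invmx (face g) = S.
have gg i k : \sum_j gi i j * g j k = (i == k)%:R.
  by have /matrixP /(_ i k) := mulVmx ug; rewrite !mxE.
suff SE : S *m face g = 1%:M.
  have uF : face g \in unitmx by have [] := mulmx1_unit SE. by rewrite -[RHS](mulmxK uF) SE mul1mx.
apply/matrixP => a c; rewrite !mxE.
have Ea := gg (lift ord0 a) (lift ord0 c); have E0 := gg ord0 (lift ord0 c).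
rewrite sum_ord0 in Ea; rewrite sum_ord0 in E0.
rewrite (_ : (ord0 == lift ord0 c) = false) // in E0.
have /eqP := E0; rewrite addr_eq0 => /eqP E0'.
transitivity (\sum_b gi (lift ord0 a) (lift ord0 b) * g (lift ord0 b) (lift ord0 c)
  - gi (lift ord0 a) ord0 / gi ord0 ord0 * \sum_b gi ord0 (lift ord0 b) * g (lift ord0 b) (lift ord0 c)).
  rewrite mulr_sumr -sumrB; bigr => b _; rewrite !mxE [gi ord0 (lift _ _)]giT; ring.
rewrite -[X in _ - _ * X]opprK -E0' mulrN opprK mulrA mulfVK //.
by rewrite addrC Ea (inj_eq lift_inj).
Qed.

(** dTheta = - A(grad tau) has no tangential component on the boundary, so the conormal is a
    principal direction: this expresses A_{a0} through the A_{ab}. The left side is then d_0 tau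
    times the trace of A over the directions tangent to the boundary. *)
Lemma face_trace : \tr (gi *m A) * T 0 ord0 + th 0 ord0 =
  T 0 ord0 * \sum_a \sum_b invmx (face g) a b * A (lift ord0 a) (lift ord0 b).
have thi i : th 0 i = - (T 0 ord0 * \sum_j A i j * gi j ord0).
  have /matrixP /(_ i 0) := thE; rewrite mxE mxNE mxE => ->; congr (- _).
  rewrite sum_ord0 big1 ?addr0 => [|a _]; last by rewrite !mxE T0 mulr0. by rewrite !mxE mulrC.
have Aa a : A (lift ord0 a) ord0 = - (\sum_b A (lift ord0 a) (lift ord0 b) * gi (lift ord0 b) ord0) / gi ord0 ord0.
  have := thi (lift ord0 a); rewrite th0 sum_ord0 => /eqP; rewrite eq_sym oppr_eq0 mulf_eq0 (negbTE T00) /=.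
  by rewrite addr_eq0 => /eqP <-; rewrite mulfK.
rewrite thi -mulrN [T 0 ord0 * - _]mulrC -mulrDl mulrC; congr (_ * _).
rewrite face_inv /mxtrace sum_ord0.
have -> : (gi *m A) ord0 ord0 = gi ord0 ord0 * A ord0 ord0 + \sum_b gi ord0 (lift ord0 b) * A (lift ord0 b) ord0.
  by rewrite mxE sum_ord0.
have -> : \sum_a (gi *m A) (lift ord0 a) (lift ord0 a) = \sum_a gi (lift ord0 a) ord0 * A ord0 (lift ord0 a)
   + \sum_a \sum_b gi (lift ord0 a) (lift ord0 b) * A (lift ord0 b) (lift ord0 a).
  by rewrite -big_split /=; bigr => a _; rewrite mxE sum_ord0.
have -> : \sum_j A ord0 j * gi j ord0 = gi ord0 ord0 * A ord0 ord0 +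
   \sum_a gi (lift ord0 a) ord0 * A ord0 (lift ord0 a).
  by rewrite sum_ord0 mulrC; congr (_ + _); bigr => a _; rewrite mulrC.
have -> : \sum_b gi ord0 (lift ord0 b) * A (lift ord0 b) ord0 =
   - \sum_a \sum_b gi (lift ord0 a) ord0 * gi (lift ord0 b) ord0 / gi ord0 ord0 * A (lift ord0 a) (lift ord0 b).
  rewrite -sumrN; bigr => a _; rewrite Aa giT mulNr mulrN; congr (- _).
  rewrite mulrA mulr_sumr mulr_suml; bigr => b _; ring.
have -> : \sum_a \sum_b gi (lift ord0 a) (lift ord0 b) * A (lift ord0 b) (lift ord0 a) =
  \sum_a \sum_b gi (lift ord0 a) (lift ord0 b) * A (lift ord0 a) (lift ord0 b).
  by bigr => a _; bigr => b _; rewrite [A _ _]AT'.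
set X := \sum_a \sum_b _ / _ * _; set Y := \sum_a \sum_b gi _ _ * A _ _; set Z := \sum_a _ * A ord0 _.
transitivity (Y - X); first by ring.
rewrite -sumrB; bigr => a _; rewrite -sumrB; bigr => b _; rewrite mxE; ring.
Qed.

Lemma face_cofactor : \det (face g) = gi ord0 ord0 * \det g.
have dg : \det g != 0 by rewrite -unitfE -unitmxE.
rewrite /gi /invmx ug mxE mxE /cofactor addn0 expr0 mul1r mulrAC mulVf // mul1r.
congr (\det _); apply/matrixP => i j; by rewrite !mxE.
Qed.

End Face.
End PointAlgebra.

Section HyperBoundary.
Context {R : realType} (m : nat) (M E : manifold R m) (I : interval R).
Variables (h : metric_field E) (u : M -> E) (tau : M -> R).
Variables (Nt : M -> 'rV[R]_m.+1) (Theta : M -> R).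
Hypotheses (hh : smooth_metric h) (himm : immersion I u tau) (hN : unit_normal h u tau Nt Theta).
Implicit Types (c d : chart R m M) (e : chart R m E).
Let g := induced_metric h u tau.
Let rg : smooth_metric g := induced_smooth hh himm.

Definition sff c e := sform (dom2 u c e) (cod e) (map_in u c e) (fun_in c tau)
  (fun_in c Theta) (normal_in u Nt c e) (coef e h) (coef c g).

Lemma sff_facts c e x : atlas c -> atlas e -> dom2 u c e x -> [/\ (sff c e x)^T = sff c e x,
      (dcf c Theta x)^T = - (sff c e x *m invmx (coef c g x) *m (dcf c tau x)^T),
      H h u tau Nt Theta (pt c x) = \tr (invmx (coef c g x) *m sff c e x),
      forall i, dmx (dom2 u c e) (normal_in u Nt c e) i x
          + normal_in u Nt c e x *m pull_chr (dom2 u c e) (cod e) (map_in u c e) (coef e h) i x =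
        - row i (sff c e x) *m invmx (coef c g x) *m dcv c (fun p => co e (u p)) x
    & forall i, dmx (dom2 u c e) (fun z => (grad (dom2 u c e) (fun_in c tau) z)^T) i x =
        chr (dom2 u c e) (coef c g) i x *m (dcf c tau x)^T + Theta (pt c x) *: (row i (sff c e x))^T].
move=> ac ae xA.
have rA := regular_dom2 himm ac ae; have rB := regular_cod ae.
have sU := map_sm (su himm) ac ae; have sN := normal_sm hN ac ae; have sh := coef_sm hh ae.
have st := fun_sm2 himm (tau_sm himm) ac ae; have sTh := fun_sm2 himm (Theta_sm hN) ac ae.
have hT y : cod e y -> (coef e h y)^T = coef e h y by move=> _; exact: coef_sym.
have ug y : dom2 u c e y -> coef c g y \in unitmx.
  by move=> /(coimg_cod ac); exact: coef_unit.
have uh y : cod e y -> coef e h y \in unitmx by exact: coef_unit.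
have AB y : dom2 u c e y -> cod e (map_in u c e y) by exact: dom2_map.
have gE y := @induced_in _ _ _ _ _ h _ _ himm c e y ac ae.
have NN y := @normal_norm _ _ _ _ _ _ _ _ _ hN c e y ac ae.
have NT y := @normal_tangent _ _ _ _ _ _ _ _ _ _ himm hN c e y ac ae.
rewrite -(grad_fun himm Theta ac ae xA) -(grad_fun himm tau ac ae xA) -(jac_map himm ac ae xA).
split.
- exact: (sform_sym rA AB sU (fun_in c Theta) st (normal_in u Nt c e) (coef c g) hT xA).
- exact: (grad_angle rA rB AB sU st sTh sN sh hT uh gE ug NN NT xA).
- rewrite (HE hh himm hN ac ae xA) (mean_curv_inE h tau Nt Theta ac ae (open_dom2 himm ae) (fun _ => id) xA).
  exact: (mean_curvE rA rB AB sU st sTh sN sh hT uh gE ug NN NT xA).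
- by move=> i; exact: (weingarten rA rB AB sU st sTh sN sh hT uh gE ug NN NT i xA).
- by move=> i; exact: (hess_height rA rB AB sU st sTh sN sh hT uh gE ug NN NT i xA).
Qed.

Lemma height_norm c x : atlas c -> cod c x ->
  (dcf c tau x *m invmx (coef c g x) *m (dcf c tau x)^T) 0 0 + Theta (pt c x) ^+ 2 = 1.
move=> ac cx; have [e ae xA] := chartsE u ac cx.
have := gradient_norm (induced_in h himm ac ae xA) (coef_sym hh _ _) (coef_unit rg ac cx)
  (normal_tangent himm hN ac ae xA) (normal_norm hN ac ae xA).
by rewrite (grad_fun himm tau ac ae xA).
Qed.

(** The inner product for g of df and H dtau + dTheta. *)
Definition pairing (f : M -> R) (p : M) : R := (diff_fun f p *m invmx (g p)
     *m (H h u tau Nt Theta p *: diff_fun tau p + diff_fun Theta p)^T) 0 0.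

Lemma field_pairing c x f : atlas c -> cod c x -> C1fun f ->
  \sum_i pd (cod c) (fun y => f (pt c y)) i x * field_in h u tau Nt Theta c i x =
  sqrdet (coef c g x) * pairing f (pt c x).
move=> ac cx Cf; set q := pt c x; have cq : dom c q := cod_dom ac cx.
have aq := chart_at_atlas q; have qq := chart_at_dom q.
have xA : coimg c (dom (chart_at q) `&` setT) x by apply/(coimgP _ _ ac).
have xA' : coimg c (dom (chart_at q)) x by apply/(coimgP _ _ ac).
have dE : dcf c f x = diff_fun f q *m (jacobian c (chart_at q) x)^T.
  rewrite (dcf_change ac aq openT xA) //. by apply: CkA_coimg => //; [exact: openT|exact: Cf].
have tE := diff_funE (tau_sm himm) ac cx; have TE := diff_funE (Theta_sm hN) ac cx.
have gE : coef c g x = jacobian c (chart_at q) x *m g q *m (jacobian c (chart_at q) x)^T by [].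
have uJ := jacobian_unit ac aq xA'.
transitivity (sqrdet (coef c g x) * (dcf c f x *m invmx (coef c g x)
    *m (H h u tau Nt Theta q *: dcf c tau x + dcf c Theta x)^T) 0 0).
  transitivity (\sum_i \sum_j sqrdet (coef c g x) * (dcf c f x 0 i * invmx (coef c g x) i j
      * form_in h u tau Nt Theta c j x)).
    bigr => i _; rewrite /field_in mulrCA 2!mulr_sumr; bigr => j _. by rewrite [dcf _ _ _ _ _]mxE !mulrA.
  rewrite exchange_big mxE mulr_sumr; bigr => j _.
  rewrite [in RHS]mxE mulr_suml mulr_sumr; bigr => i _; congr (_ * (_ * _)).
  by rewrite mxE mxDE mxZE /form_in ![dcf _ _ _ _ _]mxE.
congr (_ * _); rewrite /pairing dE tE TE gE -/q.
move: (jacobian c (chart_at q) x) uJ => J uJ.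
have uJT : J^T \in unitmx by rewrite unitmx_tr.
have ug : g q \in unitmx by rewrite -(coef_self g q); apply: coef_unit => //; exact: dom_cod.
rewrite !invmx_mul ?unitmx_mul ?uJ // scalemxAl -mulmxDl trmx_mul trmxK !mulmxA.
by rewrite mulmxK // -!mulmxA (mulmxA _ J) mulVmx // mul1mx.
Qed.

Section AtBoundary.
Variables (t0 : R) (Gamma_slice : forall p, boundary M p -> tau p = t0).
Hypothesis Gamma_orthogonal : forall p, boundary M p -> Theta p = 0.

Lemma dcf_boundary c x f (k : R) a : atlas c -> cod c x -> boundary M (pt c x) ->
  (forall p, boundary M p -> f p = k) -> dcf c f x 0 (lift ord0 a) = 0.
move=> ac cx bx fk; rewrite mxE.
have [W oW cO] := boundary_half ac (cod_dom ac cx) bx.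
have x0 : x 0 ord0 = 0.
  by have := boundary_cod ac (cod_dom ac cx) bx; rewrite to_coordK.
have rc := regular_cod ac.
have E1 : f (pt c x) = k by exact: fk.
have N1 : \forall s \near (0 : R), cod c (x + s *: ev (lift ord0 a)) <->
    cod c (x + s *: ev (lift ord0 a)).
  have NT := near_line (lift ord0 a) (@openT 'rV[R]_m.+1) (Logic.I : setT x).
  by move: NT; apply: filterS => s _; split.
rewrite (pd_line (f := fun y => f (pt c y)) (g := fun=> k) E1 N1) ?pd_cst //.
have NT := near_line (lift ord0 a) (@openT 'rV[R]_m.+1) (Logic.I : setT x).
move: NT; apply: filterS => s _ cs; apply: fk; apply: (cod_boundary ac cO cs).
by rewrite !mxE x0 /= mulr0 addr0.
Qed.

Let T0 c x := dcf c tau x 0 ord0.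
Let th0 c x := dcf c Theta x 0 ord0.

Definition face_sum c e x := \sum_a \sum_b invmx (face (coef c g x)) a b
   * sff c e x (lift ord0 a) (lift ord0 b).

Lemma boundary_facts c e x : atlas c -> atlas e -> dom2 u c e x -> boundary M (pt c x) ->
  [/\ invmx (coef c g x) ord0 ord0 * T0 c x ^+ 2 = 1,
      H h u tau Nt Theta (pt c x) * T0 c x + th0 c x = T0 c x * face_sum c e x
    & \det (face (coef c g x)) = invmx (coef c g x) ord0 ord0 * \det (coef c g x)].
move=> ac ae xA bx; have [cx ex] := (dom2P u e x ac).1 xA.
have [sT thE HE' _ _] := sff_facts ac ae xA.
have gT := coef_sym rg c x; have ug := coef_unit rg ac cx.
have T0E a := dcf_boundary a ac cx bx Gamma_slice.
have thE0 a := dcf_boundary a ac cx bx Gamma_orthogonal.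
have T1 := height_norm ac cx; rewrite Gamma_orthogonal // expr0n addr0 in T1.
split; first exact: (face_normal T0E T1).
  by rewrite HE'; apply: (face_trace gT ug sT T0E thE0 thE T1).
exact: face_cofactor.
Qed.

(** With G = g^{00} and T = d_0 tau, the field is sqrt(det g) G T times the face trace. Since G T^2
    = 1 and the face determinant is G det g, the factor sqrt(det g) G T is the sign of T times the
    density of the boundary. *)
Lemma field_boundary c e x : atlas c -> atlas e -> dom2 u c e x -> boundary M (pt c x) ->
  - field_in h u tau Nt Theta c ord0 x =
  - (Num.sg (T0 c x) * face_sum c e x) * sqrdet (face (coef c g x)).
move=> ac ae xA bx; have [cx ex] := (dom2P u e x ac).1 xA.
have [E1 E2 E3] := boundary_facts ac ae xA bx.
have gi0 : 0 <= invmx (coef c g x) ord0 ord0.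
  rewrite leNgt; apply/negP => gi0; have : (0 : R) <= 1 by []; rewrite -E1 leNgt => /negP; apply.
  rewrite nmulr_rlt0 // exprn_even_gt0 //=; apply/eqP => T00.
  by move: E1; rewrite T00 expr0n mulr0 => /eqP; rewrite eq_sym oner_eq0.
rewrite E3 sqrtrM // mulNr; congr (- _).
have -> : field_in h u tau Nt Theta c ord0 x = sqrdet (coef c g x) *
    (invmx (coef c g x) ord0 ord0 * (T0 c x * face_sum c e x)).
  rewrite /field_in; congr (_ * _); rewrite sum_ord0 big1 ?addr0 => [|a _]; last first.
    rewrite /form_in. have := dcf_boundary a ac cx bx Gamma_slice; rewrite mxE => ->.
    have := dcf_boundary a ac cx bx Gamma_orthogonal; rewrite mxE => ->. by rewrite mulr0 addr0 mulr0.
  by rewrite -E2 /form_in /T0 /th0 !mxE.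
move: (invmx _ _ _) (T0 c x) E1 gi0 => gi T E1 gi0.
have sT : Num.sqrt gi * `|T| = 1 by rewrite -sqrtr_sqr -sqrtrM // E1 sqrtr1.
have sg2 : Num.sqrt gi * T = Num.sg T by rewrite {1}[T]numEsg mulrCA sT mulr1.
by rewrite -sg2 -[X in _ * (X * _)](sqr_sqrtr gi0); ring.
Qed.

Lemma face_sumE c e x : atlas c -> atlas e -> dom2 u c e x -> boundary M (pt c x) ->
  T0 c x != 0 /\ face_sum c e x = H h u tau Nt Theta (pt c x) + th0 c x / T0 c x.
move=> ac ae xA bx; have [E1 E2 _] := boundary_facts ac ae xA bx.
have T00 : T0 c x != 0.
  apply/eqP => T00; move: E1; rewrite T00 expr0n mulr0 => /eqP. by rewrite eq_sym oner_eq0.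
split=> //; apply: (mulfI T00); by rewrite -E2 mulrDr mulrC [T0 c x * (_ / _)]mulrC divfK.
Qed.

(** tau and Theta are constant on the boundary, so their differentials have only a component of
    index 0. It is multiplied by the derivative d_0 of coordinate 0 of the change of charts,
    nonnegative at a minimum and nonzero because d_0 tau is. *)
Lemma normal_scale c c' x : atlas c -> atlas c' -> coimg c (dom c') x ->
  boundary M (pt c x) -> exists2 k : R, 0 < k &
  T0 c x = k * T0 c' (co c' (pt c x)) /\ th0 c x = k * th0 c' (co c' (pt c x)).
move=> ac ac' xc' bx; have [cx c'x] := (coimgP _ _ ac).1 xc'.
have [W oW cO] := boundary_half ac (cod_dom ac cx) bx.
have [W2 oW2 cO2] := boundary_half ac' c'x bx.
set x' := co c' (pt c x); have cx' : cod c' x' by exact: dom_cod.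
have x'p : pt c' x' = pt c x by rewrite of_coordK.
have x0 : x 0 ord0 = 0 by have := boundary_cod ac (cod_dom ac cx) bx; rewrite to_coordK.
have x'0 : x' 0 ord0 = 0 by exact: boundary_cod.
have xT : coimg c (dom c' `&` setT) x by rewrite setIT.
have scale f (k : R) : smooth_fun f -> (forall p, boundary M p -> f p = k) ->
    dcf c f x 0 ord0 = jacobian c c' x ord0 ord0 * dcf c' f x' 0 ord0.
  move=> sf fk; rewrite (dcf_change ac ac' openT xT); last first.
    by apply: (coimg_sm ac' openT (fun_sm sf ac')).
  rewrite mxE sum_ord0 big1 ?addr0 => [|a _]; first by rewrite [_^T _ _]mxE mulrC.
  by rewrite (dcf_boundary a ac' cx' _ fk) ?x'p // mul0r.
exists (jacobian c c' x ord0 ord0); last first.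
  by split; [exact: (scale _ t0 (tau_sm himm))|exact: (scale _ 0 (Theta_sm hN))].
have J0 : jacobian c c' x ord0 ord0 != 0.
  apply/eqP => J0; have [e ae xA] := chartsE u ac cx.
  have [/eqP] := face_sumE ac ae xA bx; rewrite /T0 (scale _ t0 (tau_sm himm)) // J0 mul0r. by [].
rewrite lt_neqAle eq_sym J0 /= mxE -(pd_coimg _ _ ac (open_dom ac') xc').
apply: pd_normal_ge0 => //.
- by apply: regular_coimg => //; exact: open_dom.
- by move=> y /(coimg_cod ac); rewrite cO => -[].
- exact: trans_sm.
- move=> y /(coimgP _ _ ac)[cy c'y]; rewrite -/x' x'0.
  by have := dom_cod c'y; rewrite cO2 => -[].
Qed.

Lemma face_sum_change c c' e x : atlas c -> atlas c' -> atlas e -> coimg c (dom c') x ->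
  dom2 u c e x -> boundary M (pt c x) -> let x' := co c' (pt c x) in
  Num.sg (T0 c x) = Num.sg (T0 c' x') /\ face_sum c e x = face_sum c' e x'.
move=> ac ac' ae xc' xA bx x'; have [cx c'x] := (coimgP _ _ ac).1 xc'.
have x'p : pt c' x' = pt c x by rewrite of_coordK.
have [k k0 [E1 E2]] := normal_scale ac ac' xc' bx.
have xA' : dom2 u c' e x'.
  by apply/(dom2P _ _ _ ac'); rewrite x'p; split; [exact: dom_cod|have [] := (dom2P u e x ac).1 xA].
have [T00 ->] := face_sumE ac ae xA bx.
have bx' : boundary M (pt c' x') by rewrite x'p.
have [T00' ->] := face_sumE ac' ae xA' bx'.
rewrite x'p E1 E2 sgrM gtr0_sg // mul1r; split=> //; congr (_ + _).
by rewrite -/x' invfM mulrACA mulfV ?mul1r // lt0r_neq0.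
Qed.

Variables (mu eta : M -> 'rV[R]_m.+1).
Hypothesis heta : exterior_conormal g eta.
Hypothesis orient_up : forall p, boundary M p ->
  eta p *m diff_map u p = 0 -> (eta p *m (diff_fun tau p)^T) 0 0 = 1 -> Nt p = - mu p.
Hypothesis orient_down : forall p, boundary M p ->
  eta p *m diff_map u p = 0 -> (eta p *m (diff_fun tau p)^T) 0 0 = -1 -> Nt p = mu p.

Lemma dcf_self (f : M -> R) (q : M) : dcf (chart_at q) f (co (chart_at q) q) = diff_fun f q.
by apply/rowP => i; rewrite !mxE. Qed.

(** g eta is a multiple of the covector of index 0, which gives dtau(eta)^2 = 1; as eta is a unit
    vector, it is vertical. Its component of index 0 being negative, dtau(eta) has the sign opposite
    to d_0 tau, and this selects one of the two orientation hypotheses. *)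
Lemma mu_normal q : boundary M q -> mu q = Num.sg (diff_fun tau q 0 ord0) *: Nt q.
move=> bq; set c := chart_at q; set e := chart_at (u q).
have ac : atlas c := chart_at_atlas q; have ae : atlas e := chart_at_atlas (u q).
have cq : dom c q := chart_at_dom q; have eq : dom e (u q) := chart_at_dom (u q).
pose x := co c q; have xq : pt c x = q by rewrite /x of_coordK.
have xA : dom2 u c e x by apply/(dom2P _ _ _ ac); rewrite xq; split=> //; exact: dom_cod.
have bx : boundary M (pt c x) by rewrite xq.
have [gi1 _ _] := boundary_facts ac ae xA bx.
have [T00 _] := face_sumE ac ae xA bx.
have cg : coef c g x = g q := coef_self g q.
have TE : T0 c x = diff_fun tau q 0 ord0 by rewrite /T0 /x dcf_self.
rewrite cg TE in gi1; rewrite TE in T00.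
have [n1 n2 n3] := heta bq.
have ug : g q \in unitmx by rewrite -cg; apply: coef_unit => //; exact: dom_cod.
have gT : (g q)^T = g q by case: rg.
have Tl a : diff_fun tau q 0 (lift ord0 a) = 0.
  by rewrite -dcf_self; apply: (dcf_boundary a ac _ _ Gamma_slice); [exact: dom_cod|rewrite of_coordK].
set l := (eta q *m g q) 0 ord0.
have eg : eta q *m g q = l *: delta_mx 0 ord0.
  apply/rowP => i; rewrite mxZE [delta_mx _ _ _ _]mxE eqxx /=; case: (unliftP ord0 i) => [a ->|->]; last by rewrite mulr1.
  have := n2 a; rewrite /dot mxE (bigD1 (lift ord0 a)) //= big1 ?addr0 => [|j ja]; last first.
    have -> : (ev (lift ord0 a))^T j 0 = 0 :> R by rewrite !mxE eqxx (negbTE ja). by rewrite mulr0.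
  have -> : (ev (lift ord0 a))^T (lift ord0 a) 0 = 1 :> R by rewrite !mxE !eqxx.
  by rewrite mulr1 => ->; rewrite mulr0.
have e0 : eta q 0 ord0 = l * invmx (g q) ord0 ord0.
  rewrite -[eta q in LHS](mulmxK ug) eg -scalemxAl mxZE; congr (_ * _). by rewrite -rowE mxE.
have l1 : l * eta q 0 ord0 = 1.
  rewrite -n1 /dot eg -scalemxAl mxZE; congr (_ * _). by rewrite -rowE !mxE.
have tE : (eta q *m (diff_fun tau q)^T) 0 0 = eta q 0 ord0 * diff_fun tau q 0 ord0.
  by rewrite mxE sum_ord0 big1 ?addr0 => [|a _]; rewrite [_^T _ _]mxE // Tl mulr0.
have t2 : ((eta q *m (diff_fun tau q)^T) 0 0) ^+ 2 = 1.
  rewrite tE; move: (diff_fun tau q 0 ord0) (eta q 0 ord0) (invmx (g q) ord0 ord0) e0 l1 gi1 => t a gi -> l1 gi1.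
  by transitivity ((l * (l * gi)) * (gi * t ^+ 2)); [ring|rewrite l1 gi1 mulr1].
have U0 : eta q *m diff_map u q = 0.
  apply/eqP; apply: contraT => U0. have [_ hp _] := hh; have := hp (u q) _ U0.
  have gq : dot (g q) (eta q) (eta q) = dot (h (u q)) (eta q *m diff_map u q) (eta q *m diff_map u q)
     + ((eta q *m (diff_fun tau q)^T) 0 0) ^+ 2.
    exact: induced_dot.
  by move: n1; rewrite gq t2 -[RHS]add0r => /addIr ->; rewrite ltxx.
have [T_gt|T_lt] : (0 < diff_fun tau q 0 ord0) \/ (diff_fun tau q 0 ord0 < 0).
  by move: T00; rewrite neq_lt => /orP[]; [right|left].
- rewrite gtr0_sg // scale1r -(orient_down bq U0) //.
  move: t2 => /eqP; rewrite sqrf_eq1 => /orP[/eqP t1|/eqP //].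
  have : (eta q *m (diff_fun tau q)^T) 0 0 < 0 by rewrite tE nmulr_rlt0. by rewrite t1 ltr10.
- rewrite ltr0_sg // scaleN1r (orient_up bq U0) ?opprK //.
  move: t2 => /eqP; rewrite sqrf_eq1 => /orP[/eqP //|/eqP t1].
  have : 0 < (eta q *m (diff_fun tau q)^T) 0 0 by rewrite tE nmulr_rgt0. by rewrite t1 oppr_gt0 ltr10.
Qed.

(** Along the boundary mu is a locally constant sign times Nt, so the Weingarten equation gives its
    tangential derivatives, and the trace of A over the face appears up to that sign. *)
Lemma mean_curvature_face p : boundary M p -> mean_curvature h u mu p =
  Num.sg (diff_fun tau p 0 ord0) * face_sum (chart_at p) (chart_at (u p)) (co (chart_at p) p).
move=> bp; set c := chart_at p; set e := chart_at (u p).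
have ac : atlas c := chart_at_atlas p; have ae : atlas e := chart_at_atlas (u p).
have cp : dom c p := chart_at_dom p; have ep : dom e (u p) := chart_at_dom (u p).
set x := co c p; have xp : pt c x = p by rewrite /x of_coordK.
have cx : cod c x by exact: dom_cod.
have xA : dom2 u c e x by apply/(dom2P _ _ _ ac); rewrite xp.
have bx : boundary M (pt c x) by rewrite xp.
have [T00 _] := face_sumE ac ae xA bx.
have TE : T0 c x = diff_fun tau p 0 ord0 by rewrite /T0 /x dcf_self.
set sigma := Num.sg _; have sE : sigma = Num.sg (T0 c x) by rewrite TE.
have [W oW cO] := boundary_half ac cp bp.
have x0 : x 0 ord0 = 0 by exact: boundary_cod.
have rc := regular_cod ac; have rA := regular_dom2 himm ac ae.
have [V oV dV] := coimg_open ac (open_dom2 himm ae).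
have xV : V x by move: xA; rewrite /dom2 dV => -[].
(* d_0 tau is continuous and nonzero at x, so its sign is constant nearby. *)
have sT : \forall y \near x, cod c y -> Num.sg (T0 c y) = sigma.
  have CT : CkA 0 (cod c) (fun y => pd (cod c) (fun_in c tau) ord0 y).
    by apply: CkA_pd => //; exact: (fun_sm (tau_sm himm) ac 1).
  have T0x : 0 < `|pd (cod c) (fun_in c tau) ord0 x| by move: T00; rewrite /T0 mxE normr_gt0.
  have /cvgrPdist_lt /(_ _ T0x) := CkA_cvg CT cx; rewrite near_withinE.
  apply: filterS => y + cy => /(_ cy); rewrite sE /T0 !mxE -/(fun_in c tau).
  move: T00; rewrite /T0 mxE -/(fun_in c tau).
  move: (pd _ _ _ x) (pd _ _ _ y) => a b; rewrite neq_lt => /orP[] a0.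
    rewrite (ltr0_norm a0) ltr_norml => /andP[b1 b2]. by rewrite !ltr0_sg //; lra.
  rewrite (gtr0_norm a0) ltr_norml => /andP[b1 b2]. by rewrite !gtr0_sg //; lra.
(* mu is related to Nt at boundary points only; lines tangent to the face stay in the boundary, and
   [pd] in these directions sees nothing else. *)
have sline (a : 'I_m) : \forall s \near (0 : R), cod c (x + s *: ev (lift ord0 a)) ->
    mu (pt c (x + s *: ev (lift ord0 a))) = sigma *: Nt (pt c (x + s *: ev (lift ord0 a))).
  have : nbhs x [set y | cod c y -> Num.sg (T0 c y) = sigma] by exact: sT.
  rewrite nbhsE => -[U [oU Ux] Us]. apply: filterS (near_line (lift ord0 a) oU Ux) => s Uy cy.
  set y := x + _ in Uy cy *. have y0 : y 0 ord0 = 0 by rewrite !mxE x0 /= mulr0 addr0.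
  have by' := cod_boundary ac cO cy y0. rewrite mu_normal // -(Us _ Uy cy); congr (_ *: _).
  set q := pt c y.
  have yq : coimg c (dom (chart_at q)) y by apply/(coimgP _ _ ac); split=> //; exact: chart_at_dom.
  have [k k0 [E1 _]] := normal_scale ac (chart_at_atlas q) yq by'.
  by rewrite E1 sgrM (gtr0_sg k0) mul1r /T0 dcf_self.
have mup : mu p = sigma *: Nt p by rewrite mu_normal.
have [_ _ _ wg _] := sff_facts ac ae xA.
set U := dcv c (fun p => co e (u p)) x in wg.
have UE : U = diff_map u p by apply/matrixP => i j; rewrite !mxE.
have NE : normal_in u Nt c e x = Nt p by rewrite /normal_in xp; exact: vec_in_self.
have hE : coef e h (co e (u p)) = h (u p) := coef_self h (u p).
set S := sff c e x in wg *; set gi := invmx (coef c g x) in wg.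
pose X (a : 'I_m) : 'rV[R]_m.+1 := row (lift ord0 a) U.
pose nab (a : 'I_m) : 'rV[R]_m.+1 := \row_k (pd (cod c)
        (fun y => vec_in e (u (pt c y)) (mu (pt c y)) 0 k) (lift ord0 a) x
     + \sum_i \sum_j christoffel (cod e) (coef e h) k i j (co e (u p)) * X a 0 i * mu p 0 j).
have nabE a : nab a = - sigma *: (row (lift ord0 a) S *m gi *m U).
  have -> : - sigma *: (row (lift ord0 a) S *m gi *m U) = sigma *: (- row (lift ord0 a) S *m gi *m U).
    by rewrite !mulNmx scalerN scaleNr.
  rewrite -wg; apply/rowP => k; rewrite mxE mxZE mxDE mulrDr; congr (_ + _).
    rewrite dmxE -(@pdZ _ _ (dom2 u c e)) //; last exact: (normal_sm hN ac ae 0 k 1). apply: pd_line.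
    - by rewrite xp mup /normal_in xp /vec_in -scalemxAl mxZE.
    - apply: filterS (near_line (lift ord0 a) oV xV) => s Vs; rewrite /dom2 dV; split=> [|[]//].
      by move=> cs; split.
    - apply: filterS (sline a) => s Hs cs; rewrite Hs // /normal_in /vec_in.
      by rewrite -scalemxAl mxZE.
  rewrite NE mulmx_sumr summxE mulr_sumr; bigr => i _.
  rewrite -scalemxAr mxZE (_ : jac _ _ _ _ _ = U (lift ord0 a) i); last first.
    by rewrite (jac_map himm ac ae xA).
  rewrite [(_ *m _) _ _]mxE mulrCA mulr_sumr mulr_sumr; bigr => j _.
  by rewrite mup mxZE [X a 0 i]mxE [chr _ _ _ _ _ _]mxE /map_in xp; ring.
have Tl a : dcf c tau x 0 (lift ord0 a) = 0 by exact: (dcf_boundary a ac cx bx Gamma_slice).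
(* The rank-one term in dtau vanishes on tangential indices, so g and the horizontal metric have the
   same face. *)
have gE : U *m h (u p) *m U^T = coef c g x - (dcf c tau x)^T *m dcf c tau x.
  rewrite (induced_in h himm ac ae xA) (jac_map himm ac ae xA) (grad_fun himm tau ac ae xA).
  by rewrite /map_in xp hE addrK.
have XX a b : dot (h (u p)) (X a) (X b) = face (coef c g x) a b.
  have -> : dot (h (u p)) (X a) (X b) = (U *m h (u p) *m U^T) (lift ord0 a) (lift ord0 b).
    by rewrite /dot /X tr_row colE mulmxA -!row_mul -colE !mxE.
  by rewrite gE mxDE mxNE [((dcf _ _ _)^T *m _) _ _]mxE big_ord1 [_^T _ _]mxE Tl mul0r subr0 !mxE.
have nX a b : dot (h (u p)) (nab a) (X b) = - sigma * S (lift ord0 a) (lift ord0 b).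
  rewrite nabE /dot -!scalemxAl mxZE; congr (_ * _).
  have -> : row (lift ord0 a) S *m gi *m U *m h (u p) *m (X b)^T =
     (row (lift ord0 a) S *m gi) *m (U *m h (u p) *m U^T) *m delta_mx (lift ord0 b) 0.
    by rewrite /X tr_row colE !mulmxA.
  rewrite gE mulmxBr mulmxBl mxDE mxNE. rewrite mulmxKV; last exact: coef_unit.
  rewrite -!mulmxA -[(dcf _ _ _) *m delta_mx _ _]colE.
  have -> : col (lift ord0 b) (dcf c tau x) = 0 by apply/colP => i; rewrite ord1 mxE Tl mxE.
  by rewrite !mulmx0 [(0 : 'M[R]_1) _ _]mxE subr0 -colE !mxE.
have -> : mean_curvature h u mu p = - \sum_a \sum_b
    invmx (\matrix_(a, b) dot (h (u p)) (X a) (X b)) a b * dot (h (u p)) (nab a) (X b).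
  by rewrite /mean_curvature /boundary_tangent -/c -/e /nab /X UE.
have -> : \matrix_(a, b) dot (h (u p)) (X a) (X b) = face (coef c g x).
  by apply/matrixP => a b; rewrite mxE XX.
rewrite -sumrN /face_sum mulr_sumr; bigr => a _; rewrite -sumrN mulr_sumr; bigr => b _.
by rewrite nX; ring.
Qed.

Lemma field_mean_curvature c x : atlas c -> cod c x -> boundary M (pt c x) ->
  - field_in h u tau Nt Theta c ord0 x =
  - mean_curvature h u mu (pt c x) * sqrdet (face (coef c g x)).
move=> ac cx bx; set p := pt c x.
have ap := chart_at_atlas p; have aup := chart_at_atlas (u p).
have xA : dom2 u c (chart_at (u p)) x by apply/(dom2P _ _ _ ac); split=> //; exact: chart_at_dom.
have xc : coimg c (dom (chart_at p)) x by apply/(coimgP _ _ ac); split=> //; exact: chart_at_dom.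
have [E1 E2] := face_sum_change ac ap aup xc xA bx.
by rewrite (field_boundary ac aup xA bx) (mean_curvature_face bx) E1 E2 /T0 dcf_self.
Qed.

End AtBoundary.

End HyperBoundary.

(** * The end *)

Section Decay.
Context {R : realType} (m : nat).
Notation X := (@exterior R m.+1).
Implicit Types (f : 'rV[R]_m.+1 -> R) (s : R).

Lemma decays_eq s f f' : (forall x, X x -> f x = f' x) -> decays s f -> decays s f'.
move=> E /decaysP[K [R0 [K0 R1 Kf]]]; apply/decaysP; exists K, R0; split=> // x xR.
rewrite -E; [exact: Kf|exact: (lt_le_trans R1)].
Qed.

Lemma decays_le s s' f : s' <= s -> decays s f -> decays s' f.
move=> ss /decaysP[K [R0 [K0 R1 Kf]]]; apply/decaysP; exists K, R0; split=> // x xR.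
apply: le_trans (Kf x xR) _; apply: ler_wpM2l => //.
by rewrite ler_powR ?lerN2 //; apply: ltW; exact: lt_le_trans xR.
Qed.

Lemma decaysD s f f' : decays s f -> decays s f' -> decays s (fun x => f x + f' x).
move=> /decaysP[K [R0 [K0 R1 Kf]]] /decaysP[K' [R0' [K0' R1' Kf']]]; apply/decaysP.
exists (K + K'), (Num.max R0 R0'); split=> [||x]; rewrite ?addr_ge0 ?lt_max ?R1 // ge_max => /andP[a b].
by rewrite mulrDl (le_trans (ler_normD _ _)) // lerD ?Kf ?Kf'.
Qed.

Lemma decaysM s s' f f' : decays s f -> decays s' f' -> decays (s + s') (fun x => f x * f' x).
move=> /decaysP[K [R0 [K0 R1 Kf]]] /decaysP[K' [R0' [K0' R1' Kf']]]; apply/decaysP.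
exists (K * K'), (Num.max R0 R0'); split=> [||x]; rewrite ?mulr_ge0 ?lt_max ?R1 // ge_max => /andP[a b].
have x0 : enorm x != 0 by rewrite gt_eqF //; apply: lt_trans ltr01 _; exact: lt_le_trans a.
rewrite normrM opprD powRD; last by rewrite x0 implybT.
by rewrite mulrACA ler_pM ?normr_ge0 ?Kf ?Kf'.
Qed.

Lemma decays_cst c : decays 0 (fun _ : 'rV[R]_m.+1 => c).
apply/decaysP; exists `|c|, 2; split=> // [|x _]; first by rewrite ltr1n.
by rewrite oppr0 powRr0 mulr1.
Qed.

Lemma decays0 s : decays s (fun _ : 'rV[R]_m.+1 => 0).
apply/decaysP; exists 0, 2; split=> // [|x _]; first by rewrite ltr1n.
by rewrite normr0 mul0r.
Qed.

Lemma decaysZ s c f : decays s f -> decays s (fun x => c * f x).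
by move=> df; rewrite -[s]add0r; apply: decaysM => //; exact: decays_cst. Qed.

Lemma decaysN s f : decays s f -> decays s (fun x => - f x).
by move=> df; apply: decays_eq (decaysZ (-1) df) => x _; rewrite mulN1r. Qed.

Lemma decaysB s f f' : decays s f -> decays s f' -> decays s (fun x => f x - f' x).
by move=> df df'; apply: decaysD => //; exact: decaysN. Qed.

Lemma decays_sum s (J : Type) (r : seq J) (f : J -> 'rV[R]_m.+1 -> R) :
  (forall j, decays s (f j)) -> decays s (fun x => \sum_(j <- r) f j x).
move=> df; elim: r => [|j r IH].
  by apply: decays_eq (decays0 s) => x _; rewrite big_nil.
by apply: decays_eq (decaysD (df j) IH) => x _; rewrite big_cons.
Qed.

(** f = c + O(|x|^(-s)). *)
Definition tends s c f := decays s (fun x => f x - c).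

Lemma tends_bounded s c f : 0 <= s -> tends s c f -> decays 0 f.
move=> s0 tf; apply: decays_eq (decaysD (decays_le s0 tf) (decays_cst c)) => x _.
by rewrite subrK.
Qed.

Lemma tends_eq s c f f' : (forall x, X x -> f x = f' x) -> tends s c f -> tends s c f'.
by move=> E; apply: decays_eq => x Xx; rewrite E. Qed.

Lemma tends_cst s c : tends s c (fun=> c).
by apply: decays_eq (decays0 s) => x _; rewrite subrr. Qed.

Lemma tendsM s c c' f f' : 0 <= s -> tends s c f -> tends s c' f' -> tends s (c * c') (fun x => f x * f' x).
move=> s0 tf tf'; have b := tends_bounded s0 tf'.
apply: decays_eq (decaysD (f := fun x => (f x - c) * f' x) _ (decaysZ c tf')); first by move=> x _; ring.
by rewrite -[s]addr0; exact: decaysM.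
Qed.

Lemma tends_sum s (J : Type) (r : seq J) c (f : J -> 'rV[R]_m.+1 -> R) :
  (forall j, tends s (c j) (f j)) -> tends s (\sum_(j <- r) c j) (fun x => \sum_(j <- r) f j x).
move=> tf; apply: decays_eq (decays_sum r tf) => x _; by rewrite sumrB.
Qed.

Lemma tends_prod s (J : Type) (r : seq J) c (f : J -> 'rV[R]_m.+1 -> R) : 0 <= s ->
  (forall j, tends s (c j) (f j)) -> tends s (\prod_(j <- r) c j) (fun x => \prod_(j <- r) f j x).
move=> s0 tf; elim: r => [|j r IH].
  by rewrite big_nil; apply: tends_eq (tends_cst s 1) => x _; rewrite big_nil.
by rewrite big_cons; apply: tends_eq (tendsM s0 (tf j) IH) => x _; rewrite big_cons.
Qed.

Lemma tends_det s p (G : 'rV[R]_m.+1 -> 'M[R]_p) (C : 'M[R]_p) : 0 <= s ->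
  (forall i j, tends s (C i j) (fun x => G x i j)) -> tends s (\det C) (fun x => \det (G x)).
move=> s0 tG; apply: tends_sum => t; apply: tendsM => //; first exact: tends_cst.
by apply: tends_prod.
Qed.

Lemma tends_half s f : 0 < s -> tends s 1 f -> exists2 R0 : R, 1 < R0 &
  forall x, R0 <= enorm x -> 2^-1 <= f x.
move=> s0 /decaysP[K [R0 [K0 R1 Kf]]].
have K1 : 0 < K + 1 by rewrite ltr_pwDr.
have e0 : 0 < 2^-1 / (K + 1) by rewrite divr_gt0.
have [R2 R21 sm] := powR_small s0 e0.
exists (Num.max R0 R2); first by rewrite lt_max R1.
move=> x; rewrite ge_max => /andP[a b]; have := Kf x a.
have : K * enorm x `^ (- s) <= 2^-1.
  apply: (@le_trans _ _ ((K + 1) * enorm x `^ (- s))).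
    by rewrite ler_wpM2r ?powR_ge0 // lerDl.
  by rewrite mulrC -ler_pdivlMr //; exact: sm.
by move: (K * _) => a' a2; rewrite ler_norml => /andP[]; lra.
Qed.

Lemma tends_inv s f : 0 < s -> tends s 1 f -> tends s 1 (fun x => (f x)^-1).
move=> s0 tf; have [R0 R01 Hf] := tends_half s0 tf.
have bd : decays 0 (fun x => (f x)^-1).
  apply/decaysP; exists 2, R0; split=> // x xR; rewrite oppr0 powRr0 mulr1.
  have f0 := Hf x xR; have fp : 0 < f x by apply: lt_le_trans f0.
  by rewrite normfV (gtr0_norm fp) -[leRHS]invrK lef_pV2 ?posrE ?invr_gt0.
move: tf => /decaysP[K [R1 [K0 R11 Kf]]]; move: bd => /decaysP[K' [R2 [K0' R21 Kf']]].
apply/decaysP; exists (K * K'), (Num.max R0 (Num.max R1 R2)).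
split=> [||x]; rewrite ?mulr_ge0 ?lt_max ?R01 // !ge_max => /and3P[a b c].
have f0 : f x != 0 by rewrite gt_eqF //; apply: lt_le_trans (Hf x a).
have -> : (f x)^-1 - 1 = - (f x - 1) * (f x)^-1 by rewrite mulNr mulrBl mulfV // mul1r opprB.
rewrite normrM normrN mulrAC ler_pM ?normr_ge0 ?Kf //.
by apply: le_trans (Kf' x c) _; rewrite oppr0 powRr0 mulr1.
Qed.

(** |sqrt f - 1| <= |f - 1|, because f - 1 factors through sqrt f + 1 >= 1. *)
Lemma tends_sqrt s f : 0 < s -> (forall x, X x -> 0 <= f x) -> tends s 1 f ->
  tends s 1 (fun x => Num.sqrt (f x)).
move=> s0 f0 /decaysP[K [R1 [K0 R11 Kf]]]; apply/decaysP; exists K, R1; split=> // x xR.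
apply: le_trans _ (Kf x xR); have {}f0 : 0 <= f x by apply: f0; exact: lt_le_trans xR.
have -> : f x - 1 = (Num.sqrt (f x) - 1) * (Num.sqrt (f x) + 1) by rewrite -{1}(sqr_sqrtr f0); ring.
rewrite normrM ler_peMr // ger0_norm ?addr_ge0 ?sqrtr_ge0 //.
by rewrite lerDr sqrtr_ge0.
Qed.

Lemma tends_invmx s (G : 'rV[R]_m.+1 -> 'M[R]_m.+1) : 0 < s -> (forall x, X x -> G x \in unitmx) ->
  (forall i j, tends s (i == j)%:R (fun x => G x i j)) ->
  forall i j, tends s (i == j)%:R (fun x => invmx (G x) i j).
move=> s0 uG tG i j; have s0' := ltW s0.
have t1 a b : tends s ((1%:M : 'M[R]_m.+1) a b) (fun x => G x a b) by rewrite mxE.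
have td : tends s 1 (fun x => \det (G x)) by rewrite -(det1 R m.+1); exact: tends_det.
have tc : tends s (i == j)%:R (fun x => \adj (G x) i j).
  have -> : (i == j)%:R = (\adj (1%:M : 'M[R]_m.+1)) i j :> R.
    by have := mul_adj_mx (1%:M : 'M[R]_m.+1); rewrite mulmx1 det1 => ->; rewrite mxE.
  rewrite mxE /cofactor; apply: (@tends_eq _ _ (fun x => (-1) ^+ (j + i) * \det (row' j (col' i (G x))))).
    by move=> x _; rewrite mxE.
  apply: tendsM => //; first exact: tends_cst.
  by apply: tends_det => // a b; rewrite !mxE; apply: tends_eq (tG _ _) => x _; rewrite !mxE.
rewrite -[_%:R]mul1r; apply: tends_eq (tendsM s0' (tends_inv s0 td) tc) => x Xx.
by rewrite /invmx uG // [RHS]mxE.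
Qed.

End Decay.

Section FluxLimits.
Context {R : realType} (m : nat).
Notation X := (@exterior R m.+1).

Lemma flux_limit (Y Z : 'I_m.+1 -> 'rV[R]_m.+1 -> R) (l : R) :
  (forall i, CkA 0 X (Y i)) -> (forall i, CkA 0 X (Z i)) ->
  flux Y r @[r --> +oo] --> l -> flux (fun i x => Z i x - Y i x) r @[r --> +oo] --> (0 : R) ->
  flux Z r @[r --> +oo] --> l.
move=> CY CZ cY cD.
have c3 : flux Y r + flux (fun i x => Z i x - Y i x) r @[r --> +oo] --> l.
  by rewrite -[l]addr0; exact: cvgD cY cD.
apply: cvg_trans c3; apply: near_eq_cvg; near=> r.
rewrite /= -fluxD; last 3 first.
- by near: r; exact: nbhs_pinfty_gt.
- exact: CY.
- by move=> i; apply: CkAB.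
rewrite /flux; congr (sphere_int _ _); apply/funext => x; bigr => i _; congr (_ * _).
by rewrite addrC subrK.
Unshelve. all: by end_near.
Qed.

End FluxLimits.

Section FiniteSums.
Context {R : realType} (n : nat).

Lemma sum_delta (i : 'I_n) (F : 'I_n -> R) : \sum_j (i == j)%:R * F j = F i.
rewrite (bigD1 i) //= eqxx mul1r big1 ?addr0 // => j ji.
by rewrite eq_sym (negbTE ji) mul0r.
Qed.

Lemma sum_rot (F : 'I_n -> 'I_n -> 'I_n -> R) :
  \sum_k \sum_i \sum_j F k i j = \sum_i \sum_j \sum_k F k i j.
by rewrite exchange_big; bigr => i _; rewrite exchange_big. Qed.

Lemma sum_swap13 (F : 'I_n -> 'I_n -> 'I_n -> R) :
  \sum_k \sum_i \sum_j F k i j = \sum_i \sum_j \sum_k F j i k.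
by rewrite exchange_big. Qed.

Lemma sum2B (F F' : 'I_n -> 'I_n -> R) : \sum_i \sum_j (F i j - F' i j) =
  \sum_i \sum_j F i j - \sum_i \sum_j F' i j.
by rewrite -sumrB; bigr => i _; rewrite sumrB. Qed.

Lemma sum2D (F F' : 'I_n -> 'I_n -> R) : \sum_i \sum_j (F i j + F' i j) =
  \sum_i \sum_j F i j + \sum_i \sum_j F' i j.
by rewrite -big_split; bigr => i _; rewrite big_split. Qed.

End FiniteSums.

(** * Convergence of the ADM fluxes *)

Section ScalarFlux.
Context {R : realType} (m : nat).
Notation X := (@exterior R m.+1).
Variables (G : 'rV[R]_m.+1 -> 'M[R]_m.+1) (s : R).
Hypotheses (sG : smx X G) (GT : forall x, X x -> (G x)^T = G x).
Hypotheses (dG : forall x, X x -> 0 < \det (G x)) (s0 : 0 < s).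
Hypothesis tG : forall i j, tends s (i == j)%:R (fun x => G x i j).
Hypothesis tdG : forall i j k, decays (s + 1) (pd X (fun x => G x i j) k).

Let rX : regular X := open_regular (@open_exterior R m).
Let uG x : X x -> G x \in unitmx.
by move=> Xx; rewrite unitmxE unitfE gt_eqF ?dG. Qed.
Let s0' : 0 <= s := ltW s0.
Let sI : smx X (fun x => invmx (G x)). exact: smx_inv. Qed.

Let Gam k i j x := christoffel X G k i j x.
Let low i j l x := pd X (fun y => G y j l) i x + pd X (fun y => G y i l) j x - pd X (fun y => G y i j) l x.

Let GamE k i j x : Gam k i j x = 2^-1 * \sum_l invmx (G x) k l * low i j l x.
by []. Qed.

Let sGam k i j : sm X (Gam k i j).
move=> l; have sc := chr_smooth rX sG GT uG i j k l.
by apply: CkA_eq sc => x Xx; rewrite mxE.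
Qed.

Lemma tends_metric_inv i j : tends s (i == j)%:R (fun x => invmx (G x) i j).
exact: tends_invmx. Qed.

Let bI i j : decays 0 (fun x => invmx (G x) i j).
exact: tends_bounded s0' (tends_metric_inv i j). Qed.

Let dlow i j l : decays (s + 1) (low i j l).
by apply: decaysB; [apply: decaysD|]; exact: tdG. Qed.

Lemma christoffel_decays k i j : decays (s + 1) (christoffel X G k i j).
apply: decaysZ; apply: decays_sum => l; rewrite -[s + 1]add0r.
by apply: decaysM; [exact: bI|exact: dlow].
Qed.

Lemma inv_metric_decays i j k : decays (s + 1) (pd X (fun x => invmx (G x) i j) k).
apply: (@decays_eq _ _ _ (fun x => - \sum_b (\sum_a invmx (G x) i a * pd X (fun y => G y a b) k x) * invmx (G x) b j)).
  move=> x Xx; rewrite -(dmxE X (fun y => invmx (G y)) k x i j) (dmx_inv rX sG uG k Xx) mxNE; congr (- _).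
  rewrite mxE; bigr => b _; rewrite mxE; congr (_ * _). by bigr => a _; rewrite mxE.
apply: decaysN; apply: decays_sum => b; rewrite -[s + 1]addr0; apply: decaysM => //.
by apply: decays_sum => a; rewrite -[s + 1]add0r; apply: decaysM.
Qed.

Definition vol x := sqrdet (G x).

Lemma vol_sm : sm X vol.
by move=> k; apply: CkA_sqrt => //; exact: sm_det. Qed.

Lemma vol_tends : tends s 1 vol.
apply: tends_sqrt => //; first by move=> x /dG /ltW.
by rewrite -(det1 R m.+1); apply: tends_det => // i j; rewrite mxE.
Qed.

Let vol_gt0 x : X x -> 0 < vol x. by move=> Xx; rewrite sqrtr_gt0 dG. Qed.

Lemma vol_decays k : decays (s + 1) (pd X vol k).
apply: (@decays_eq _ _ _ (fun x => vol x * (2^-1 * \sum_a \sum_b invmx (G x) a b * pd X (fun y => G y b a) k x))).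
  move=> x Xx; have v0 := vol_gt0 Xx.
  have E : pd X (fun y => vol y * vol y) k x = \det (G x) * \tr (invmx (G x) *m dmx X G k x).
    rewrite -(pd_det rX k Xx sG (uG Xx)); apply: pd_eq => // y Xy.
    by rewrite -expr2 sqr_sqrtr // ltW // dG.
  rewrite pdM // in E; try exact: (vol_sm 1).
  have -> : \sum_a \sum_b invmx (G x) a b * pd X (fun y => G y b a) k x = \tr (invmx (G x) *m dmx X G k x).
    by bigr => a _; rewrite mxE; bigr => b _; rewrite mxE.
  move: E; rewrite -(sqr_sqrtr (ltW (dG Xx))) -/(vol x).
  move: (\tr _) (pd X vol k x) => t d E; apply: (mulfI (lt0r_neq0 v0)); lra.
rewrite -[s + 1]add0r; apply: decaysM; first exact: tends_bounded s0' vol_tends.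
apply: decaysZ; apply: decays_sum => a; apply: decays_sum => b; rewrite -[s + 1]add0r.
exact: decaysM.
Qed.

Definition adm_field i x := \sum_j (pd X (fun y => G y i j) j x - pd X (fun y => G y j j) i x).

Let Z k x := \sum_i \sum_j invmx (G x) i j * Gam k i j x - \sum_i \sum_j invmx (G x) i k * Gam j i j x.

(* Divergence of vol * Z is the leading part of vol * (scalar curvature). *)
Definition scal_field k x := vol x * Z k x.

Definition scal_in x := \sum_i \sum_j invmx (G x) i j * ricci_coord X G x i j.

Let Z_sm k : sm X (Z k).
move=> l; apply: CkAB; apply: CkA_sum => i _; apply: CkA_sum => j _.
  by apply: CkAM; [exact: sI|exact: sGam].
by apply: CkAM; [exact: sI|exact: sGam].
Qed.

Lemma scal_field_sm k : sm X (scal_field k).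
by move=> l; apply: CkAM; [exact: vol_sm|exact: Z_sm]. Qed.

Lemma adm_field_sm k : sm X (adm_field k).
move=> l; apply: CkA_sum => j _; apply: CkAB; apply: CkA_pd => //; exact: sG.
Qed.

Let dZ k : decays (s + 1) (Z k).
apply: decaysB; apply: decays_sum => i; apply: decays_sum => j; rewrite -[s + 1]add0r;
  by apply: decaysM; [exact: bI|exact: christoffel_decays].
Qed.

(** Replacing vol by 1, g^-1 by the identity and the Christoffel symbols by their linear part gains
    a factor O(|x|^(-s)) on terms that are O(|x|^(-s-1)); the linear part is exactly the ADM
    integrand. *)
Lemma scal_field_adm k : decays (2 * s + 1) (fun x => scal_field k x - adm_field k x).
have E2 : 2 * s + 1 = s + (s + 1) by ring.
have dGam k' i j : decays (2 * s + 1) (fun x => Gam k' i j x - 2^-1 * low i j k' x).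
  apply: (@decays_eq _ _ _ (fun x => 2^-1 * \sum_l (invmx (G x) k' l - (k' == l)%:R) * low i j l x)).
    move=> x _; rewrite GamE -mulrBr; congr (_ * _).
    rewrite -[low i j k' x](sum_delta k' (fun l => low i j l x)).
    by rewrite -sumrB; bigr => l _; rewrite mulrBl.
  by apply: decaysZ; apply: decays_sum => l; rewrite E2; apply: decaysM; [exact: tends_metric_inv|exact: dlow].
have dIG a b k' i j : decays (2 * s + 1) (fun x => invmx (G x) a b * Gam k' i j x - (a == b)%:R * (2^-1 * low i j k' x)).
  apply: (@decays_eq _ _ _ (fun x => (invmx (G x) a b - (a == b)%:R) * Gam k' i j x
      + (a == b)%:R * (Gam k' i j x - 2^-1 * low i j k' x))); first by move=> x _; ring.
  apply: decaysD; last exact: decaysZ.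
  by rewrite E2; apply: decaysM; [exact: tends_metric_inv|exact: christoffel_decays].
apply: (@decays_eq _ _ _ (fun x => (vol x - 1) * Z k x +
   (\sum_i \sum_j (invmx (G x) i j * Gam k i j x - (i == j)%:R * (2^-1 * low i j k x))
    - \sum_i \sum_j (invmx (G x) i k * Gam j i j x - (i == k)%:R * (2^-1 * low i j j x))))); last first.
  apply: decaysD; first by rewrite E2; apply: decaysM; [exact: vol_tends|exact: dZ].
  by apply: decaysB; apply: decays_sum => i; apply: decays_sum => j; exact: dIG.
move=> x Xx; rewrite /scal_field.
have -> : adm_field k x = \sum_i \sum_j (i == j)%:R * (2^-1 * low i j k x)
     - \sum_i \sum_j (i == k)%:R * (2^-1 * low i j j x).
  rewrite (eq_bigr (fun i => 2^-1 * low i i k x)); last first.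
    by move=> i _; exact: (sum_delta i (fun j => 2^-1 * low i j k x)).
  rewrite [X in _ - X](_ : _ = \sum_j 2^-1 * low k j j x); last first.
    rewrite -(sum_delta k (fun i => \sum_j 2^-1 * low i j j x)); bigr => i _.
    by rewrite mulr_sumr eq_sym.
  rewrite -sumrB; bigr => j _; rewrite /low.
  have -> : pd X (fun y => G y k j) j x = pd X (fun y => G y j k) j x := g_sym_pd GT _ _ _ Xx.
  by move: (pd X _ j x) (pd X _ k x) => a b; lra.
rewrite !sum2B.
have alg (v a b c d : R) : (v - 1) * (a - b) + ((a - c) - (b - d)) = v * (a - b) - (c - d) by ring.
exact: alg.
Qed.

(** The second derivatives make up those of the scalar curvature. What remains is a sum of products
    of two quantities of first order (derivatives of vol, of g^-1, Christoffel symbols), each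
    O(|x|^(-s-1)). *)
Lemma scal_field_div : exists2 f : 'rV[R]_m.+1 -> R, decays (2 * s + 2) f &
  forall x, X x -> \sum_k pd X (scal_field k) k x = vol x * scal_in x + f x.
have E2 : 2 * s + 2 = (s + 1) + (s + 1) by ring.
pose q i j x := \sum_k \sum_l (Gam k k l x * Gam l i j x - Gam k j l x * Gam l i k x).
pose P x := \sum_k \sum_i \sum_j pd X (fun y => invmx (G y) i j) k x * Gam k i j x
  - \sum_k \sum_i \sum_j pd X (fun y => invmx (G y) i k) k x * Gam j i j x
  - \sum_i \sum_j invmx (G x) i j * q i j x.
exists (fun x => \sum_k pd X vol k x * Z k x + vol x * P x).
  apply: decaysD.
    by apply: decays_sum => k; rewrite E2; apply: decaysM; [exact: vol_decays|exact: dZ].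
  rewrite -[2 * s + 2]add0r; apply: decaysM; first exact: tends_bounded s0' vol_tends.
  apply: decaysB; first apply: decaysB.
  - apply: decays_sum => k; apply: decays_sum => i; apply: decays_sum => j; rewrite E2.
    by apply: decaysM; [exact: inv_metric_decays|exact: christoffel_decays].
  - apply: decays_sum => k; apply: decays_sum => i; apply: decays_sum => j; rewrite E2.
    by apply: decaysM; [exact: inv_metric_decays|exact: christoffel_decays].
  - apply: decays_sum => i; apply: decays_sum => j; rewrite -[2 * s + 2]add0r.
    apply: decaysM => //; apply: decays_sum => k; apply: decays_sum => l; rewrite E2.
    by apply: decaysB; apply: decaysM; exact: christoffel_decays.
move=> x Xx.
have C1I i j : CkA 1 X (fun y => invmx (G y) i j) by exact: (sI i j 1).
have dZE k : pd X (Z k) k x =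
    (\sum_i \sum_j (pd X (fun y => invmx (G y) i j) k x * Gam k i j x + invmx (G x) i j * pd X (Gam k i j) k x))
    - \sum_i \sum_j (pd X (fun y => invmx (G y) i k) k x * Gam j i j x + invmx (G x) i k * pd X (Gam j i j) k x).
  have C1 i j a b c : CkA 1 X (fun y => invmx (G y) i j * Gam a b c y).
    by apply: CkAM => //; exact: (sGam a b c 1).
  rewrite pdB //; last 2 first.
  - by apply: CkA_sum => i _; apply: CkA_sum => j _.
  - by apply: CkA_sum => i _; apply: CkA_sum => j _.
  congr (_ - _); rewrite pd_sum // => [|i _]; do 2?[by apply: CkA_sum => j _];
    bigr => i _; rewrite pd_sum //; bigr => j _; by rewrite pdM //; exact: (sGam _ _ _ 1).
transitivity (\sum_k (pd X vol k x * Z k x + vol x * pd X (Z k) k x)).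
  by bigr => k _; rewrite pdM //; [exact: (vol_sm 1)|exact: (Z_sm k 1)].
rewrite big_split /= [RHS]addrC -addrA; congr (_ + _).
rewrite -mulr_sumr -mulrDr; congr (_ * _).
under eq_bigr => k _ do rewrite dZE !sum2D.
rewrite sumrB !big_split /=.
have -> : scal_in x = \sum_k \sum_i \sum_j invmx (G x) i j * pd X (Gam k i j) k x
    - \sum_k \sum_i \sum_j invmx (G x) i k * pd X (Gam j i j) k x + \sum_i \sum_j invmx (G x) i j * q i j x.
  rewrite (sum_rot (fun k i j => invmx (G x) i j * pd X (Gam k i j) k x)).
  rewrite (sum_swap13 (fun k i j => invmx (G x) i k * pd X (Gam j i j) k x)).
  rewrite -sumrB -big_split; bigr => i _ /=; rewrite -sumrB -big_split; bigr => j _ /=.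
  by rewrite [ricci_coord _ _ _ _ _]mxE mulrDr -sumrB; congr (_ + _); rewrite mulr_sumr; bigr => k _; rewrite mulrBr.
by rewrite /P; ring.
Qed.

Lemma scal_in_sm : sm X scal_in.
move=> l; apply: CkA_sum => i _; apply: CkA_sum => j _; apply: CkAM; first exact: (sI i j l).
apply: (@CkA_eq _ _ _ _ (fun x => \sum_k (pd X (Gam k i j) k x - pd X (Gam k i k) j x)
   + \sum_k \sum_l (Gam k k l x * Gam l i j x - Gam k j l x * Gam l i k x))).
  by move=> x _; rewrite mxE.
apply: CkAD; apply: CkA_sum => k _; first by apply: CkAB; apply: sm_pd => //; exact: sGam.
by apply: CkA_sum => l' _; apply: CkAB; apply: CkAM; exact: sGam.
Qed.

Hypothesis s_big : (m.+1%:R - 2) / 2 < s.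
Hypothesis m0 : (0 < m)%N.
Hypothesis iR : (lebn m.+1).-integrable (X : set (bor 'rV[R]_m.+1)) (EFin \o (fun x => vol x * scal_in x)).

(** The condition s > (n - 2) / 2 enters twice: 2 s + 2 > n makes the quadratic error of the
    divergence small at infinity, and 2 s + 1 > n - 1 makes the fluxes of the two fields
    asymptotic. *)
Lemma adm_flux_cvg : cvg (flux adm_field r @[r --> +oo]).
have m1 : (m.+1%:R : R) = m%:R + 1 by rewrite -natr1.
have [f df fE] := scal_field_div.
have CvR : CkA 0 X (fun x => vol x * scal_in x) by apply: CkAM; [exact: vol_sm|exact: scal_in_sm].
have Cdiv : CkA 0 X (fun x => \sum_k pd X (scal_field k) k x).
  by apply: CkA_sum => k _; apply: CkA_pd => //; exact: (scal_field_sm k 1).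
have Cf : CkA 0 X f.
  apply: (CkA_eq _ (CkAB Cdiv CvR)) => x Xx; rewrite fE // addrC addKr; by [].
have ts : tail_small (fun x => \sum_k pd X (scal_field k) k x).
  have : tail_small (fun x => vol x * scal_in x + f x).
    apply: tail_smallD => //; first exact: tail_integrable.
    have big2 : m.+1%:R < 2 * s + 2 by move: s_big; rewrite m1; lra. exact: (tail_decay m0 big2).
  move=> H e e0; have [R0 R01 HR] := H e e0; exists R0 => // r1 r2 a b.
  rewrite (II_eq (g := (fun x => vol x * scal_in x + f x) \_ (annulus r1 r2))); first exact: HR.
  move=> x; rewrite /patch; case: ifP => // /set_mem /andP[x1 _].
  by apply: fE; apply: lt_trans x1; exact: lt_le_trans a.
have c1 := flux_cvg m0 (fun i => scal_field_sm i 1) ts.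
have c2 : flux (fun i x => adm_field i x - scal_field i x) r @[r --> +oo] --> (0 : R).
  have big1' : m%:R < 2 * s + 1 by move: s_big; rewrite m1; lra. apply: (flux_small big1').
    by move=> i; apply: CkAB; [exact: adm_field_sm|exact: scal_field_sm].
  move=> i; apply: decays_eq (decaysN (scal_field_adm i)) => x _; by rewrite opprB.
apply/cvg_ex; case/cvg_ex: c1 => l c1; exists l; apply: (flux_limit _ _ c1 c2).
  by move=> i; exact: scal_field_sm.
by move=> i; exact: adm_field_sm.
Qed.

End ScalarFlux.

(** * The field in graph coordinates *)

Section EndField.
Context {R : realType} (m : nat) (M E : manifold R m) (I : interval R).
Notation X := (@exterior R m.+1).
Variables (h : metric_field E) (u : M -> E) (tau : M -> R).
Variables (Nt : M -> 'rV[R]_m.+1) (Theta : M -> R).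
Hypotheses (hh : smooth_metric h) (himm : immersion I u tau) (hN : unit_normal h u tau Nt Theta).
Let g := induced_metric h u tau.
Let rg : smooth_metric g := induced_smooth hh himm.
Variables (theta : chart R m M) (phi : chart R m E).
Hypotheses (ath : atlas theta) (aph : atlas phi).
Hypotheses (cth : cod theta = X) (cph : cod phi = X).
Hypothesis graph : forall p, dom theta p -> dom phi (u p) /\ co phi (u p) = co theta p.

Let rX : regular X := open_regular (@open_exterior R m).
Let f := fun_in theta tau.
Let Th := fun_in theta Theta.
Let sf : sm X f. by rewrite -cth; exact: (fun_sm (tau_sm himm)). Qed.
Let sTh : sm X Th. by rewrite -cth; exact: (fun_sm (Theta_sm hN)). Qed.

Let thX x : X x -> cod theta x. by rewrite cth. Qed.

Lemma dom2_end : dom2 u theta phi = X.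
apply/seteqP; split=> x; first by move=> /(dom2P _ _ _ ath)[]; rewrite cth.
move=> Xx; apply/(dom2P _ _ _ ath); split; first exact: thX.
by have [] := graph (cod_dom ath (thX Xx)).
Qed.

Lemma map_in_end x : X x -> map_in u theta phi x = x.
move=> Xx; rewrite /map_in; have [_ ->] := graph (cod_dom ath (thX Xx)).
by rewrite to_coordK //; exact: thX.
Qed.

Lemma metric_end x i j : X x -> coef theta g x i j = coef phi h x i j + pd X f i x * pd X f j x.
move=> Xx; have xA : dom2 u theta phi x by rewrite dom2_end.
rewrite (induced_in h himm ath aph xA) dom2_end map_in_end //.
have -> : jac X (map_in u theta phi) x = 1%:M.
  apply/matrixP => a b; rewrite !mxE (@pd_eq _ _ X _ (fun y => y 0 b)) ?pd_coord //.
  by move=> y Xy; rewrite map_in_end.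
rewrite mul1mx trmx1 mulmx1 mxDE; congr (_ + _).
by rewrite mxE big_ord1 !mxE.
Qed.

Let Gh := coef phi h.
Let Gg := coef theta g.

Lemma end_h_sm : smx X Gh. by rewrite -cph; exact: coef_sm. Qed.
Lemma end_g_sm : smx X Gg. by rewrite -cth; exact: coef_sm. Qed.
Lemma end_g_det x : X x -> 0 < \det (Gg x). by rewrite -cth; exact: coef_det. Qed.

Let D i k x := pd X (pd X f k) i x.
Let DC i k x : X x -> D i k x = D k i x.
by move=> Xx; rewrite /D (pdC _ _ rX Xx (sf 2)). Qed.

Let sdf i : sm X (pd X f i). exact: sm_pd. Qed.

Lemma pd_metric_end a b k x : X x -> pd X (fun y => Gg y a b) k x =
  pd X (fun y => Gh y a b) k x + (D k a x * pd X f b x + pd X f a x * D k b x).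
move=> Xx; have C1 : CkA 1 X (fun y => Gh y a b) by exact: (end_h_sm a b 1).
have C2 : CkA 1 X (fun y => pd X f a y * pd X f b y) by apply: CkAM; exact: (sdf _ 1).
transitivity (pd X (fun y => Gh y a b + pd X f a y * pd X f b y) k x).
  by apply: pd_eq => // y Xy; exact: metric_end.
by rewrite pdD // pdM //; exact: (sdf _ 1).
Qed.

(** The contribution of f to the ADM field of h + df df. It is also H dtau + dTheta with g^-1
    replaced by the identity and A by the Hessian of f, and this coincidence makes the two fluxes
    agree. *)
Definition bending i x := \sum_j (D j j x * pd X f i x - D i j x * pd X f j x).

Lemma adm_end i x : X x -> adm_field Gg i x - adm_field Gh i x = bending i x.
move=> Xx; rewrite /adm_field -sumrB /bending; bigr => j _.
rewrite !pd_metric_end // (DC j i Xx).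
move: (pd X (fun y => Gh y i j) j x) (pd X (fun y => Gh y j j) i x) (D i j x) (D j j x) (pd X f i x) (pd X f j x) => a b c d e k.
by ring.
Qed.

Variable s : R.
Hypotheses (s0 : 0 < s).
Hypothesis tGh : forall i j, tends s (i == j)%:R (fun x => Gh x i j).
Hypothesis dGh : forall i j k, decays (s + 1) (pd X (fun x => Gh x i j) k).
Hypothesis df : forall i, decays (s / 2) (pd X f i).
Hypothesis ddf : forall i j, decays (s / 2 + 1) (pd X (pd X f i) j).
Hypothesis Theta_infty : \forall r \near +oo, forall p, dom theta p ->
  enorm (co theta p) = r -> `|Theta p - 1| < 1.

Lemma end_g_tends i j : tends s (i == j)%:R (fun x => Gg x i j).
apply: (@decays_eq _ _ _ (fun x => (Gh x i j - (i == j)%:R) + pd X f i x * pd X f j x)).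
  by move=> x Xx; rewrite /Gg metric_end //; ring.
apply: decaysD; first exact: tGh.
have -> : s = s / 2 + s / 2 by field.
by apply: decaysM; exact: df.
Qed.

Lemma end_g_decays i j k : decays (s + 1) (pd X (fun x => Gg x i j) k).
apply: (@decays_eq _ _ _ (fun x => pd X (fun y => Gh y i j) k x +
   (D k i x * pd X f j x + pd X f i x * D k j x))).
  by move=> x Xx; rewrite pd_metric_end.
apply: decaysD; first exact: dGh.
have E1 : s + 1 = s / 2 + 1 + s / 2 by field.
apply: decaysD; first by rewrite E1; apply: decaysM; [exact: ddf|exact: df].
by rewrite E1 [s / 2 + 1 + _]addrC; apply: decaysM; [exact: df|exact: ddf].
Qed.

Let GgT x : X x -> (Gg x)^T = Gg x. by move=> _; exact: coef_sym. Qed.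
Let gi i j x := invmx (Gg x) i j.
Let tgi i j : tends s (i == j)%:R (gi i j).
exact: (tends_metric_inv end_g_det s0 end_g_tends). Qed.
Let s0' : 0 <= s := ltW s0.
Let bgi i j : decays 0 (gi i j). exact: tends_bounded s0' (tgi i j). Qed.
Let Gam k i j x := christoffel X Gg k i j x.
Let dGam k i j : decays (s + 1) (Gam k i j).
exact: (christoffel_decays end_g_det s0 end_g_tends end_g_decays). Qed.

Lemma decays_near (a : R) (F F' : 'rV[R]_m.+1 -> R) (R1 : R) :
  (forall x, R1 <= enorm x -> F x = F' x) -> decays a F -> decays a F'.
move=> EF /decaysP[K [R0 [K0 R01 KF]]]; apply/decaysP; exists K, (Num.max R0 R1).
by split=> [||x]; rewrite ?lt_max ?R01 // ge_max => /andP[a1 a2]; rewrite -EF // KF.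
Qed.

Lemma Theta_end : exists2 R1 : R, 1 < R1 & forall x, R1 <= enorm x -> `|Th x - 1| < 1.
have [R1 [_ HR]] := Theta_infty.
exists (Num.max 2 (R1 + 1)); first by rewrite lt_max ltr1n.
move=> x; rewrite ge_max => /andP[x2 xR].
have Xx : X x by rewrite /exterior /=; apply: lt_le_trans x2; rewrite ltr1n.
rewrite /Th /fun_in; apply: (HR (enorm x)); first by apply: lt_le_trans xR; rewrite ltrDl.
  exact: (cod_dom ath (thX Xx)).
by rewrite to_coordK //; exact: thX.
Qed.

(** 1 - Theta^2 = |grad tau|^2 is O(|x|^(-s)). The hypothesis at infinity selects the root near 1:
    there 1 + Theta >= 1 and 1 - Theta inherits the decay. *)
Lemma Theta_tends : tends s 1 Th.
have [R1 R11 HT] := Theta_end.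
have : decays s (fun x => - \sum_j (\sum_i pd X f i x * gi i j x) * pd X f j x).
  apply: decaysN; apply: decays_sum => j; have -> : s = s / 2 + s / 2 by field.
  apply: decaysM => //; apply: decays_sum => i; rewrite -[s / 2]addr0; exact: decaysM.
move=> /decaysP[K [R0 [K0 R01 KF]]]; apply/decaysP; exists K, (Num.max R0 R1).
split=> [||x]; rewrite ?lt_max ?R01 // ge_max => /andP[a1 a2].
apply: le_trans (KF x a1); have Xx : X x by exact: lt_le_trans a1.
have HN := height_norm hh himm hN ath (thX Xx).
have -> : - (\sum_j (\sum_i pd X f i x * gi i j x) * pd X f j x) = (Th x - 1) * (Th x + 1).
  have -> : \sum_j (\sum_i pd X f i x * gi i j x) * pd X f j x =
      (dcf theta tau x *m invmx (Gg x) *m (dcf theta tau x)^T) 0 0.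
    rewrite mxE; bigr => j _; rewrite [_^T _ _]mxE [in RHS]mxE; congr (_ * _).
      by bigr => i _; rewrite [dcf _ _ _ _ _]mxE cth.
    by rewrite mxE cth.
  by move: HN; rewrite -/g -/Gg /Th /fun_in; move: (_ 0 0) (Theta _) => a b; lra.
rewrite normrM ler_peMr //; have := HT x a2; rewrite ltr_norml => /andP[b1 b2].
by rewrite ger0_norm; lra.
Qed.

Let A i k x := (Th x)^-1 * (D i k x - \sum_l Gam l i k x * pd X f l x).

(** Hess tau = Theta A solved for A, which requires Theta != 0 and so is asserted far out only. *)
Let A_sff : exists2 R1 : R, 1 < R1 & forall x, R1 <= enorm x -> forall i k,
  sff h u tau Nt Theta theta phi x i k = A i k x.
have [R1 R11 HT] := Theta_end; exists R1 => // x xR i k.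
have Xx : X x by exact: lt_le_trans xR.
have T0 : Th x != 0.
  by have := HT x xR; rewrite ltr_norml => /andP[b1 b2]; rewrite gt_eqF //; lra.
have xA : dom2 u theta phi x by rewrite dom2_end.
have [_ _ _ _ hs] := sff_facts hh himm hN ath aph xA.
have := hs i; rewrite dom2_end => /matrixP /(_ k 0).
rewrite mxDE mxZE dmxE.
have -> : pd X (fun y => (grad X (fun_in theta tau) y)^T k 0) i x = D i k x.
  by apply: pd_eq => // y Xy; rewrite !mxE.
have -> : (chr X (coef theta (induced_metric h u tau)) i x *m (dcf theta tau x)^T) k 0 =
    \sum_l Gam l i k x * pd X f l x.
  by rewrite mxE; bigr => l _; rewrite !mxE cth.
have TE : Theta (pt theta x) = Th x by [].
move=> DE; rewrite /A DE addrAC subrr add0r TE mulKf //.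
by rewrite [_^T _ _]mxE [row _ _ _ _]mxE.
Qed.

Let dA i k : decays (s / 2 + 1) (A i k).
rewrite -[s / 2 + 1]add0r; apply: decaysM.
  exact: tends_bounded s0' (tends_inv s0 Theta_tends).
apply: decaysB; first exact: ddf.
have le1 : s / 2 + 1 <= s + 1 + s / 2 by have := s0'; lra.
apply: decays_sum => l; apply: (decays_le le1); exact: decaysM.
Qed.

Let dAD i k : decays (3 * s / 2 + 1) (fun x => A i k x - D i k x).
apply: (@decays_eq _ _ _ (fun x => ((Th x)^-1 - 1) * D i k x - (Th x)^-1 * \sum_l Gam l i k x * pd X f l x)).
  by move=> x _; rewrite /A; ring.
have E1 : 3 * s / 2 + 1 = s + (s / 2 + 1) by field.
apply: decaysB.
  by rewrite E1; apply: decaysM; [exact: tends_inv s0 Theta_tends|exact: ddf].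
rewrite -[3 * s / 2 + 1]add0r; apply: decaysM.
  exact: tends_bounded s0' (tends_inv s0 Theta_tends).
apply: decays_sum => l; have -> : 3 * s / 2 + 1 = s + 1 + s / 2 by field.
exact: decaysM.
Qed.

(** H dtau + dTheta with the explicit [A]; the subtracted sum comes from dTheta = - A(grad tau). *)
Let form j x := (\sum_k \sum_l gi k l x * A l k x) * pd X f j x
  - \sum_l (\sum_k A j k x * gi k l x) * pd X f l x.

(** A - Hess f and g^-1 - 1 both gain |x|^(-s) on the order |x|^(-s/2-1) of A; together with the
    factor df = O(|x|^(-s/2)) the exponents add up to 2 s + 1. *)
Let form_bending j : decays (2 * s + 1) (fun x => form j x - bending j x).
have E1 : 2 * s + 1 = (3 * s / 2 + 1) + s / 2 by field.
have E2 : 3 * s / 2 + 1 = s + (s / 2 + 1) by field.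
have E3 : 3 * s / 2 + 1 = (s / 2 + 1) + s by field.
apply: (@decays_eq _ _ _ (fun x =>
   (\sum_k \sum_l ((gi k l x - (k == l)%:R) * A l k x + (k == l)%:R * (A l k x - D l k x))) * pd X f j x
   - \sum_l (\sum_k (A j k x * (gi k l x - (k == l)%:R) + (A j k x - D j k x) * (k == l)%:R)) * pd X f l x)).
  move=> x _.
  have S1 : \sum_k \sum_l ((gi k l x - (k == l)%:R) * A l k x + (k == l)%:R * (A l k x - D l k x)) =
      \sum_k \sum_l gi k l x * A l k x - \sum_k D k k x.
    rewrite -sumrB; bigr => k _; rewrite -(sum_delta k (fun l => D l k x)) -sumrB. by bigr => l _; ring.
  have S2 l : \sum_k (A j k x * (gi k l x - (k == l)%:R) + (A j k x - D j k x) * (k == l)%:R) =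
      \sum_k A j k x * gi k l x - D j l x.
    rewrite -(sum_delta l (fun k => D j k x)) -sumrB. by bigr => k _; rewrite [l == k]eq_sym; ring.
  rewrite S1 [X in _ - X](eq_bigr (fun l => (\sum_k A j k x * gi k l x) * pd X f l x - D j l x * pd X f l x)); last first.
    by move=> l _; rewrite S2 mulrBl.
  have B : bending j x = (\sum_k D k k x) * pd X f j x - \sum_l D j l x * pd X f l x.
    by rewrite /bending sumrB -mulr_suml.
  rewrite sumrB B. have alg (a b c d e : R) : (a - b) * c - (d - e) = a * c - d - (b * c - e) by ring.
  exact: alg.
apply: decaysB.
  rewrite E1; apply: decaysM => //; apply: decays_sum => k; apply: decays_sum => l.
  apply: decaysD; first by rewrite E2; apply: decaysM => //; exact: tgi. exact: decaysZ.
apply: decays_sum => l; rewrite E1; apply: decaysM => //; apply: decays_sum => k.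
apply: decaysD; first by rewrite E3; apply: decaysM => //; exact: tgi.
by apply: decays_eq (decaysZ (k == l)%:R (dAD j k)) => x _; rewrite mulrC.
Qed.

Let dform j : decays (s + 1) (form j).
have E1 : s + 1 = s / 2 + 1 + s / 2 by field.
rewrite E1; apply: decaysB.
  apply: decaysM => //; apply: decays_sum => k; apply: decays_sum => l.
  by rewrite -[s / 2 + 1]add0r; apply: decaysM.
apply: decays_sum => l; apply: decaysM => //; apply: decays_sum => k.
by rewrite -[s / 2 + 1]addr0; apply: decaysM.
Qed.

Lemma field_adm i : decays (2 * s + 1) (fun x => field_in h u tau Nt Theta theta i x
   - (adm_field Gg i x - adm_field Gh i x)).
have [R1 R11 AE] := A_sff.
apply: (@decays_near _ (fun x => \sum_j (vol Gg x * gi i j x - (i == j)%:R) * form j x + (form i x - bending i x)) _ R1).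
  move=> x xR; have Xx : X x by exact: lt_le_trans xR. have xA : dom2 u theta phi x by rewrite dom2_end.
  have [_ thE HE' _ _] := sff_facts hh himm hN ath aph xA. rewrite adm_end // addrA; congr (_ - _).
  have fE j : form_in h u tau Nt Theta theta j x = form j x.
    rewrite /form_in /fun_in HE' cth; congr (_ * _ + _).
      by bigr => k _; rewrite mxE; bigr => l _; rewrite AE.
    have /matrixP /(_ j 0) := thE; rewrite mxE mxNE => E1.
    transitivity (dcf theta Theta x 0 j); first by rewrite mxE cth.
    rewrite E1 mxE; congr (- _); bigr => l _; rewrite [_^T _ _]mxE [dcf _ _ _ _ _]mxE cth; congr (_ * _).
    by rewrite mxE; bigr => k _; rewrite AE.
  rewrite /field_in -[form i x](sum_delta i (fun j => form j x)) -big_split /= mulr_sumr.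
  by bigr => j _; rewrite fE -/(vol Gg x) -/(gi i j x); ring.
have E1 : 2 * s + 1 = s + (s + 1) by ring.
apply: decaysD; last exact: form_bending.
apply: decays_sum => j; rewrite E1; apply: decaysM; last exact: dform.
rewrite -[(i == j)%:R]mul1r; apply: tendsM => //.
exact: (vol_tends end_g_det s0 end_g_tends).
Qed.

End EndField.

Section EndIntegrals.
Context {R : realType} (m : nat) (M : manifold R m).
Variables (g : metric_field M) (rg : smooth_metric g).
Variables (dM : {measure set (borel M) -> \bar R}) (hdM : volume_measure g dM).
Variables (theta : chart R m M) (ath : atlas theta).
Notation X := (@exterior R m.+1).

Lemma integrable_chart (phi : M -> R) : CkA 0 (cod theta) (fun x => phi (pt theta x)) ->
  dM.-integrable (dom theta : set (borel M)) (EFin \o phi) ->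
  (lebn m.+1).-integrable (cod theta : set (bor 'rV[R]_m.+1))
    (EFin \o (fun x => sqrdet (coef theta g x) * phi (pt theta x))).
move=> Cphi /integrableP[mphi fin].
have Cw : CkA 0 (cod theta) (fun x => sqrdet (coef theta g x)).
  apply: CkA_sqrt => [x cx|]; first exact: coef_det. exact: (sm_det (coef_sm rg ath) 0).
apply/integrableP; split.
  by apply/measurable_EFinP; apply: (CkA_measurable_cod ath); exact: CkAM.
have mC := measurable_cod ath; have mw := CkA_measurable_cod ath Cw.
have mp : measurable_fun (dom theta : set (borel M)) (fun p => `|(EFin \o phi) p|%E).
  exact: measurableT_comp.
rewrite (ge0_integral_density (measurable_dom ath) mC (measurable_of_coord ath) mw
  (fun y cy => cod_dom ath cy) (fun y _ => sqrtr_ge0 _) (volume_lebn rg hdM ath) mp) // in fin.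
apply: le_lt_trans fin; under [leLHS]eq_integral do rewrite /= normrM (ger0_norm (sqrtr_ge0 _)) mulrC.
by under [leRHS]eq_integral do rewrite /= -EFinM.
Qed.

Hypothesis cth : cod theta = X.
Variable s : R.
Hypotheses (s_big : (m.+1%:R - 2) / 2 < s) (s0 : 0 < s) (m0 : (0 < m)%N).
Hypothesis tG : forall i j, tends s (i == j)%:R (fun x => coef theta g x i j).
Hypothesis tdG : forall i j k, decays (s + 1) (pd X (fun x => coef theta g x i j) k).
Hypothesis iR : dM.-integrable (dom theta : set (borel M)) (EFin \o scal g).

Lemma chart_flux_cvg : cvg (flux (adm_field (coef theta g)) r @[r --> +oo]).
have sG : smx X (coef theta g) by rewrite -cth; exact: coef_sm.
have GT x : X x -> (coef theta g x)^T = coef theta g x by move=> _; exact: coef_sym.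
have dG x : X x -> 0 < \det (coef theta g x) by rewrite -cth; exact: coef_det.
apply: (adm_flux_cvg sG GT dG s0 tG tdG s_big m0).
have sE x : X x -> scal g (pt theta x) = scal_in (coef theta g) x.
  by rewrite -cth => cx; rewrite -(scal_chart rg ath cx) cth.
have Cs : CkA 0 (cod theta) (fun x => scal g (pt theta x)).
  have sS : sm X (scal_in (coef theta g)) := scal_in_sm sG GT dG.
  have sE' x : X x -> scal_in (coef theta g) x = scal g (pt theta x) by move=> Xx; rewrite (sE x Xx).
  rewrite cth. exact: (CkA_eq sE' (sS 0%N)).
have mX : measurable (X : set (bor 'rV[R]_m.+1)) by exact: open_borel (@open_exterior R m).
have H := integrable_chart Cs iR; rewrite cth in H.
have E x : X x -> sqrdet (coef theta g x) * scal g (pt theta x) =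
    vol (coef theta g) x * scal_in (coef theta g) x.
  move=> Xx. exact: (congr1 ( *%R (vol (coef theta g) x)) (sE x Xx)).
have E2 : {in X, EFin \o (fun x => sqrdet (coef theta g x) * scal g (pt theta x)) =1
    EFin \o (fun x => vol (coef theta g) x * scal_in (coef theta g) x)}.
  by move=> x /set_mem Xx; exact: (congr1 EFin (E x Xx)).
exact: (eq_integrable mX _ _ E2 H).
Qed.

Lemma integral_exhaustion (F : M -> R) (R0 J : R) :
  (forall r, R0 < r -> measurable (truncation theta r)) ->
  (\int[dM]_(p in truncation theta r) F p) @[r --> +oo] --> J ->
  dM.-integrable ([set: M] : set (borel M)) (EFin \o F) ->
  \int[dM]_(p in ([set: M] : set (borel M))) F p = J.
move=> mT FJ iF; pose r_ (k : nat) : R := R0 + 1 + k%:R.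
have rR k : R0 < r_ k by rewrite /r_ -addrA ltrDl ltr_pwDl.
have roo : r_ k @[k --> \oo] --> +oo.
  apply/cvgryPge => A; have [k _ Hk] := (cvgryPge (fun k : nat => k%:R : R)).1 cvgr_idn (A - (R0 + 1)).
  by exists k => // j /Hk /=; rewrite lerBlDl.
have FJ' := cvg_comp _ _ roo FJ.
have /integrableP [mF _] := iF.
have [] := dominated_convergence (mu := dM) (D := setT) measurableT
  (f_ := fun k => (EFin \o F) \_ (truncation theta (r_ k))) (f := EFin \o F) (g := fun p => `|(F p)%:E|%E).
- by move=> k; apply/(measurable_restrictT _ (mT _ (rR k))); exact: measurable_funTS.
- exact: mF.
- apply: aeW => p _; apply: cvg_near_cst.
  have [k _ Hk] := (cvgryPge r_).1 roo (enorm (co theta p)).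
  exists k => // j /Hk /= xj; rewrite /patch mem_set // => -[_ /=]; by rewrite ltNge xj.
- exact: integrable_abse.
- apply: aeW => p k _; rewrite /patch; case: ifP => // _; by rewrite abse0.
move=> _ _ H.
have : fine (\int[dM]_(p in setT) (((EFin \o F) \_ (truncation theta (r_ k))) p))%E @[k --> \oo]
    --> \int[dM]_(p in ([set: M] : set (borel M))) F p.
  by apply: fine_cvg; rewrite fineK //; exact: integrable_fin_num.
move=> H1; apply: (cvg_unique _ H1) => //; apply: cvg_trans FJ'; apply: near_eq_cvg.
by apply: nearW => k /=; rewrite /Rintegral [in LHS]integral_mkcond.
Qed.

End EndIntegrals.

Lemma ADM_mass_flux {R : realType} (m : nat) (G : 'rV[R]_m.+1 -> 'M[R]_m.+1) :
  ADM_mass G = c_ADM m * lim (flux (adm_field G) r @[r --> +oo]).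
by []. Qed.

Local Notation X := (@exterior _ _.+1).

Theorem theorem1p7 (R : realType) (m : nat) (hm : (3 <= m.+1)%N)
  (E : manifold R m) (hE : boundary E = set0)
  (h : metric_field E) (hh : riemannian h) (hcomplete : riem_complete h)
  (dE : {measure set (borel E) -> \bar R}) (hdE : volume_measure h dE)
  (phi : chart R m E) (hphi : asymptotically_flat h dE phi)
  (I : interval R) (M : manifold R m) (u : M -> E) (tau : M -> R)
  (himm : immersion I u tau)
  (g : metric_field M) (hg : g = induced_metric h u tau)
  (gcomplete : riem_complete g)
  (dM : {measure set (borel M) -> \bar R}) (hdM : volume_measure g dM)
  (theta : chart R m M)
  (htheta : asymptotically_flat_hypersurface phi g dM u tau theta)
  (Nt : M -> 'rV[R]_m.+1) (Theta : M -> R)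
  (hN : unit_normal h u tau Nt Theta)
  (hN_infty : forall e : R, 0 < e -> \forall r \near +oo,
     forall p, chart_dom theta p -> enorm (to_coord theta p) = r ->
     `|Theta p - 1| < e)
  (dGamma : {measure set (borel M) -> \bar R})
  (hdGamma : boundary_measure g dGamma)
  (Gamma_nonempty : boundary M !=set0)
  (Gamma_compact : compact (boundary M))
  (Gamma_connected : connected (boundary M))
  (t0 : R) (Gamma_slice : forall p, boundary M p -> tau p = t0)
  (Gamma_embedded : set_inj (boundary M) u)
  (Omega : set E) (hOmega : compact_domain Omega)
  (Gamma_bounds : Omega `\` Omega° = u @` boundary M)
  (Gamma_orthogonal : forall p, boundary M p -> Theta p = 0)
  (mu : M -> 'rV[R]_m.+1) (hmu : inward_unit_normal h u Omega mu)
  (eta : M -> 'rV[R]_m.+1) (heta : exterior_conormal g eta)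
  (orient_up : forall p, boundary M p ->
     eta p *m diff_map u p = 0 -> (eta p *m (diff_fun tau p)^T) 0 0 = 1 ->
     Nt p = - mu p)
  (orient_down : forall p, boundary M p ->
     eta p *m diff_map u p = 0 -> (eta p *m (diff_fun tau p)^T) 0 0 = -1 ->
     Nt p = mu p) :
  exists2 J : R,
    is_integral_AF theta dM
      (fun p => Theta p * (scal g p - scal h (u p)
                           + dot (ricci h (u p)) (Nt p) (Nt p))) J
    & ADM_mass (coef theta g) =
      ADM_mass (coef phi h)
      + c_ADM m * (\int[dGamma]_(p in (boundary M : set (borel M)))
                  mean_curvature h u mu p)
      + c_ADM m * J.
Proof.
have m0 : (0 < m)%N by rewrite -(leq_add2l 1) !add1n; exact: ltnW.
have {}hh := riemannian_smooth hh.
case: hphi => aph cph cch [s1 s1b [tG1 dG1]] iE.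
case: htheta => iM [ath ccth] ctp graph [s2 s2b [df2 ddf2]].
have cth : cod theta = X by rewrite ctp.
subst g; have rg : smooth_metric (induced_metric h u tau) := induced_smooth hh himm.
(* h and f come with decay exponents of their own; the smaller one serves both and still exceeds (n
   - 2) / 2. *)
pose s := Num.min s1 s2.
have s_big : (m.+1%:R - 2) / 2 < s by rewrite lt_min s1b.
(* Dimension at least 3 makes (n - 2) / 2 nonnegative, so that s > 0. *)
have m2 : (2 : R) <= m%:R by rewrite ler_nat.
have s0 : 0 < s by apply: le_lt_trans s_big; rewrite -natr1; lra.
have ss1 : s <= s1 by rewrite ge_min lexx.
have ss2 : s <= s2 by rewrite ge_min lexx orbT.
have tGh i j : tends s (i == j)%:R (fun x => coef phi h x i j) by apply: decays_le (tG1 i j).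
have dGh i j k : decays (s + 1) (pd X (fun x => coef phi h x i j) k).
  by apply: decays_le (dG1 i j k); rewrite lerD2r.
have df i : decays (s / 2) (pd X (fun_in theta tau) i).
  by apply: decays_le (df2 i); rewrite ler_pM2r.
have ddf i j : decays (s / 2 + 1) (pd X (pd X (fun_in theta tau) i) j).
  by apply: decays_le (ddf2 i j); rewrite lerD2r ler_pM2r.
have tGg := end_g_tends himm ath aph cth graph tGh df.
have dGg := end_g_decays hh himm ath aph cth cph graph dGh df ddf.
have dGg0 x : X x -> 0 < \det (coef theta (induced_metric h u tau) x).
  by rewrite -cth; exact: coef_det.
have vol_large := tends_half s0 (vol_tends dGg0 s0 tGg).
(* The image of the chart of the end is open in R^n, so boundary points of M lie in the core. *)
have core_nonempty : exists p, ~ dom theta p.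
  have [p bp] := Gamma_nonempty; exists p => tp.
  by apply: (open_no_boundary ath _ tp bp); rewrite cth; exact: open_exterior.
have iMt : dM.-integrable (dom theta : set (borel M)) (EFin \o scal (induced_metric h u tau)).
  by apply: integrableS iM => //; exact: measurable_dom.
have cg := chart_flux_cvg rg hdM ath cth s_big s0 m0 tGg dGg iMt.
have ch := chart_flux_cvg hh hdE aph cph s_big s0 m0 tGh dGh iE.
pose V := field_in h u tau Nt Theta.
pose Yg := adm_field (coef theta (induced_metric h u tau)).
pose Yh := adm_field (coef phi h).
pose lg := lim (flux Yg r @[r --> +oo]); pose lh := lim (flux Yh r @[r --> +oo]).
have CYg i : CkA 0 X (Yg i).
  by apply: (adm_field_sm (end_g_sm hh himm ath cth) i 0).
have CYh i : CkA 0 X (Yh i) by apply: (adm_field_sm (end_h_sm hh aph cph) i 0).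
have CV k i : CkA k X (V theta i) by have := field_sm hh himm hN i ath k; rewrite cth.
have fluxB : flux (fun i x => Yg i x - Yh i x) r @[r --> +oo] --> lg - lh.
  apply: cvg_trans (cvgB cg ch); apply: near_eq_cvg; near=> r.
  have r1 : 1 < r by near: r; exact: nbhs_pinfty_gt.
  have YgE : Yg = (fun i x => (Yg i x - Yh i x) + Yh i x) by apply/funext => i; apply/funext => x; rewrite subrK.
  have fE : flux Yg r = flux (fun i x => Yg i x - Yh i x) r + flux Yh r.
    by rewrite {1}YgE; apply: fluxD => // i; exact: CkAB.
  by rewrite -[LHS]/(flux Yg r - flux Yh r) fE addrK.
have fluxV : flux (V theta) r @[r --> +oo] --> lg - lh.
  apply: flux_limit fluxB _ => // [i|]; first exact: CkAB.
  apply: (flux_small (a := 2 * s + 1)) => [|i|i].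
  - by move: s_big; rewrite -natr1; lra.
  - by apply: CkAB => //; exact: CkAB.
  - exact: (field_adm hh himm hN ath aph cth cph graph s0 tGh dGh df ddf (hN_infty 1 ltr01) i).
have VC (c : chart R m M) i : atlas c -> CkA 1 (cod c) (V c i) by move=> ac; exact: (field_sm hh himm hN i ac 1).
have [R0 HR0] := @truncated_stokes _ _ M _ rg dM hdM dGamma hdGamma V
  (defect h u tau Nt Theta) (fun p => - mean_curvature h u mu p) (pairing h u tau Nt Theta) VC
  (fun c x => @field_divergence _ _ _ _ _ _ _ _ _ _ hh himm hN c x)
  (fun c x f => @field_pairing _ _ _ _ _ _ _ _ _ _ hh himm hN c x f)
  (fun c x => @field_mean_curvature _ _ _ _ _ _ _ _ _ _ hh himm hN _ Gamma_slice Gamma_orthogonal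
    _ _ heta orient_up orient_down c x) m0 theta ath cth ccth core_nonempty vol_large.
pose mc := \int[dGamma]_(p in (Gamma_ M)) mean_curvature h u mu p.
have Emc : \int[dGamma]_(p in (Gamma_ M)) (- mean_curvature h u mu p) = - mc.
  have [ib _] := HR0 (R0 + 1) (ltr_pwDr ltr01 (lexx R0)).
  have mb : measurable (Gamma_ M) by apply: (@closed_borel M); exact: closed_boundary.
  have -> : mc = \int[dGamma]_(p in (Gamma_ M)) (-1 * - mean_curvature h u mu p).
    by apply: eq_Rintegral => p _; rewrite mulN1r opprK.
  by rewrite RintegralZl // mulN1r opprK.
have lim_trunc : (\int[dM]_(p in truncation theta r) defect h u tau Nt Theta p) @[r --> +oo] -->
    - mc + (lg - lh).
  apply: (@cvg_trans _ ((fun r => - mc + flux (V theta) r) @ +oo)); last by apply: cvgD => //; exact: cvg_cst.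
  apply: near_eq_cvg; near=> r. have rR0 : R0 < r by near: r; exact: nbhs_pinfty_gt (num_real R0).
  by have [_ [_ _ _ ->]] := HR0 r rR0; rewrite Emc.
(* J is the limit of Stokes' formula on the truncations, and the mass formula becomes a linear
   identity between the limits. *)
exists (- mc + (lg - lh)).
  split=> // iF; apply: (integral_exhaustion (R0 := R0) _ lim_trunc) => // r rR.
  by have [_ []] := HR0 r rR.
have Eg : ADM_mass (coef theta (induced_metric h u tau)) = c_ADM m * lg := ADM_mass_flux _.
have Eh : ADM_mass (coef phi h) = c_ADM m * lh := ADM_mass_flux _.
rewrite Eg Eh -[\int[dGamma]_(p in _) _]/mc.
have alg (c a b d : R) : c * a = c * b + c * d + c * (- d + (a - b)) by ring.
exact: alg.
Unshelve. all: by end_near.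
Qed.
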